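(* Let $1<p,q<\infty$. Assume that $u\in\mathcal W(0,\infty)\cap C(0,\infty)$ and $a,v,w\in\mathcal W(0,\infty)$. Put $$N:=\sup_{f\in\mathfrak M^{+,\downarrow}(0,\infty)}\frac{\Big(\int_0^\infty\Big(\int_0^x(R_uf)(t)\,a(t)\,dt\Big)^q w(x)\,dx\Big)^{1/q}}{\Big(\int_0^\infty f(s)^p v(s)\,ds\Big)^{1/p}},\qquad (R_uf)(t):=\sup_{\tau\ge t}u(\tau)f(\tau),$$ $$\varphi(t):=\sup_{\tau\ge t}u(\tau)^{p'}V(\tau)^{-2p'}\int_0^\tau V(s)^{p'}v(s)\,ds,\quad t>0.$$ (i) If $p\le q$, then \begin{align*} N\approx\;&\sup_{t>0}\Big(\int_0^t V(x)^{p'}v(x)\Big(\int_x^t\Big(\sup_{\tau\ge s}u(\tau)V(\tau)^{-2}\Big)a(s)\,ds\Big)^{p'}dx\Big)^{1/p'}\Big(\int_t^\infty w(y)\,dy\Big)^{1/q}\\ &+\sup_{t>0}\Big(\int_0^tV(x)^{p'}v(x)\,dx\Big)^{1/p'}\Big(\int_t^\infty\Big(\int_t^y\Big(\sup_{\tau\ge s}u(\tau)V(\tau)^{-2}\Big)a(s)\,ds\Big)^{q}w(y)\,dy\Big)^{1/q}\\ &+\sup_{x>0}\Big(\int_{[x,\infty)}d(-\varphi(t))\Big)^{1/p'}\Big(\int_0^x A(y)^q w(y)\,dy\Big)^{1/q}\\ &+\sup_{x>0}\Big(\int_{(0,x]}A(t)^{p'}\,d(-\varphi(t))\Big)^{1/p'}\Big(\int_x^\infty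 w(y)\,dy\Big)^{1/q}\\ &+\Big(\int_0^\infty A(y)^q w(y)\,dy\Big)^{1/q}\lim_{t\to\infty}\Big(\sup_{\tau\ge t}u(\tau)V(\tau)^{-2}\Big(\int_0^\tau V(s)^{p'}v(s)\,ds\Big)^{1/p'}\Big). \end{align*} (ii) If $q<p$, then \begin{align*} N\approx\;&\Big(\int_0^\infty\Big(\int_0^tV(x)^{p'}v(x)\,dx\Big)^{r/q'}V(t)^{p'}v(t)\Big(\int_t^\infty\Big(\int_t^z\Big(\sup_{y\ge s}u(y)V(y)^{-2}\Big)a(s)\,ds\Big)^{q}w(z)\,dz\Big)^{r/q}dt\Big)^{1/r}\\ &+\Big(\int_0^\infty\Big(\int_0^tV(x)^{p'}v(x)\Big(\int_x^t\Big(\sup_{y\ge s}u(y)V(y)^{-2}\Big)a(s)\,ds\Big)^{p'}dx\Big)^{r/p'}\Big(\int_t^\infty w(s)\,ds\Big)^{r/p}w(t)\,dt\Big)^{1/r}\\ &+\Big(\int_0^\infty\Big(\int_{[x,\infty)}d(-\varphi(t))\Big)^{r/p'}\Big(\int_0^xA(y)^qw(y)\,dy\Big)^{r/p}A(x)^qw(x)\,dx\Big)^{1/r}\\ &+\Big(\int_0^\infty\Big(\int_{(0,x]}A(t)^{p'}\,d(-\varphi(t))\Big)^{r/p'}\Big(\int_x^\infty w(y)\,dy\Big)^{r/p}w(x)\,dx\Big)^{1/r}\\ &+\Big(\int_0^\infty A(y)^q w(y)\,dy\Big)^{1/q}\lim_{t\to\infty}\Big(\sup_{\tau\ge t}u(\tau)V(\tau)^{-2}\Big(\int_0^\tau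 V(s)^{p'}v(s)\,ds\Big)^{1/p'}\Big). \end{align*}
   Context: $\mathfrak M^+(0,\infty)$ is the set of non-negative measurable functions on $(0,\infty)$, and $\mathfrak M^{+,\downarrow}(0,\infty)$ its subset of non-increasing functions. $\mathcal W(0,\infty)$ (weights) is the set of $v\in\mathfrak M^+(0,\infty)$ with $0<\int_0^x v(t)\,dt<\infty$ for all $x>0$. $C(0,\infty)$ is the set of continuous functions on $(0,\infty)$. $A(t):=\int_0^t a(s)\,ds$, $V(t):=\int_0^t v(s)\,ds$. For $p\in(1,\infty)$, $1/p+1/p'=1$; for $0<q<p<\infty$, $r$ is defined by $1/r=1/q-1/p$. Conventions: $0\cdot\infty=0$, $\infty/\infty=0$, $0/0=0$. For a non-increasing function $\varphi$, $d(-\varphi)$ denotes integration with respect to the Lebesgue–Stieltjes measure generated by the non-decreasing function $-\varphi$. $F\approx G$ means $c^{-1}G\le F\le cG$ with a constant $c>0$ depending only on inessential parameters, i.e. on $p,q$ and not on the functions $u,a,v,w$ (both sides may be $+\infty$). *)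

(* Defs.v *)
From HB Require Import structures.
From mathcomp Require Import all_boot all_order all_algebra.
From mathcomp Require Import all_classical all_reals all_analysis measurable_realfun.

Set Implicit Arguments.
Unset Strict Implicit.
Unset Printing Implicit Defensive.
Import Order.TTheory GRing.Theory Num.Theory.
Import numFieldNormedType.Exports.

Local Open Scope classical_set_scope.
Local Open Scope ring_scope.
Local Open Scope ereal_scope.

(** Lebesgue integration on the line.  Functions on (0, oo) are represented by
    functions on the whole of R whose values outside (0, oo) are never used, and
    measurability is Lebesgue (not only Borel) measurability: the domain is R
    equipped with the Caratheodory sigma-algebra of the length function. *)

Definition lebesgueR (R : realType) :=
  caratheodory_type (@mu_ext _ (ocitv_type R) R (@wlength R idfun)).

Definition lebesgue_integral (R : realType) (D : set R) (f : R -> \bar R) :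
    \bar R :=
  integral (@completed_lebesgue_measure R) (D : set (lebesgueR R))
    (f : lebesgueR R -> \bar R).

Reserved Notation "\lint_ ( x 'in' D ) F"
  (at level 36, F at level 36, x, D at level 50,
   format "'[' \lint_ ( x  'in'  D ) '/  '  F ']'").
Notation "\lint_ ( x 'in' D ) F" :=
  (lebesgue_integral D%classic (fun x => F%E)) : ereal_scope.

Section classes.
Context {R : realType}.
Implicit Types (f v : R -> \bar R) (u : R -> R).

Definition Mplus f :=
  measurable_fun (`]0%R, +oo[ : set (lebesgueR R))
    (f : lebesgueR R -> \bar R) /\
  (forall x : R, (0 < x)%R -> 0 <= f x).

Definition Mplus_nonincreasing f :=
  Mplus f /\ (forall x y : R, (0 < x)%R -> (x <= y)%R -> f y <= f x).

Definition weight v :=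
  Mplus v /\
  (forall x : R, (0 < x)%R ->
     0 < \lint_(t in `]0%R, x[) v t /\ \lint_(t in `]0%R, x[) v t < +oo).

Definition continuous_on_pos u := {within `]0%R, +oo[, continuous u}.

End classes.

Section stieltjes.
Context {R : realType}.
Implicit Types (g : R -> R) (phi : R -> \bar R).

Definition right_lim g (x : R) : R := inf [set g y | y in `]x, +oo[].

Section right_lim_cumulative.
Variables (g : R -> R) (nd : nondecreasing g).

Let lbg x : has_lbound [set g y | y in `]x, +oo[].
Proof.
exists (g x) => _ [y /= xy <-]; apply: nd; move: xy.
by rewrite in_itv /= andbT => /ltW.
Qed.

Let neg x : [set g y | y in `]x, +oo[] !=set0.
Proof. by exists (g (x + 1)%R), (x + 1)%R => //=; rewrite in_itv /= andbT ltrDl. Qed.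

Lemma right_lim_nondecreasing : nondecreasing (right_lim g).
Proof.
move=> x y xy; apply: lb_le_inf; first exact: neg.
move=> _ [z /= yz <-]; apply: ge_inf; first exact: lbg.
exists z => //=; move: yz; rewrite !in_itv /= !andbT; exact: le_lt_trans.
Qed.

Lemma right_lim_right_continuous : right_continuous (right_lim g).
Proof.
move=> x; apply/cvgrPdist_le => e e0.
have [_ [z /= xz <-] gz] := inf_adherent e0 (conj (neg x) (lbg x)).
move: xz; rewrite in_itv /= andbT => xz.
near=> t.
have xt : (x < t)%R by near: t; exact: nbhs_right_gt.
have tz : (t < z)%R by near: t; exact: nbhs_right_lt.
rewrite ler0_norm ?subr_le0 ?right_lim_nondecreasing // 1?ltW // opprB.
rewrite ltrBlDr addrC; apply: le_lt_trans gz.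
apply: ge_inf; first exact: lbg.
by exists z => //=; rewrite in_itv /= andbT.
Unshelve. all: by end_near. Qed.

HB.instance Definition _ :=
  isCumulative.Build R _ R (right_lim g)
    right_lim_nondecreasing right_lim_right_continuous.

Definition cumulative_right_lim : cumulative R R := right_lim g.

End right_lim_cumulative.

(** The Lebesgue-Stieltjes measure on R generated by a non-decreasing g, not
    necessarily right-continuous: it gives mass g(b+) - g(a+) to ]a, b].  The
    value is 0 if g is not non-decreasing. *)
Definition stieltjes g : {measure set (measurableTypeR R) -> \bar R} :=
  match pselect (nondecreasing g) with
  | left nd => lebesgue_stieltjes_measure (cumulative_right_lim nd)
  | right _ => mzero
  end.

(** The Lebesgue-Stieltjes measure d(-phi) on (0, oo) generated by -phi, for a
    non-increasing phi on (0, oo).  As phi may blow up at 0+, it is obtained by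
    transporting to (0, oo), along s |-> e^s, the measure on R generated by
    s |-> - phi(e^s); see [dminus_itv] and [dminus_nonpos]. *)
Definition dminus phi : set (measurableTypeR R) -> \bar R :=
  pushforward (stieltjes (fun s => - fine (phi (expR s)))%R)
    (expR : measurableTypeR R -> measurableTypeR R).

Section dminus_measure.
Variable phi : R -> \bar R.

Let pre A := (expR : measurableTypeR R -> measurableTypeR R) @^-1` A.

Let mpre (A : set (measurableTypeR R)) : measurable A -> measurable (pre A).
Proof. by move=> mA; rewrite -[pre A]setTI; exact: measurable_expR. Qed.

Let dminus0 : dminus phi set0 = 0.
Proof. by rewrite /dminus /pushforward preimage_set0 measure0. Qed.

Let dminus_ge0 A : 0 <= dminus phi A.
Proof. exact: measure_ge0. Qed.

Let dminus_sigma_additive : semi_sigma_additive (dminus phi).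
Proof.
move=> F mF tF mUF; rewrite /dminus /pushforward preimage_bigcup.
apply: measure_semi_sigma_additive.
- by move=> n; exact: mpre.
- apply/trivIsetP => /= i j _ _ ij; rewrite -preimage_setI.
  by move/trivIsetP : tF => /(_ _ _ _ _ ij) ->//; rewrite preimage_set0.
- by rewrite -preimage_bigcup; exact: mpre.
Qed.

HB.instance Definition _ :=
  isMeasure.Build _ _ _ (dminus phi) dminus0 dminus_ge0 dminus_sigma_additive.

End dminus_measure.

Lemma right_lim_id g x : nondecreasing g -> g y @[y --> x^'+] --> g x ->
  right_lim g x = g x.
Proof.
move=> nd gx; apply/eqP; rewrite eq_le; apply/andP; split; last first.
  apply: lb_le_inf.
    by exists (g (x + 1)%R), (x + 1)%R => //=; rewrite in_itv /= andbT ltrDl.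
  by move=> _ [y /= + <-]; rewrite in_itv /= andbT => /ltW; exact: nd.
apply/ler_addgt0Pr => e e0.
have [y [xy ye]] : exists y : R, (x < y)%R /\ (g y <= g x + e)%R.
  near x^'+ => y; exists y; split; first by near: y; exact: nbhs_right_gt.
  rewrite -lerBlDl; apply: le_trans (ler_norm _) _; rewrite distrC.
  by near: y; move/cvgrPdist_le : gx; exact.
apply: le_trans ye; apply: ge_inf; last by exists y => //=; rewrite in_itv /= andbT.
by exists (g x) => _ [z /= + <-]; rewrite in_itv /= andbT => /ltW; exact: nd.
Unshelve. all: by end_near. Qed.

(** For a finite non-increasing phi, right-continuous at a and b:
    d(-phi)(]a, b]) = phi(a) - phi(b). *)
Lemma dminus_itv phi (a b : R) :
  (forall x : R, (0 < x)%R -> phi x \is a fin_num) ->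
  (forall x y : R, (0 < x)%R -> (x <= y)%R -> phi y <= phi x) ->
  fine (phi x) @[x --> a^'+] --> fine (phi a) ->
  fine (phi x) @[x --> b^'+] --> fine (phi b) ->
  (0 < a)%R -> (a <= b)%R -> dminus phi `]a, b] = phi a - phi b.
Proof.
move=> fphi niphi ca cb a0 ab; have b0 := lt_le_trans a0 ab.
rewrite /dminus; set g := (fun s => _).
have nd : nondecreasing g.
  move=> x y xy; rewrite /g lerN2 fine_le ?fphi ?expR_gt0 //.
  by apply: niphi; rewrite ?expR_gt0 // ler_expR.
have gE c : (0 < c)%R -> fine (phi x) @[x --> c^'+] --> fine (phi c) ->
    right_lim g (ln c) = (- fine (phi c))%R.
  move=> c0 cc; rewrite right_lim_id //; last first.
    rewrite /g lnK //; apply: cvgN.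
    apply: (@cvg_comp _ _ _ expR (fine \o phi) _ c^'+) => //.
    have ec : expR x @[x --> (ln c)^'+] --> c.
      rewrite -[X in _ --> X](lnK (c0 : c \in Num.pos)).
      by apply: cvg_within_filter; exact: continuous_expR.
    move=> A /ec /= wA; near=> x; have : (c < expR x -> A (expR x))%R.
      by near: x.
    apply; rewrite -[ltLHS](lnK (c0 : c \in Num.pos)) ltr_expR.
    by near: x; exact: nbhs_right_gt.
  by rewrite /g lnK.
rewrite /stieltjes; case: pselect => // nd'; rewrite /pushforward /=.
rewrite (_ : _ @^-1` _ = `]ln a, ln b]%classic); last first.
  have eab x : (ln a < x <= ln b)%R = (a < expR x <= b)%R.
    by rewrite -ltr_expR -[(x <= _)%R]ler_expR !lnK.
  by apply/seteqP; split=> x /=; rewrite !in_itv /= eab.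
rewrite /lebesgue_stieltjes_measure /measure_extension /= measurable_mu_extE /=; last first.
  exact: is_ocitv.
rewrite wlength_itv_bnd ?ler_ln //=.
by rewrite !gE // opprK addrC EFinB !fineK ?fphi.
Unshelve. all: by end_near. Qed.

Lemma dminus_nonpos phi : dminus phi `]-oo, 0%R] = 0.
Proof.
rewrite /dminus /pushforward (_ : _ @^-1` _ = set0) ?measure0 //.
apply/seteqP; split => // x /=; rewrite in_itv /= => /le_lt_trans.
by move=> /(_ _ (expR_gt0 x)); rewrite ltxx.
Qed.

End stieltjes.

Section hardy.
Context {R : realType}.
Implicit Types (p q : R) (u : R -> R) (a f v w : R -> \bar R).

Definition conjexp p : R := (1 - p^-1)^-1%R.

Definition rexp p q : R := (q^-1 - p^-1)^-1%R.

Definition primitive v (t : R) : \bar R := \lint_(s in `]0%R, t[) v s.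

Definition sup_from (g : R -> \bar R) (t : R) : \bar R :=
  ereal_sup [set g tau | tau in `[t, +oo[].

(** R_u f. *)
Definition sup_operator u f : R -> \bar R :=
  sup_from (fun tau => (u tau)%:E * f tau).

(** The quotient uses [inve]: c / 0 = +oo for c > 0 and
    0 / 0 = +oo / +oo = 0, since 0 * +oo = 0. *)
Definition best_constant p q u a v w : \bar R :=
  ereal_sup [set
    (\lint_(x in `]0%R, +oo[)
       ((\lint_(t in `]0%R, x[) (sup_operator u f t * a t)) `^ q * w x))
      `^ q^-1
    / (\lint_(s in `]0%R, +oo[) (f s `^ p * v s)) `^ p^-1
    | f in Mplus_nonincreasing].

(** V^p' v.  For a weight v, 0 < V < +oo on (0, oo), so that real powers of V,
    negative ones included, have their usual meaning ([poweR] sends both 0 and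
    +oo to themselves for a negative exponent). *)
Definition Vpv p v (x : R) : \bar R := primitive v x `^ conjexp p * v x.

Definition uVm2 u v (tau : R) : \bar R :=
  (u tau)%:E * primitive v tau `^ (- 2%:R)%R.

(** If u is continuous and u, v are weights then varphi is either finite and
    continuous on (0, oo) or identically +oo.  In the latter case
    [dminus (varphi p u v)] is 0, but then [limit_term] is +oo. *)
Definition varphi p u v : R -> \bar R :=
  sup_from (fun tau =>
    (u tau)%:E `^ conjexp p * primitive v tau `^ (- (2 * conjexp p))%R *
    \lint_(s in `]0%R, tau[) Vpv p v s).

Definition limit_term p q u a v w : \bar R :=
  (\lint_(y in `]0%R, +oo[) (primitive a y `^ q * w y)) `^ q^-1 *
  lim (sup_from (fun tau =>
         uVm2 u v tau *
         (\lint_(s in `]0%R, tau[) Vpv p v s) `^ (conjexp p)^-1) t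
       @[t --> +oo%R]).

(** c^-1 G <= F <= c G *)
Definition equivalent_upto (c : R) (F G : \bar R) : Prop :=
  c^-1%:E * G <= F /\ F <= c%:E * G.

End hardy.

(* Main.v *)
(** Write s = V^p' v, K(t) = int_0^t k s and R k(t) = sup_(tau >= t) u(tau) V(tau)^-2 K(tau).
    The substitution f = k V^(p'-1) removes the monotonicity: N is comparable with the norm of
    k |-> int_0^x (R k) a from L^p(s) to L^q(w) over all k >= 0.  Indeed f <= 4 V^-2 int_0^x f V v
    for a non-increasing f, and conversely V^-2 K has, by Hoelder's inequality on the dyadic level
    sets of V, a non-increasing majorant f with int f^p v <= C int k^p s.

    Upper bound.  R k is at most U K, where U(t) = sup_(tau >= t) u V^-2, plus
    2 (h^(1/p) + phi(oo)^(1/p') |k|), where h(t) = int_t^oo (phi - phi(oo))^(p-1) k^p s.  The part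
    U K is a Hardy operator with kernel int_x^y U a (first two terms), the constant part gives the
    last term, and int_0^x h^(1/p) a is split where phi - phi(oo) passes 4 times its value at x,
    into Hardy operators for the measures A^q w (third term) and A^p' d(-phi) (fourth term).  All
    of them are discretized on the dyadic levels of monotone functions.

    Lower bound.  The first two terms come from the kernel operator and its dual.  The indicator of
    (0, tau) gives the last term, the third one when p <= q, and the finiteness of phi.
    For the third and fourth terms let tau_m be the last point where phi - phi(oo) = 2^m, so that
    phi is attained at tau_m: testing with (sum_m x_m S(tau_m)^-1 1_(0, tau_m))^(1/p),
    S = int_0^t s, gives a discrete dual inequality from which both follow. *)
Require Import Defs.
From HB Require Import structures.
From mathcomp Require Import all_boot all_order all_algebra.
From mathcomp Require Import all_classical all_reals all_analysis measurable_realfun.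
From mathcomp Require Import ring lra zify.

Set Implicit Arguments.
Unset Strict Implicit.
Unset Printing Implicit Defensive.
Import Order.TTheory GRing.Theory Num.Theory.
Import numFieldNormedType.Exports.

Local Open Scope classical_set_scope.
Local Open Scope ring_scope.
Local Open Scope ereal_scope.

(** The exponent -2 comes from [V^2 <= 4 int_0^x V v], the density [V^p' v] from the identity
    [(p' - 1) p = p'], which turns [int f^p v] into [int k^p V^p' v]. Two obstacles shape the rest.
    First, [V], [A] and the tails are primitives of functions that are merely locally integrable,
    and [phi] is only a supremum; the chain rule and integration by parts are therefore replaced by
    one property, [rank]: the set where [S <= l] has mass at most [l]. It gives
    [int S^g e >= 2^-(g+1) (int e)^(g+1)], makes Hoelder's inequality summable over dyadic levels,
    and makes sense for sequences under the counting measure, as the term with [d(-phi)] requires.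
    Second, [p <= q] calls for suprema and [q < p] for integrals; both are hidden in [gauge], so
    that each upper bound reduces to one for [sum_n del_n^(q/p) X_n] with [sum_n del_n] controlled
    by the norm. Subtracting its limit from [phi] leaves a continuous function that decreases to 0
    and so crosses every positive level below its supremum. Truncation enters in the tests for the
    lower bounds, where a finite quantity has to be cancelled. *)

Section ereal_powers.
Context {R : realType}.
Implicit Types (x y z : \bar R) (r s : R).

Lemma le_poweR r x y : (0 <= r)%R -> 0 <= x -> x <= y -> x `^ r <= y `^ r.
Proof.
move=> r0 x0 xy; apply: gt0_ler_poweR => //; rewrite in_itv/= leey andbT//.
exact: le_trans xy.
Qed.

Lemma le_mull x y z : 0 <= x -> y <= z -> x * y <= x * z.
Proof. by move=> x0 yz; exact: lee_wpmul2l. Qed.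

Lemma le_mulr x y z : 0 <= x -> y <= z -> y * x <= z * x.
Proof. by move=> x0 yz; exact: lee_wpmul2r. Qed.

Lemma poweR_addr x r s : 0 <= x -> (0 < r)%R -> (0 < s)%R ->
  x `^ r * x `^ s = x `^ (r + s).
Proof.
move=> x0 r0 s0; rewrite poweRD//; apply: add_neq0_poweRD_def.
by rewrite gt_eqF// addr_gt0.
Qed.

Lemma poweR_addr_ge0 x r s : 0 < x -> (0 <= r)%R -> (0 <= s)%R ->
  x `^ r * x `^ s = x `^ (r + s).
Proof.
by move=> x0 r0 s0; rewrite poweRD//; apply: nneg_neq0_poweRD_def; rewrite // gt_eqF.
Qed.

Lemma poweRK x r : 0 <= x -> (r != 0)%R -> (x `^ r) `^ r^-1 = x.
Proof. by move=> x0 r0; rewrite -poweRrM mulfV// poweRe1. Qed.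

Lemma poweRVK x r : 0 <= x -> (r != 0)%R -> (x `^ r^-1) `^ r = x.
Proof. by move=> x0 r0; rewrite -poweRrM mulVf// poweRe1. Qed.

Lemma poweR_le_inv x y r : (0 < r)%R -> 0 <= x -> 0 <= y ->
  x `^ r <= y `^ r -> x <= y.
Proof.
move=> r0 x0 y0 h; have := @le_poweR r^-1 _ _ _ (poweR_ge0 _ _) h.
by rewrite !poweRK ?gt_eqF//; apply; rewrite invr_ge0 ltW.
Qed.

Lemma poweR_max_le x y r : (0 <= r)%R -> 0 <= x -> 0 <= y ->
  (x + y) `^ r <= (2 `^ r)%:E * (x `^ r + y `^ r).
Proof.
move=> r0.
wlog xy : x y / x <= y.
  move=> h; case/orP: (le_total x y) => [|yx x0 y0]; first exact: h.
  by rewrite addeC [leRHS]muleC [X in X * _]addeC muleC; exact: h.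
move=> x0 y0; apply: (@le_trans _ _ ((2%:E * y) `^ r)).
  apply: le_poweR => //; first exact: adde_ge0.
  by rewrite -[2%R]/(1 + 1)%R EFinD ge0_muleDl// mul1e leeD2r.
rewrite poweRM// poweR_EFin lee_pmul2l ?lte_fin ?powR_gt0//.
by rewrite leeDr ?poweR_ge0.
Qed.

Lemma poweR_addr_unit x r s : 0 <= x -> (0 <= r)%R -> (0 < s)%R ->
  x `^ r * x `^ s = x `^ (r + s).
Proof.
move=> x0; rewrite le_eqVlt => /predU1P[<-|r0] s0; last exact: poweR_addr.
by rewrite poweRe0 mul1e add0r.
Qed.

(** Negative powers fix 0 and [+oo], so that for [r > 0] the cancellation fails at both; this is why
    quantities are compared with 0 and [+oo] before a power is cancelled. *)
Lemma poweR_inv_le1 (x : \bar R) (r : R) : 0 < x -> x < +oo ->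
  x `^ (- r) * x `^ r = 1.
Proof.
case: x => [x|//|//]; rewrite lte_fin => x0 _.
by rewrite !poweR_EFin -EFinM powRN mulVf// gt_eqF// powR_gt0.
Qed.

(** Passes to a supremum [M] inside a product: [l < M] then yields an actual value above [l].
    Multiplication is not continuous at [0 * +oo], so the infinite values of [c], [M] and [Y] are
    treated one by one. *)
Lemma mule_le_of_lt (c M Y : \bar R) : 0 <= c -> 0 <= Y ->
  (forall l : R, (0 < l)%R -> l%:E < M -> c * l%:E <= Y) -> c * M <= Y.
Proof.
move=> c0 Y0 h.
have [M0|M0] := leP M 0.
  by apply: le_trans Y0; rewrite mule_ge0_le0.
case: M M0 h => [M| |//].
  rewrite lte_fin => M0 h.
  have cfin : Y < +oo -> c \is a fin_num.
    move=> Yoo; have := h (M / 2)%R.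
    rewrite divr_gt0// lte_fin ltr_pdivrMr// ltr_pMr// ltr1n => /(_ isT isT).
    case: c c0 h => // _ _; rewrite gt0_mulye ?lte_fin ?divr_gt0// leye_eq.
    by move=> /eqP YE; move: Yoo; rewrite YE.
  case: Y Y0 h cfin => [Y Y0 h /(_ (ltry _))|Y0 _ _|//]; last by rewrite leey.
  case: c c0 h => // c c0 h _; rewrite -EFinM lee_fin.
  rewrite leNgt; apply/negP => YcM.
  have cp : (0 < c)%R.
    rewrite lt_neqAle -lee_fin c0 andbT eq_sym; apply/eqP => c0'.
    by move: YcM; rewrite c0' mul0r ltNge; move: Y0; rewrite lee_fin => ->.
  (* The midpoint of [Y / c] and [M] is an admissible [l] with [c * l > Y]. *)
  pose l := ((Y / c + M) / 2)%R.
  have Yc : (Y / c < M)%R by rewrite ltr_pdivrMr// mulrC.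
  have Yc0 : (0 <= Y / c)%R by rewrite divr_ge0// ltW.
  have lM : (l < M)%R by rewrite /l; lra.
  have l0 : (0 < l)%R by rewrite /l; lra.
  have lY : (Y / c < l)%R by rewrite /l; lra.
  have := h l l0; rewrite lte_fin => /(_ lM); rewrite -EFinM lee_fin leNgt => /negP.
  by apply; rewrite mulrC -ltr_pdivrMr.
move=> _ h; case: c c0 h => [c c0 h|_ h|//]; last first.
  by have := h 1%R ltr01 (ltry _); rewrite mule1 mulyy.
have [->|c0'] := eqVneq c 0%R; first by rewrite mul0e.
have cp : (0 < c)%R by rewrite lt_neqAle eq_sym c0' -lee_fin.
rewrite gt0_muley ?lte_fin// leye_eq; apply/eqP.
case: Y Y0 h => [Y Y0 h|//|//].
have Yp : (0 <= Y)%R by rewrite -lee_fin.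
have := h ((Y + 1) / c)%R; rewrite divr_gt0 ?ltr_wpDl// => /(_ isT (ltry _)).
by rewrite -EFinM lee_fin mulrCA divff ?gt_eqF// mulr1 leNgt ltrDl ltr01.
Qed.

End ereal_powers.

(** * Non-negative measurable functions and Hoelder's inequality *)

Section nonneg_measurable.
Context d {T : measurableType d} {R : realType}.
Implicit Types (f g : T -> \bar R) (D : set T).

(** Both conditions are global, so that every restriction inherits them; functions on the half-line
    are extended by 0, see [posp]. *)
Definition nnm f := measurable_fun setT f /\ forall x, 0 <= f x.

Lemma nnm_meas f D : nnm f -> measurable_fun D f.
Proof. by move=> [mf _]; exact: measurable_funS mf. Qed.

Lemma nnm_cst (c : \bar R) : 0 <= c -> nnm (fun=> c).
Proof. by move=> c0; split => //; exact: measurable_cst. Qed.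

Lemma nnmD f g : nnm f -> nnm g -> nnm (fun x => f x + g x).
Proof.
move=> [mf f0] [mg g0]; split; last by move=> x; exact: adde_ge0.
exact: emeasurable_funD.
Qed.

Lemma nnmM f g : nnm f -> nnm g -> nnm (fun x => f x * g x).
Proof.
move=> [mf f0] [mg g0]; split; last by move=> x; exact: mule_ge0.
exact: emeasurable_funM.
Qed.

Lemma nnm_poweR f (r : R) : nnm f -> nnm (fun x => f x `^ r).
Proof.
move=> [mf f0]; split; last by move=> x; exact: poweR_ge0.
exact: (measurableT_comp (measurable_poweR _)).
Qed.

Lemma nnm_patch f D : measurable D -> nnm f -> nnm (f \_ D).
Proof.
move=> mD [mf f0]; split; last by move=> x; rewrite /patch; case: ifP.
by apply/(measurable_restrictT f mD); exact: measurable_funS mf.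
Qed.

Lemma nnm_nneseries (F : nat -> T -> \bar R) : (forall n, nnm (F n)) ->
  nnm (fun x => \sum_(n <oo) F n x).
Proof.
move=> mF; split; last by move=> x; apply: nneseries_ge0 => n _ _; exact: (mF n).2.
apply: ge0_emeasurable_sum => [n x _ _|n _]; [exact: (mF n).2|exact: (mF n).1].
Qed.

Lemma nnm_sum n (F : nat -> T -> \bar R) : (forall n, nnm (F n)) ->
  nnm (fun x => \sum_(i < n) F i x).
Proof.
move=> mF; split; last by move=> x; apply: sume_ge0 => i _; exact: (mF i).2.
by apply: emeasurable_sum => i; exact: (mF i).1.
Qed.

Lemma measurable_le f (l : \bar R) : nnm f -> measurable [set x | f x <= l].
Proof. by move=> [mf _]; rewrite -[X in measurable X]setTI; exact: emeasurable_fun_infty_c. Qed.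

Lemma measurable_gt f (l : \bar R) : nnm f -> measurable [set x | l < f x].
Proof. by move=> [mf _]; rewrite -[X in measurable X]setTI; exact: emeasurable_fun_o_infty. Qed.

Lemma measurable_lt f (l : \bar R) : nnm f -> measurable [set x | f x < l].
Proof. by move=> [mf _]; rewrite -[X in measurable X]setTI; exact: emeasurable_fun_infty_o. Qed.

Lemma measurable_eqy f : nnm f -> measurable [set x | f x = +oo].
Proof.
move=> nf; rewrite (_ : [set x | _] = ~` [set x | f x < +oo]).
  by apply: measurableC; exact: measurable_lt.
apply/seteqP; split => x /=; rewrite ltey.
  by move=> ->; rewrite eqxx.
by move=> /negP/negPn/eqP.
Qed.

Lemma measurable_eq0 f : nnm f -> measurable [set x | f x = 0].
Proof.
move=> nf; rewrite (_ : [set x | _] = [set x | f x <= 0]); first exact: measurable_le.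
apply/seteqP; split => x /=; first by move=> ->.
by move=> S0; apply/eqP; rewrite eq_le S0 nf.2.
Qed.

Variable m : {measure set T -> \bar R}.

(** Free of measurability: the integral of a non-negative function is a supremum over the simple
    functions below it. *)
Lemma le_integral_nng f g D : (forall x, D x -> 0 <= f x) ->
  (forall x, D x -> f x <= g x) -> \int[m]_(x in D) f x <= \int[m]_(x in D) g x.
Proof.
move=> f0 fg; rewrite integral_mkcond [leRHS]integral_mkcond.
have h0 x : 0 <= (f \_ D) x.
  by rewrite /patch; case: ifPn => // /set_mem; exact: f0.
have hfg x : (f \_ D) x <= (g \_ D) x.
  by rewrite /patch; case: ifPn => // /set_mem; exact: fg.
have k0 x : 0 <= (g \_ D) x by exact: le_trans (hfg x).
rewrite !ge0_integralTE//; apply: ereal_sup_le => _ [h hf <-].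
by exists h => // x; exact: le_trans (hf x) (hfg x).
Qed.

Lemma subset_integral_nng f D E : (forall x, E x -> 0 <= f x) -> D `<=` E ->
  \int[m]_(x in D) f x <= \int[m]_(x in E) f x.
Proof.
move=> f0 DE; rewrite integral_mkcond [leRHS]integral_mkcond.
apply: le_integral_nng => x _.
  by rewrite /patch; case: ifPn => // /set_mem /DE; exact: f0.
rewrite /patch; case: ifPn => [/set_mem /DE Ex|_]; first by rewrite mem_set.
by case: ifPn => // /set_mem; exact: f0.
Qed.

Lemma integralMl (c : \bar R) f D : measurable D -> 0 <= c -> nnm f ->
  \int[m]_(x in D) (c * f x) = c * \int[m]_(x in D) f x.
Proof. by move=> mD c0 [mf f0]; rewrite ge0_integralZl//; exact: measurable_funS mf. Qed.

Lemma integralMr (c : \bar R) f D : measurable D -> 0 <= c -> nnm f ->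
  \int[m]_(x in D) (f x * c) = (\int[m]_(x in D) f x) * c.
Proof. by move=> ? ? ?; under eq_integral do rewrite muleC; rewrite integralMl// muleC. Qed.

Lemma integralDn f g D : measurable D -> nnm f -> nnm g ->
  \int[m]_(x in D) (f x + g x) = \int[m]_(x in D) f x + \int[m]_(x in D) g x.
Proof.
by move=> mD [mf f0] [mg g0]; rewrite ge0_integralD//;
  [exact: measurable_funS mf|exact: measurable_funS mg].
Qed.

Lemma integral_seriesn (F : nat -> T -> \bar R) D : measurable D ->
  (forall n, nnm (F n)) ->
  \int[m]_(x in D) (\sum_(n <oo) F n x) = \sum_(n <oo) \int[m]_(x in D) F n x.
Proof.
move=> mD mF; rewrite integral_nneseries// => [n|n x _]; last exact: (mF n).2.
exact: measurable_funS (mF n).1.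
Qed.

Lemma integral_sumn n (F : nat -> T -> \bar R) D : measurable D ->
  (forall n, nnm (F n)) ->
  \int[m]_(x in D) (\sum_(i < n) F i x) = \sum_(i < n) \int[m]_(x in D) F i x.
Proof.
move=> mD mF; rewrite ge0_integral_sum// => [i|i x _]; last exact: (mF i).2.
exact: measurable_funS (mF i).1.
Qed.

Lemma integral_nng f D : (forall x, D x -> 0 <= f x) -> 0 <= \int[m]_(x in D) f x.
Proof. by move=> f0; exact: integral_ge0. Qed.

Lemma young_poweR (P Q : R) (x y : \bar R) : (0 < P)%R -> (0 < Q)%R ->
  (P^-1 + Q^-1 = 1)%R -> 0 <= x -> 0 <= y ->
  x * y <= P^-1%:E * x `^ P + Q^-1%:E * y `^ Q.
Proof.
move=> P0 Q0 PQ; case: x => [x| |//]; case: y => [y| |//].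
- rewrite !lee_fin => x0 y0.
  by rewrite (mulrC P^-1%R) (mulrC Q^-1%R); exact: conjugate_powR.
- move=> x0 _; rewrite poweRyr ?gt_eqF// [Q^-1%:E * _]gt0_muley ?lte_fin ?invr_gt0//.
  by rewrite addey ?leey// gt_eqF// (lt_le_trans (ltNy0 _))// mule_ge0// ?poweR_ge0// lee_fin invr_ge0 ltW.
- move=> _ x0; rewrite poweRyr ?gt_eqF// [P^-1%:E * _]gt0_muley ?lte_fin ?invr_gt0//.
  by rewrite addye ?leey// gt_eqF// (lt_le_trans (ltNy0 _))// mule_ge0// ?poweR_ge0// lee_fin invr_ge0 ltW.
- move=> _ _; rewrite !poweRyr ?gt_eqF// !gt0_muley ?lte_fin ?invr_gt0//.
Qed.

(** Young's inequality for the factors normalised to norm 1. A factor of norm 0 vanishes almost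
    everywhere, which makes the product null even against a factor of infinite norm. *)
Lemma integral_hoelder (P Q : R) f g D : measurable D -> (0 < P)%R -> (0 < Q)%R ->
  (P^-1 + Q^-1 = 1)%R -> nnm f -> nnm g ->
  \int[m]_(x in D) (f x * g x) <=
  (\int[m]_(x in D) f x `^ P) `^ P^-1 * (\int[m]_(x in D) g x `^ Q) `^ Q^-1.
Proof.
move=> mD P0 Q0 PQ nf ng.
set X := \int[m]_(x in D) f x `^ P; set Y := \int[m]_(x in D) g x `^ Q.
have ae0 (h : T -> \bar R) (r : R) : nnm h -> (0 < r)%R ->
    \int[m]_(x in D) h x `^ r = 0 -> forall k, nnm k -> \int[m]_(x in D) (h x * k x) = 0.
  move=> nh r0 h0 k nk.
  have : \int[m]_(x in D) `|h x `^ r| = 0.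
    by rewrite -[RHS]h0; apply: eq_integral => x _; rewrite gee0_abs ?poweR_ge0.
  move=> /(ae_eq_integral_abs m mD (nnm_meas (nnm_poweR r nh))) aeh.
  rewrite (@ge0_ae_eq_integral _ _ _ m D _ (cst 0))//.
  - by rewrite integral0.
  - exact: nnm_meas (nnmM nh nk).
  - by move=> x _; exact: (nnmM nh nk).2.
  - apply: filterS aeh => x hx Dx; have := hx Dx.
    by move=> /(poweR_eq0_eq0 (nh.2 x)) ->; rewrite mul0e.
have X0 : 0 <= X by apply: integral_nng => x _; exact: poweR_ge0.
have Y0 : 0 <= Y by apply: integral_nng => x _; exact: poweR_ge0.
have [X0'|Xp] := eqVneq X 0; first by rewrite (ae0 f P)// mule_ge0 ?poweR_ge0.
have [Y0'|Yp] := eqVneq Y 0.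
  under eq_integral do rewrite muleC.
  by rewrite (ae0 g Q)// mule_ge0 ?poweR_ge0.
have {}Xp : 0 < X by rewrite lt_def Xp.
have {}Yp : 0 < Y by rewrite lt_def Yp.
have [->|Xoo] := eqVneq X +oo.
  by rewrite poweRyr ?gt_eqF ?invr_gt0// gt0_mulye ?leey// poweR_gt0.
have [->|Yoo] := eqVneq Y +oo.
  by rewrite poweRyr ?gt_eqF ?invr_gt0// gt0_muley ?leey// poweR_gt0.
have {}Xoo : X < +oo by rewrite ltey.
have {}Yoo : Y < +oo by rewrite ltey.
pose x1 := X `^ P^-1; pose y1 := Y `^ Q^-1.
have i1 r s : (0 < r)%R -> nnm s -> (forall Z, 0 < Z -> Z < +oo ->
   (\int[m]_(x in D) s x `^ r = Z) ->
   \int[m]_(x in D) ((Z `^ (- r^-1) * s x) `^ r) = 1).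
  move=> r0 ns Z Zp Zoo ZE.
  under eq_integral do rewrite poweRM ?poweR_ge0 ?(ns.2)// -poweRrM mulNr mulVf ?gt_eqF//.
  rewrite integralMl ?poweR_ge0//; last exact: nnm_poweR.
  by rewrite ZE -[X in _ * X]poweRe1 ?ltW// poweR_inv_le1.
have nfx : nnm (fun x => X `^ (- P^-1) * f x) by apply: nnmM => //; apply: nnm_cst; exact: poweR_ge0.
have ngy : nnm (fun x => Y `^ (- Q^-1) * g x) by apply: nnmM => //; apply: nnm_cst; exact: poweR_ge0.
have h : \int[m]_(x in D) ((X `^ (- P^-1) * f x) * (Y `^ (- Q^-1) * g x)) <= 1.
  apply: (@le_trans _ _ (\int[m]_(x in D) (P^-1%:E * (X `^ (- P^-1) * f x) `^ P +
     Q^-1%:E * (Y `^ (- Q^-1) * g x) `^ Q))).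
    apply: le_integral_nng => x _; first by rewrite mule_ge0// ?nfx.2 ?ngy.2.
    exact: young_poweR (nfx.2 x) (ngy.2 x).
  have nP : 0 <= P^-1%:E by rewrite lee_fin invr_ge0 ltW.
  have nQ : 0 <= Q^-1%:E by rewrite lee_fin invr_ge0 ltW.
  rewrite integralDn//; [|by apply: nnmM; [exact: nnm_cst|exact: nnm_poweR]..].
  rewrite !integralMl//; [|exact: nnm_poweR..].
  by rewrite (i1 _ _ P0 nf X)// (i1 _ _ Q0 ng Y)// !mule1 -EFinD PQ.
have {}h : X `^ (- P^-1) * Y `^ (- Q^-1) * \int[m]_(x in D) (f x * g x) <= 1.
  rewrite -integralMl//; [|by rewrite mule_ge0 ?poweR_ge0|exact: nnmM].
  by under eq_integral do rewrite muleACA.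
set I := \int[m]_(x in D) (f x * g x) in h *.
have -> : I = X `^ (- P^-1) * Y `^ (- Q^-1) * I * (X `^ P^-1 * Y `^ Q^-1).
  rewrite muleAC muleACA (poweR_inv_le1 P^-1 Xp Xoo) (poweR_inv_le1 Q^-1 Yp Yoo).
  by rewrite !mul1e.
rewrite -[leRHS]mul1e; apply: lee_wpmul2r => //.
by rewrite mule_ge0 ?poweR_ge0.
Qed.

Lemma integral_setID f D E : measurable D -> measurable E -> nnm f ->
  \int[m]_(x in D) f x =
  \int[m]_(x in D `&` E) f x + \int[m]_(x in D `&` ~` E) f x.
Proof.
move=> mD mE [mf f0]; rewrite -ge0_integral_setU//=.
- by rewrite -setIUr setUv setIT.
- exact: measurableI.
- by apply: measurableI => //; exact: measurableC.
- exact: measurable_funS mf.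
- by rewrite disj_set2E setIACA setICr setI0.
Qed.

End nonneg_measurable.

Ltac nnm_tac := repeat first
  [ assumption | exact: poweR_ge0 | apply: nnmM | apply: nnmD | apply: nnm_poweR
  | apply: nnm_cst ].

(** * Ranks and dyadic levels *)

Section rank.
Context d {T : measurableType d} {R : realType}.
Variable m : {measure set T -> \bar R}.
Implicit Types (D : set T) (e S : T -> \bar R).

(* [S] ranks the mass [e]: each sublevel set of [S] carries a mass at most equal to the
   level, as is the case when [S] is a primitive or a tail of [e]. *)
Definition rank D e S := forall l : R, (0 < l)%R ->
  \int[m]_(x in D `&` [set x | S x <= l%:E]) e x <= l%:E.

Lemma rank_gt D e S (l : R) : measurable D -> nnm e -> nnm S -> rank D e S ->
  (0 < l)%R -> \int[m]_(x in D) e x <= l%:E + \int[m]_(x in D `&` [set x | l%:E < S x]) e x.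
Proof.
move=> mD ne nS rk l0.
rewrite (integral_setID m mD (measurable_le l%:E nS) ne); apply: leeD; first exact: rk.
apply: subset_integral_nng => [x _|x [Dx /= /negP]]; first exact: ne.2.
by rewrite -ltNge => ?; split.
Qed.

(** Let [l] be half of [mine M c], [M] the mass: at most [l] of the mass lies where [S <= l], so at
    least [l] lies where [S > l], and there the power in the integrand is at least [l ^ g]. *)
Lemma rank_poweR D e S (g : R) (c : \bar R) : measurable D -> nnm e -> nnm S ->
  rank D e S -> (0 <= g)%R -> 0 <= c ->
  (2^-1%:E * mine (\int[m]_(x in D) e x) c) `^ (g + 1) <=
  \int[m]_(x in D) (mine (S x) c `^ g * e x).
Proof.
move=> mD ne nS rk g0 c0.
set M := \int[m]_(x in D) e x.
have M0 : 0 <= M by apply: integral_nng => x _; exact: ne.2.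
set N := mine M c.
have N0 : 0 <= N by rewrite le_min M0 c0.
have key (l : R) : (0 < l)%R -> l%:E <= N ->
    l%:E `^ g * \int[m]_(x in D `&` [set x | l%:E < S x]) e x <=
    \int[m]_(x in D) (mine (S x) c `^ g * e x).
  move=> l0 lN.
  have mG : measurable (D `&` [set x | l%:E < S x]).
    by apply: measurableI => //; exact: measurable_gt.
  rewrite -integralMl ?poweR_ge0//.
  apply: (@le_trans _ _ (\int[m]_(x in D `&` [set x | l%:E < S x])
      (mine (S x) c `^ g * e x))).
    apply: le_integral_nng => x [Dx lS]; first exact: mule_ge0 (poweR_ge0 _ _) (ne.2 x).
    apply: le_mulr; first exact: ne.2.
    apply: le_poweR => //; first by rewrite lee_fin ltW.
    by rewrite le_min (ltW lS)/=; apply: le_trans lN _; rewrite ge_min lexx orbT.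
  by apply: subset_integral_nng => [x Dx|x []//]; exact: mule_ge0 (poweR_ge0 _ _) (ne.2 x).
have [N00|Np] := eqVneq N 0.
  rewrite N00 mule0 poweR0r ?gt_eqF ?ltr_wpDl//.
  by apply: integral_nng => x _; exact: mule_ge0 (poweR_ge0 _ _) (ne.2 x).
have {}Np : 0 < N by rewrite lt_def Np.
have NM : N <= M by rewrite ge_min lexx.
case NE : N Np N0 => [n| |//] Np N0.
- have n0 : (0 < n)%R by rewrite -lte_fin.
  have l0 : (0 < 2^-1 * n)%R by rewrite mulr_gt0// invr_gt0.
  apply: le_trans (key _ l0 _); last by rewrite NE lee_fin; lra.
  rewrite -EFinM -poweR_addr_ge0 ?lte_fin// poweRe1 ?lee_fin ?(ltW l0)//.
  apply: le_mull; first exact: poweR_ge0.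
  have := rank_gt mD ne nS rk l0; rewrite -/M => /(le_trans NM).
  set X := \int[m]_(x in _) _; rewrite NE.
  have : 0 <= X by apply: integral_nng => x _; exact: ne.2.
  case: X => [X _| _ _|//]; last by rewrite leey.
  by rewrite -EFinD !lee_fin => ?; lra.
(* Both [M] and [c] are infinite here: the level 1 already leaves infinite mass above it. *)
- have ME : M = +oo by move: NM; rewrite NE leye_eq => /eqP.
  apply: le_trans (key 1%R ltr01 _); last by rewrite NE leey.
  rewrite poweR1r mul1e.
  have := rank_gt mD ne nS rk ltr01; rewrite -/M ME leye_eq.
  have : 0 <= \int[m]_(x in D `&` [set x | 1 < S x]) e x.
    by apply: integral_nng => x _; exact: ne.2.
  set X := integral _ _ _.
  by case: X => //= _ _; rewrite leey.
Qed.

(** Stands for [int S^g dS = S^(g+1) / (g+1)]: for [S] a primitive or a tail of [e] it bounds a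
    power of the mass without differentiating [S]. *)
Lemma rank_poweR_int D e S (g : R) : measurable D -> nnm e -> nnm S ->
  rank D e S -> (0 <= g)%R ->
  (2^-1 `^ (g + 1))%:E * (\int[m]_(x in D) e x) `^ (g + 1) <=
  \int[m]_(x in D) (S x `^ g * e x).
Proof.
move=> mD ne nS rk g0; have := rank_poweR mD ne nS rk g0 (leey 0).
have me (y : \bar R) : mine y +oo = y by apply/min_idPl; exact: leey.
have meS : (fun x => mine (S x) +oo `^ g * e x) = (fun x => S x `^ g * e x).
  by apply/funext => x; rewrite me.
rewrite (me (integral _ _ _)) meS poweRM ?poweR_EFin// ?lee_fin//.
by apply: integral_nng => x _; exact: ne.2.
Qed.

(** A subset of mass above [l] does not fit into the sublevel set; the point found serves the
    supremum in [hardy_const] when [p <= q]. *)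
Lemma rank_exists D e S (l : R) : measurable D -> nnm e -> nnm S -> rank D e S ->
  (0 < l)%R -> forall E, measurable E -> E `<=` D -> l%:E < \int[m]_(x in E) e x ->
  exists2 x, E x & l%:E < S x.
Proof.
move=> mD ne nS rk l0 E mE ED lE; apply: contrapT => h.
move: lE; apply/negP; rewrite -leNgt; apply: le_trans (rk l l0).
apply: subset_integral_nng => [x _|x Ex]; first exact: ne.2.
by split; [exact: ED|rewrite /= leNgt; apply/negP => lS; apply: h; exists x].
Qed.

Lemma rank_sub D E e S : nnm e -> E `<=` D -> rank D e S -> rank E e S.
Proof.
move=> ne ED rk l l0; apply: le_trans (rk l l0).
apply: subset_integral_nng => [x _|x [Ex Sx]]; first exact: ne.2.
by split => //; exact: ED.
Qed.

End rank.

Section levels.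
Context {R : realType}.

Definition zeta (n : nat) : int := if odd n then Negz n./2 else Posz n./2.

Lemma zeta_inj : injective zeta.
Proof.
move=> m n; rewrite /zeta => h.
rewrite -(odd_double_half m) -(odd_double_half n).
by move: h; case: (odd m); case: (odd n) => // -[->].
Qed.

Lemma zeta_surj z : exists n, zeta n = z.
Proof.
case: z => n; first by exists n.*2; rewrite /zeta odd_double doubleK.
by exists n.*2.+1; rewrite /zeta/= odd_double/= uphalf_double.
Qed.

(* The levels [2^z], [z : int], are enumerated by [nat] so as to be summed as series. *)
Definition lev (n : nat) : R := (2 `^ (zeta n)%:~R)%R.

Lemma lev_gt0 n : (0 < lev n)%R. Proof. exact: powR_gt0. Qed.

Lemma levE_ge0 n : 0 <= (lev n)%:E. Proof. by rewrite lee_fin ltW ?lev_gt0. Qed.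

Lemma lev_ge0 n : (0 <= lev n)%R. Proof. by rewrite ltW ?lev_gt0. Qed.

Hint Resolve lev_gt0 levE_ge0 lev_ge0 : core.

Lemma ltr_pow2 (x y : R) : (2 `^ x < 2 `^ y)%R = (x < y)%R.
Proof. by rewrite /powR pnatr_eq0/= ltr_expR ltr_pM2r// ln_gt0// ltr1n. Qed.

Lemma ler_pow2 (x y : R) : (2 `^ x <= 2 `^ y)%R = (x <= y)%R.
Proof. by rewrite /powR pnatr_eq0/= ler_expR ler_pM2r// ln_gt0// ltr1n. Qed.

Lemma mul2_pow2 (x : R) : (2 * 2 `^ x = 2 `^ (x + 1))%R.
Proof. by rewrite powRD ?pnatr_eq0 ?implybT// powRr1// mulrC. Qed.

Lemma pow2_ln (x : R) : (0 < x)%R -> (x = 2 `^ (ln x / ln 2))%R.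
Proof.
by move=> x0; rewrite /powR pnatr_eq0/= divfK ?lnK// gt_eqF// ln_gt0// ltr1n.
Qed.

Lemma lev_exists (x : R) : (0 < x)%R -> exists n, (lev n < x <= 2 * lev n)%R.
Proof.
(* The layers are open on the left and closed on the right, hence the ceiling minus one. *)
move=> x0; have [n nE] := zeta_surj (Num.ceil (ln x / ln 2 : R) - 1); exists n.
have /andP[h1 h2] := ceil_itv (ln x / ln 2 : R).
have xE := pow2_ln x0; rewrite /lev nE mul2_pow2; apply/andP; split.
  by rewrite [ltRHS]xE ltr_pow2.
by rewrite [leLHS]xE ler_pow2 rmorphB/= subrK.
Qed.

Lemma lev_disjoint i j (x : R) : (lev i < x <= 2 * lev i)%R -> (lev j < x <= 2 * lev j)%R ->
  i = j.
Proof.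
have h k l : (lev k < x <= 2 * lev k)%R -> (lev l < x <= 2 * lev l)%R -> (zeta k <= zeta l)%R.
  move=> /andP[k1 k2] /andP[l1 l2]; have := lt_le_trans k1 l2.
  by rewrite /lev mul2_pow2 ltr_pow2 -[1%R]/(1%:~R) -rmorphD/= ltr_int ltzD1.
move=> hi hj; apply: zeta_inj; apply/eqP; rewrite eq_le.
by rewrite (h i j)// (h j i).
Qed.

(** Distinct exponents make this a rearranged part of the geometric series. *)
Lemma uniq_geometric (th : R) (P : pred nat) (e : nat -> nat) : (0 < th)%R -> (th < 1)%R ->
  {in P &, injective e} ->
  \sum_(n <oo | P n) (th ^+ (e n))%:E <= ((1 - th)^-1)%:E.
Proof.
move=> th0 th1 ei.
rewrite nneseries_esum; last by move=> n _; rewrite lee_fin exprn_ge0// ltW.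
rewrite -(@esum_image _ _ _ [set x | P x] e (fun k => (th ^+ k)%:E)); last first.
  by move=> x y; rewrite !inE => Px Py; exact: ei.
apply: (@le_trans _ _ (\esum_(j in [set: nat]) (th ^+ j)%:E)).
  rewrite esum_mkcond [leRHS]esum_mkcond; apply: le_esum => k _; rewrite in_setT.
  by case: ifP => // _; rewrite lee_fin exprn_ge0// ltW.
rewrite -nneseries_esumT; last by move=> n; rewrite lee_fin exprn_ge0// ltW.
apply: lime_le; first by apply: is_cvg_nneseries => n _ _; rewrite lee_fin exprn_ge0// ltW.
apply: nearW => n; rewrite sumEFin lee_fin.
have := @geometric_le_lim R n 1 th ler01 th0; rewrite ger0_norm ?(ltW th0)// => /(_ th1).
rewrite mul1r; apply: le_trans; rewrite /series/=.
by under [leRHS]eq_bigr do rewrite mul1r.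
Qed.

(** The terms form part of a geometric progression in [z n] and none exceeds [rho]. So the exponents
    are at most [k], the integer part of [log_2 (rho / b) / g], and the sum is dominated by the
    geometric series descending from [rho]. *)
Let pow2_sum (g : R) : (0 < g)%R -> exists2 C : R, (0 < C)%R &
  forall (z : nat -> int) (P : pred nat) (b rho : \bar R), injective z -> 0 <= b -> 0 <= rho ->
  (forall n, P n -> (2 `^ (g * (z n)%:~R))%:E * b <= rho) ->
  \sum_(n <oo | P n) ((2 `^ (g * (z n)%:~R))%:E * b) <= C%:E * rho.
Proof.
move=> g0; pose th := (2 `^ (- g) : R)%R.
have th0 : (0 < th)%R by exact: powR_gt0.
have th1 : (th < 1)%R by rewrite -(powRr0 2%R) /th ltr_pow2 oppr_lt0.
exists (2 `^ g * (1 - th)^-1)%R.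
  by rewrite mulr_gt0 ?powR_gt0// invr_gt0 subr_gt0.
move=> z P b rho zi b0 rho0 h.
have [->|bN0] := eqVneq b 0.
  rewrite eseries0 ?mule_ge0// ?lee_fin ?mulr_ge0 ?powR_ge0 ?invr_ge0 ?subr_ge0 ?(ltW th1)//.
  by move=> n _ _; rewrite mule0.
have {bN0}b0 : 0 < b by rewrite lt_def bN0.
have Cp : (0 < 2 `^ g * (1 - th)^-1)%R.
  by rewrite mulr_gt0 ?powR_gt0// invr_gt0 subr_gt0.
case: rho rho0 h => [rho| |//] rho0 h; last by rewrite gt0_muley ?lte_fin// leey.
have [[n0 Pn0]|noP] := pselect (exists n, P n); last first.
  rewrite eseries_pred0 ?mule_ge0 ?lee_fin ?(ltW Cp)//.
  by move=> n; apply/negbTE/negP => Pn; apply: noP; exists n.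
have p0 n : (0 < 2 `^ (g * (z n)%:~R) :> R)%R by exact: powR_gt0.
case: b b0 h => [b| |//] b0 h; last first.
  by have := h _ Pn0; rewrite gt0_muley ?lte_fin// leye_eq.
rewrite lte_fin in b0.
have rp : (0 < rho)%R.
  by have := h _ Pn0; rewrite -EFinM lee_fin; apply: lt_le_trans; rewrite mulr_gt0.
have zle n : P n -> (z n <= Num.floor (ln (rho / b) / ln 2 / g : R))%R.
  move=> Pn; rewrite floor_ge_int ler_pdivlMr// mulrC -ler_pow2 -pow2_ln ?divr_gt0//.
  by rewrite ler_pdivlMr// -lee_fin EFinM h.
set k := Num.floor _ in zle.
have kle : (2 `^ (g * k%:~R) * b <= rho)%R.
  rewrite -ler_pdivlMr// [leRHS]pow2_ln ?divr_gt0// ler_pow2 mulrC -ler_pdivlMr//.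
  exact: floor_le_tmp.
apply: (@le_trans _ _ (\sum_(n <oo | P n) (rho%:E * (th ^+ `|k - z n|%N)%:E))).
  apply: lee_nneseries => [n _ Pn|n Pn].
    by rewrite mule_ge0 ?lee_fin ?powR_ge0 ?ltW.
  rewrite -!EFinM lee_fin; apply: le_trans (ler_wpM2r _ kle); last by rewrite exprn_ge0 ?ltW.
  rewrite mulrAC ler_pM2r// -powR_mulrn ?(ltW th0)// /th -powRrM -powRD ?pnatr_eq0 ?implybT//.
  rewrite ler_pow2 mulNr -mulrBr ler_pM2l//.
  have -> : (`|k - z n|%:R = (k - z n)%:~R :> R)%R.
    by rewrite natr_absz ger0_norm// subr_ge0 zle.
  by rewrite rmorphB/= opprB addrC subrK.
rewrite nneseriesZl; last by move=> n _; rewrite lee_fin exprn_ge0 ?ltW.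
rewrite muleC; apply: lee_pmul => //.
- by apply: nneseries_ge0 => n _ _; rewrite lee_fin exprn_ge0 ?ltW.
- apply: le_trans (uniq_geometric th0 th1 _) _ => [i j Pi Pj|].
    have zi0 := zle _ Pi; have zj0 := zle _ Pj.
    move=> hij; apply: zi; move: zi0 zj0 hij; move: (z i) (z j) (k) => x y l; clear; lia.
  rewrite lee_fin ler_peMl ?invr_ge0 ?subr_ge0 ?(ltW th1)//.
  by rewrite -[leLHS](powRr0 2%R) ler_pow2 ltW.
Qed.

Lemma levE_pow (n : nat) (g : R) : (lev n)%:E `^ g = (2 `^ (g * (zeta n)%:~R))%:E.
Proof. by rewrite poweR_EFin /lev -powRrM mulrC. Qed.

(** A dyadic sum over an arbitrary set of levels is controlled by a bound common to its terms, so
    that the extremal level never has to be located. For [g < 0] the integers are reflected. *)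
Lemma level_sum (g : R) : (g != 0)%R -> exists2 C : R, (0 < C)%R &
  forall (P : pred nat) (b rho : \bar R), 0 <= b -> 0 <= rho ->
  (forall n, P n -> (lev n)%:E `^ g * b <= rho) ->
  \sum_(n <oo | P n) ((lev n)%:E `^ g * b) <= C%:E * rho.
Proof.
have [g0 _|g0 _|//] := ltrgtP g 0; last first.
  have [C C0 hC] := pow2_sum g0; exists C => // P b rho b0 rho0 h.
  under eq_eseriesr do rewrite levE_pow.
  by apply: (hC zeta) => //; [exact: zeta_inj|move=> n /h; rewrite levE_pow].
have [|C C0 hC] := @pow2_sum (- g); first by rewrite oppr_gt0.
exists C => // P b rho b0 rho0 h.
have e n : (lev n)%:E `^ g = (2 `^ (- g * (- zeta n)%:~R))%:E.
  by rewrite levE_pow rmorphN/= mulrNN.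
under eq_eseriesr do rewrite e.
apply: (hC (fun n => - zeta n)%R) => //; last by move=> n /h; rewrite e.
by move=> i j /oppr_inj; exact: zeta_inj.
Qed.

End levels.
#[export] Hint Resolve lev_gt0 levE_ge0 lev_ge0 : core.

(** * Relations between the exponents *)

Section conjugates.
Context {R : realType}.
Implicit Types p q : R.
Local Open Scope ring_scope.

Lemma conjexp_gt1 p : 1 < p -> 1 < conjexp p.
Proof.
move=> p1; rewrite /conjexp invf_gt1; last by rewrite subr_gt0 invf_lt1// (lt_trans _ p1).
by rewrite ltrBlDr ltrDl invr_gt0 (lt_trans _ p1).
Qed.

Lemma conjexp_gt0 p : 1 < p -> 0 < conjexp p.
Proof. by move=> /conjexp_gt1; exact: lt_trans. Qed.

Lemma conjexpV p : (conjexp p)^-1 = 1 - p^-1.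
Proof. by rewrite /conjexp invrK. Qed.

Lemma conjexp_add p : p^-1 + (conjexp p)^-1 = 1.
Proof. by rewrite conjexpV addrC subrK. Qed.

Lemma conjexp_div p : 1 < p -> p / conjexp p = p - 1.
Proof. by move=> p1; rewrite conjexpV mulrBr mulr1 divff// gt_eqF// (lt_trans _ p1). Qed.

Lemma conjexpB1 p : 1 < p -> (conjexp p - 1) * p = conjexp p.
Proof.
move=> p1; have p0 : p != 0 by rewrite gt_eqF// (lt_trans _ p1).
have q0 : conjexp p != 0 by rewrite gt_eqF// conjexp_gt0.
have := conjexp_add p => h.
apply: (mulIf (invr_neq0 p0)); rewrite mulfK// -[in RHS](addrK (conjexp p)^-1 p^-1) h.
by rewrite mulrBr mulr1 divff.
Qed.

Lemma rexp_gt0 p q : 0 < q -> q < p -> 0 < rexp p q.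
Proof.
by move=> q0 qp; rewrite /rexp invr_gt0 subr_gt0 ltf_pV2 ?posrE// (lt_trans q0).
Qed.

Lemma rexp_q p q : 0 < q -> q < p -> rexp p q / q = rexp p q / p + 1.
Proof.
move=> q0 qp; have r0 := rexp_gt0 q0 qp; set r := rexp p q.
have -> : q^-1 = r^-1 + p^-1 by rewrite /r /rexp invrK subrK.
by rewrite mulrDr divff ?gt_eqF// addrC.
Qed.

Lemma rexp_conj p q : 1 < q -> q < p ->
  rexp p q / conjexp p = rexp p q / conjexp q + 1.
Proof.
move=> q1 qp; have r0 := rexp_gt0 (lt_trans ltr01 q1) qp.
rewrite !conjexpV !mulrBr !mulr1 (rexp_q _ qp) ?(lt_trans ltr01)//; ring.
Qed.

End conjugates.

(** * Summation over dyadic levels *)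

Section level_lemmas.
Context {R : realType}.

(** For fixed [x] the sum over the levels with [lev n >= S x / k] is geometric, and each of its
    terms is at most [k^c] times [lam x]. *)
Lemma summable_levels (c k : R) : (0 < c)%R -> (0 < k)%R ->
  exists2 C : R, (0 < C)%R & forall d (T : measurableType d)
    (m : {measure set T -> \bar R}) (D : set T) (S lam : T -> \bar R),
    measurable D -> nnm S -> nnm lam ->
  \sum_(n <oo) \int[m]_(x in D `&` [set x | S x <= (k * lev n)%:E])
     ((lev n)%:E `^ (- c) * (S x `^ c * lam x)) <= C%:E * \int[m]_(x in D) lam x.
Proof.
move=> c0 k0; have [|C C0 hC] := @level_sum R (- c); first by rewrite oppr_eq0 gt_eqF.
exists (C * k `^ c)%R; first by rewrite mulr_gt0// powR_gt0.
move=> d T m D S lam mD nS nlam.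
have nF n : nnm (fun x => (lev n)%:E `^ (- c) * (S x `^ c * lam x)).
  by nnm_tac.
under eq_eseriesr do rewrite integral_mkcondr.
rewrite -integral_seriesn//; last first.
  by move=> n; apply: nnm_patch => //; exact: measurable_le.
rewrite -integralMl//; last by rewrite lee_fin mulr_ge0 ?powR_ge0 ?ltW.
apply: le_integral_nng => x Dx.
  by apply: nneseries_ge0 => n _ _; rewrite /patch; case: ifP => // _; exact: (nF n).2.
pose P n := S x <= (k * lev n)%:E.
rewrite (eq_eseriesr (g := fun n => if P n then (lev n)%:E `^ (- c) * (S x `^ c * lam x) else 0)); last first.
  move=> n _; rewrite /patch /P; congr (if _ then _ else _).
  by apply/idP/idP; rewrite inE.
rewrite -eseries_mkcond.
apply: le_trans (hC P (S x `^ c * lam x) ((k `^ c)%:E * lam x) _ _ _) _.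
- by rewrite mule_ge0 ?poweR_ge0 ?nlam.2.
- by rewrite mule_ge0 ?lee_fin ?powR_ge0 ?nlam.2.
- move=> n Pn; rewrite muleA; apply: le_mulr; first exact: nlam.2.
  apply: (@le_trans _ _ ((lev n)%:E `^ (- c) * ((k%:E * (lev n)%:E) `^ c))).
    apply: le_mull; first exact: poweR_ge0.
    by apply: le_poweR; [exact: ltW|exact: nS.2|exact: Pn].
  rewrite poweRM//; last by rewrite lee_fin ltW.
  by rewrite muleCA poweR_inv_le1 ?mule1 ?lte_fin ?ltry ?lev_gt0.
- by rewrite muleA EFinM.
Qed.

(* The weights [S `^ (+- 1/(2Q))] make both factors in Hoelder's inequality
   geometrically summable over the levels of [S]. *)
Lemma rank_hoelder (P Q : R) : (1 < P)%R -> (1 < Q)%R -> (P^-1 + Q^-1 = 1)%R ->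
  let c := (P / (2 * Q))%R in
  exists2 C : R, (0 < C)%R & forall d (T : measurableType d)
    (m : {measure set T -> \bar R}) (S kap eps : T -> \bar R),
    nnm S -> nnm kap -> nnm eps -> (forall x, S x = 0 -> eps x = 0) ->
    rank m setT (fun x => eps x `^ Q) S ->
  let del n := \int[m]_(x in [set x | S x <= (2 * lev n)%:E])
     ((lev n)%:E `^ (- c) * (S x `^ c * kap x `^ P)) in
  (forall n, \int[m]_(x in [set x | S x <= (2 * lev n)%:E]) (kap x * eps x) <=
     C%:E * (lev n)%:E `^ Q^-1 * del n `^ P^-1) /\
  \sum_(n <oo) del n <= C%:E * \int[m]_x kap x `^ P.
Proof.
move=> P1 Q1 PQ c.
have P0 : (0 < P)%R by apply: lt_trans P1.
have Q0 : (0 < Q)%R by apply: lt_trans Q1.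
have c0 : (0 < c)%R by rewrite divr_gt0// mulr_gt0.
have [C1 C10 hC1] := @summable_levels c 2 c0 (ltr0n _ 2).
pose Pl n l := ((lev l : R) <= 2 * lev n)%R.
(* With exponent 1/2 the sum over the layers up to level [n] is governed by the top layer. *)
have [C2 C20 hC2] : exists2 C2 : R, (0 < C2)%R &
    forall n, \sum_(l <oo | Pl n l) ((lev l)%:E `^ (1/2) * 2%:E) <= C2%:E * (lev n)%:E `^ (1/2).
  have [|C2 C20 hC2] := @level_sum R (1/2); first by rewrite gt_eqF.
  exists (C2 * (2 * 2 `^ (1/2)))%R; first by rewrite !mulr_gt0// powR_gt0.
  move=> n; apply: le_trans (hC2 (Pl n) 2%:E (2%:E * (2 * lev n)%:E `^ (1/2)) _ _ _) _ => //.
  - by rewrite mule_ge0 ?poweR_ge0.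
  - move=> l Pll; rewrite muleC; apply: le_mull => //.
    by apply: le_poweR => //; rewrite ?lee_fin// divr_ge0.
  - rewrite [X in X `^ _]EFinM poweRM// poweR_EFin.
    by rewrite !muleA -!EFinM mulrA.
pose b : R := ((2 * Q)^-1)%R.
have b0 : (0 < b)%R by rewrite invr_gt0 mulr_gt0.
have bQ : (- b * Q = - (1/2))%R.
  by rewrite mulNr mul1r /b invfM -mulrA mulVf ?mulr1// gt_eqF.
have Qb : (1 / 2 / Q = b)%R by rewrite /b invfM mul1r.
have bb : (Q^-1 = b + b)%R by rewrite /b invfM; lra.
have bP : (b * P = c)%R by rewrite /b /c mulrC.
have cP : (c * P^-1 = b)%R by rewrite -bP mulfK// gt_eqF.
clearbody b.
pose C3 : R := (C2 `^ Q^-1)%R.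
have C30 : (0 < C3)%R by rewrite powR_gt0.
exists (C1 + C3)%R; first exact: addr_gt0.
move=> d T m S kap eps nS nkap neps Se rk del.
have mG n : measurable [set x | S x <= (2 * lev n)%:E] by exact: measurable_le.
split => [n|]; last first.
  apply: le_trans (_ : C1%:E * \int[m]_x kap x `^ P <= _).
    have := hC1 d T m setT S (fun x => kap x `^ P) measurableT nS (nnm_poweR _ nkap).
    by under eq_eseriesr do rewrite setTI.
  apply: le_mulr; last by rewrite lee_fin lerDl ltW.
  by apply: integral_nng => x _; exact: poweR_ge0.
(* On the layer of level [l] the weight is at most [lev l ^ (-1/2)] and the mass of [eps ^ Q] at
   most [2 * lev l] by [rank], which leaves the summable [lev l ^ (1/2)]. *)
have half : \int[m]_(x in [set x | S x <= (2 * lev n)%:E]) (S x `^ (- b) * eps x) `^ Q <=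
    C2%:E * (lev n)%:E `^ (1/2).
  apply: (@le_trans _ _ (\int[m]_(x in [set x | S x <= (2 * lev n)%:E])
    \sum_(l <oo) ((fun x => if Pl n l then (lev l)%:E `^ (- (1/2)) * eps x `^ Q else 0)
       \_ [set x | S x <= (2 * lev l)%:E]) x)).
    apply: le_integral_nng => x Sx; first exact: poweR_ge0.
    have F0 l : 0 <= ((fun x => if Pl n l then (lev l)%:E `^ (- (1/2)) * eps x `^ Q else 0)
       \_ [set x | S x <= (2 * lev l)%:E]) x.
      by rewrite /patch; case: ifP => // _; case: ifP => // _; rewrite mule_ge0 ?poweR_ge0.
    rewrite poweRM ?poweR_ge0 ?neps.2// -poweRrM.
    rewrite bQ.
    have [S0|S0] := eqVneq (S x) 0.
      rewrite Se// poweR0r ?gt_eqF// mule0; exact: nneseries_ge0.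
    have Sp : 0 < S x by rewrite lt_def S0 nS.2.
    move: Sp Sx; rewrite /=; case SE : (S x) => [s| |]//.
    rewrite lte_fin => s0; rewrite lee_fin => sn.
    have [l /andP[ls sl]] := lev_exists s0.
    have Pll : Pl n l by rewrite /Pl; apply: le_trans sn; exact: ltW.
    apply: le_trans (nneseries_lim_ge l.+1 _); last by move=> i _ _.
    rewrite big_mkord big_ord_recr/=.
    apply: (@le_trans _ _ ((lev l)%:E `^ (- (1/2)) * eps x `^ Q)).
      apply: le_mulr; first exact: poweR_ge0.
      rewrite lee_fin !powRN lef_pV2 ?posrE ?powR_gt0//.
      by apply: ge0_ler_powR; rewrite ?nnegrE ?lev_ge0 ?(ltW s0) ?(ltW ls)// divr_ge0.
    rewrite [X in _ + X](_ : _ = (lev l)%:E `^ (- (1/2)) * eps x `^ Q); last first.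
      by rewrite /patch mem_set ?Pll//= SE lee_fin.
    by rewrite leeDr// sume_ge0.
  have nFl l : nnm (fun x => if Pl n l then (lev l)%:E `^ (- (1/2)) * eps x `^ Q else 0).
    by case: (Pl n l); nnm_tac.
  rewrite integral_seriesn//; last by move=> l; exact: nnm_patch.
  apply: (@le_trans _ _ (\sum_(l <oo | Pl n l) ((lev l)%:E `^ (1/2) * 2%:E))).
    rewrite [leRHS]eseries_mkcond; apply: lee_nneseries => l _.
      by move=> _; apply: integral_nng => x _; exact: (nnm_patch (mG l) (nFl l)).2.
    rewrite -integral_mkcondr; case: (Pl n l); last first.
      by rewrite integral0.
    rewrite integralMl ?poweR_ge0//; [|exact: measurableI|exact: nnm_poweR].
    apply: (@le_trans _ _ ((lev l)%:E `^ (- (1/2)) * (2 * lev l)%:E)).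
      apply: le_mull; first exact: poweR_ge0.
      have l0 : (0 < 2 * lev l :> R)%R by rewrite mulr_gt0 ?lev_gt0.
      apply: le_trans (rk _ l0).
      apply: subset_integral_nng => [x _|x [_ ?]//]; first exact: poweR_ge0.
    rewrite EFinM muleCA muleC -[X in _ * X * _](poweRe1 (levE_ge0 l)).
    by rewrite -poweRD ?add_neq0_poweRD_def//; [rewrite (_ : - (1/2) + 1 = 1/2)%R//; lra|
      rewrite gt_eqF//; lra].
  exact: hC2.
apply: (@le_trans _ _ (\int[m]_(x in [set x | S x <= (2 * lev n)%:E])
   ((S x `^ b * kap x) * (S x `^ (- b) * eps x)))).
  apply: le_integral_nng => x Sx; first by rewrite mule_ge0 ?nkap.2 ?neps.2.
  have [S0|S0] := eqVneq (S x) 0; first by rewrite (Se _ S0) !mule0.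
  have Sp : 0 < S x by rewrite lt_def S0 nS.2.
  have Soo : S x < +oo by exact: le_lt_trans Sx (ltry _).
  by rewrite muleACA [S x `^ b * _]muleC poweR_inv_le1// mul1e.
apply: le_trans (integral_hoelder m (mG n) P0 Q0 PQ _ _) _; [by nnm_tac..|].
have -> : \int[m]_(x in [set x | S x <= (2 * lev n)%:E]) (S x `^ b * kap x) `^ P =
   (lev n)%:E `^ c * del n.
  rewrite /del integralMl ?poweR_ge0//; [|by nnm_tac].
  rewrite muleA [_ `^ c * _]muleC poweR_inv_le1 ?lte_fin ?ltry ?lev_gt0// mul1e.
  apply: eq_integral => x _; rewrite poweRM ?poweR_ge0 ?nkap.2// -poweRrM.
  by rewrite bP.
have d0 : 0 <= del n.
  by apply: integral_nng => x _; rewrite !mule_ge0 ?poweR_ge0.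
rewrite poweRM ?poweR_ge0// -poweRrM.
rewrite cP.
apply: (@le_trans _ _ ((lev n)%:E `^ b * del n `^ P^-1 *
   (C3%:E * (lev n)%:E `^ b))).
  apply: le_mull; first by rewrite mule_ge0 ?poweR_ge0.
  apply: le_trans (le_poweR _ _ half) _; rewrite ?invr_ge0 ?(ltW Q0)//.
    by apply: integral_nng => x _; exact: poweR_ge0.
  have K0 : 0 <= C2%:E by rewrite lee_fin ltW.
  rewrite (poweRM _ K0 (poweR_ge0 _ _)) (poweR_EFin C2) -poweRrM Qb.
  exact: lexx.
have -> : (lev n)%:E `^ Q^-1 = (lev n)%:E `^ b * (lev n)%:E `^ b.
  by rewrite poweR_addr// bb.
move: (poweR_ge0 (lev n)%:E b) (poweR_ge0 (del n) P^-1).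
set x := _ `^ b; set y := _ `^ P^-1 => x0 y0.
rewrite muleCA [x * y * x]muleAC -[leRHS]muleA.
by apply: le_mulr; rewrite ?mule_ge0// lee_fin lerDr ltW.
Qed.

End level_lemmas.

(** * Discrete dual norms and constants of Hardy type *)

Section gauge.
Context {R : realType}.
Variables p q : R.
Hypotheses (p1 : (1 < p)%R) (q1 : (1 < q)%R).
Let p' := conjexp p.
Let r := rexp p q.
Let p0 : (0 < p)%R := lt_trans ltr01 p1.
Let q0 : (0 < q)%R := lt_trans ltr01 q1.
Let p'0 : (0 < p')%R := conjexp_gt0 p1.

(* The norm dual to a [del] with [\sum_n del n] finite in [\sum_n del n `^ (q / p) * X n]. *)
Definition gauge (X : nat -> \bar R) : \bar R :=
  if (p <= q)%R then ereal_sup (range X)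
  else (\sum_(n <oo) X n `^ (r / q)) `^ (q / r).

Lemma gauge_ge0 X : (forall n, 0 <= X n) -> 0 <= gauge X.
Proof.
move=> X0; rewrite /gauge; case: ifP => _; last exact: poweR_ge0.
by apply: le_trans (X0 0%N) _; apply: ereal_sup_ubound; exists 0%N.
Qed.

Lemma gauge_ge X n : (forall n, 0 <= X n) -> X n <= gauge X.
Proof.
move=> X0; rewrite /gauge; case: ifPn => [_|]; first by apply: ereal_sup_ubound; exists n.
rewrite -ltNge => qp; have r0 : (0 < r)%R := rexp_gt0 q0 qp.
have rq : (0 < r / q)%R by rewrite divr_gt0.
rewrite -[leLHS](poweRK (X0 n) (lt0r_neq0 rq)) invf_div.
apply: le_poweR; [by rewrite divr_ge0 ?ltW|exact: poweR_ge0|].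
apply: le_trans (nneseries_lim_ge n.+1 _); last by move=> i _ _; exact: poweR_ge0.
rewrite big_mkord big_ord_recr/= leeDr// sume_ge0// => i _; exact: poweR_ge0.
Qed.

(** For [p <= q] write [del n ^ (q/p)] as [del n] times a power that is at most
    [(sum del) ^ (q/p - 1)]; for [q < p] this is Hoelder's inequality for sequences with the
    conjugate exponents [p/q] and [r/q]. *)
Lemma gauge_hoelder (del X : nat -> \bar R) : (forall n, 0 <= del n) -> (forall n, 0 <= X n) ->
  \sum_(n <oo) (del n `^ (q / p) * X n) <=
  (\sum_(n <oo) del n) `^ (q / p) * gauge X.
Proof.
move=> d0 X0; rewrite /gauge; case: ifPn => [pq|].
  have qp0 : (0 <= q / p - 1)%R by rewrite subr_ge0 ler_pdivlMr// mul1r.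
  have s0 : 0 <= \sum_(n <oo) del n by exact: nneseries_ge0.
  have sX : 0 <= ereal_sup (range X).
    by apply: le_trans (X0 0%N) _; apply: ereal_sup_ubound; exists 0%N.
  set c := (\sum_(n <oo) del n) `^ (q / p - 1) * ereal_sup (range X).
  have c0 : 0 <= c by rewrite mule_ge0 ?poweR_ge0.
  apply: (@le_trans _ _ (\sum_(n <oo) (del n * c))).
    apply: lee_nneseries => [n _ _|n _]; first by rewrite mule_ge0 ?poweR_ge0.
    rewrite -[X in del n `^ X](subrK 1%R) -poweR_addr_unit// poweRe1//.
    rewrite -muleA muleCA; apply: le_mull => //; apply: lee_pmul; rewrite ?poweR_ge0//.
      apply: le_poweR => //; apply: le_trans (nneseries_lim_ge n.+1 _); last by [].
      by rewrite big_mkord big_ord_recr/= leeDr// sume_ge0.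
    by apply: ereal_sup_ubound; exists n.
  rewrite -(ge0_integral_count (fun n => mule_ge0 (d0 n) c0)).
  have nd : nnm (del : nat -> \bar R) by split.
  rewrite integralMr//.
  rewrite ge0_integral_count// /c muleA -[X in X * _ * _](poweRe1 s0) muleC.
  rewrite [_ * (_ `^ (q / p - 1))]muleC poweR_addr_unit// subrK muleC//.
rewrite -ltNge => qp; have r0 : (0 < r)%R := rexp_gt0 q0 qp.
have h : ((p / q)^-1 + (r / q)^-1 = 1)%R.
  rewrite !invf_div /r /rexp invrK mulrBr divff ?gt_eqF//.
  by rewrite addrC subrK.
have nd : nnm (fun n : nat => del n `^ (q / p)) by split => // n; exact: poweR_ge0.
have nX : nnm (X : nat -> \bar R) by split.
have := @integral_hoelder _ _ R counting (p / q) (r / q) _ _ setT measurableT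
  (divr_gt0 p0 q0) (divr_gt0 r0 q0) h nd nX.
rewrite !ge0_integral_count//; last 3 first.
- by move=> k; exact: poweR_ge0.
- by move=> k; exact: poweR_ge0.
- by move=> k; rewrite mule_ge0 ?poweR_ge0.
rewrite !invf_div.
have qp1 : (q / p != 0)%R by rewrite gt_eqF// divr_gt0.
have -> : \sum_(n <oo) (del n `^ (q / p)) `^ (p / q) = \sum_(n <oo) del n.
  by apply: eq_eseriesr => n _; rewrite -poweRrM -[(p / q)%R]invf_div mulfV// poweRe1.
by [].
Qed.

(* The constants of the third and fourth terms of both parts have this form, and so does
   the first term of (i), which is the second one of (ii). *)
Definition hardy_const {d} {T : measurableType d} (m : {measure set T -> \bar R})
    (D : set T) (w I W : T -> \bar R) : \bar R :=
  if (p <= q)%R then ereal_sup [set I x `^ p'^-1 * W x `^ q^-1 | x in D]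
  else (\int[m]_(x in D) (I x `^ (r / p') * W x `^ (r / p) * w x)) `^ r^-1.

Lemma hardy_const_ge0 {d} {T : measurableType d} (m : {measure set T -> \bar R})
    (D : set T) (w I W : T -> \bar R) : D !=set0 -> 0 <= hardy_const m D w I W.
Proof.
move=> [x Dx]; rewrite /hardy_const; case: ifP => _; last exact: poweR_ge0.
apply: (@le_trans _ _ (I x `^ p'^-1 * W x `^ q^-1)).
  by rewrite mule_ge0 ?poweR_ge0.
by apply: ereal_sup_ubound; exists x.
Qed.

(** Recovers the constants of the theorem from their discretizations. For [p <= q] each term is
    approached at a point supplied by [rank_exists]; for [q < p] the power [r/q = r/p + 1] of the
    mass of [E n] is absorbed by [rank_poweR_int], and the integrals over the disjoint sets add
    up. *)
Lemma gauge_hardy_const : exists2 C : R, (0 < C)%R &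
  forall d (T : measurableType d) (m : {measure set T -> \bar R})
    (D : set T) (w I W : T -> \bar R) (E : nat -> set T) (c : nat -> \bar R),
  measurable D -> nnm w -> nnm I -> nnm W -> D !=set0 ->
  rank m D w W -> (forall n, measurable (E n)) -> (forall n, E n `<=` D) ->
  trivIset setT E -> (forall n, 0 <= c n) -> (forall n x, E n x -> c n <= I x) ->
  gauge (fun n => c n `^ (q / p') * \int[m]_(x in E n) w x) <=
  C%:E * hardy_const m D w I W `^ q.
Proof.
exists 2%R => //.
move=> d T m D w I W E c mD nw nI nW DN0 rk mE ED tE c0 cI.
have w0 n : 0 <= \int[m]_(x in E n) w x by apply: integral_nng => x _; exact: nw.2.
have H0 : 0 <= hardy_const m D w I W by exact: hardy_const_ge0.
rewrite /gauge; case: ifPn => pq.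
  apply: (@le_trans _ _ (1 * hardy_const m D w I W `^ q)); last first.
    apply: le_mulr; first exact: poweR_ge0.
    by rewrite lee_fin ler1n.
  rewrite mul1e; apply: ge_ereal_sup => _ [n _ <-].
  apply: mule_le_of_lt; rewrite ?poweR_ge0// => l l0 lw.
  have [x Ex lW] := rank_exists mD nw nW rk l0 (mE n) (ED n) lw.
  apply: (@le_trans _ _ ((I x `^ p'^-1 * W x `^ q^-1) `^ q)).
    rewrite poweRM ?poweR_ge0// -!poweRrM mulVf ?gt_eqF// poweRe1 ?nW.2//.
    rewrite [(p'^-1 * q)%R]mulrC; apply: lee_pmul; rewrite ?poweR_ge0 ?lee_fin ?(ltW l0) ?(ltW lW)//.
    by apply: le_poweR; rewrite ?c0 ?cI// divr_ge0 ?ltW.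
  apply: le_poweR; rewrite ?(ltW q0)// ?mule_ge0 ?poweR_ge0//.
  rewrite /hardy_const pq; apply: ereal_sup_ubound; exists x => //; exact: ED Ex.
rewrite -ltNge in pq; have r0 : (0 < r)%R := rexp_gt0 q0 pq.
have rq := rexp_q q0 pq; rewrite -/r in rq.
have rp0 : (0 <= r / p)%R by rewrite divr_ge0 ?ltW.
have rp'0 : (0 <= r / p')%R by rewrite divr_ge0 ?ltW.
have nG : nnm (fun x => I x `^ (r / p') * W x `^ (r / p) * w x) by nnm_tac.
have term n : (c n `^ (q / p') * \int[m]_(x in E n) w x) `^ (r / q) <=
    (2 `^ (r / q))%:E * \int[m]_(x in E n) (I x `^ (r / p') * W x `^ (r / p) * w x).
  rewrite poweRM ?poweR_ge0// -poweRrM.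
  rewrite (_ : q / p' * (r / q) = r / p')%R; last first.
    by rewrite mulrC mulrA divfK ?gt_eqF.
  have rkE : rank m (E n) w W by exact: rank_sub rk.
  have := rank_poweR_int (mE n) nw nW rkE rp0; rewrite -rq => h.
  apply: (@le_trans _ _ ((2 `^ (r / q))%:E * (c n `^ (r / p') *
      \int[m]_(x in E n) (W x `^ (r / p) * w x)))).
    rewrite muleCA; apply: le_mull; first exact: poweR_ge0.
    apply: (@le_trans _ _ ((2 `^ (r / q))%:E * ((2^-1 `^ (r / q))%:E *
        (\int[m]_(x in E n) w x) `^ (r / q)))).
      by rewrite muleA -EFinM -powRM// mulfV ?powR1 ?mul1e.
    by apply: le_mull => //; rewrite lee_fin powR_ge0.
  apply: le_mull; first by rewrite lee_fin powR_ge0.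
  rewrite -integralMl ?poweR_ge0//; last by nnm_tac.
  apply: le_integral_nng => x Ex; first by rewrite !mule_ge0 ?poweR_ge0 ?nw.2.
  rewrite muleA; apply: le_mulr; first exact: nw.2.
  apply: le_mulr; first exact: poweR_ge0.
  by apply: le_poweR; rewrite ?c0 ?cI.
rewrite /hardy_const ifF; last by apply/negbTE; rewrite -ltNge.
rewrite -poweRrM [(r^-1 * q)%R]mulrC.
(* The loss [2 ^ (r/q)] in each term becomes 2 after the root [q/r]. *)
have -> : (2%:E : \bar R) = ((2 `^ (r / q))%R%:E) `^ (q / r).
  have rq1 : (r / q != 0)%R by rewrite gt_eqF// divr_gt0.
  by rewrite poweR_EFin -powRrM -[(q / r)%R]invf_div mulfV// powRr1.
rewrite -poweRM ?lee_fin ?powR_ge0//; last by apply: integral_nng => x _; exact: nG.2.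
apply: le_poweR; first by rewrite divr_ge0 ?ltW.
  by apply: nneseries_ge0 => n _ _; exact: poweR_ge0.
apply: (@le_trans _ _ (\sum_(n <oo) ((2 `^ (r / q))%:E *
    \int[m]_(x in E n) (I x `^ (r / p') * W x `^ (r / p) * w x)))).
  by apply: lee_nneseries => [n _ _|n _]; [exact: poweR_ge0|exact: term].
rewrite nneseriesZl; last by move=> n _; apply: integral_nng => x _; exact: nG.2.
apply: le_mull; first by rewrite lee_fin powR_ge0.
rewrite -ge0_integral_bigcup//; [|exact: nnm_meas|by move=> x _; exact: nG.2].
by apply: subset_integral_nng => [x _|x [n _ /ED]//]; exact: nG.2.
Qed.

(** Apply [gauge_hardy_const] to the single set where [I] is infinite, with the value [+oo] on it:
    any mass there would make the constant infinite. *)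
Lemma hardy_const_null d (T : measurableType d) (m : {measure set T -> \bar R})
    (D : set T) (w I W : T -> \bar R) :
  measurable D -> nnm w -> nnm I -> nnm W -> D !=set0 -> rank m D w W ->
  hardy_const m D w I W < +oo -> \int[m]_(x in D `&` [set x | I x = +oo]) w x = 0.
Proof.
move=> mD nw nI nW DN0 rk Hoo; have [C C0 hC] := gauge_hardy_const.
have mI : measurable (D `&` [set x | I x = +oo]).
  by apply: measurableI => //; exact: measurable_eqy.
pose E n := if n is 0%N then D `&` [set x | I x = +oo] else set0.
have mE n : measurable (E n) by case: n => [|n]; [exact: mI|exact: measurable0].
have ED n : E n `<=` D by case: n => [|n] x // [].
have tE : trivIset setT E by move=> [|i] [|j] _ _ //= [x []].
have X0 n : 0 <= (+oo : \bar R) `^ (q / p') * \int[m]_(x in E n) w x.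
  by rewrite mule_ge0 ?poweR_ge0//; apply: integral_nng => x _; exact: nw.2.
have h : gauge (fun n => +oo `^ (q / p') * \int[m]_(x in E n) w x) <= C%:E * hardy_const m D w I W `^ q.
  by apply: (hC d T m D w I W E (fun=> +oo)) => // -[|n] x // [_ /= ->].
have := le_trans (gauge_ge 0 X0) h.
rewrite poweRyr ?gt_eqF ?divr_gt0//= => h0.
set X := \int[m]_(x in _) _ in h0 *.
have : 0 <= X by apply: integral_nng => x _; exact: nw.2.
rewrite le_eqVlt => /predU1P[//|Xp].
move: h0; rewrite gt0_mulye// leye_eq => /eqP.
have : C%:E * hardy_const m D w I W `^ q < +oo.
  by rewrite lte_mul_pinfty// ?lee_fin ?(ltW C0)// poweR_lty.
by move=> /[swap] ->.
Qed.

End gauge.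

(** The dyadic layers miss exactly the points where [S] is 0 or [+oo]; each application disposes of
    these two sets separately. *)
Lemma level_decomp {R : realType} d (T : measurableType d) (m : {measure set T -> \bar R})
    (D : set T) (S g : T -> \bar R) : measurable D -> nnm S -> nnm g ->
  \int[m]_(x in D) g x <=
  \sum_(n <oo) \int[m]_(x in D `&` [set x | (lev n)%:E < S x <= (2 * lev n)%:E]) g x +
  \int[m]_(x in D `&` [set x | S x = 0]) g x +
  \int[m]_(x in D `&` [set x | S x = +oo]) g x.
Proof.
move=> mD nS ng.
have mn (l : \bar R) : measurable [set x | l < S x] by exact: measurable_gt.
have mL n : measurable (D `&` [set x | (lev n)%:E < S x <= (2 * lev n)%:E]).
  apply: measurableI => //; rewrite (_ : [set x | _] =
    [set x | (lev n)%:E < S x] `&` [set x | S x <= (2 * lev n)%:E]); last first.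
    by apply/seteqP; split => x /= => [/andP[]|[-> ->]].
  by apply: measurableI; [exact: mn|exact: measurable_le].
have m0 := measurable_eq0 nS; have moo := measurable_eqy nS.
have mD0 : measurable (D `&` ~` [set x | S x = 0]).
  by apply: measurableI => //; exact: measurableC.
rewrite (integral_setID m mD m0 ng) (integral_setID m mD0 moo ng).
set X := \int[m]_(x in D `&` [set x | S x = 0]) g x.
rewrite [leRHS]addeAC [leLHS]addeC; apply: leeD => //; rewrite [leLHS]addeC; apply: leeD; last first.
  by apply: subset_integral_nng => [x _|x [[]]//]; exact: ng.2.
have tL : trivIset setT (fun n => D `&` [set x | (lev n)%:E < S x <= (2 * lev n)%:E]).
  move=> i j _ _ [x [[_ /= hi] [_ /= hj]]].
  move: hi hj; case: (S x) => [s| |]//=; rewrite ?lte_fin ?lee_fin.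
    exact: lev_disjoint.
  by move=> /andP[_]; rewrite leye_eq.
rewrite -ge0_integral_bigcup//; [|exact: nnm_meas|by move=> x _; exact: ng.2].
apply: subset_integral_nng => [x _|x [[Dx /= /eqP S0] /= /eqP Soo]]; first exact: ng.2.
have := nS.2 x; case SE : (S x) S0 Soo => [s| |]// S0 _ s0.
have [|n hn] := @lev_exists R s; first by rewrite lt_neqAle -lee_fin s0 eq_sym andbT.
by exists n => //; split => //=; rewrite SE lte_fin lee_fin.
Qed.

(** * Primitives and tails on the line *)

Section mono.
Context {R : realType}.
Implicit Types f : R -> \bar R.

Lemma nondecreasing_measurableE f : {homo f : x y / (x <= y)%R >-> x <= y} ->
  measurable_fun setT (f : measurableTypeR R -> \bar R).
Proof.
move=> ndf; apply: (@measurability _ _ (measurableTypeR R) _ setT f (@ErealGenCInfty.G R)) => [|/= _ [_] [r] -> <-].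
  exact: ErealGenCInfty.measurableE.
apply: measurableI => //; apply: is_interval_measurable => s t/=.
rewrite !in_itv/= !andbT => fs ft u /andP[su ut].
by rewrite in_itv/= andbT (le_trans fs)// ndf.
Qed.

Lemma nonincreasing_measurableE f : {homo f : x y / (x <= y)%R >-> y <= x} ->
  measurable_fun setT (f : measurableTypeR R -> \bar R).
Proof.
move=> ndf; apply: (@measurability _ _ (measurableTypeR R) _ setT f (@ErealGenCInfty.G R)) => [|/= _ [_] [r] -> <-].
  exact: ErealGenCInfty.measurableE.
apply: measurableI => //; apply: is_interval_measurable => s t/=.
rewrite !in_itv/= !andbT => fs ft u /andP[su ut].
by rewrite in_itv/= andbT (le_trans ft)// ndf.
Qed.

Lemma borel_lebesgue (D : set R) : measurable (D : set (measurableTypeR R)) ->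
  measurable (D : set (lebesgueR R)).
Proof. exact: sub_caratheodory. Qed.

Lemma measurable_fun_lebesgue d (U : measurableType d) (f : R -> U) :
  measurable_fun setT (f : measurableTypeR R -> U) ->
  measurable_fun setT (f : lebesgueR R -> U).
Proof. by move=> mf _ Y mY; apply: borel_lebesgue; exact: mf. Qed.

Lemma nnm_nondecreasing f : (forall x, 0 <= f x) -> {homo f : x y / (x <= y)%R >-> x <= y} ->
  nnm (f : lebesgueR R -> \bar R).
Proof.
by move=> f0 ndf; split; [apply: measurable_fun_lebesgue; exact: nondecreasing_measurableE|exact: f0].
Qed.

Lemma nnm_nonincreasing f : (forall x, 0 <= f x) -> {homo f : x y / (x <= y)%R >-> y <= x} ->
  nnm (f : lebesgueR R -> \bar R).
Proof.
by move=> f0 ndf; split; [apply: measurable_fun_lebesgue; exact: nonincreasing_measurableE|exact: f0].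
Qed.

End mono.

Section lebesgue.
Context {R : realType}.
Local Notation T := (lebesgueR R).
Local Notation mu := (@completed_lebesgue_measure R).
Implicit Types (e b g : R -> \bar R) (D : set R).

Lemma measurable_litv (i : interval R) : measurable ([set` i] : set T).
Proof. by apply: borel_lebesgue; exact: measurable_itv. Qed.
Hint Resolve measurable_litv : core.

Lemma completed_lebesgue_set1 (x : R) : mu [set x] = 0.
Proof. exact: lebesgue_measure_set1. Qed.

Lemma lint_setU1 e (x : R) D : nnm (e : T -> \bar R) -> measurable (D : set T) ->
  \int[mu]_(y in D `|` [set x]) e y = \int[mu]_(y in D) e y.
Proof.
move=> ne mD.
have m1 : measurable ([set x] : set T) by rewrite -set_itv1.
apply/eqP; rewrite eq_le; apply/andP; split; last first.
  by apply: subset_integral_nng => [y _|y]; [exact: ne.2|left].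
rewrite (integral_setID mu _ m1 ne); last exact: measurableU.
apply: (@le_trans _ _ (0 + \int[mu]_(y in D) e y)); last by rewrite add0e.
apply: leeD.
  apply: (@le_trans _ _ (\int[mu]_(y in [set x]) e y)).
    by apply: subset_integral_nng => [y _|y []//]; exact: ne.2.
  rewrite (@ge0_negligible_integral _ T R mu [set x] [set x])//.
  - by rewrite setDv integral_set0.
  - exact: nnm_meas.
  - by move=> y _; exact: ne.2.
  - exact: completed_lebesgue_set1.
by apply: subset_integral_nng => [y _|y [[]//]]; exact: ne.2.
Qed.

Definition tail e (x : R) : \bar R := \int[mu]_(y in `]x, +oo[) e y.

Lemma primitive_ge0 e x : nnm (e : T -> \bar R) -> 0 <= primitive e x.
Proof. by move=> ne; apply: integral_nng => y _; exact: ne.2. Qed.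

Lemma tail_ge0 e x : nnm (e : T -> \bar R) -> 0 <= tail e x.
Proof. by move=> ne; apply: integral_nng => y _; exact: ne.2. Qed.

Lemma le_primitive e x y : nnm (e : T -> \bar R) -> (x <= y)%R -> primitive e x <= primitive e y.
Proof.
move=> ne xy; apply: subset_integral_nng => [z _|]; first exact: ne.2.
by apply: subset_itvl; rewrite bnd_simp.
Qed.

Lemma le_tail e x y : nnm (e : T -> \bar R) -> (x <= y)%R -> tail e y <= tail e x.
Proof.
move=> ne xy; apply: subset_integral_nng => [z _|]; first exact: ne.2.
by apply: subset_itvr; rewrite bnd_simp.
Qed.

Lemma nnm_primitive e : nnm (e : T -> \bar R) -> nnm (primitive e : T -> \bar R).
Proof.
by move=> ne; apply: nnm_nondecreasing => [x|x y]; [exact: primitive_ge0|exact: le_primitive].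
Qed.

Lemma nnm_tail e : nnm (e : T -> \bar R) -> nnm (tail e : T -> \bar R).
Proof.
by move=> ne; apply: nnm_nonincreasing => [x|x y]; [exact: tail_ge0|exact: le_tail].
Qed.

Lemma integral_bigcup_le e (F : nat -> set R) (l : \bar R) : nnm (e : T -> \bar R) ->
  (forall n, measurable (F n : set T)) ->
  {homo F : m n / (m <= n)%N >-> m `<=` n} -> (forall n, \int[mu]_(x in F n) e x <= l) ->
  \int[mu]_(x in \bigcup_n F n) e x <= l.
Proof.
move=> ne mF ndF Fl.
have cv := @ge0_nondecreasing_set_cvg_integral _ T R F e mu _ mF _ _.
rewrite -(cvg_lim _ (cv _ _ _))//.
- apply: lime_le; last by apply: nearW.
  apply: cvgP; apply: cv => //.
  + by move=> m n mn; rewrite subsetEset; exact: ndF.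
  + by move=> i; exact: nnm_meas.
  + by move=> i x _; exact: ne.2.
- by move=> m n mn; rewrite subsetEset; exact: ndF.
- by move=> i; exact: nnm_meas.
- by move=> i x _; exact: ne.2.
Qed.

Lemma exists_natSinv (e : R) : (0 < e)%R -> exists n : nat, (n.+1%:R^-1 < e)%R.
Proof.
move=> e0; have [N _ /(_ N (leqnn _)) h] := near_infty_natSinv_lt (PosNum e0).
by exists N.
Qed.

Lemma natSinv_le m n : (m <= n)%N -> (n.+1%:R^-1 <= m.+1%:R^-1 :> R)%R.
Proof. by move=> mn; rewrite lef_pV2 ?posrE ?ltr0n// ler_nat. Qed.

(** Exhausts the set by [y < b - 1/(n+1)]; this is the left continuity of primitives, stated as the
    passage of a bound to the limit. *)
Lemma integral_left_le e D (b : R) (l : \bar R) : nnm (e : T -> \bar R) ->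
  measurable (D : set T) ->
  (forall x, (x < b)%R -> \int[mu]_(y in D `&` [set y | (y < x)%R]) e y <= l) ->
  \int[mu]_(y in D `&` [set y | (y < b)%R]) e y <= l.
Proof.
move=> ne mD h; pose F n := D `&` [set y | (y < b - n.+1%:R^-1)%R].
have mlt (x : R) : measurable ([set y | (y < x)%R] : set T).
  by rewrite -set_itvNyo; exact: measurable_litv.
have -> : D `&` [set y | (y < b)%R] = \bigcup_n F n.
  apply/seteqP; split => y /= => [[Dy yb]|[n _ [Dy /= yn]]].
    have [n yn] : exists n : nat, (n.+1%:R^-1 < b - y)%R by apply: exists_natSinv; rewrite subr_gt0.
    by exists n => //; split => //=; rewrite ltrBrDr addrC -ltrBrDr.
  split => //; apply: lt_trans yn _; by rewrite ltrBlDr ltrDl invr_gt0.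
apply: integral_bigcup_le => // [n|m n mn y [Dy /= yn]|n].
- exact: measurableI.
- by split => //=; apply: lt_le_trans yn _; rewrite lerD2l lerN2 natSinv_le.
- by apply: h; rewrite ltrBlDr ltrDl invr_gt0.
Qed.

Lemma integral_right_le e D (b : R) (l : \bar R) : nnm (e : T -> \bar R) ->
  measurable (D : set T) ->
  (forall x, (b < x)%R -> \int[mu]_(y in D `&` [set y | (x < y)%R]) e y <= l) ->
  \int[mu]_(y in D `&` [set y | (b < y)%R]) e y <= l.
Proof.
move=> ne mD h; pose F n := D `&` [set y | (b + n.+1%:R^-1 < y)%R].
have mlt (x : R) : measurable ([set y | (x < y)%R] : set T).
  by rewrite -set_itvoy; exact: measurable_litv.
have -> : D `&` [set y | (b < y)%R] = \bigcup_n F n.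
  apply/seteqP; split => y /= => [[Dy yb]|[n _ [Dy /= yn]]].
    have [n yn] : exists n : nat, (n.+1%:R^-1 < y - b)%R by apply: exists_natSinv; rewrite subr_gt0.
    by exists n => //; split => //=; rewrite -ltrBrDl.
  split => //; apply: lt_trans yn; by rewrite ltrDl invr_gt0.
apply: integral_bigcup_le => // [n|m n mn y [Dy /= yn]|n].
- exact: measurableI.
- by split => //=; apply: le_lt_trans yn; rewrite lerD2l natSinv_le.
- by apply: h; rewrite ltrDl invr_gt0.
Qed.

Lemma integral_unbounded_le e D (l : \bar R) : nnm (e : T -> \bar R) ->
  measurable (D : set T) ->
  (forall x, \int[mu]_(y in D `&` [set y | (y < x)%R]) e y <= l) ->
  \int[mu]_(y in D) e y <= l.
Proof.
move=> ne mD h; pose F n := D `&` [set y | (y < n%:R)%R].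
have mlt (x : R) : measurable ([set y | (y < x)%R] : set T).
  by rewrite -set_itvNyo; exact: measurable_litv.
have -> : D = \bigcup_n F n.
  apply/seteqP; split => y /= => [Dy|[n _ []//]].
  exists (Num.trunc `|y|).+1 => //; split => //=.
  apply: le_lt_trans (ler_norm _) _; exact: truncnS_gt.
apply: integral_bigcup_le => // [n|m n mn y [Dy /= yn]|n].
- exact: measurableI.
- by split => //=; apply: lt_le_trans yn _; rewrite ler_nat.
- exact: h.
Qed.

Lemma set_itv0o (x : R) : `]0%R, x[%classic = `]0%R, +oo[%classic `&` [set y | (y < x)%R].
Proof.
apply/seteqP; split => y; rewrite /= !in_itv/= andbT; first by move=> /andP[].
by move=> [-> ->].
Qed.

Lemma set_itvoy0 (x : R) : (0 <= x)%R ->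
  `]x, +oo[%classic = `]0%R, +oo[%classic `&` [set y | (x < y)%R].
Proof.
move=> x0; apply/seteqP; split => y; rewrite /= !in_itv/= !andbT; last by case.
by move=> xy; split => //; exact: le_lt_trans xy.
Qed.

(** The sublevel set is an initial interval up to the null point [sup G]; before that point the
    primitive is at most [l], and left continuity carries the bound over. If the set is unbounded,
    the whole mass is at most [l]. *)
Lemma rank_primitive e : nnm (e : T -> \bar R) ->
  rank mu (`]0%R, +oo[ : set T) e (primitive e).
Proof.
move=> ne l l0; set G := _ `&` _.
have l0' : 0 <= l%:E by rewrite lee_fin ltW.
have lt_G x y : G y -> (x < y)%R -> primitive e x <= l%:E.
  by move=> [_ /= yl] xy; apply: le_trans yl; exact: le_primitive (ltW xy).
have [G0|/set0P[g0 Gg0]] := eqVneq G set0; first by rewrite G0 integral_set0.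
have [hub|nub] := pselect (has_ubound G); last first.
  apply: (@le_trans _ _ (\int[mu]_(y in (`]0%R, +oo[ : set T)) e y)).
    by apply: subset_integral_nng => [x _|x []//]; exact: ne.2.
  apply: integral_unbounded_le => // x; rewrite -set_itv0o.
  have [y Gy xy] : exists2 y, G y & (x < y)%R.
    apply: contrapT => h; apply: nub; exists x => y Gy; rewrite leNgt; apply/negP => xy.
    by apply: h; exists y.
  exact: lt_G Gy xy.
pose b := sup G; have hs : has_sup G by split => //; exists g0.
apply: (@le_trans _ _ (\int[mu]_(y in (`]0%R, b[%classic `|` [set b])) e y)).
  apply: subset_integral_nng => [x _|x Gx]; first exact: ne.2.
  have := sup_upper_bound hs Gx; rewrite le_eqVlt => /predU1P[->|xb]; [by right|left].
  by case: Gx => + _; rewrite /= !in_itv/= xb andbT => ->.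
rewrite lint_setU1//.
rewrite set_itv0o; apply: integral_left_le => // x xb; rewrite -set_itv0o.
have [y Gy xy] := sup_gt (ex_intro _ _ Gg0) xb.
exact: lt_G Gy xy.
Qed.

Lemma rank_tail e : nnm (e : T -> \bar R) ->
  rank mu (`]0%R, +oo[ : set T) e (tail e).
Proof.
move=> ne l l0; set G := _ `&` _.
have lt_G x y : G x -> (x < y)%R -> tail e y <= l%:E.
  by move=> [_ /= yl] xy; apply: le_trans yl; exact: le_tail (ltW xy).
have [G0|/set0P[g0 Gg0]] := eqVneq G set0.
  by rewrite G0 integral_set0 lee_fin ltW.
have hi : has_inf G.
  by split; [exists g0|exists 0%R => x [+ _]; rewrite /= in_itv/= andbT => /ltW].
pose b := inf G; have b0 : (0 <= b)%R.
  by apply: lb_le_inf; [exists g0|move=> x [+ _]; rewrite /= in_itv/= andbT => /ltW].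
apply: (@le_trans _ _ (\int[mu]_(y in (`]b, +oo[%classic `|` [set b])) e y)).
  apply: subset_integral_nng => [x _|x Gx]; first exact: ne.2.
  have : (b <= x)%R by apply: ge_inf => //; case: hi.
  rewrite le_eqVlt => /predU1P[->|xb]; [by right|left].
  by rewrite /= in_itv/= xb.
rewrite lint_setU1//.
rewrite set_itvoy0//; apply: integral_right_le => // x bx; rewrite -set_itvoy0; last first.
  exact: le_trans (ltW bx).
have [y Gy xy] := inf_lt (ex_intro _ _ Gg0) bx.
exact: lt_G Gy xy.
Qed.

End lebesgue.
#[export] Hint Resolve measurable_litv : core.

Section split.
Context {R : realType}.
Local Notation T := (lebesgueR R).
Local Notation mu := (@completed_lebesgue_measure R).
Implicit Types (e b g : R -> \bar R).

Definition lkernel b (x t : R) : \bar R := \int[mu]_(y in `]x, t[) b y.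

Lemma lkernel_ge0 b x t : nnm (b : T -> \bar R) -> 0 <= lkernel b x t.
Proof. by move=> nb; apply: integral_nng => y _; exact: nb.2. Qed.

(** The upper bound [d] is arbitrary so as to cover bounded intervals and half-lines; the point [x]
    lost between the two pieces is null. *)
Lemma lint_split e (c x : R) (d : itv_bound R) : nnm (e : T -> \bar R) -> (c <= x)%R ->
  (BLeft x <= d)%O ->
  \int[mu]_(y in [set` Interval (BRight c) d]) e y =
  \int[mu]_(y in `]c, x[) e y + \int[mu]_(y in [set` Interval (BRight x) d]) e y.
Proof.
move=> ne; rewrite le_eqVlt => /predU1P[<- _|cx xd].
  have -> : `]c, c[%classic = set0 :> set R by rewrite set_itv_ge ?bnd_simp ?ltxx.
  by rewrite integral_set0 add0e.
have dj : [disjoint `]c, x[%classic & [set` Interval (BRight x) d]].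
  apply/eqP; apply/seteqP; split => y //=; rewrite !in_itv/= => -[/andP[_ yx]].
  by move=> /andP[xy _]; have := lt_trans yx xy; rewrite ltxx.
rewrite -ge0_integral_setU//; last 2 first.
- exact: nnm_meas.
- by move=> y _; exact: ne.2.
rewrite -[RHS](lint_setU1 x ne); last exact: measurableU.
have [xd'|xd'] := boolP (x \in Interval (BRight c) d).
  congr (integral _ _ _); apply/seteqP; split => y /=.
    rewrite !in_itv/= => /andP[cy yd]; rewrite yd cy/= andbT.
    by case: (ltgtP y x) => [|//|->]; [left; left|left; right|right].
  move=> [[|]|->//]; rewrite !in_itv/=.
    move=> /andP[-> yx]/=; move: xd; case: d {dj xd'} => [[] d|[]//] /=; rewrite bnd_simp => h.
      exact: lt_le_trans yx h.
    exact: ltW (lt_le_trans yx h).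
  by move=> /andP[xy ->]; rewrite (lt_trans cx).
have dx : d = BLeft x.
  move: xd xd'; rewrite in_itv/= cx/=; case: d {dj} => [[] d|[]]//=; rewrite !bnd_simp => xd.
    by rewrite -leNgt => dx; congr (BLeft _); apply/eqP; rewrite eq_le dx xd.
  by rewrite -ltNge => /lt_le_trans => /(_ _ xd); rewrite ltxx.
rewrite dx (_ : [set` Interval (BRight x) (BLeft x)] = set0) ?setU0 ?lint_setU1//.
by rewrite set_itv_ge// bnd_simp ltxx.
Qed.

Lemma primitive_split e (x z : R) : nnm (e : T -> \bar R) -> (0 <= x)%R -> (x <= z)%R ->
  primitive e z = primitive e x + lkernel e x z.
Proof. by move=> ne x0 xz; apply: lint_split => //; rewrite bnd_simp. Qed.

Lemma le_lkernel e (x x' t t' : R) : nnm (e : T -> \bar R) -> (x' <= x)%R -> (t <= t')%R ->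
  lkernel e x t <= lkernel e x' t'.
Proof.
move=> ne xx tt; apply: subset_integral_nng => [y _|]; first exact: ne.2.
by apply: subset_itv; rewrite bnd_simp.
Qed.

Lemma lkernel_le_primitive e (x t : R) : nnm (e : T -> \bar R) -> (0 <= x)%R ->
  lkernel e x t <= primitive e t.
Proof. by move=> ne x0; apply: le_lkernel. Qed.

(** An intermediate value theorem, obtained from the last point where the primitive is at most [th].
    It precedes continuity, which is deduced from it. *)
Lemma primitive_level e (b th : R) : nnm (e : T -> \bar R) -> (0 < th)%R ->
  th%:E < primitive e b -> primitive e b < +oo ->
  exists2 c, (0 < c < b)%R & primitive e c = th%:E.
Proof.
move=> ne th0 thb boo.
have p0 x : (x <= 0)%R -> primitive e x = 0.
  by move=> x0; rewrite /primitive /lebesgue_integral set_itv_ge ?integral_set0// bnd_simp -leNgt.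
have b0 : (0 < b)%R.
  by rewrite ltNge; apply/negP => b0; move: thb; rewrite p0// lte_fin ltNge (ltW th0).
pose G := [set x | (x <= b)%R /\ primitive e x <= th%:E].
have G0 : G 0%R by split; [exact: ltW|rewrite p0// lee_fin ltW].
have hs : has_sup G by split; [exists 0%R|exists b => x []].
pose c := sup G.
have c0 : (0 <= c)%R by exact: sup_upper_bound.
have cb : (c <= b)%R by apply: ge_sup; [exists 0%R|move=> x []].
have c1 : primitive e c <= th%:E.
  have -> : primitive e c =
      \int[mu]_(x in (`]0%R, +oo[%classic : set T) `&` [set y | (y < c)%R]) e x.
    by rewrite -set_itv0o.
  apply: integral_left_le => // x xc; rewrite -set_itv0o.
  have [y [_ Gy] xy] := sup_gt (ex_intro _ _ G0) xc.
  by apply: le_trans Gy; exact: le_primitive (ltW xy).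
have cb' : (c < b)%R.
  rewrite lt_neqAle cb andbT; apply/eqP => cb'; move: thb.
  by rewrite -cb' ltNge c1.
have bE := primitive_split ne c0 cb.
have pbE : primitive e b = (fine (primitive e b))%:E.
  by rewrite fineK// ge0_fin_numE// primitive_ge0.
have pc0 := primitive_ge0 c ne; have kc0 := lkernel_ge0 c b ne.
(* To the right of [c] the primitive is at least [th], so the mass of each []x, b[] with [x > c] is
   at most the remainder; let [x] decrease to [c]. *)
have c2 : lkernel e c b <= primitive e b - th%:E.
  have -> : lkernel e c b =
      \int[mu]_(x in (`]-oo, b[%classic : set T) `&` [set y | (c < y)%R]) e x.
    congr (integral _ _ _); apply/seteqP; split => y /=; rewrite !in_itv/=.
      by move=> /andP[].
    by move=> [-> ->].
  apply: integral_right_le => // x cx.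
  have -> : (`]-oo, b[%classic : set T) `&` [set y | (x < y)%R] = `]x, b[%classic.
    apply/seteqP; split => y /=; rewrite !in_itv/=; first by move=> [-> ->].
    by move=> /andP[].
  rewrite -/(lkernel e x b).
  have [xb|bx] := leP x b; last first.
    have -> : lkernel e x b = 0.
      by rewrite /lkernel set_itv_ge ?integral_set0// bnd_simp -leNgt ltW.
    by move: thb; rewrite pbE lte_fin -EFinB lee_fin subr_ge0 => /ltW.
  have px : th%:E <= primitive e x.
    rewrite leNgt; apply/negP => /ltW px.
    by have : G x by []; move=> /(sup_upper_bound hs); rewrite leNgt cx.
  have x0 : (0 <= x)%R by apply: le_trans (ltW cx).
  have kx0 := lkernel_ge0 x b ne.
  move: pbE px kx0; rewrite (primitive_split ne x0 xb).
  case: (primitive e x) => [px| |]; case: (lkernel e x b) => [kx| |]//=.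
  by move=> _; rewrite -EFinB !lee_fin => ? ?; lra.
have cE : primitive e c = th%:E.
  apply/eqP; rewrite eq_le c1/=.
  move: pbE pc0 kc0 c2; rewrite bE.
  case: (primitive e c) => [pc| |]; case: (lkernel e c b) => [kc| |]//=.
  by move=> _ _ _; rewrite -EFinB !lee_fin => ?; lra.
exists c => //; rewrite cb' andbT lt_neqAle c0 andbT; apply/eqP => c00.
by move: cE; rewrite -c00 p0// => -[] h; move: th0; rewrite -h ltxx.
Qed.

(** A monotone function that takes all intermediate values has no jumps. *)
Lemma continuous_primitive e (b : R) : nnm (e : T -> \bar R) ->
  (forall x, primitive e x < +oo) ->
  fine (primitive e y) @[y --> b] --> fine (primitive e b).
Proof.
move=> ne foo; have [P [PE fP]] : exists P : R -> R,
    (forall x, primitive e x = (P x)%:E) /\ (forall x, fine (primitive e x) = P x).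
  exists (fun x => fine (primitive e x)); split => // x.
  by rewrite fineK// ge0_fin_numE// primitive_ge0.
have P0 x : (0 <= P x)%R by rewrite -lee_fin -PE primitive_ge0.
have Pm x y : (x <= y)%R -> (P x <= P y)%R.
  by move=> xy; rewrite -lee_fin -!PE; exact: le_primitive.
rewrite fP; under eq_fun do rewrite fP.
apply/cvgrPdist_lt => eps e0.
have [c1 c1b hc1] : exists2 c, (c < b)%R & (P b - eps < P c)%R.
  have [h|h] := leP (P b) (eps / 2)%R.
    by exists (b - 1)%R; [rewrite ltrBlDr ltrDl|have := P0 (b - 1)%R; lra].
  have [||c /andP[_ cb] cE] := @primitive_level e b (P b - eps / 2)%R ne _ _ (foo b).
  - lra.
  - by rewrite PE lte_fin; lra.
  - by exists c => //; move: cE; rewrite PE => -[->]; lra.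
have [c2 c2b hc2] : exists2 c, (b < c)%R & (P c < P b + eps)%R.
  have [h|h] := leP (P (b + 1)%R) (P b + eps / 2)%R.
    by exists (b + 1)%R; [rewrite ltrDl|lra].
  have [||c /andP[_ cb] cE] := @primitive_level e (b + 1)%R (P b + eps / 2)%R ne _ _ (foo _).
  - by have := P0 b; lra.
  - by rewrite PE lte_fin; lra.
  - move: cE; rewrite PE => -[cE]; exists c; last by rewrite cE; lra.
    by rewrite ltNge; apply/negP => /Pm; rewrite cE; lra.
near=> y.
have yc1 : (P c1 <= P y)%R.
  by apply: Pm; apply: ltW; near: y; exact: lt_nbhsr.
have yc2 : (P y <= P c2)%R.
  by apply: Pm; apply: ltW; near: y; exact: lt_nbhsl.
by rewrite ltr_norml; apply/andP; split; lra.
Unshelve. all: by end_near. Qed.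

Lemma measurable_fun_lt_prod : measurable ([set z : T * T | (z.1 < z.2 :> R)%R]).
Proof.
have mf : measurable_fun setT (fun z : T * T => (z.1 : measurableTypeR R)).
  move=> _ Y mY; rewrite setTI; have := @measurable_fst _ _ T T measurableT _ (borel_lebesgue mY).
  by rewrite setTI.
have mg : measurable_fun setT (fun z : T * T => (z.2 : measurableTypeR R)).
  move=> _ Y mY; rewrite setTI; have := @measurable_snd _ _ T T measurableT _ (borel_lebesgue mY).
  by rewrite setTI.
have h := measurable_fun_ltr mf mg; have := h measurableT [set true] I.
by rewrite setTI; congr measurable; apply/seteqP; split => z /=.
Qed.

Lemma nnm_fst e : nnm (e : T -> \bar R) -> nnm (fun z : T * T => e z.1).
Proof.
move=> [me e0]; split => // z; exact: measurableT_comp.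
Qed.

Lemma nnm_snd e : nnm (e : T -> \bar R) -> nnm (fun z : T * T => e z.2).
Proof.
move=> [me e0]; split => // z; exact: measurableT_comp.
Qed.

(** Tonelli's theorem on the triangle [c < x < y], with [y] bounded by [d], finite or not. *)
Lemma tonelli_itv (f : T * T -> \bar R) (c : R) (d : itv_bound R) : nnm f ->
  \int[mu]_(x in [set` Interval (BRight c) d])
     \int[mu]_(y in [set` Interval (BRight x) d]) f (x, y) =
  \int[mu]_(y in [set` Interval (BRight c) d]) \int[mu]_(x in `]c, y[) f (x, y).
Proof.
move=> nf.
pose A := [set z : T * T | z.1 \in Interval (BRight c) d] `&`
  [set z : T * T | (z.1 < z.2 :> R)%R] `&` [set z : T * T | z.2 \in Interval (BRight c) d].
have mA : measurable A.
  apply: measurableI; first apply: measurableI; last 1 first.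
  - have := @measurable_snd _ _ T T measurableT _ (measurable_litv (Interval (BRight c) d)).
    by rewrite setTI.
  - have := @measurable_fst _ _ T T measurableT _ (measurable_litv (Interval (BRight c) d)).
    by rewrite setTI.
  - exact: measurable_fun_lt_prod.
have [mF F0] := nnm_patch mA nf.
transitivity (\int[mu]_x \int[mu]_y (f \_ A) (x, y)).
  rewrite integral_mkcond; apply: eq_integral => x _; rewrite /patch.
  case: ifPn => [/set_mem/= xI|xI].
    rewrite integral_mkcond; apply: eq_integral => y _; rewrite /patch.
    congr (if _ then _ else _); apply/idP/idP; rewrite !inE /A /=.
      rewrite in_itv/= => /andP[xy yd]; split; first by split.
      by move: xI; rewrite !in_itv/= yd andbT => /andP[cx _]; exact: lt_trans xy.
    by move=> [[_ xy]]; rewrite !in_itv/= xy => /andP[].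
  rewrite integral0_eq// => y _; rewrite memNset// /A/= => -[[xI' _] _].
  by move/negP: xI; apply; rewrite inE.
apply: (etrans (@fubini_tonelli _ _ T T R mu mu (f \_ A) mF F0)).
rewrite [RHS]integral_mkcond; apply: eq_integral => y _; rewrite /patch.
case: ifPn => [/set_mem/= yI|yI].
  rewrite [RHS]integral_mkcond; apply: eq_integral => x _; rewrite /patch.
  congr (if _ then _ else _); apply/idP/idP; rewrite !inE /A /=.
    by move=> [[]]; rewrite !in_itv/= => /andP[-> _] -> _.
  rewrite [in X in X -> _]in_itv/= => /andP[cx xy]; split => //; split => //.
  move: yI; rewrite !in_itv/= cx/= => /andP[_]; case: d {A mA mF F0} => [[] d|[]//] /=.
    exact: lt_trans.
  by move=> yd; exact: ltW (lt_le_trans xy yd).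
rewrite integral0_eq// => x _; rewrite memNset// /A/= => -[_ yI'].
by move/negP: yI; apply; rewrite inE.
Qed.

(** Joint measurability in the two endpoints, as the kernel tests require, by integrating out the
    third variable of a function supported on [x < y < t]. *)
Lemma nnm_lkernel b : nnm (b : T -> \bar R) ->
  nnm (fun z : T * T => lkernel b z.1 z.2).
Proof.
move=> nb; split; last by move=> z; exact: lkernel_ge0.
pose A := [set z : (T * T) * T | (z.1.1 < z.2 :> R)%R] `&` [set z : (T * T) * T | (z.2 < z.1.2 :> R)%R].
have m1 : measurable_fun setT (fun z : (T * T) * T => (z.1.1, z.2)).
  apply: measurable_fun_pair => //; exact: measurableT_comp.
have m2 : measurable_fun setT (fun z : (T * T) * T => (z.2, z.1.2)).
  apply: measurable_fun_pair => //; exact: measurableT_comp.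
have mA : measurable A.
  apply: measurableI.
    by have := m1 measurableT _ measurable_fun_lt_prod; rewrite setTI.
  by have := m2 measurableT _ measurable_fun_lt_prod; rewrite setTI.
have nbb : nnm (fun z : (T * T) * T => b z.2).
  by split => [|z]; [apply: (measurableT_comp nb.1)|exact: nb.2].
have [mF F0] := nnm_patch mA nbb.
have := @measurable_fun_fubini_tonelli_F _ _ _ T R mu _ mF F0.
apply: eq_measurable_fun => z _; rewrite /fubini_F /lkernel [RHS]integral_mkcond.
apply: eq_integral => y _; rewrite /patch; congr (if _ then _ else _).
apply/idP/idP; rewrite !inE /A /= in_itv/=; first by move=> [-> ->].
by move=> /andP[].
Qed.

Lemma tonelli_lkernel b g (c : R) (d : R) : nnm (b : T -> \bar R) -> nnm (g : T -> \bar R) ->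
  \int[mu]_(t in `]c, d[) (b t * lkernel g c t) =
  \int[mu]_(x in `]c, d[) (g x * lkernel b x d).
Proof.
move=> nb ng.
have nf : nnm (fun z : T * T => g z.1 * b z.2) by apply: nnmM; [exact: nnm_fst|exact: nnm_snd].
have h : \int[mu]_(x in `]c, d[) \int[mu]_(y in `]x, d[) (g x * b y) =
  \int[mu]_(y in `]c, d[) \int[mu]_(x in `]c, y[) (g x * b y).
  exact: (tonelli_itv c (BLeft d) nf).
transitivity (\int[mu]_(y in `]c, d[) \int[mu]_(x in `]c, y[) (g x * b y)).
  apply: eq_integral => y _.
  by rewrite (@integralMr _ T R mu (b y) g _ (measurable_litv _) (nb.2 y) ng) muleC.
apply: (etrans (esym h)); apply: eq_integral => x _.
by rewrite (@integralMl _ T R mu (g x) b _ (measurable_litv _) (ng.2 x) nb).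
Qed.

Lemma tonelli_tail b g (c : R) : nnm (b : T -> \bar R) -> nnm (g : T -> \bar R) ->
  \int[mu]_(t in `]c, +oo[) (b t * lkernel g c t) =
  \int[mu]_(x in `]c, +oo[) (g x * tail b x).
Proof.
move=> nb ng.
have nf : nnm (fun z : T * T => g z.1 * b z.2) by apply: nnmM; [exact: nnm_fst|exact: nnm_snd].
have h : \int[mu]_(x in `]c, +oo[) \int[mu]_(y in `]x, +oo[) (g x * b y) =
  \int[mu]_(y in `]c, +oo[) \int[mu]_(x in `]c, y[) (g x * b y).
  exact: (tonelli_itv c +oo%O nf).
transitivity (\int[mu]_(y in `]c, +oo[) \int[mu]_(x in `]c, y[) (g x * b y)).
  apply: eq_integral => y _.
  by rewrite (@integralMr _ T R mu (b y) g _ (measurable_litv _) (nb.2 y) ng) muleC.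
apply: (etrans (esym h)); apply: eq_integral => x _.
by rewrite (@integralMl _ T R mu (g x) b _ (measurable_litv _) (ng.2 x) nb).
Qed.

End split.

(** * The inequality after removal of the monotonicity *)

Section sup_from.
Context {R : realType}.
Implicit Types (g h : R -> \bar R) (t u : R).

Lemma sup_from_ge g t u : (t <= u)%R -> g u <= sup_from g t.
Proof. by move=> tu; apply: ereal_sup_ubound; exists u => //=; rewrite in_itv/= andbT. Qed.

Lemma sup_from_le g t (M : \bar R) : (forall u, (t <= u)%R -> g u <= M) -> sup_from g t <= M.
Proof. by move=> h; apply: ge_ereal_sup => _ [u /= + <-]; rewrite in_itv/= andbT; exact: h. Qed.

Lemma sup_from_ge0 g t : (forall u, 0 <= g u) -> 0 <= sup_from g t.
Proof. by move=> g0; apply: le_trans (g0 t) (sup_from_ge _ (lexx _)). Qed.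

Lemma sup_from_anti g t u : (t <= u)%R -> sup_from g u <= sup_from g t.
Proof. by move=> tu; apply: sup_from_le => y uy; apply: sup_from_ge; exact: le_trans uy. Qed.

Lemma nnm_sup_from g : (forall u, 0 <= g u) -> nnm (sup_from g : lebesgueR R -> \bar R).
Proof.
by move=> g0; apply: nnm_nonincreasing => [x|x y]; [exact: sup_from_ge0|exact: sup_from_anti].
Qed.

Lemma eq_sup_from g h t : (0 < t)%R -> (forall u, (0 < u)%R -> g u = h u) ->
  sup_from g t = sup_from h t.
Proof.
move=> t0 gh; congr ereal_sup; apply: eq_imagel => u /=; rewrite in_itv/= andbT => tu.
by rewrite gh// (lt_le_trans t0).
Qed.

End sup_from.

Section null.
Context d {T : measurableType d} {R : realType}.
Variable m : {measure set T -> \bar R}.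

(** The factor [f] may take the value [+oo], as [+oo * 0 = 0]; this discards the sets where an
    operator is infinite. *)
Lemma integral_null_mul (D : set T) (f w : T -> \bar R) : measurable D -> nnm f -> nnm w ->
  \int[m]_(x in D) w x = 0 -> \int[m]_(x in D) (f x * w x) = 0.
Proof.
move=> mD nf nw w0.
have /(ae_eq_integral_abs m mD (nnm_meas nw)) aw : \int[m]_(x in D) `|w x| = 0.
  by rewrite -[RHS]w0; apply: eq_integral => x _; rewrite gee0_abs ?nw.2.
rewrite (@ge0_ae_eq_integral _ _ _ m D _ (cst 0))//.
- by rewrite integral0.
- exact: nnm_meas (nnmM nf nw).
- by move=> x _; exact: (nnmM nf nw).2.
- by apply: filterS aw => x hx Dx; rewrite (hx Dx) mule0.
Qed.

End null.

(* The data of the inequality for all [k >= 0] obtained from the one for non-increasing [f]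
   by putting [f = k V^(p'-1)]: [hs] is [V^p' v] and [hU] is [u V^-2]. Then [hT1] to [hT5]
   below are the terms of (i); part (ii) has the first two in the opposite order. *)
Record hdata (R : realType) := HData {
  ha : R -> \bar R;
  hw : R -> \bar R;
  hs : R -> \bar R;
  hU : R -> R;
  nha : nnm (ha : lebesgueR R -> \bar R);
  nhw : nnm (hw : lebesgueR R -> \bar R);
  nhs : nnm (hs : lebesgueR R -> \bar R);
  ha_oo : forall x, primitive ha x < +oo;
  hw_oo : forall x, primitive hw x < +oo;
  hs_oo : forall x, primitive hs x < +oo;
  ha_gt0 : forall x, (0 < x)%R -> 0 < primitive ha x;
  hw_gt0 : forall x, (0 < x)%R -> 0 < primitive hw x;
  hs_gt0 : forall x, (0 < x)%R -> 0 < primitive hs x;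
  hs_le0 : forall x, (x <= 0)%R -> hs x = 0;
  hU_ge0 : forall x, (0 <= hU x)%R;
  hU_cont : forall x, (0 < x)%R -> {for x, continuous hU} }.

Section hardy_data.
Context {R : realType}.
Local Notation mu := (@completed_lebesgue_measure R).
Variables (D : hdata R) (p q : R).
Local Notation p' := (conjexp p).
Local Notation r := (rexp p q).
Let pos : set R := `]0%R, +oo[%classic.

Definition hS := primitive (hs D).
Definition hA := primitive (ha D).
Definition hW := tail (hw D).
Definition hUs : R -> \bar R := sup_from (fun tau => (hU D tau)%:E).
Definition hUa (t : R) := hUs t * ha D t.
Definition hB := lkernel hUa.
Definition hK (k : R -> \bar R) := primitive (fun y => k y * hs D y).
Definition hR (k : R -> \bar R) := sup_from (fun tau => (hU D tau)%:E * hK k tau).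
Definition hT (k : R -> \bar R) := primitive (fun t => hR k t * ha D t).
(** The [p']-th power of the constant in Hoelder's estimate of [hU tau * hK k tau] by the norm of
    [k]. *)
Definition hg (tau : R) := (hU D tau)%:E `^ p' * hS tau.
Definition hphi := sup_from hg.
(** The limit of [hphi] at infinity, since [hphi] is non-increasing. *)
Definition hphi_inf := ereal_inf [set hphi t | t in pos].
Definition hpt (t : R) := hphi t - hphi_inf.
Definition hI (x : R) := \int[mu]_(y in `]0%R, x[) (hs D y * hB y x `^ p').
Definition hT1 := hardy_const p q mu pos (hw D) hI hW.
Definition hOm (t : R) := \int[mu]_(y in `]t, +oo[) (hB t y `^ q * hw D y).
Definition hT2 : \bar R :=
  if (p <= q)%R then ereal_sup [set hS t `^ p'^-1 * hOm t `^ q^-1 | t in pos]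
  else (\int[mu]_(t in pos) (hS t `^ (r / conjexp q) * hs D t * hOm t `^ (r / q))) `^ r^-1.
Definition hAq (y : R) := hA y `^ q * hw D y.
Definition hAt := primitive hAq.
Definition hT3 := hardy_const p q mu pos hAq hpt hAt.
Definition hE (m : {measure set (measurableTypeR R) -> \bar R}) (x : R) :=
  \int[m]_(t in `]0%R, x]) (hA t `^ p').
Definition hT4 m := hardy_const p q mu pos (hw D) (hE m) hW.
Definition hT5 := (\int[mu]_(y in pos) hAq y) `^ q^-1 * hphi_inf `^ p'^-1.
Definition hnorm (k : R -> \bar R) := \int[mu]_(x in pos) (k x `^ p * hs D x).

End hardy_data.

Section basic.
Context {R : realType}.
Local Notation T := (lebesgueR R).
Local Notation mu := (@completed_lebesgue_measure R).
Variables (D : hdata R) (p q : R).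
Hypotheses (p1 : (1 < p)%R) (q1 : (1 < q)%R).
Local Notation p' := (conjexp p).
Let pos : set R := `]0%R, +oo[%classic.
Let p0 : (0 < p)%R := lt_trans ltr01 p1.
Let q0 : (0 < q)%R := lt_trans ltr01 q1.
Let p'0 : (0 < p')%R := conjexp_gt0 p1.

Lemma nnm_hS : nnm (hS D : T -> \bar R). Proof. exact: nnm_primitive (nhs D). Qed.
Lemma nnm_hA : nnm (hA D : T -> \bar R). Proof. exact: nnm_primitive (nha D). Qed.
Lemma nnm_hW : nnm (hW D : T -> \bar R). Proof. exact: nnm_tail (nhw D). Qed.

Lemma nnm_hUs : nnm (hUs D : T -> \bar R).
Proof. by apply: nnm_sup_from => u; rewrite lee_fin hU_ge0. Qed.

Lemma nnm_hUa : nnm (hUa D : T -> \bar R).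
Proof. by apply: nnmM; [exact: nnm_hUs|exact: nha]. Qed.

Lemma hS_fin x : hS D x = (fine (hS D x))%:E.
Proof. by rewrite fineK// ge0_fin_numE ?hs_oo// (nnm_hS).2. Qed.

Lemma nnm_hAq : nnm (hAq D q : T -> \bar R).
Proof. by apply: nnmM; [apply: nnm_poweR; exact: nnm_hA|exact: nhw]. Qed.

Lemma nnm_hAt : nnm (hAt D q : T -> \bar R).
Proof. exact: nnm_primitive nnm_hAq. Qed.

Lemma le_hB (x x' t t' : R) : (x' <= x)%R -> (t <= t')%R -> hB D x t <= hB D x' t'.
Proof. exact: le_lkernel nnm_hUa. Qed.

Lemma hB_ge0 (x t : R) : 0 <= hB D x t. Proof. exact: lkernel_ge0 nnm_hUa. Qed.

Lemma nnm_hB_snd x : nnm (hB D x : T -> \bar R).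
Proof.
by apply: nnm_nondecreasing => [y|y z yz]; [exact: hB_ge0|exact: le_hB (lexx _) yz].
Qed.

Lemma nnm_hB_fst x : nnm (fun y : T => hB D y x).
Proof.
by apply: nnm_nonincreasing => [y|y z yz]; [exact: hB_ge0|exact: le_hB yz (lexx _)].
Qed.

Lemma nnm_hI_integrand x : nnm (fun y : T => hs D y * hB D y x `^ p').
Proof. exact: (nnmM (nhs D) (nnm_poweR p' (nnm_hB_fst x))). Qed.

Lemma hI_ge0 x : 0 <= hI D p x.
Proof. by apply: integral_nng => y _; exact: (nnm_hI_integrand x).2. Qed.

Lemma le_hI x z : (x <= z)%R -> hI D p x <= hI D p z.
Proof.
move=> xz; apply: (@le_trans _ _ (\int[mu]_(y in `]0%R, x[) (hs D y * hB D y z `^ p'))).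
  apply: le_integral_nng => y _; first exact: (nnm_hI_integrand x).2.
  apply: le_mull; first exact: (nhs D).2.
  apply: le_poweR; [exact: ltW|exact: hB_ge0|exact: le_hB (lexx _) xz].
apply: subset_integral_nng => [y _|]; first exact: (nnm_hI_integrand z).2.
by apply: subset_itvl; rewrite bnd_simp.
Qed.

Lemma nnm_hI : nnm (hI D p : T -> \bar R).
Proof. by apply: nnm_nondecreasing => [x|x z xz]; [exact: hI_ge0|exact: le_hI xz]. Qed.

Lemma nnm_hOm_integrand x : nnm (fun y : T => hB D x y `^ q * hw D y).
Proof. exact: (nnmM (nnm_poweR q (nnm_hB_snd x)) (nhw D)). Qed.

Lemma hOm_ge0 x : 0 <= hOm D q x.
Proof. by apply: integral_nng => y _; exact: (nnm_hOm_integrand x).2. Qed.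

Lemma le_hOm x z : (x <= z)%R -> hOm D q z <= hOm D q x.
Proof.
move=> xz; apply: (@le_trans _ _ (\int[mu]_(y in `]z, +oo[) (hB D x y `^ q * hw D y))).
  apply: le_integral_nng => y _; first exact: (nnm_hOm_integrand z).2.
  apply: le_mulr; first exact: (nhw D).2.
  apply: le_poweR; [exact: ltW|exact: hB_ge0|exact: le_hB xz (lexx _)].
apply: subset_integral_nng => [y _|]; first exact: (nnm_hOm_integrand x).2.
by apply: subset_itvr; rewrite bnd_simp.
Qed.

Lemma nnm_hOm : nnm (hOm D q : T -> \bar R).
Proof. by apply: nnm_nonincreasing => [x|x z xz]; [exact: hOm_ge0|exact: le_hOm xz]. Qed.

Lemma pos_nonempty : pos !=set0. Proof. by exists 1%R; rewrite /pos/= in_itv/= ltr01. Qed.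

Lemma nnm_ks (k : R -> \bar R) : nnm (k : T -> \bar R) -> nnm (fun y : T => k y * hs D y).
Proof. by move=> nk; exact: (nnmM nk (nhs D)). Qed.

Lemma nnm_hK (k : R -> \bar R) : nnm (k : T -> \bar R) -> nnm (hK D k : T -> \bar R).
Proof. by move=> nk; exact: nnm_primitive (nnm_ks nk). Qed.

Lemma nnm_lam (k : R -> \bar R) : nnm (k : T -> \bar R) -> nnm (fun y : T => k y `^ p * hs D y).
Proof. by move=> nk; apply: nnmM; [exact: nnm_poweR|exact: nhs]. Qed.

Lemma lint_pos (f : R -> \bar R) (A : set R) : (forall x, (x <= 0)%R -> f x = 0) ->
  \int[mu]_(x in (pos `&` A : set T)) f x = \int[mu]_(x in (A : set T)) f x.
Proof.
move=> f0; rewrite setIC integral_mkcondr; apply: eq_integral => x _.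
rewrite /patch; case: ifPn => // xp; rewrite f0// leNgt; apply/negP => x0.
by move/negP: xp; apply; rewrite inE /pos/= in_itv/= x0.
Qed.

Lemma rank_hS : rank mu (setT : set T) (fun x => (hs D x `^ p'^-1) `^ p') (hS D).
Proof.
move=> l l0; apply: le_trans (rank_primitive (nhs D) l0).
have -> : \int[mu]_(x in ((setT : set T) `&` [set x | hS D x <= l%:E])) (hs D x `^ p'^-1) `^ p' =
    \int[mu]_(x in ((setT : set T) `&` [set x | hS D x <= l%:E])) hs D x.
  by apply: eq_integral => x _; rewrite poweRVK ?(nhs D).2// gt_eqF.
rewrite setTI -[leLHS]lint_pos; last exact: hs_le0.
exact: lexx.
Qed.

(* The factors are [k s^(1/p)] and [b s^(1/p')]. *)
Lemma lint_ks_hoelder (k b : R -> \bar R) (A : set T) : measurable A ->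
  nnm (k : T -> \bar R) -> nnm (b : T -> \bar R) ->
  \int[mu]_(y in A) (k y * hs D y * b y) <=
  (\int[mu]_(y in A) (k y `^ p * hs D y)) `^ p^-1 *
  (\int[mu]_(y in A) (hs D y * b y `^ p')) `^ p'^-1.
Proof.
move=> mA nk nb.
have := @integral_hoelder _ T R mu p p' (fun y => k y * hs D y `^ p^-1)
  (fun y => hs D y `^ p'^-1 * b y) A mA p0 p'0 (conjexp_add p).
have n1 : nnm (fun y : T => k y * hs D y `^ p^-1).
  exact: (nnmM nk (nnm_poweR p^-1 (nhs D))).
have n2 : nnm (fun y : T => hs D y `^ p'^-1 * b y).
  exact: (nnmM (nnm_poweR p'^-1 (nhs D)) nb).
move=> /(_ n1 n2).
have -> : \int[mu]_(x in A) (k x * hs D x `^ p^-1 * (hs D x `^ p'^-1 * b x)) =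
    \int[mu]_(y in A) (k y * hs D y * b y).
  apply: eq_integral => y _; rewrite -muleA [_ `^ p^-1 * _]muleA.
  have i1 : (0 < p^-1)%R by rewrite invr_gt0.
  have i2 : (0 < p'^-1)%R by rewrite invr_gt0.
  rewrite (poweR_addr ((nhs D).2 y) i1 i2) conjexp_add (poweRe1 ((nhs D).2 y)).
  exact: muleA.
have E1 : \int[mu]_(x in A) (k x * hs D x `^ p^-1) `^ p =
    \int[mu]_(y in A) (k y `^ p * hs D y).
  apply: eq_integral => y _; rewrite poweRM ?nk.2 ?poweR_ge0//.
  by rewrite poweRVK ?(nhs D).2// gt_eqF.
have E2 : \int[mu]_(x in A) (hs D x `^ p'^-1 * b x) `^ p' =
    \int[mu]_(y in A) (hs D y * b y `^ p').
  apply: eq_integral => y _; rewrite poweRM ?nb.2 ?poweR_ge0//.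
  by rewrite poweRVK ?(nhs D).2// gt_eqF.
by rewrite -E1 -E2.
Qed.

End basic.

(** * The Hardy operator with kernel [hB] *)

Section kernel_operator.
Context {R : realType}.
Local Notation T := (lebesgueR R).
Local Notation mu := (@completed_lebesgue_measure R).
Variables (p q : R).
Hypotheses (p1 : (1 < p)%R) (q1 : (1 < q)%R).
Local Notation p' := (conjexp p).
Local Notation r := (rexp p q).
Let p0 : (0 < p)%R := lt_trans ltr01 p1.
Let q0 : (0 < q)%R := lt_trans ltr01 q1.
Let p'0 : (0 < p')%R := conjexp_gt0 p1.
Let pV0 : (0 <= p^-1)%R. Proof. by rewrite invr_ge0 ltW. Qed.
Let p'V0 : (0 <= p'^-1)%R. Proof. by rewrite invr_ge0 ltW. Qed.
Implicit Types (D : hdata R) (k : R -> \bar R).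

Definition hUK D k (t : R) := hUa D t * hK D k t.
Definition hlam D k (t : R) := k t `^ p * hs D t.

Lemma nnm_hUK D k : nnm (k : T -> \bar R) -> nnm (hUK D k : T -> \bar R).
Proof. by move=> nk; apply: nnmM; [exact: nnm_hUa|exact: nnm_hK]. Qed.

(** On []x, z[] write [hK k t] as its value at [x] plus the increment from [x]: the first part
    contributes [hK k x * hB x z]; the second, after an exchange of integrals, is estimated by
    Hoelder's inequality with the norm of [k] on []x, z[] only. *)
Lemma lkernel_hUK_le D k (x z : R) : nnm (k : T -> \bar R) -> (0 <= x)%R -> (x <= z)%R ->
  lkernel (hUK D k) x z <=
  hK D k x * hB D x z + lkernel (hlam D k) x z `^ p^-1 * hI D p z `^ p'^-1.
Proof.
move=> nk x0 xz.
have nUa := nnm_hUa D; have nks := nnm_ks D nk.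
have nB := nnm_hB_fst D z.
have nkx : nnm (fun t : T => lkernel (fun y => k y * hs D y) x t).
  apply: nnm_nondecreasing => [t|t t' tt']; first exact: lkernel_ge0.
  exact: le_lkernel.
have -> : lkernel (hUK D k) x z =
    \int[mu]_(t in `]x, z[) (hK D k x * hUa D t + hUa D t * lkernel (fun y => k y * hs D y) x t).
  apply: eq_integral => t /set_mem/=; rewrite in_itv/= => /andP[xt _].
  rewrite /hUK /hK (primitive_split nks x0 (ltW xt)) [hK D k x * _]muleC.
  by rewrite (ge0_muleDr _ (primitive_ge0 x nks) (nkx.2 t)).
have K0 : 0 <= hK D k x by exact: (nnm_hK D nk).2.
have n1 : nnm (fun t : T => hK D k x * hUa D t) by exact: (nnmM (nnm_cst K0) nUa).
have n2 : nnm (fun t : T => hUa D t * lkernel (fun y => k y * hs D y) x t) by exact: (nnmM nUa nkx).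
rewrite (integralDn mu (measurable_litv _) n1 n2).
rewrite (integralMl mu (measurable_litv _) K0 nUa).
apply: leeD; first exact: lexx.
rewrite (tonelli_lkernel x z nUa nks).
apply: le_trans (lint_ks_hoelder D p1 (measurable_litv _) nk nB) _.
apply: le_mull; first exact: poweR_ge0.
apply: le_poweR p'V0 _ _.
  by apply: integral_nng => y _; exact: (nnm_hI_integrand D p z).2.
apply: subset_integral_nng => [y _|]; first exact: (nnm_hI_integrand D p z).2.
by apply: subset_itvr; rewrite bnd_simp.
Qed.

Lemma hK0 D k : hK D k 0%R = 0.
Proof.
by rewrite /hK /primitive /lebesgue_integral set_itv_ge ?integral_set0// bnd_simp ltxx.
Qed.

Lemma primitive_hUK_le D k (z : R) : nnm (k : T -> \bar R) -> (0 <= z)%R ->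
  primitive (hUK D k) z <= hnorm D p k `^ p^-1 * hI D p z `^ p'^-1.
Proof.
move=> nk z0; apply: le_trans (lkernel_hUK_le D nk (lexx _) z0) _.
rewrite hK0 mul0e add0e; apply: le_mulr; first exact: poweR_ge0.
have nl := nnm_lam D p nk.
apply: le_poweR pV0 _ _; first exact: lkernel_ge0.
apply: subset_integral_nng => [y _|]; first exact: nl.2.
by apply: subset_itvl; rewrite bnd_simp.
Qed.

(** This is [rank_hoelder] with [kap = k s^(1/p)] and [eps = s^(1/p')]: at level [n] only a summable
    share [del n] of the norm enters. *)
Lemma hK_level : exists2 C : R, (0 < C)%R & forall D k, nnm (k : T -> \bar R) ->
  exists2 del : nat -> \bar R, (forall n, 0 <= del n) &
  (forall n x, hS D x <= (2 * lev n)%:E -> hK D k x <= C%:E * (lev n)%:E `^ p'^-1 * del n `^ p^-1) /\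
  \sum_(n <oo) del n <= C%:E * hnorm D p k.
Proof.
have p'1 := conjexp_gt1 p1.
have [C C0 hC] := @rank_hoelder R p p' p1 p'1 (conjexp_add p).
exists C => // D k nk.
have nkap : nnm (fun x : T => k x * hs D x `^ p^-1).
  exact: (nnmM nk (nnm_poweR p^-1 (nhs D))).
have neps : nnm (fun x : T => hs D x `^ p'^-1) by apply: nnm_poweR; exact: nhs.
set c := (p / (2 * p'))%R in hC.
have Se x : hS D x = 0 -> hs D x `^ p'^-1 = 0.
  move=> S0; have [x0|x0] := leP x 0%R; first by rewrite hs_le0// poweR0r// gt_eqF// invr_gt0.
  by have := hs_gt0 D x0; rewrite -/(hS D x) S0 ltxx.
pose del n := \int[mu]_(x in [set x | hS D x <= (2 * lev n)%:E])
   ((lev n)%:E `^ (- c) * (hS D x `^ c * (k x * hs D x `^ p^-1) `^ p)).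
have [h1 h2] := hC _ T mu (hS D) _ _ (nnm_hS D) nkap neps Se (rank_hS D p1).
exists del.
  move=> n; apply: integral_nng => x _; rewrite !mule_ge0 ?poweR_ge0//.
split => [n x Sx|]; last first.
  apply: le_trans h2 _; apply: le_mull; first by rewrite lee_fin ltW.
  have -> : \int[mu]_x (k x * hs D x `^ p^-1) `^ p = \int[mu]_x (k x `^ p * hs D x).
    apply: eq_integral => y _; rewrite poweRM ?nk.2 ?poweR_ge0//.
    by rewrite poweRVK ?(nhs D).2// gt_eqF.
  rewrite -lint_pos; last by move=> x x0; rewrite hs_le0// mule0.
  by rewrite setIT.
apply: le_trans (h1 n).
have E : \int[mu]_(y in [set y | hS D y <= (2 * lev n)%:E]) (k y * hs D y `^ p^-1 * hs D y `^ p'^-1) =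
    \int[mu]_(y in [set y | hS D y <= (2 * lev n)%:E]) (k y * hs D y).
  apply: eq_integral => y _; rewrite -muleA.
  have i1 : (0 < p^-1)%R by rewrite invr_gt0.
  have i2 : (0 < p'^-1)%R by rewrite invr_gt0.
  by rewrite (poweR_addr ((nhs D).2 y) i1 i2) conjexp_add (poweRe1 ((nhs D).2 y)).
rewrite E; apply: subset_integral_nng => y; first by rewrite mule_ge0 ?nk.2 ?(nhs D).2.
rewrite /= in_itv/= => /andP[_ yx]; apply: le_trans Sx.
exact: le_primitive (nhs D) (ltW yx).
Qed.

(** For [q < p], [hT2] integrates against [s] instead of [w], so it needs its own discretization.
    The part of []0, s n[] where [hS > lev n / 2] carries [s]-mass at least [lev n / 2], [hOm] is at
    least [hOm (s n)] on it, and [r/q' + 1 = r/p'] adjusts the powers. *)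
Lemma gauge_hOm : exists2 C : R, (0 < C)%R & forall D (s : nat -> R) (P : pred nat),
  (forall n, P n -> (0 < s n)%R /\ hS D (s n) = (lev n)%:E) ->
  gauge p q (fun n => if P n then (lev n)%:E `^ (q / p') * hOm D q (s n) else 0) <=
  C%:E * hT2 D p q `^ q.
Proof.
case: (leP p q) => pq.
  exists 1%R => // D s P sP; rewrite mul1e /gauge /hT2 pq.
  set M := ereal_sup [set hS D t `^ _ * _ | t in _].
  have M0 : 0 <= M.
    apply: (@le_trans _ _ (hS D 1%R `^ p'^-1 * hOm D q 1%R `^ q^-1)).
      by rewrite mule_ge0 ?poweR_ge0.
    by apply: ereal_sup_ubound; exists 1%R => //; rewrite /= in_itv/= ltr01.
  apply: ge_ereal_sup => _ [n _ <-]; case: ifPn => [Pn|_]; last exact: poweR_ge0.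
  have [sn Sn] := sP n Pn.
  have Om0 : 0 <= hOm D q (s n) by exact: (nnm_hOm D q1).2.
  rewrite -[X in _ * X](poweRVK Om0 (lt0r_neq0 q0)) [(q / p')%R]mulrC poweRrM -(poweRM _ (poweR_ge0 _ _) (poweR_ge0 _ _)).
  apply: le_poweR; [exact: ltW|by rewrite mule_ge0 ?poweR_ge0|].
  by apply: ereal_sup_ubound; exists (s n); rewrite ?Sn//= in_itv/= sn.
have r0 : (0 < r)%R := rexp_gt0 q0 pq.
have rq0 : (0 < r / q)%R by rewrite divr_gt0.
have q'0 := conjexp_gt0 q1.
have rq'0 : (0 <= r / conjexp q)%R by rewrite divr_ge0 ?ltW.
have rp'0 : (0 <= r / p')%R by rewrite divr_ge0 ?ltW.
have [K [K0 KE]] : exists K : R, (0 < K)%R /\ (K = 2 `^ (r / p'))%R.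
  by exists (2 `^ (r / p'))%R; rewrite powR_gt0.
exists (K `^ (q / r))%R; first by rewrite powR_gt0.
move=> D s P sP; have pq' : (p <= q)%R = false by rewrite leNgt pq.
rewrite /gauge /hT2 !(ifF _ _ pq').
set J := \int[mu]_(t in _) _.
have nOm := nnm_hOm D q1; have nS := nnm_hS D.
have nj : nnm (fun t : T => hS D t `^ (r / conjexp q) * hs D t * hOm D q t `^ (r / q)).
  by apply: nnmM; [apply: nnmM|]; [exact: nnm_poweR|exact: nhs|exact: nnm_poweR].
have J0 : 0 <= J by apply: integral_nng => t _; exact: nj.2.
have K0' : 0 <= K%:E by rewrite lee_fin ltW.
rewrite -(poweRrM J) [(r^-1 * q)%R]mulrC -(poweR_EFin K) -(poweRM _ K0' J0).
apply: le_poweR; first by rewrite divr_ge0 ?ltW.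
  by apply: nneseries_ge0 => n _ _; exact: poweR_ge0.
pose G n := if P n then `]0%R, s n[%classic `&` [set x | (lev n / 2)%:E < hS D x] else set0.
have mG n : measurable (G n : set T).
  by rewrite /G; case: (P n) => //; apply: measurableI => //; exact: measurable_gt.
have Gin n x : P n -> G n x -> (x <= s n)%R /\ (lev n / 2)%:E <= hS D x.
  by move=> Pn; rewrite /G Pn => -[/=]; rewrite in_itv/= => /andP[_ /ltW ? /ltW].
have GS n x : G n x -> (lev n < 2 * fine (hS D x) <= 2 * lev n)%R.
  rewrite /G; case: ifPn => // Pn [/=]; rewrite in_itv/= => /andP[x0 xs].
  rewrite hS_fin lte_fin => Sx.
  have : hS D x <= (lev n)%:E by rewrite -(sP n Pn).2; exact: le_primitive (nhs D) (ltW xs).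
  by rewrite hS_fin lee_fin => Sx'; apply/andP; split; lra.
have tG : trivIset setT G.
  by move=> i j _ _ [x [/GS hi /GS hj]]; exact: lev_disjoint hi hj.
apply: (@le_trans _ _ (\sum_(n <oo) (K%:E * \int[mu]_(x in G n)
    (hS D x `^ (r / conjexp q) * hs D x * hOm D q x `^ (r / q))))); last first.
  rewrite nneseriesZl; last by move=> n _; apply: integral_nng => x _; exact: nj.2.
  apply: le_mull; first by rewrite lee_fin ltW.
  rewrite -(@ge0_integral_bigcup _ T R mu G _ mG (nnm_meas nj) (fun x _ => nj.2 x) tG).
  apply: subset_integral_nng => [x _|x [n _]]; first exact: nj.2.
  by rewrite /G; case: ifP => // _ [/= + _]; rewrite !in_itv/= andbT => /andP[].
apply: lee_nneseries => [n _ _|n _]; first exact: poweR_ge0.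
case: ifPn => Pn; last first.
  rewrite poweR0r ?gt_eqF//; apply: mule_ge0; first by rewrite lee_fin ltW.
  by apply: integral_nng => x _; exact: nj.2.
have [sn Sn] := sP n Pn.
have Om0 : 0 <= hOm D q (s n) by exact: nOm.2.
have lE := @levE_ge0 R n.
rewrite (poweRM _ (poweR_ge0 _ _) Om0) -poweRrM.
have -> : (q / p' * (r / q) = r / p')%R by rewrite mulrC mulrA divfK// gt_eqF.
have h2 : 0 <= (lev n / 2 : R)%:E by rewrite lee_fin divr_ge0.
have mass : (lev n / 2)%:E <= \int[mu]_(x in G n) hs D x.
  have rk : rank mu (`]0%R, s n[ : set T) (hs D) (hS D).
    apply: rank_sub (rank_primitive (nhs D)); first exact: nhs.
    by apply: subset_itvl; rewrite bnd_simp.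
  have l2 : (0 < lev n / 2 :> R)%R by apply: divr_gt0; [exact: lev_gt0|exact: ltr0n].
  have := rank_gt (measurable_litv _) (nhs D) nS rk l2.
  rewrite /G Pn; have -> : \int[mu]_(x in `]0%R, s n[) hs D x = (lev n)%:E by rewrite -Sn.
  set X := \int[mu]_(x in _) _.
  have -> : (lev n)%:E = (lev n / 2)%:E + (lev n / 2)%:E :> \bar R.
    by rewrite -EFinD; congr EFin; move: (lev n) => l; field.
  by rewrite leeD2lE.
apply: (@le_trans _ _ (K%:E * ((lev n / 2)%:E `^ (r / conjexp q) * hOm D q (s n) `^ (r / q) *
    \int[mu]_(x in G n) hs D x))); last first.
  apply: le_mull; first by rewrite lee_fin ltW.
  have c0 : 0 <= (lev n / 2)%:E `^ (r / conjexp q) * hOm D q (s n) `^ (r / q).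
    by rewrite mule_ge0 ?poweR_ge0.
  rewrite -(integralMl mu (mG n) c0 (nhs D)).
  apply: le_integral_nng => x Gx; first by rewrite mule_ge0 ?(nhs D).2.
  rewrite [leRHS]muleAC; apply: le_mulr; first exact: (nhs D).2.
  have [xs Sx] := Gin n x Pn Gx.
  apply: (lee_pmul (poweR_ge0 _ _) (poweR_ge0 _ _)); first exact: le_poweR rq'0 h2 Sx.
  exact: le_poweR (ltW rq0) Om0 (le_hOm D q1 xs).
apply: (@le_trans _ _ (K%:E * ((lev n / 2)%:E `^ (r / conjexp q) * hOm D q (s n) `^ (r / q) *
    (lev n / 2)%:E))); last first.
  apply: le_mull; first by rewrite lee_fin ltW.
  by apply: le_mull mass; rewrite mule_ge0 ?poweR_ge0.
rewrite [X in K%:E * X]muleAC muleA; apply: le_mulr; first exact: poweR_ge0.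
rewrite -[X in _ * (_ * X)](poweRe1 h2) poweR_addr_unit// -(rexp_conj q1 pq).
rewrite !poweR_EFin -EFinM lee_fin KE -(powRM _ (ler0n _ 2) _); last by rewrite divr_ge0.
by rewrite mulrCA mulfV ?mulr1.
Qed.

End kernel_operator.

Section upper.
Context {R : realType}.
Local Notation T := (lebesgueR R).
Local Notation mu := (@completed_lebesgue_measure R).
Variables (p q : R).
Hypotheses (p1 : (1 < p)%R) (q1 : (1 < q)%R).
Local Notation p' := (conjexp p).
Let pos : set R := `]0%R, +oo[%classic.
Let p0 : (0 < p)%R := lt_trans ltr01 p1.
Let q0 : (0 < q)%R := lt_trans ltr01 q1.
Let p'0 : (0 < p')%R := conjexp_gt0 p1.
Let q00 : (0 <= q)%R := ltW q0.
Let pV0 : (0 <= p^-1)%R. Proof. by rewrite invr_ge0 ltW. Qed.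
Let qp0 : (0 <= q / p)%R. Proof. by rewrite divr_ge0// ltW. Qed.
Implicit Types (D : hdata R) (k : R -> \bar R).

Lemma half_lt (l : R) : (0 < l)%R -> (l / 2 < l)%R. Proof. by move=> ?; lra. Qed.

Lemma double_half_le (l : R) : (2 * l <= 4 * (l / 2))%R. Proof. by lra. Qed.

Lemma nneseries_term (f : nat -> \bar R) n : (forall i, 0 <= f i) -> f n <= \sum_(i <oo) f i.
Proof.
move=> f0; apply: le_trans (nneseries_lim_ge n.+1 _); last by move=> i _ _; exact: f0.
by rewrite big_mkord big_ord_recr/= leeDr// sume_ge0.
Qed.

Lemma hOm_pos D (s : R) : (0 <= s)%R ->
  \int[mu]_(y in pos) (hB D s y `^ q * hw D y) = hOm D q s.
Proof.
move=> s0; have n := nnm_hOm_integrand D q s.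
have s1 : (BLeft s <= BInfty R false)%O by rewrite bnd_simp.
rewrite (lint_split n s0 s1).
rewrite (_ : \int[mu]_(y in `]0%R, s[) _ = 0) ?add0e//.
apply: integral0_eq => y /=; rewrite in_itv/= => /andP[_ ys].
rewrite /hB /lkernel set_itv_ge; last by rewrite bnd_simp -leNgt ltW.
by rewrite integral_set0 poweR0r ?mul0e// gt_eqF.
Qed.

(** One majorant [G] for all [x] at once, since [x] will later depend on [y]. If [hS x] lies in
    layer [n], then [hK k x] is bounded by [hK_level], and [hB x y] by its value at the earlier
    point [s n] where [hS] equals [lev n]. *)
Lemma upper_hKB : exists2 C : R, (0 < C)%R & forall D k, nnm (k : T -> \bar R) ->
  exists G : R -> \bar R, [/\ nnm (G : T -> \bar R),
   forall x y, (0 < x)%R -> (x <= y)%R -> (hK D k x * hB D x y) `^ q * hw D y <= G y &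
   \int[mu]_(y in pos) G y <= C%:E * (hT2 D p q `^ q * hnorm D p k `^ (q / p))].
Proof.
have [C1 C10 hC1] := hK_level p1.
have [C2 C20 hC2] := gauge_hOm p1 q1.
have C1E : 0 <= C1%:E by rewrite lee_fin ltW.
have C1q : 0 <= C1%:E `^ q by exact: poweR_ge0.
exists (C1 `^ q * C1 `^ (q / p) * C2)%R; first by rewrite !mulr_gt0// powR_gt0.
move=> D k nk; have [del d0 [hdel sdel]] := hC1 D k nk.
(* A level that [hS] does not attain gets the dummy point 0 and is discarded by [P]. *)
have ex n : exists s : R, (exists2 s' : R, (0 < s')%R & hS D s' = (lev n)%:E) ->
    (0 < s)%R /\ hS D s = (lev n)%:E.
  have [[s s0 sS]|h] := pselect (exists2 s' : R, (0 < s')%R & hS D s' = (lev n)%:E).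
    by exists s.
  by exists 0%R.
have [s hs] := choice ex.
pose P n := (0 < s n)%R && (hS D (s n) == (lev n)%:E).
have sP n : P n -> (0 < s n)%R /\ hS D (s n) = (lev n)%:E by move=> /andP[? /eqP].
pose X n := if P n then (lev n)%:E `^ (q / p') * hOm D q (s n) else 0.
have X0 n : 0 <= X n.
  by rewrite /X; case: (P n) => //; apply: mule_ge0; [exact: poweR_ge0|exact: hOm_ge0].
pose c n := C1%:E `^ q * (del n `^ (q / p) * (lev n)%:E `^ (q / p')).
have c0 n : 0 <= c n by rewrite /c !mule_ge0 ?poweR_ge0.
pose F n (y : R) := if P n then c n * (hB D (s n) y `^ q * hw D y) else 0.
have nF n : nnm (F n : T -> \bar R).
  rewrite /F; case: (P n); last exact: nnm_cst.
  exact: (nnmM (nnm_cst (c0 n)) (nnm_hOm_integrand D q (s n))).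
exists (fun y => \sum_(n <oo) F n y); split.
- exact: nnm_nneseries.
- move=> x y x0 xy.
  have Sx0 : (0 < fine (hS D x))%R by rewrite -lte_fin -hS_fin; exact: hs_gt0.
  have [n /andP[ls sl]] := lev_exists Sx0.
  have lS : (lev n)%:E < hS D x by rewrite hS_fin lte_fin.
  have [s' /andP[s'0 s'x] s'E] := primitive_level (nhs D) (lev_gt0 n) lS (hs_oo D x).
  have [sn0 snE] : (0 < s n)%R /\ hS D (s n) = (lev n)%:E by apply: hs; exists s'.
  have Pn : P n by rewrite /P sn0 snE eqxx.
  have snx : (s n <= x)%R.
    rewrite leNgt; apply/negP => /ltW xs.
    by have := le_primitive (nhs D) xs; rewrite -/(hS D x) -/(hS D (s n)) snE leNgt lS.
  have Sxl : hS D x <= (2 * lev n)%:E by rewrite hS_fin lee_fin.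
  have Kx0 : 0 <= hK D k x by exact: (nnm_hK D nk).2.
  have h1 : (hK D k x * hB D x y) `^ q <= c n * hB D (s n) y `^ q.
    apply: (@le_trans _ _ ((C1%:E * (lev n)%:E `^ p'^-1 * del n `^ p^-1 * hB D (s n) y) `^ q)).
      apply: (le_poweR q00 (mule_ge0 Kx0 (hB_ge0 D x y))).
      exact: (lee_pmul Kx0 (hB_ge0 D x y) (hdel n x Sxl) (le_hB D snx (lexx _))).
    have z1 : 0 <= C1%:E * (lev n)%:E `^ p'^-1 by exact: (mule_ge0 C1E (poweR_ge0 _ _)).
    have z2 : 0 <= C1%:E * (lev n)%:E `^ p'^-1 * del n `^ p^-1 by exact: (mule_ge0 z1 (poweR_ge0 _ _)).
    rewrite (poweRM q z2 (hB_ge0 D _ _)) (poweRM q z1 (poweR_ge0 _ _)) (poweRM q C1E (poweR_ge0 _ _)).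
    rewrite -(poweRrM (del n)) -(poweRrM (lev n)%:E) [(p^-1 * q)%R]mulrC [(p'^-1 * q)%R]mulrC.
    by rewrite /c -[X in X * _ <= _]muleA [X in _ * X * _]muleC.
  apply: (@le_trans _ _ (F n y)).
    by rewrite /F Pn muleA; exact: (le_mulr ((nhw D).2 y) h1).
  by apply: (nneseries_term (f := fun n => F n y)) => i; exact: (nF i).2.
have mpos : measurable (pos : set T) by exact: measurable_litv.
rewrite (integral_seriesn mu mpos nF).
have FE n : \int[mu]_(y in pos) F n y = C1%:E `^ q * (del n `^ (q / p) * X n).
  rewrite /F /X; case: ifPn => Pn; last by rewrite integral0 !mule0.
  have [sn0 _] := sP n Pn.
  rewrite (integralMl mu mpos (c0 n) (nnm_hOm_integrand D q (s n))).
  by rewrite (hOm_pos D (ltW sn0)) /c -!muleA.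
rewrite (eq_eseriesr (fun n _ => FE n)).
rewrite nneseriesZl; last by move=> n _; apply: mule_ge0; [exact: poweR_ge0|exact: X0].
have gX : gauge p q X <= C2%:E * hT2 D p q `^ q by exact: hC2.
have sd0 : 0 <= \sum_(n <oo) del n by exact: nneseries_ge0.
have L0 : 0 <= hnorm D p k by apply: integral_nng => x _; exact: (nnm_lam D p nk).2.
have h2 : \sum_(n <oo) (del n `^ (q / p) * X n) <=
    (C1%:E `^ (q / p) * hnorm D p k `^ (q / p)) * (C2%:E * hT2 D p q `^ q).
  apply: le_trans (gauge_hoelder p1 q1 d0 X0) _.
  apply: lee_pmul; [exact: poweR_ge0|exact: gauge_ge0| |exact: gX].
  rewrite -(poweRM _ C1E L0); exact: le_poweR sdel.
apply: le_trans (le_mull C1q h2) _.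
rewrite (poweR_EFin C1 q) (poweR_EFin C1 (q / p)) !EFinM.
set a := (C1 `^ q)%:E; set b := (C1 `^ (q / p))%:E; set t := hT2 D p q `^ q.
set l := hnorm D p k `^ _.
by rewrite -(muleA b) (muleCA l) [l * t]muleC !muleA.
Qed.

(** In the layer [lev n < F <= 2 lev n] of [F = int_0^x U K a], [F] is at most 4 times its increase
    from [lev n / 2] to [lev n], which takes place between two earlier points; [lkernel_hUK_le] on
    that interval gives a term for [upper_hKB] and one that contains only a local norm of [k]. *)
Lemma upper_hUK : exists2 C : R, (0 < C)%R & forall D k, nnm (k : T -> \bar R) ->
  hT1 D p q < +oo -> hnorm D p k < +oo ->
  \int[mu]_(x in pos) (primitive (hUK D k) x `^ q * hw D x) <=
  C%:E * ((hT1 D p q `^ q + hT2 D p q `^ q) * hnorm D p k `^ (q / p)).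
Proof.
have [C1 C10 hC1] := upper_hKB.
have [C2 C20 hC2] := @summable_levels R 1 1 ltr01 ltr01.
have [C3 C30 hC3] := @gauge_hardy_const R p q p1 q1.
have [C4 [C40 C4E]] : exists C : R, (0 < C)%R /\ (C = 4 `^ q * 2 `^ q * 2 `^ (q / p))%R.
  by eexists; split; last reflexivity; rewrite !mulr_gt0// powR_gt0.
have C2E : 0 <= C2%:E by rewrite lee_fin ltW.
have C4E0 : 0 <= C4%:E by rewrite lee_fin ltW.
exists (C4 * (C1 + C2 `^ (q / p) * C3))%R.
  by rewrite mulr_gt0// addr_gt0// mulr_gt0// powR_gt0.
move=> D k nk T1 Loo.
have [G [nG hG iG]] := hC1 D k nk.
have nUK := nnm_hUK D nk; have nl := nnm_lam D p nk.
have [F FE] : exists F, F = primitive (hUK D k) by exists (primitive (hUK D k)).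
rewrite -FE; have nF : nnm (F : T -> \bar R) by rewrite FE; exact: nnm_primitive nUK.
have leF x y : (x <= y)%R -> F x <= F y by rewrite FE; exact: le_primitive nUK.
have mpos : measurable (pos : set T) by exact: measurable_litv.
have L0 : 0 <= hnorm D p k by apply: integral_nng => x _; exact: nl.2.
have nFw : nnm (fun x : T => F x `^ q * hw D x) by exact: nnmM (nnm_poweR q nF) (nhw D).
have nI := nnm_hI D p1; have nW := nnm_hW D.
have rkW : rank mu (pos : set T) (hw D) (hW D) by exact: rank_tail (nhw D).
have F0 : \int[mu]_(x in ((pos : set T) `&` [set x | F x = 0])) (F x `^ q * hw D x) = 0.
  by apply: integral0_eq => x [_ /= ->]; rewrite poweR0r ?mul0e// gt_eqF.
(* Where [F] is infinite so is [hI], by the global Hoelder bound, and that set carries no [w]-mass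
   because [hT1] is finite. *)
have Foo : \int[mu]_(x in ((pos : set T) `&` [set x | F x = +oo])) (F x `^ q * hw D x) = 0.
  apply: integral_null_mul; [|exact: nnm_poweR|exact: nhw|].
    by apply: measurableI => //; exact: measurable_eqy.
  apply/eqP; rewrite eq_le; apply/andP; split; last by apply: integral_nng => x _; exact: (nhw D).2.
  rewrite -(hardy_const_null p1 q1 mpos (nhw D) nI nW pos_nonempty rkW T1).
  apply: subset_integral_nng => [x _|x [px /= Fx]]; first exact: (nhw D).2.
  split => //=; move: px; rewrite /pos/= in_itv/= andbT => x0.
  have := primitive_hUK_le p1 D nk (ltW x0); rewrite -FE Fx leye_eq => /eqP h.
  apply/eqP; rewrite -[_ == _]negbK -ltey; apply/negP => Ix.
  have h1 : hnorm D p k `^ p^-1 < +oo by exact: poweR_lty.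
  have h2 : hI D p x `^ p'^-1 < +oo by exact: poweR_lty.
  have h3 : hnorm D p k `^ p^-1 \is a fin_num by rewrite ge0_fin_numE ?poweR_ge0.
  by have := lte_mul_pinfty (poweR_ge0 _ _) h3 h2; rewrite h.
pose E n := (pos : set T) `&` [set x | (lev n)%:E < F x <= (2 * lev n)%:E].
have mE n : measurable (E n).
  apply: measurableI => //; rewrite (_ : [set x | _] =
    [set x | (lev n)%:E < F x] `&` [set x | F x <= (2 * lev n)%:E]); last first.
    by apply/seteqP; split => x /= => [/andP[]|[-> ->]].
  by apply: measurableI; [exact: measurable_gt|exact: measurable_le].
have tE : trivIset setT E.
  move=> i j _ _ [x [[_ /= hi] [_ /= hj]]].
  move: hi hj; case: (F x) => [f| |]//=; rewrite ?lte_fin ?lee_fin; first exact: lev_disjoint.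
  by move=> /andP[_]; rewrite leye_eq.
have ex n : exists z : R * R, E n !=set0 ->
    [/\ (0 < z.1)%R, (z.1 < z.2)%R, F z.1 = (lev n / 2)%:E & F z.2 = (lev n)%:E].
  have [[b [pb /andP[lb bl]]]|h] := pselect (E n !=set0); last by exists (0, 0)%R.
  have boo : F b < +oo by exact: le_lt_trans bl (ltry _).
  have l2 : (0 < lev n / 2 :> R)%R by apply: divr_gt0; [exact: lev_gt0|exact: ltr0n].
  have [y /andP[y0 yb] Fy] : exists2 c, (0 < c < b)%R & F c = (lev n)%:E.
    by rewrite FE; apply: (primitive_level nUK (lev_gt0 n)); rewrite -FE.
  have l2y : (lev n / 2)%:E < F y.
    by rewrite Fy lte_fin half_lt// lev_gt0.
  have yoo : F y < +oo by rewrite Fy ltry.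
  have [x /andP[x0 xy] Fx] : exists2 c, (0 < c < y)%R & F c = (lev n / 2)%:E.
    by rewrite FE; apply: (primitive_level nUK l2); rewrite -FE.
  by exists (x, y).
have [z hz] := choice ex.
(* Between the two points [F >= lev n / 2], so inserting the factor [F / lev n] costs at most 2
   there; in return the local norms become summable over [n]. *)
pose del n := \int[mu]_(x in (pos : set T) `&` [set x | F x <= (1 * lev n)%:E])
     ((lev n)%:E `^ (- 1) * (F x `^ 1 * hlam p D k x)).
have nd n : nnm (fun x : T => (lev n)%:E `^ (- 1) * (F x `^ 1 * hlam p D k x)).
  exact: nnmM (nnm_cst (poweR_ge0 _ _)) (nnmM (nnm_poweR 1 nF) nl).
have d0 n : 0 <= del n by apply: integral_nng => x _; exact: (nd n).2.
have sdel : \sum_(n <oo) del n <= C2%:E * hnorm D p k by exact: hC2 mpos nF nl.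
have dz n : E n !=set0 -> lkernel (hlam p D k) (z n).1 (z n).2 <= 2%:E * del n.
  move=> /hz[z0 z12 Fz1 Fz2].
  have e2 : 0 <= 2%:E :> \bar R by rewrite lee_fin.
  have m2 : measurable ((pos : set T) `&` [set x | F x <= (1 * lev n)%:E]).
    by apply: measurableI mpos _; exact: measurable_le.
  rewrite -(integralMl mu m2 e2 (nd n)).
  have nd2 : nnm (fun x : T => 2%:E * ((lev n)%:E `^ (- 1) * (F x `^ 1 * hlam p D k x))).
    exact: nnmM (nnm_cst e2) (nd n).
  apply: (@le_trans _ _ (\int[mu]_(x in `](z n).1, (z n).2[)
      (2%:E * ((lev n)%:E `^ (- 1) * (F x `^ 1 * hlam p D k x))))); last first.
    apply: subset_integral_nng => [x _|x /=]; first exact: nd2.2.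
    rewrite in_itv/= => /andP[zx xz]; split; first by rewrite /pos/= in_itv/= (lt_trans z0).
    by rewrite /= mul1r -Fz2; exact: leF (ltW xz).
  apply: le_integral_nng => x; first by move=> _; exact: nl.2.
  rewrite /= in_itv/= => /andP[zx xz].
  have Fx : (lev n / 2)%:E <= F x by rewrite -Fz1; exact: leF (ltW zx).
  have Fx0 : 0 <= F x by exact: nF.2.
  have lE : hlam p D k x = 2%:E * ((lev n)%:E `^ (- 1) * ((lev n / 2)%:E * hlam p D k x)).
    rewrite poweR_EFin powR_inv1// !muleA -!EFinM.
    rewrite (_ : 2 * (lev n)^-1 * (lev n / 2) = 1)%R ?mul1e//.
    by field; rewrite gt_eqF ?lev_gt0.
  rewrite [leLHS]lE; apply: (le_mull e2); apply: (le_mull (poweR_ge0 _ _)).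
  by rewrite (poweRe1 Fx0); exact: (le_mulr (nl.2 x) Fx).
pose P n := `[< E n !=set0 >].
pose c n := if P n then hI D p (z n).2 else 0.
have c0 n : 0 <= c n by rewrite /c; case: (P n) => //; exact: hI_ge0.
have cE n : E n !=set0 -> c n = hI D p (z n).2.
  by move=> En; rewrite /c /P (asboolT En).
have EI n x : E n x -> c n <= hI D p x.
  move=> Ex; have En : E n !=set0 by exists x.
  rewrite (cE n En); apply: (le_hI D p1).
  have [_ _ _ Fz2] := hz n En; case: Ex => _ /andP[lx _].
  by rewrite leNgt; apply/negP => /ltW /leF; rewrite Fz2 leNgt lx.
pose Y n := c n `^ (q / p') * \int[mu]_(x in E n) hw D x.
have Y0 n : 0 <= Y n.
  by apply: mule_ge0; [exact: poweR_ge0|apply: integral_nng => x _; exact: (nhw D).2].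
have gY : gauge p q Y <= C3%:E * hT1 D p q `^ q.
  have ED n : E n `<=` pos by move=> x [].
  exact: (hC3 _ T mu pos (hw D) _ _ E c mpos (nhw D) nI nW pos_nonempty rkW mE ED tE c0 EI).
have est n : \int[mu]_(x in E n) (F x `^ q * hw D x) <=
    C4%:E * (\int[mu]_(x in E n) G x + del n `^ (q / p) * Y n).
  have [En|En] := pselect (E n !=set0); last first.
    have -> : E n = set0 by apply/seteqP; split => // x Ex; apply: En; exists x.
    rewrite !integral_set0; apply: mule_ge0 C4E0 _; rewrite add0e.
    by apply: mule_ge0; [exact: poweR_ge0|exact: Y0].
  have [z0 z12 Fz1 Fz2] := hz n En.
  pose b := del n `^ (q / p) * c n `^ (q / p').
  have b0 : 0 <= b by apply: mule_ge0; exact: poweR_ge0.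
  have -> : del n `^ (q / p) * Y n = \int[mu]_(x in E n) (b * hw D x).
    by rewrite (integralMl mu (mE n) b0 (nhw D)) /b /Y muleA.
  have nbw : nnm (fun x : T => b * hw D x) by exact: nnmM (nnm_cst b0) (nhw D).
  rewrite -(integralDn mu (mE n) nG nbw) -(integralMl mu (mE n) C4E0 (nnmD nG nbw)).
  apply: le_integral_nng => y; first by move=> _; exact: nFw.2.
  move=> Ey; have [_ /andP[lF Fl]] := Ey.
  have z2y : ((z n).2 <= y)%R.
    by rewrite leNgt; apply/negP => /ltW /leF; rewrite Fz2 leNgt lF.
  set a := hK D k (z n).1 * hB D (z n).1 y.
  have a0 : 0 <= a by apply: mule_ge0; [exact: (nnm_hK D nk).2|exact: hB_ge0].
  set b1 := (2%:E * del n) `^ p^-1 * c n `^ p'^-1.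
  have b10 : 0 <= b1 by apply: mule_ge0; exact: poweR_ge0.
  have e2 : 0 <= 2%:E :> \bar R by rewrite lee_fin.
  have half : (lev n / 2)%:E <= a + b1.
    have : F (z n).2 <= F (z n).1 + (a + b1).
      rewrite {1}FE (primitive_split nUK (ltW z0) (ltW z12)) -FE; apply: leeD (lexx _) _.
      apply: le_trans (lkernel_hUK_le p1 D nk (ltW z0) (ltW z12)) _; apply: leeD.
        apply: le_mull; first exact: (nnm_hK D nk).2.
        exact: le_hB (lexx _) z2y.
      rewrite -(cE n En); apply: le_mulr; first exact: poweR_ge0.
      by apply: (le_poweR pV0 _ (dz n En)); exact: lkernel_ge0 nl.
    rewrite Fz1 Fz2 (_ : (lev n)%:E = (lev n / 2)%:E + (lev n / 2)%:E).
      by rewrite leeD2lE.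
    by rewrite -EFinD; congr EFin; move: (lev n) => l; field.
  have Fab : F y `^ q <= (4 `^ q * 2 `^ q)%:E * (a `^ q + b1 `^ q).
    apply: (@le_trans _ _ ((4%:E * (a + b1)) `^ q)).
      apply: (le_poweR q00 (nF.2 y)); apply: le_trans Fl _.
      apply: (@le_trans _ _ (4%:E * (lev n / 2)%:E)); last by apply: le_mull half; rewrite lee_fin.
      by rewrite -EFinM lee_fin double_half_le.
    have e4 : 0 <= 4%:E :> \bar R by rewrite lee_fin.
    rewrite (poweRM q e4 (adde_ge0 a0 b10)) EFinM -muleA poweR_EFin.
    apply: le_mull; first by rewrite lee_fin powR_ge0.
    exact: poweR_max_le.
  have b1E : b1 `^ q = (2 `^ (q / p))%:E * b.
    rewrite (poweRM q (poweR_ge0 _ _) (poweR_ge0 _ _)) -!poweRrM [(p^-1 * q)%R]mulrC [(p'^-1 * q)%R]mulrC.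
    by rewrite (poweRM _ e2 (d0 n)) (poweR_EFin 2) -muleA.
  have c1 : (1 <= 2 `^ (q / p) :> R)%R by rewrite -[leLHS](powRr0 2) ler_powR// ler1n.
  apply: le_trans (le_mulr ((nhw D).2 y) Fab) _.
  rewrite C4E [X in _ <= X * _]EFinM -[leLHS]muleA -[leRHS]muleA; apply: le_mull.
    by rewrite lee_fin mulr_ge0 ?powR_ge0.
  rewrite b1E.
  have hGy : a `^ q * hw D y <= G y by exact: hG z0 (le_trans (ltW z12) z2y).
  have w0 := (nhw D).2 y; have aq0 := poweR_ge0 a q.
  have tb0 : 0 <= (2 `^ (q / p))%:E * b by apply: mule_ge0 => //; rewrite lee_fin powR_ge0.
  rewrite (ge0_muleDl _ aq0 tb0) (ge0_muleDr _ (nG.2 y) (nbw.2 y)) -[_%:E * b * _]muleA.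
  apply: leeD (lexx _); apply: le_trans hGy _; rewrite -[leLHS]mul1e.
  by apply: le_mulr; [exact: nG.2|rewrite lee_fin].
apply: le_trans (level_decomp mu mpos nF nFw) _; rewrite F0 Foo !adde0.
have GE0 n : 0 <= \int[mu]_(x in E n) G x by apply: integral_nng => x _; exact: nG.2.
have dY0 n : 0 <= del n `^ (q / p) * Y n by apply: mule_ge0; [exact: poweR_ge0|exact: Y0].
apply: (@le_trans _ _ (\sum_(n <oo) (C4%:E * (\int[mu]_(x in E n) G x + del n `^ (q / p) * Y n)))).
  by apply: lee_nneseries => [n _ _|n _]; [apply: integral_nng => x _; exact: nFw.2|exact: est].
rewrite nneseriesZl; last by move=> n _; exact: adde_ge0.
rewrite EFinM -[leRHS]muleA; apply: (le_mull C4E0).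
rewrite nneseriesD//.
set t1 := hT1 D p q `^ q; set t2 := hT2 D p q `^ q; set l := hnorm D p k `^ (q / p).
have t10 : 0 <= t1 by exact: poweR_ge0.
have t20 : 0 <= t2 by exact: poweR_ge0.
have l0 : 0 <= l by exact: poweR_ge0.
have C1E : 0 <= C1%:E by rewrite lee_fin ltW.
have C5E : 0 <= (C2 `^ (q / p) * C3)%:E by rewrite lee_fin mulr_ge0 ?powR_ge0 ?ltW.
rewrite EFinD (ge0_muleDl _ C1E C5E); apply: leeD.
  rewrite -(@ge0_integral_bigcup _ T R mu E _ mE (nnm_meas nG) (fun x _ => nG.2 x) tE).
  apply: (@le_trans _ _ (\int[mu]_(x in pos) G x)).
    by apply: subset_integral_nng => [x _|x [n _ []//]]; exact: nG.2.
  apply: le_trans iG _; apply: (le_mull C1E); apply: (le_mulr l0).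
  by rewrite leeDr.
apply: le_trans (gauge_hoelder p1 q1 d0 Y0) _.
apply: (@le_trans _ _ ((C2%:E `^ (q / p) * l) * (C3%:E * t1))).
  apply: lee_pmul; [exact: poweR_ge0|exact: gauge_ge0| |exact: gY].
  by rewrite -(poweRM _ C2E L0); exact: (le_poweR qp0 (nneseries_ge0 (fun n _ _ => d0 n)) sdel).
rewrite (poweR_EFin C2) EFinM -!muleA; apply: le_mull; first by rewrite lee_fin powR_ge0.
rewrite muleCA; apply: le_mull; first by rewrite lee_fin ltW.
by rewrite muleC; apply: (le_mulr l0); rewrite leeDl.
Qed.

End upper.

(** * Continuity and crossing points of a supremum over a half-line *)

Section continuous_sup.
Context {R : realType}.
Variables (G Phi : R -> R).
Hypothesis Gc : forall x : R, (0 < x)%R -> G y @[y --> x] --> G x.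
Hypothesis ub : forall t tau, (0 < t)%R -> (t <= tau)%R -> (G tau <= Phi t)%R.
Hypothesis lub : forall t M, (0 < t)%R ->
  (forall tau, (t <= tau)%R -> (G tau <= M)%R) -> (Phi t <= M)%R.
Local Open Scope ring_scope.

Let Gball x e : 0 < x -> 0 < e -> exists2 d, 0 < d & forall y, `|x - y| < d -> `|G x - G y| < e.
Proof.
move=> x0 e0; have /cvgrPdist_lt/(_ _ e0) /nbhs_ballP[d d0 h] := Gc x0.
by exists d => // y xy; exact: h.
Qed.

Let Phi_anti x y : 0 < x -> x <= y -> Phi y <= Phi x.
Proof.
move=> x0 xy; apply: lub => [|tau ytau]; first exact: lt_le_trans xy.
by apply: ub => //; exact: le_trans ytau.
Qed.

(** A near-maximiser [tau > x] serves every [y < tau]; if it is [x] itself, continuity of [G] at [x]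
    takes over. *)
Lemma continuous_sup_right x e : 0 < x -> 0 < e ->
  exists2 d, x < d & forall y, y < d -> 0 < y -> Phi x - e <= Phi y.
Proof.
move=> x0 e0; have e20 : 0 < e / 2 by rewrite divr_gt0.
have [tau xtau Gtau] : exists2 tau, x <= tau & Phi x - e / 2 < G tau.
  apply: contrapT => h; have : Phi x <= Phi x - e / 2.
    apply: lub => // tau xtau; rewrite leNgt; apply/negP => H; apply: h; by exists tau.
  by rewrite leNgt => /negP; apply; lra.
move: xtau; rewrite le_eqVlt => /predU1P[E|xtau]; last first.
  exists tau => // y ytau y0; apply: (@le_trans _ _ (G tau)); last by apply: ub => //; exact: ltW.
  by lra.
have [d d0 hd] := Gball x0 e20; exists (x + d / 2); first by lra.
move=> y yd y0; have [yx|xy] := leP y x.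
  by apply: le_trans (Phi_anti y0 yx); lra.
have xyd : `|x - y| < d by rewrite ltr_norml; apply/andP; split; lra.
have := hd y xyd; rewrite ltr_norml => /andP[_ h].
apply: le_trans (ub y0 (lexx _)); rewrite -E in Gtau; lra.
Qed.

(** Moving slightly to the left of [x] only adds values of [G] close to [G x <= Phi x] to the
    supremum. *)
Lemma continuous_sup_left x e : 0 < x -> 0 < e ->
  exists2 c, 0 < c < x & forall y, c <= y -> Phi y <= Phi x + e.
Proof.
move=> x0 e0; have [d d0 hd] := Gball x0 e0.
pose c := Num.max (x / 2) (x - d / 2).
have cx : c < x by rewrite gt_max; apply/andP; split; lra.
have c0 : 0 < c by rewrite lt_max divr_gt0.
have cd : x - d / 2 <= c by rewrite le_max lexx orbT.
exists c => [|y cy]; first by rewrite c0.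
have y0 : 0 < y by exact: lt_le_trans cy.
apply: lub => // tau ytau; have [xtau|taux] := leP x tau.
  by apply: le_trans (ub x0 xtau) _; lra.
have xd : `|x - tau| < d by rewrite ltr_norml; apply/andP; split; lra.
have := hd tau xd; rewrite ltr_norml => /andP[h _].
by have := ub x0 (lexx x); lra.
Qed.

(** Take the last point with [Phi >= l]. If [G] were below [l] there, it would stay below near that
    point, while further right already [Phi < l]; the supremum could not be [l]. *)
Lemma continuous_sup_cross l t0 t1 : 0 < t0 -> l < Phi t0 -> 0 < t1 -> Phi t1 < l ->
  exists c, [/\ 0 < c, Phi c = l, G c = l & forall t, c < t -> Phi t < l].
Proof.
move=> t00 lt0 t10 t1l; pose A := [set t | 0 < t /\ l <= Phi t].
have At0 : A t0 by split => //; exact: ltW.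
have At1 t : A t -> t <= t1.
  move=> [t0' lt]; rewrite leNgt; apply/negP => /ltW /(Phi_anti t10) h.
  by have := le_lt_trans (le_trans lt h) t1l; rewrite ltxx.
have hs : has_sup A by split; [exists t0|exists t1].
pose c := sup A; have t0c : t0 <= c by exact: sup_upper_bound.
have c0 : 0 < c by exact: lt_le_trans t0c.
have beyond t : c < t -> Phi t < l.
  move=> ct; rewrite ltNge; apply/negP => h.
  have : A t by split => //; exact: lt_trans ct.
  by move=> /(sup_upper_bound hs); rewrite leNgt ct.
have lc : l <= Phi c.
  rewrite leNgt; apply/negP => h.
  have e0 : 0 < (l - Phi c) / 2 by rewrite divr_gt0// subr_gt0.
  have [c' /andP[c'0 c'c] h'] := continuous_sup_left c0 e0.
  have [y [_ ly] c'y] := sup_gt (ex_intro _ _ At0) c'c.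
  by have := h' _ (ltW c'y); lra.
have cl : Phi c <= l.
  rewrite leNgt; apply/negP => h; have e0 : 0 < Phi c - l by rewrite subr_gt0.
  have [d cd h'] := continuous_sup_right c0 e0.
  have y1 : c < (c + d) / 2 by lra.
  have y2 : (c + d) / 2 < d by lra.
  have := h' _ y2 (lt_trans c0 y1); have := beyond _ y1; lra.
have cE : Phi c = l by apply/eqP; rewrite eq_le cl.
exists c; split => //; apply/eqP; rewrite eq_le -{1}cE ub//=.
rewrite leNgt; apply/negP => h.
have e0 : 0 < (l - G c) / 2 by rewrite divr_gt0// subr_gt0.
have [d d0 hd] := Gball c0 e0.
have y1 : c < c + d / 2 by lra.
have y0 : 0 < c + d / 2 by exact: lt_trans y1.
have : Phi c <= Num.max (G c + (l - G c) / 2) (Phi (c + d / 2)).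
  apply: lub => // tau ctau; rewrite le_max; have [ytau|tauy] := leP (c + d / 2) tau.
    by rewrite (ub y0 ytau) orbT.
  have xd : `|c - tau| < d by rewrite ltr_norml; apply/andP; split; lra.
  have := hd tau xd; rewrite ltr_norml => /andP[H _]; apply/orP; left; lra.
rewrite le_max => /orP[H|H]; first by lra.
by have := beyond _ y1; lra.
Qed.

End continuous_sup.

(** * The function phi and its Stieltjes measure *)

Section phi.
Context {R : realType}.
Local Notation T := (lebesgueR R).
Variables (D : hdata R) (p : R).
Hypothesis (p1 : (1 < p)%R).
Local Notation p' := (conjexp p).
Let pos : set R := `]0%R, +oo[%classic.
Let p'0 : (0 < p')%R := conjexp_gt0 p1.

Lemma continuous_powR_nonneg (U : R -> R) (x g : R) : (forall y, (0 <= U y)%R) -> (0 < g)%R ->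
  {for x, continuous U} -> (U y `^ g)%R @[y --> x] --> (U x `^ g)%R.
Proof.
move=> U0 g0 Uc; apply/cvgrPdist_lt => e e0.
have gV0 : (0 < g^-1)%R by rewrite invr_gt0.
have K z : (0 <= z)%R -> ((z `^ g) `^ g^-1 = z)%R by move=> ?; rewrite -powRrM mulfV ?gt_eqF// powRr1.
have KV z : (0 <= z)%R -> ((z `^ g^-1) `^ g = z)%R by move=> ?; rewrite -powRrM mulVf ?gt_eqF// powRr1.
have P0 z : (0 <= z `^ g)%R by exact: powR_ge0.
have xM : (U x < (U x `^ g + e) `^ g^-1)%R.
  rewrite -[ltLHS](K _ (U0 x)); apply: gt0_ltr_powR; rewrite ?nnegrE//; last by rewrite ltrDl.
  by rewrite addr_ge0// ltW.
have [m [mx hm]] : exists m, (m < U x)%R /\ forall z, (0 <= z)%R -> (m < z)%R -> (U x `^ g - e < z `^ g)%R.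
  have [h|h] := leP 0%R (U x `^ g - e)%R.
    exists ((U x `^ g - e) `^ g^-1)%R; split.
      rewrite -[ltRHS](K _ (U0 x)); apply: gt0_ltr_powR; rewrite ?nnegrE//.
      by rewrite ltrBlDr ltrDl.
    move=> z z0 mz; rewrite -[ltLHS](KV _ h).
    by apply: gt0_ltr_powR; rewrite ?nnegrE ?powR_ge0.
  exists (-1)%R; split; first by have := U0 x; lra.
  by move=> z _ _; exact: lt_le_trans h _.
near=> y.
have yM : (U y < (U x `^ g + e) `^ g^-1)%R by near: y; exact: (cvgr_lt _ Uc).
have my : (m < U y)%R by near: y; exact: (cvgr_gt _ Uc).
have h1 : (U y `^ g < U x `^ g + e)%R.
  rewrite -[ltRHS]KV ?addr_ge0// ?ltW//.
  by apply: gt0_ltr_powR; rewrite ?nnegrE ?powR_ge0.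
have h2 := hm _ (U0 y) my.
by rewrite ltr_norml; apply/andP; split; lra.
Unshelve. all: by end_near. Qed.

Lemma hg_fin x : hg D p x = (hU D x `^ p' * fine (hS D x))%R%:E.
Proof. by rewrite /hg hS_fin poweR_EFin. Qed.

Lemma hg_ge0 x : 0 <= hg D p x.
Proof. by apply: mule_ge0; [exact: poweR_ge0|exact: (nnm_hS D).2]. Qed.

Lemma fine_hg x : fine (hg D p x) = (hU D x `^ p' * fine (hS D x))%R.
Proof. by rewrite hg_fin. Qed.

Lemma hg_cont (x : R) : (0 < x)%R -> fine (hg D p y) @[y --> x] --> fine (hg D p x).
Proof.
move=> x0; rewrite fine_hg; under eq_fun do rewrite fine_hg.
have h1 : (hU D y `^ p')%R @[y --> x] --> (hU D x `^ p')%R.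
  exact (@continuous_powR_nonneg (hU D) x p' (hU_ge0 D) p'0 (@hU_cont R D x x0)).
have h2 : fine (hS D y) @[y --> x] --> fine (hS D x).
  exact: continuous_primitive (nhs D) (hs_oo D).
exact: cvgM h1 h2.
Qed.

Lemma hphi_ge0 t : 0 <= hphi D p t.
Proof. exact: sup_from_ge0 hg_ge0. Qed.

Lemma hphi_inf_ge0 : 0 <= hphi_inf D p.
Proof. by apply: le_ereal_inf_tmp => _ [t _ <-]; exact: hphi_ge0. Qed.

Lemma hphi_inf_le t : hphi_inf D p <= hphi D p t.
Proof.
have [t0|t0] := ltP 0%R t; first by apply: ereal_inf_lbound; exists t => //; rewrite /= in_itv/= t0.
apply: (@le_trans _ _ (hphi D p 1%R)).
  by apply: ereal_inf_lbound; exists 1%R => //; rewrite /= in_itv/= ltr01.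
by apply: sup_from_anti; apply: le_trans t0 _; exact: ler01.
Qed.

(** If [hphi] is finite at [t1], then beyond [t1] it bounds [hg], and on [[t, t1]] the continuous
    [hg] has a maximum. *)
Lemma hphi_fin_of_inf : hphi_inf D p < +oo -> forall t, (0 < t)%R -> hphi D p t < +oo.
Proof.
move=> h; have [_ [t1 + <-] ht1] : exists2 y, [set hphi D p t | t in pos] y & y < +oo.
  by have := ereal_inf_lt h => -[y ? ?]; exists y.
rewrite /pos/= in_itv/= andbT => t10 t t0.
have [t1t|tt1] := leP t1 t; first by apply: le_lt_trans ht1; exact: sup_from_anti.
have cg : {within `[t, t1], continuous (fun y => fine (hg D p y))}.
  apply: continuous_in_subspaceT => y /set_mem/=; rewrite in_itv/= => /andP[ty _].
  by apply: hg_cont; exact: lt_le_trans ty.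
have [c _ hc] := EVT_max (ltW tt1) cg.
apply: (@le_lt_trans _ _ (maxe (fine (hg D p c))%:E (hphi D p t1))); last first.
  by rewrite gt_max ltry.
apply: sup_from_le => u tu; rewrite le_max; have [t1u|ut1] := leP t1 u.
  by apply/orP; right; exact: sup_from_ge.
apply/orP; left; rewrite hg_fin -fine_hg lee_fin; apply: hc.
by rewrite in_itv/= tu ltW.
Qed.

Section finite.
Hypothesis phoo : hphi_inf D p < +oo.

Let G x := fine (hg D p x).
Let Phi x := fine (hphi D p x).
Let ell := fine (hphi_inf D p).

Let GE x : hg D p x = (G x)%:E. Proof. by rewrite /G hg_fin. Qed.

Let PhiE x : (0 < x)%R -> hphi D p x = (Phi x)%:E.
Proof. by move=> x0; rewrite fineK// ge0_fin_numE ?hphi_ge0 ?hphi_fin_of_inf. Qed.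

Let ellE : hphi_inf D p = ell%:E.
Proof. by rewrite fineK// ge0_fin_numE ?hphi_inf_ge0. Qed.

Let ub t tau : (0 < t)%R -> (t <= tau)%R -> (G tau <= Phi t)%R.
Proof. by move=> t0 ttau; rewrite -lee_fin -GE -PhiE//; exact: sup_from_ge. Qed.

Let lub t M : (0 < t)%R ->
  (forall tau, (t <= tau)%R -> (G tau <= M)%R) -> (Phi t <= M)%R.
Proof.
move=> t0 h; rewrite -lee_fin -PhiE//; apply: sup_from_le => u tu.
by rewrite GE lee_fin h.
Qed.

Lemma hpt_ge0 t : 0 <= hpt D p t.
Proof.
have := hphi_inf_le t; rewrite /hpt ellE; case: (hphi D p t) => [x| |//].
  by rewrite -EFinB !lee_fin subr_ge0.
by rewrite addye.
Qed.

Lemma hpt_anti x y : (x <= y)%R -> hpt D p y <= hpt D p x.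
Proof. by move=> xy; rewrite /hpt; apply: leeB (lexx _); exact: sup_from_anti. Qed.

Lemma hphi_hpt t : hphi D p t = hpt D p t + hphi_inf D p.
Proof. by rewrite /hpt ellE subeK. Qed.

Lemma nnm_hpt : nnm (hpt D p : T -> \bar R).
Proof. by apply: nnm_nonincreasing => [x|x y]; [exact: hpt_ge0|exact: hpt_anti]. Qed.

Lemma hpt_finE t : (0 < t)%R -> hpt D p t = (Phi t - ell)%:E.
Proof. by move=> t0; rewrite /hpt PhiE// ellE. Qed.

Lemma hpt_oo t : (0 < t)%R -> hpt D p t < +oo.
Proof. by move=> t0; rewrite hpt_finE// ltry. Qed.

Lemma hpt_small (l : R) : (0 < l)%R -> exists2 t, (0 < t)%R & hpt D p t < l%:E.
Proof.
move=> l0; have : ereal_inf [set hphi D p t | t in pos] < (ell + l)%:E.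
  by rewrite -[ereal_inf _]/(hphi_inf D p) ellE lte_fin ltrDl.
move=> /ereal_inf_lt[_ [t + <-]]; rewrite /pos/= in_itv/= andbT => t0.
by rewrite PhiE// lte_fin => h; exists t => //; rewrite hpt_finE// lte_fin; lra.
Qed.

Lemma hpt_cross (l t0 : R) : (0 < l)%R -> (0 < t0)%R -> l%:E < hpt D p t0 ->
  exists c, [/\ (0 < c)%R, hpt D p c = l%:E, hg D p c = l%:E + hphi_inf D p &
    forall t, (c < t)%R -> hpt D p t < l%:E].
Proof.
move=> l0 t00; rewrite hpt_finE// lte_fin => lt.
have [t1 t10] := hpt_small l0; rewrite hpt_finE// lte_fin => t1l.
have h1 : (l + ell < Phi t0)%R by lra.
have h2 : (Phi t1 < l + ell)%R by lra.
have [c [c0 cE gE hc]] := @continuous_sup_cross _ G Phi hg_cont ub lub (l + ell)%R t0 t1 t00 h1 t10 h2.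
exists c; split => //.
- by rewrite hpt_finE// cE addrK.
- by rewrite GE gE ellE -EFinD.
- move=> t ct; rewrite hpt_finE ?(lt_trans c0)// lte_fin; have := hc t ct; lra.
Qed.

Let right_cont a : (0 < a)%R -> fine (hphi D p x) @[x --> a^'+] --> fine (hphi D p a).
Proof.
move=> a0; apply/cvgrPdist_le => e e0.
have [d ad hd] := @continuous_sup_right _ G Phi hg_cont ub lub a e a0 e0.
near=> y; have ay : (a < y)%R by near: y; exact: nbhs_right_gt.
have yd : (y < d)%R by near: y; exact: nbhs_right_lt.
have h1 := hd y yd (lt_trans a0 ay).
have h2 : (Phi y <= Phi a)%R.
  by apply: lub (lt_trans a0 ay) _ => tau ytau; apply: ub => //; exact: le_trans (ltW ay) ytau.
rewrite -/(Phi a) -/(Phi y) ler_norml; apply/andP; split; lra.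
Unshelve. all: by end_near. Qed.

Lemma dminus_hphi (c d : R) : (0 < c)%R -> (c <= d)%R ->
  dminus (hphi D p) `]c, d] = hpt D p c - hpt D p d.
Proof.
move=> c0 cd; have d0 := lt_le_trans c0 cd.
have h1 (x : R) : (0 < x)%R -> hphi D p x \is a fin_num by move=> x0; rewrite PhiE.
have h2 (x y : R) : (0 < x)%R -> (x <= y)%R -> hphi D p y <= hphi D p x.
  by move=> _ xy; exact: sup_from_anti.
rewrite (dminus_itv h1 h2 (right_cont c0) (right_cont d0) c0 cd).
by rewrite !hpt_finE// !PhiE// -!EFinB; congr EFin; lra.
Qed.

(** Exhaust by []c, c + n]], of mass [hpt c - hpt (c + n)]; [hpt] tends to 0. *)
Lemma dminus_hphi_oy (c : R) : (0 < c)%R -> dminus (hphi D p) `]c, +oo[ = hpt D p c.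
Proof.
move=> c0; set m := dminus (hphi D p).
pose F n := `]c, (c + n%:R)%R]%classic : set (measurableTypeR R).
have cn n : (c <= c + n%:R)%R by rewrite lerDl.
have -> : `]c, +oo[%classic = \bigcup_n F n.
  apply/seteqP; split => y /=; last first.
    by move=> [n _]; rewrite /F/= !in_itv/= andbT => /andP[].
  rewrite in_itv/= andbT => cy; exists (Num.trunc (y - c)).+1 => //.
  rewrite /F/= in_itv/= cy/= -lerBlDl; apply: ltW; exact: truncnS_gt.
have mF n : measurable (F n) by exact: measurable_itv.
have mUF : measurable (\bigcup_n F n) by exact: bigcup_measurable.
have nd : nondecreasing_seq F.
  move=> i j ij; rewrite subsetEset; apply: subset_itvl; rewrite bnd_simp lerD2l ler_nat//.
have cv : (m \o F) @ \oo --> m (\bigcup_n F n) := nondecreasing_cvg_mu mF mUF nd.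
have FE n : m (F n) = hpt D p c - hpt D p (c + n%:R)%R by exact: dminus_hphi.
rewrite -(cvg_lim _ cv)//; apply: cvg_lim => //.
rewrite [in X in _ --> X]hpt_finE//; apply/fine_cvgP; split.
  apply: nearW => n; rewrite /= FE !hpt_finE ?(lt_le_trans c0)//.
apply/cvgrPdist_le => e e0.
have [t t0 te] := hpt_small e0.
near=> n; rewrite /= FE; have cn0 : (0 < c + n%:R)%R by exact: lt_le_trans (cn n).
have tn : (t <= c + n%:R)%R.
  rewrite -lerBlDl; apply: le_trans (ler_norm _) _; near: n; exact: nbhs_infty_ger.
have := le_lt_trans (hpt_anti tn) te; have := hpt_ge0 (c + n%:R)%R.
rewrite !hpt_finE//= !lee_fin lte_fin => h1 h2.
by rewrite ler_norml; apply/andP; split; lra.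
Unshelve. all: by end_near. Qed.

(** Continuity of [hphi] from the left means that the point [c] has no mass. *)
Lemma dminus_hphi_cy (c : R) : (0 < c)%R -> dminus (hphi D p) `[c, +oo[ = hpt D p c.
Proof.
move=> c0; apply/eqP; rewrite eq_le; apply/andP; split; last first.
  rewrite -dminus_hphi_oy//; apply: le_measure; rewrite ?inE; [exact: measurable_itv..|].
  by apply: subset_itvr; rewrite bnd_simp.
apply/lee_addgt0Pr => e e0.
have [b /andP[b0 bc] hb] := @continuous_sup_left _ G Phi hg_cont ub lub c e c0 e0.
apply: (@le_trans _ _ (dminus (hphi D p) `]b, +oo[)).
  apply: le_measure; rewrite ?inE; [exact: measurable_itv..|].
  by apply: subset_itvr; rewrite bnd_simp.
rewrite dminus_hphi_oy// !hpt_finE// -EFinD lee_fin; have := hb b (lexx _); lra.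
Qed.

End finite.
End phi.

(** * Upper bound: the operator with [hphi] and the third term *)

Section upper_phi.
Context {R : realType}.
Local Notation T := (lebesgueR R).
Local Notation mu := (@completed_lebesgue_measure R).
Variables (p q : R).
Hypotheses (p1 : (1 < p)%R) (q1 : (1 < q)%R).
Local Notation p' := (conjexp p).
Let pos : set R := `]0%R, +oo[%classic.
Let p0 : (0 < p)%R := lt_trans ltr01 p1.
Let q0 : (0 < q)%R := lt_trans ltr01 q1.
Let p'0 : (0 < p')%R := conjexp_gt0 p1.
Let pV0 : (0 <= p^-1)%R. Proof. by rewrite invr_ge0 ltW. Qed.
Let p'V0 : (0 <= p'^-1)%R. Proof. by rewrite invr_ge0 ltW. Qed.
Let qp0 : (0 <= q / p)%R. Proof. by rewrite divr_ge0// ltW. Qed.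
Let pm0 : (0 < p - 1)%R. Proof. by rewrite subr_gt0. Qed.
Let pp' : ((p - 1) * p^-1 = p'^-1)%R.
Proof. by rewrite conjexpV mulrBl mul1r mulfV// gt_eqF. Qed.
Let mpos : measurable (pos : set T) := measurable_litv _.
Implicit Types (D : hdata R) (k : R -> \bar R).

Lemma in_oo (a b y : R) : `]a, b[%classic y -> (a < y)%R /\ (y < b)%R.
Proof. by rewrite /= in_itv/= => /andP[]. Qed.

Definition hlamp D k (y : R) := hpt D p y `^ (p - 1) * hlam p D k y.
Definition htail D k := tail (hlamp D k).

Lemma nnm_hlamp D k : hphi_inf D p < +oo -> nnm (k : T -> \bar R) -> nnm (hlamp D k : T -> \bar R).
Proof. by move=> h nk; exact: nnmM (nnm_poweR _ (nnm_hpt h)) (nnm_lam D p nk). Qed.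

Lemma hnorm_ge0 D k : nnm (k : T -> \bar R) -> 0 <= hnorm D p k.
Proof. by move=> nk; apply: integral_nng => x _; exact: (nnm_lam D p nk).2. Qed.

(** Split [hK k tau] at [t]. With [L] the integral of [k^p s] over []t, tau[], the increment is at
    most [L^(1/p) hS(tau)^(1/p')], and its product with [hU tau] is [(hg(tau)^(p-1) L)^(1/p)]. For
    [y] in []t, tau[], [hg tau <= hphi y = hpt y + hphi_inf], which brings the factor under the
    integral. *)
Lemma hR_le D k t : hphi_inf D p < +oo -> nnm (k : T -> \bar R) -> (0 < t)%R ->
  hR D k t <= hUs D t * hK D k t +
    2%:E * (htail D k t `^ p^-1 + hphi_inf D p `^ p'^-1 * hnorm D p k `^ p^-1).
Proof.
move=> phoo nk t0; have nks := nnm_ks D nk.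
have nl : nnm (hlam p D k : T -> \bar R) := nnm_lam D p nk.
have nlp := nnm_hlamp phoo nk; have L0 := hnorm_ge0 D nk.
have Pi0 := hphi_inf_ge0 D p.
apply: sup_from_le => tau ttau.
have U0 : 0 <= (hU D tau)%:E by rewrite lee_fin hU_ge0.
have K0 : 0 <= hK D k t by exact: (nnm_hK D nk).2.
rewrite /hK (primitive_split nks (ltW t0) ttau).
have k0 : 0 <= lkernel (fun y => k y * hs D y) t tau by exact: lkernel_ge0.
rewrite (ge0_muleDr _ K0 k0); apply: leeD.
  by apply: (le_mulr K0); exact: (sup_from_ge (fun tau => (hU D tau)%:E) ttau).
have S0 : 0 <= hS D tau by exact: (nnm_hS D).2.
set L := lkernel (hlam p D k) t tau; have L'0 : 0 <= L by exact: lkernel_ge0 nl.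
have h1 : lkernel (fun y => k y * hs D y) t tau <= L `^ p^-1 * hS D tau `^ p'^-1.
  have n1 : nnm ((fun=> 1) : T -> \bar R) by exact: (nnm_cst lee01).
  have := lint_ks_hoelder D p1 (measurable_litv `]t, tau[) nk n1.
  have -> : \int[mu]_(y in `]t, tau[) (k y * hs D y * 1) =
      lkernel (fun y => k y * hs D y) t tau by apply: eq_integral => y _; rewrite mule1.
  have -> : \int[mu]_(y in `]t, tau[) (hs D y * 1 `^ p') = \int[mu]_(y in `]t, tau[) hs D y.
    by apply: eq_integral => y _; rewrite poweR1r mule1.
  move=> h; apply: le_trans h _; apply: (le_mull (poweR_ge0 _ _)).
  apply: (le_poweR p'V0); first by apply: integral_nng => y _; exact: (nhs D).2.
  by apply: (@lkernel_le_primitive _ _ t tau (nhs D)); exact: ltW.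
apply: le_trans (le_mull U0 h1) _.
have h2 : (hU D tau)%:E * (L `^ p^-1 * hS D tau `^ p'^-1) = (hg D p tau `^ (p - 1) * L) `^ p^-1.
  have g0 := hg_ge0 D p tau.
  rewrite (poweRM _ (poweR_ge0 _ _) L'0) -poweRrM pp' /hg (poweRM _ (poweR_ge0 _ _) S0).
  rewrite (poweRK U0 (lt0r_neq0 p'0)) -muleA; congr (_ * _); exact: muleC.
rewrite h2.
have h3 : hg D p tau `^ (p - 1) * L <=
    (2 `^ (p - 1))%:E * (htail D k t + hphi_inf D p `^ (p - 1) * hnorm D p k).
  have c1 : 0 <= hg D p tau `^ (p - 1) by exact: poweR_ge0.
  have c2 : 0 <= (2 `^ (p - 1))%:E :> \bar R by rewrite lee_fin powR_ge0.
  have c3 : 0 <= hphi_inf D p `^ (p - 1) by exact: poweR_ge0.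
  have n3 : nnm (fun y : T => hphi_inf D p `^ (p - 1) * hlam p D k y) by exact: nnmM (nnm_cst c3) nl.
  rewrite /L /lkernel -(integralMl mu (measurable_litv _) c1 nl).
  apply: (@le_trans _ _ (\int[mu]_(y in `]t, tau[) ((2 `^ (p - 1))%:E *
      (hlamp D k y + hphi_inf D p `^ (p - 1) * hlam p D k y)))).
    apply: le_integral_nng => y; first by move=> _; apply: mule_ge0 => //; exact: nl.2.
    move=> /in_oo[_ ytau].
    rewrite /hlamp -(ge0_muleDl (hlam p D k y) (poweR_ge0 _ _) c3) [leRHS]muleA; apply: (le_mulr (nl.2 y)).
    apply: le_trans (poweR_max_le (ltW pm0) (hpt_ge0 phoo y) Pi0).
    apply: (le_poweR (ltW pm0) (hg_ge0 D p tau)); rewrite -(hphi_hpt phoo).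
    exact: (sup_from_ge _ (ltW ytau)).
  rewrite (integralMl mu (measurable_litv _) c2 (nnmD nlp n3)); apply: (le_mull c2).
  rewrite (integralDn mu (measurable_litv _) nlp n3) (integralMl mu (measurable_litv _) c3 nl).
  apply: leeD; last apply: (le_mull c3).
    apply: subset_integral_nng => [y _|]; first exact: nlp.2.
    by apply: subset_itvl; rewrite bnd_simp.
  apply: subset_integral_nng => [y _|]; first exact: nl.2.
  by apply: subset_itv; rewrite bnd_simp// ltW.
have T0 : 0 <= htail D k t by exact: tail_ge0.
have z0 : 0 <= hphi_inf D p `^ (p - 1) * hnorm D p k by apply: mule_ge0 => //; exact: poweR_ge0.
apply: le_trans (le_poweR pV0 (mule_ge0 (poweR_ge0 _ _) L'0) h3) _.
have c2' : 0 <= (2 `^ (p - 1))%:E :> \bar R by rewrite lee_fin powR_ge0.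
rewrite (poweRM _ c2' (adde_ge0 T0 z0)) poweR_EFin -powRrM pp'.
have -> : hphi_inf D p `^ p'^-1 * hnorm D p k `^ p^-1 = (hphi_inf D p `^ (p - 1) * hnorm D p k) `^ p^-1.
  by rewrite (poweRM _ (poweR_ge0 _ _) L0) -poweRrM pp'.
(* The constant 2 collects [2 ^ ((p-1)/p)] from splitting [hphi ^ (p-1)] and [2 ^ (1/p)] from
   splitting the root. *)
have E2 : (2 = 2 `^ p'^-1 * 2 `^ p^-1 :> R)%R.
  rewrite -powRD; last by apply/implyP => _; rewrite pnatr_eq0.
  by rewrite addrC conjexp_add powRr1.
have E2E : 2%:E = (2 `^ p'^-1)%:E * (2 `^ p^-1)%:E :> \bar R by rewrite -EFinM -E2.
rewrite [X in _ <= X * _]E2E -muleA; apply: le_mull; first by rewrite lee_fin powR_ge0.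
exact: poweR_max_le.
Qed.

Definition hH D k := primitive (fun t => htail D k t `^ p^-1 * ha D t).
(* [hH] is split according to whether [hpt t <= 4 hpt x]. *)
Definition hH2 D k (x : R) :=
  \int[mu]_(y in (pos : set T) `&` [set y | hpt D p y <= 4%:E * hpt D p x]) hlamp D k y.
(** The share of the norm seen at level [n] of [hpt], normalised as in [summable_levels] with
    exponent [p - 1]. *)
Definition hdelta c D k n :=
  \int[mu]_(y in (pos : set T) `&` [set y | hpt D p y <= (c * lev n)%:E])
    ((lev n)%:E `^ (- (p - 1)) * hlamp D k y).
Definition hAi D n := \int[mu]_(t in (pos : set T) `&` [set t | (lev n)%:E < hpt D p t]) ha D t.
(** A dyadic majorant of the part of [hH] with [hpt t > 4 hpt x]: for [t] in layer [i] this forces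
    [hpt x < 2 lev i / 4 = lev i / 2]. *)
Definition hH1 D k (x : R) := \sum_(i <oo)
  if hpt D p x < (lev i / 2)%:E then (lev i)%:E `^ p'^-1 * hdelta 2 D k i `^ p^-1 * hAi D i else 0.

Lemma hdelta_ge0 c D k n : hphi_inf D p < +oo -> nnm (k : T -> \bar R) -> 0 <= hdelta c D k n.
Proof.
move=> phoo nk; apply: integral_nng => y _; apply: mule_ge0; first exact: poweR_ge0.
exact: (nnm_hlamp phoo nk).2.
Qed.

Lemma hdeltaE (c : R) D k n : hphi_inf D p < +oo -> nnm (k : T -> \bar R) ->
  \int[mu]_(y in (pos : set T) `&` [set y | hpt D p y <= (c * lev n)%:E]) hlamp D k y =
  (lev n)%:E `^ (p - 1) * hdelta c D k n.
Proof.
move=> phoo nk; have nlp := nnm_hlamp phoo nk.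
have m1 : measurable ((pos : set T) `&` [set y | hpt D p y <= (c * lev n)%:E]).
  by apply: measurableI mpos _; exact: measurable_le (nnm_hpt phoo).
rewrite /hdelta (integralMl mu m1 (poweR_ge0 _ _) nlp) muleA [X in X * _]muleC.
by rewrite poweR_inv_le1 ?mul1e ?lte_fin ?lev_gt0 ?ltry.
Qed.

Lemma sum_hdelta (c : R) : (0 < c)%R -> exists2 C : R, (0 < C)%R &
  forall D k, hphi_inf D p < +oo -> nnm (k : T -> \bar R) ->
  \sum_(n <oo) hdelta c D k n <= C%:E * hnorm D p k.
Proof.
move=> c0; have [C C0 hC] := summable_levels pm0 c0; exists C => // D k phoo nk.
exact: hC mpos (nnm_hpt phoo) (nnm_lam D p nk).
Qed.

Lemma hH2_ge0 D k x : hphi_inf D p < +oo -> nnm (k : T -> \bar R) -> 0 <= hH2 D k x.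
Proof. by move=> phoo nk; apply: integral_nng => y _; exact: (nnm_hlamp phoo nk).2. Qed.

Lemma nnm_hH2 D k : hphi_inf D p < +oo -> nnm (k : T -> \bar R) -> nnm (hH2 D k : T -> \bar R).
Proof.
move=> phoo nk; apply: nnm_nonincreasing => [x|x y xy]; first exact: hH2_ge0.
apply: subset_integral_nng => [z _|z [pz hz]]; first exact: (nnm_hlamp phoo nk).2.
split => //; apply: le_trans hz _; apply: le_mull; first by rewrite lee_fin.
exact: (hpt_anti D p).
Qed.

Lemma nnm_hH1 D k : hphi_inf D p < +oo -> nnm (k : T -> \bar R) -> nnm (hH1 D k : T -> \bar R).
Proof.
move=> phoo nk.
have t0 i : 0 <= (lev i)%:E `^ p'^-1 * hdelta 2 D k i `^ p^-1 * hAi D i.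
  apply: mule_ge0; first by apply: mule_ge0; exact: poweR_ge0.
  by apply: integral_nng => y _; exact: (nha D).2.
apply: nnm_nondecreasing => [x|x y xy].
  by apply: nneseries_ge0 => i _ _; case: ifP.
apply: lee_nneseries => [i _ _|i _]; first by case: ifP.
case: ifPn => // hx; case: ifPn => // /negP hy; exfalso; apply: hy.
exact: le_lt_trans (hpt_anti D p xy) hx.
Qed.

(** If [hpt t <= 4 hpt x], the same holds to the right of [t], so [htail k t <= hH2 k x]; every
    other [t] lies in one layer, whose term in [hH1] dominates the integrand. *)
Lemma hH_split D k x : hphi_inf D p < +oo -> nnm (k : T -> \bar R) -> (0 < x)%R ->
  hH D k x <= hA D x * hH2 D k x `^ p^-1 + hH1 D k x.
Proof.
move=> phoo nk x0; have nlp := nnm_hlamp phoo nk; have npt := nnm_hpt (p := p) phoo.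
have nh : nnm (htail D k : T -> \bar R) by exact: nnm_tail.
have nha' : nnm (fun t : T => htail D k t `^ p^-1 * ha D t) by exact: nnmM (nnm_poweR _ nh) (nha D).
set E := [set t : T | hpt D p t <= 4%:E * hpt D p x].
have mE : measurable E by exact: measurable_le.
rewrite /hH /primitive /lebesgue_integral (integral_setID mu (measurable_litv _) mE nha').
apply: leeD.
  apply: (@le_trans _ _ (\int[mu]_(t in (`]0%R, x[%classic : set T) `&` E) (hH2 D k x `^ p^-1 * ha D t))).
    apply: le_integral_nng => t; first by move=> _; exact: nha'.2.
    move=> [/=]; rewrite in_itv/= => /andP[t0 _] Et; apply: (le_mulr ((nha D).2 t)).
    apply: (le_poweR pV0 (nh.2 t)); apply: subset_integral_nng => [y _|y /=]; first exact: nlp.2.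
    rewrite in_itv/= andbT => ty; split; first by rewrite /pos/= in_itv/= (lt_trans t0).
    by apply: le_trans Et; exact: (hpt_anti D p (ltW ty)).
  have m1 : measurable ((`]0%R, x[%classic : set T) `&` E) by exact: measurableI (measurable_litv _) mE.
  rewrite (integralMl mu m1 (poweR_ge0 _ _) (nha D)) [leRHS]muleC.
  apply: (le_mull (poweR_ge0 _ _)).
  by apply: subset_integral_nng => [y _|y []//]; exact: (nha D).2.
pose c i := (lev i)%:E `^ p'^-1 * hdelta 2 D k i `^ p^-1.
have c0 i : 0 <= c i by apply: mule_ge0; exact: poweR_ge0.
have mG i : measurable ([set t | (lev i)%:E < hpt D p t] : set T) by exact: measurable_gt.
pose f i (t : R) := if hpt D p x < (lev i / 2)%:E
  then c i * ((ha D : T -> \bar R) \_ [set t | (lev i)%:E < hpt D p t]) t else 0.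
have nf i : nnm (f i : T -> \bar R).
  rewrite /f; case: (hpt D p x < _); last exact: nnm_cst.
  exact: nnmM (nnm_cst (c0 i)) (nnm_patch (mG i) (nha D)).
apply: (@le_trans _ _ (\int[mu]_(t in pos) (\sum_(i <oo) f i t))); last first.
  rewrite (integral_seriesn mu mpos nf) /hH1; apply: lee_nneseries => [i _ _|i _].
    by apply: integral_nng => y _; exact: (nf i).2.
  rewrite /f; case: (hpt D p x < _); last by rewrite integral0.
  by rewrite (integralMl mu mpos (c0 i) (nnm_patch (mG i) (nha D))) -integral_mkcondr.
apply: (@le_trans _ _ (\int[mu]_(t in (`]0%R, x[%classic : set T) `&` ~` E) (\sum_(i <oo) f i t))); last first.
  apply: subset_integral_nng => [t _|t [/=]]; first exact: (nnm_nneseries nf).2.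
  by rewrite /pos/= !in_itv/= andbT => /andP[].
apply: le_integral_nng => t; first by move=> _; exact: nha'.2.
move=> [/=]; rewrite in_itv/= => /andP[t0 _] /negP; rewrite -ltNge => Et.
have ptx0 := hpt_ge0 phoo x.
have ptt : 0 < hpt D p t by apply: le_lt_trans Et; apply: mule_ge0 ptx0; rewrite lee_fin.
have ptE : hpt D p t = (fine (hpt D p t))%:E.
  by rewrite fineK// ge0_fin_numE ?(hpt_ge0 phoo)// (hpt_oo p1 phoo).
move: ptt; rewrite ptE lte_fin => /lev_exists[i /andP[li il]].
have pxi : hpt D p x < (lev i / 2)%:E.
  have pxE : hpt D p x = (fine (hpt D p x))%:E.
    by rewrite fineK// ge0_fin_numE// (hpt_oo p1 phoo).
  move: Et; rewrite ptE pxE -EFinM !lte_fin => h.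
  by have := lt_le_trans h il; move: (lev i) (fine _) => a b; lra.
apply: le_trans (nneseries_term (f := fun i => f i t) i (fun i => (nf i).2 t)).
rewrite /f pxi patchE mem_set; last by rewrite /= ptE lte_fin.
apply: (le_mulr ((nha D).2 t)).
have l0 : 0 <= (lev i)%:E `^ (p - 1) by exact: poweR_ge0.
rewrite /c -pp' poweRrM -(poweRM _ l0 (hdelta_ge0 2 i phoo nk)) -(hdeltaE 2 i phoo nk).
apply: (le_poweR pV0 (nh.2 t)); apply: subset_integral_nng => [y _|y /=]; first exact: nlp.2.
rewrite in_itv/= andbT => ty; split; first by rewrite /pos/= in_itv/= (lt_trans t0).
by apply: le_trans (hpt_anti D p (ltW ty)) _; rewrite ptE lee_fin.
Qed.

(** In layer [n] of [hpt], [hH2 x] only sees points with [hpt <= 4 * 2 lev n], hence the 8 in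
    [hdelta]; the identity [(p-1) q/p = q/p'] then produces the discretization of [hT3]. *)
Lemma upper_hH2 : exists2 C : R, (0 < C)%R & forall D k, hphi_inf D p < +oo -> nnm (k : T -> \bar R) ->
  \int[mu]_(x in pos) ((hA D x * hH2 D k x `^ p^-1) `^ q * hw D x) <=
  C%:E * (hT3 D p q `^ q * hnorm D p k `^ (q / p)).
Proof.
have e8 : (0 < 8 :> R)%R by rewrite ltr0n.
have [C2 C20 hC2] := sum_hdelta e8.
have [C3 C30 hC3] := @gauge_hardy_const R p q p1 q1.
have C2E : 0 <= C2%:E by rewrite lee_fin ltW.
exists (C2 `^ (q / p) * C3)%R; first by rewrite mulr_gt0// powR_gt0.
move=> D k phoo nk; have npt := nnm_hpt (p := p) phoo; have nlp := nnm_hlamp phoo nk.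
have L0 := hnorm_ge0 D nk; have nAq := nnm_hAq D q.
have n2 : nnm (hH2 D k : T -> \bar R) by exact: nnm_hH2.
have ng : nnm (fun x : T => (hA D x * hH2 D k x `^ p^-1) `^ q * hw D x).
  exact: nnmM (nnm_poweR q (nnmM (nnm_hA D) (nnm_poweR _ n2))) (nhw D).
have gE x : (hA D x * hH2 D k x `^ p^-1) `^ q * hw D x = hH2 D k x `^ (q / p) * hAq D q x.
  rewrite (poweRM q ((nnm_hA D).2 x) (poweR_ge0 _ _)) -poweRrM [(p^-1 * q)%R]mulrC.
  by rewrite -muleA muleCA.
have g0 : \int[mu]_(x in ((pos : set T) `&` [set x | hpt D p x = 0]))
    ((hA D x * hH2 D k x `^ p^-1) `^ q * hw D x) = 0.
  apply: integral0_eq => x [_ /= x0]; rewrite gE.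
  rewrite (_ : hH2 D k x = 0) ?poweR0r ?mul0e// ?gt_eqF ?divr_gt0//.
  apply: integral0_eq => y [_ /=]; rewrite x0 mule0 => y0.
  by rewrite /hlamp (_ : hpt D p y = 0) ?poweR0r ?mul0e ?gt_eqF//; apply/eqP; rewrite eq_le y0 (hpt_ge0 phoo).
have goo : \int[mu]_(x in ((pos : set T) `&` [set x | hpt D p x = +oo]))
    ((hA D x * hH2 D k x `^ p^-1) `^ q * hw D x) = 0.
  rewrite (_ : _ `&` _ = set0) ?integral_set0//; apply/seteqP; split => // x [].
  by rewrite /pos/= in_itv/= andbT => x0 h; have := hpt_oo p1 phoo x0; rewrite h.
pose E n := (pos : set T) `&` [set x | (lev n)%:E < hpt D p x <= (2 * lev n)%:E].
have mE n : measurable (E n).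
  apply: measurableI => //; rewrite (_ : [set x | _] =
    [set x | (lev n)%:E < hpt D p x] `&` [set x | hpt D p x <= (2 * lev n)%:E]); last first.
    by apply/seteqP; split => x /= => [/andP[]|[-> ->]].
  by apply: measurableI; [exact: measurable_gt|exact: measurable_le].
have tE : trivIset setT E.
  move=> i j _ _ [x [[_ /= hi] [_ /= hj]]].
  move: hi hj; case: (hpt D p x) => [f| |]//=; rewrite ?lte_fin ?lee_fin; first exact: lev_disjoint.
  by move=> /andP[_]; rewrite leye_eq.
have ED n : E n `<=` pos by move=> x [].
have c0 n : 0 <= (lev n)%:E :> \bar R by exact: levE_ge0.
have EI n x : E n x -> (lev n)%:E <= hpt D p x by move=> [_ /andP[/ltW]].
pose Y n := (lev n)%:E `^ (q / p') * \int[mu]_(x in E n) hAq D q x.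
have Y0 n : 0 <= Y n.
  by apply: mule_ge0; [exact: poweR_ge0|apply: integral_nng => x _; exact: nAq.2].
have rk : rank mu (pos : set T) (hAq D q) (hAt D q) by exact: rank_primitive.
have gY : gauge p q Y <= C3%:E * hT3 D p q `^ q.
  exact: (hC3 _ T mu pos (hAq D q) _ _ E _ mpos nAq npt (nnm_hAt D q) pos_nonempty rk mE ED tE c0 EI).
have d0 n : 0 <= hdelta 8 D k n by exact: hdelta_ge0.
have est n : \int[mu]_(x in E n) ((hA D x * hH2 D k x `^ p^-1) `^ q * hw D x) <=
    hdelta 8 D k n `^ (q / p) * Y n.
  have z0 : 0 <= ((lev n)%:E `^ (p - 1) * hdelta 8 D k n) `^ (q / p) by exact: poweR_ge0.
  apply: (@le_trans _ _ (\int[mu]_(x in E n)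
      (((lev n)%:E `^ (p - 1) * hdelta 8 D k n) `^ (q / p) * hAq D q x))).
    apply: le_integral_nng => x; first by move=> _; exact: ng.2.
    move=> [_ /andP[_ xl]]; rewrite gE; apply: (le_mulr (nAq.2 x)).
    apply: (le_poweR qp0 (n2.2 x)); rewrite -(hdeltaE 8 n phoo nk).
    apply: subset_integral_nng => [y _|y [py yx]]; first exact: nlp.2.
    split => //=; apply: le_trans yx _.
    apply: (@le_trans _ _ (4%:E * (2 * lev n)%:E)); first by apply: le_mull xl; rewrite lee_fin.
    by rewrite -EFinM lee_fin mulrA -natrM.
  rewrite (integralMl mu (mE n) z0 nAq) (poweRM _ (poweR_ge0 _ _) (d0 n)) -poweRrM.
  rewrite (_ : (p - 1) * (q / p) = q / p')%R; last by rewrite mulrCA pp'.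
  by rewrite /Y muleCA -muleA.
apply: le_trans (level_decomp mu mpos npt ng) _; rewrite g0 goo !adde0.
apply: (@le_trans _ _ (\sum_(n <oo) (hdelta 8 D k n `^ (q / p) * Y n))).
  by apply: lee_nneseries => [n _ _|n _]; [apply: integral_nng => x _; exact: ng.2|exact: est].
apply: le_trans (gauge_hoelder p1 q1 d0 Y0) _.
apply: (@le_trans _ _ ((C2%:E `^ (q / p) * hnorm D p k `^ (q / p)) * (C3%:E * hT3 D p q `^ q))).
  apply: lee_pmul; [exact: poweR_ge0|exact: gauge_ge0| |exact: gY].
  by rewrite -(poweRM _ C2E L0); exact: (le_poweR qp0 (nneseries_ge0 (fun n _ _ => d0 n)) (hC2 D k phoo nk)).
rewrite (poweR_EFin C2) EFinM -!muleA; apply: le_mull; first by rewrite lee_fin powR_ge0.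
rewrite muleCA; apply: le_mull; first by rewrite lee_fin ltW.
by rewrite muleC.
Qed.

End upper_phi.

(** * Upper bound: the fourth term *)

Section upper_final.
Context {R : realType}.
Local Notation T := (lebesgueR R).
Local Notation mu := (@completed_lebesgue_measure R).
Local Notation B := (measurableTypeR R).
Variables (p q : R).
Hypotheses (p1 : (1 < p)%R) (q1 : (1 < q)%R).
Local Notation p' := (conjexp p).
Local Notation r := (rexp p q).
Let pos : set R := `]0%R, +oo[%classic.
Let p0 : (0 < p)%R := lt_trans ltr01 p1.
Let q0 : (0 < q)%R := lt_trans ltr01 q1.
Let p'0 : (0 < p')%R := conjexp_gt0 p1.
Let q00 : (0 <= q)%R := ltW q0.
Let qp0 : (0 <= q / p)%R. Proof. by rewrite divr_ge0// ltW. Qed.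
Let mpos : measurable (pos : set T) := measurable_litv _.
Implicit Types (D : hdata R) (k : R -> \bar R).

Lemma nneseries_le_partial (f : nat -> \bar R) (l : \bar R) : (forall i, 0 <= f i) ->
  (forall N, \sum_(i < N) f i <= l) -> \sum_(i <oo) f i <= l.
Proof.
move=> f0 h; apply: lime_le; first exact: is_cvg_nneseries.
by apply: nearW => N; rewrite big_mkord; exact: h.
Qed.

Lemma counting_integral (A : set nat) (f : nat -> \bar R) : (forall i, 0 <= f i) ->
  \int[counting]_(i in A) f i = \sum_(i <oo) (f \_ A) i :> \bar R.
Proof.
move=> f0; rewrite integral_mkcond ge0_integral_count// => i.
by rewrite patchE; case: ifP.
Qed.

Lemma lev_double_le i j : (lev i < lev j :> R)%R -> (2 * lev i <= lev j :> R)%R.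
Proof.
rewrite /lev ltr_pow2 ltr_int => ij; rewrite mul2_pow2 ler_pow2.
by rewrite -[1%R](mulr1z) -intrD ler_int; lia.
Qed.

Lemma nnm_hAp D : nnm (fun t : B => hA D t `^ p').
Proof.
apply: nnm_poweR; split; last exact: (nnm_hA D).2.
by apply: nondecreasing_measurableE => x y; exact: le_primitive (nha D).
Qed.

Lemma le_hE D (m : {measure set B -> \bar R}) x y : (x <= y)%R -> hE D p m x <= hE D p m y.
Proof.
move=> xy; apply: subset_integral_nng => [t _|]; first exact: poweR_ge0.
by apply: subset_itvl; rewrite bnd_simp.
Qed.

Lemma nnm_hE D (m : {measure set B -> \bar R}) : nnm (hE D p m : T -> \bar R).
Proof.
apply: nnm_nondecreasing => [x|x y]; last exact: le_hE.
by apply: integral_nng => t _; exact: poweR_ge0.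
Qed.

(** From [z.1] to [z.2] the function [hpt] falls from [lev i] to half of it, so []z.1, z.2]] has
    mass [lev i / 2]; the last clause makes these intervals disjoint. *)
Lemma hpt_crossings D i : hphi_inf D p < +oo ->
  exists z : R * R, (exists2 t, (0 < t)%R & (lev i)%:E < hpt D p t) ->
    [/\ (0 < z.1)%R, (z.1 < z.2)%R, hpt D p z.1 = (lev i)%:E, hpt D p z.2 = (lev i / 2)%:E &
        forall t, (z.1 < t)%R -> hpt D p t < (lev i)%:E].
Proof.
move=> phoo; have [[t t0 ht]|h] := pselect (exists2 t, (0 < t)%R & (lev i)%:E < hpt D p t); last first.
  by exists (0, 0)%R.
have l0 : (0 < lev i :> R)%R by exact: lev_gt0.
have l2 : (0 < lev i / 2 :> R)%R by apply: divr_gt0 => //; exact: ltr0n.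
have l2l : (lev i / 2)%:E < (lev i)%:E :> \bar R by rewrite lte_fin half_lt.
have [c [c0 cE _ hc]] := hpt_cross p1 phoo l0 t0 ht.
have [d [d0 dE _ _]] := hpt_cross p1 phoo l2 t0 (lt_trans l2l ht).
exists (c, d) => _; split => //=; rewrite ltNge; apply/negP => /(hpt_anti D p).
by rewrite cE dE leNgt l2l.
Qed.

(** [hH1] is a sum over levels, to which [rank_hoelder] applies on [nat] with the counting measure:
    [kap] carries the shares of the norm, [eps] the values of [hA] weighted by the masses of the
    intervals [Z i], and the ranks [S i] are values of [hE]. The layers of [hE] then lead to the
    fourth term. *)
Lemma upper_hH1 : exists2 C : R, (0 < C)%R & forall D k, hphi_inf D p < +oo -> nnm (k : T -> \bar R) ->
  hT4 D p q (dminus (hphi D p)) < +oo ->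
  \int[mu]_(x in pos) (hH1 p D k x `^ q * hw D x) <=
  C%:E * (hT4 D p q (dminus (hphi D p)) `^ q * hnorm D p k `^ (q / p)).
Proof.
have p'1 := conjexp_gt1 p1.
have e2 : (0 < 2 :> R)%R by rewrite ltr0n.
have [C1 C10 hC1] := @rank_hoelder R p p' p1 p'1 (conjexp_add p).
have [C2 C20 hC2] := sum_hdelta p1 e2.
have [C3 C30 hC3] := @gauge_hardy_const R p q p1 q1.
have C1E : 0 <= C1%:E by rewrite lee_fin ltW.
have C2E : 0 <= C2%:E by rewrite lee_fin ltW.
have [K [K0 KEq]] : exists K : R, (0 < K)%R /\ K%:E = (2 `^ p'^-1)%:E * C1%:E.
  by exists (2 `^ p'^-1 * C1)%R; rewrite EFinM mulr_gt0// powR_gt0.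
have KE : 0 <= K%:E by rewrite lee_fin ltW.
exists (K `^ q * ((C1 * C2) `^ (q / p) * C3))%R.
  by rewrite !mulr_gt0// powR_gt0// mulr_gt0.
move=> D k phoo nk T4; have npt := nnm_hpt (p := p) phoo.
set m := dminus (hphi D p) : {measure set B -> \bar R}; rewrite -/m in T4 *.
have nE := nnm_hE D m; have nAp := nnm_hAp D; have nW := nnm_hW D.
have L0 := hnorm_ge0 p D nk.
have n1 : nnm (hH1 p D k : T -> \bar R) by exact: nnm_hH1.
have [z hz] := choice (fun i => hpt_crossings i phoo).
pose Q i := `[< exists2 t, (0 < t)%R & (lev i)%:E < hpt D p t >].
have hQ i : Q i -> exists2 t, (0 < t)%R & (lev i)%:E < hpt D p t by move=> /asboolP.
pose S i := if Q i then hE D p m (z i).2 else 0.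
pose eps i := if Q i then (lev i / 2)%:E `^ p'^-1 * hA D (z i).1 else 0.
pose kap i := hdelta p 2 D k i `^ p^-1.
pose Z i : set B := if Q i then `](z i).1, (z i).2]%classic else set0.
have hd0 i : 0 <= hdelta p 2 D k i by exact: hdelta_ge0.
have S0 i : 0 <= S i by rewrite /S; case: (Q i) => //; exact: nE.2.
have eps0 i : 0 <= eps i.
  by rewrite /eps; case: (Q i) => //; apply: mule_ge0; [exact: poweR_ge0|exact: (nnm_hA D).2].
have kap0 i : 0 <= kap i by exact: poweR_ge0.
have nS : nnm (S : nat -> \bar R) by split.
have neps : nnm (eps : nat -> \bar R) by split.
have nkap : nnm (kap : nat -> \bar R) by split.
have mZ i : measurable (Z i) by rewrite /Z; case: (Q i) => //; exact: measurable_itv.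
have Zin i x : Z i x -> [/\ Q i, (0 < x)%R, (x <= (z i).2)%R & ((lev i / 2)%:E <= hpt D p x < (lev i)%:E)].
  rewrite /Z; case: ifPn => // Qi; rewrite /= in_itv/= => /andP[zx xz].
  have [z0 z12 pz1 pz2 hlt] := hz i (hQ i Qi).
  split => //; first exact: lt_trans zx.
  by rewrite hlt// andbT -pz2; exact: hpt_anti.
have tZ : trivIset setT Z.
  move=> i j _ _ [x [/Zin[_ x0 _ /andP[hi hi']] /Zin[_ _ _ /andP[hj hj']]]].
  have pxE : hpt D p x = (fine (hpt D p x))%:E.
    by rewrite fineK// ge0_fin_numE ?(hpt_ge0 phoo)// (hpt_oo p1 phoo).
  move: hi hi' hj hj'; rewrite pxE !lee_fin !lte_fin; set y := fine _ => hi hi' hj hj'.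
  have y0 : (0 < y)%R by apply: lt_le_trans hi; rewrite divr_gt0// lev_gt0.
  have [li lj] : (0 < lev i :> R)%R /\ (0 < lev j :> R)%R by split; exact: lev_gt0.
  apply: contrapT => /eqP ij.
  have : (lev i != lev j :> R)%R.
    apply: contra ij => /eqP; rewrite /lev => h.
    have : (zeta i)%:~R = (zeta j)%:~R :> R.
      have h1 : ((zeta i)%:~R <= (zeta j)%:~R :> R)%R by rewrite -ler_pow2 h.
      have h2 : ((zeta j)%:~R <= (zeta i)%:~R :> R)%R by rewrite -ler_pow2 h.
      by apply/eqP; rewrite eq_le h1.
    by move=> /intr_inj /zeta_inj ->.
  rewrite neq_lt => /orP[] h.
    have := lev_double_le h; lra.
  have := lev_double_le h; lra.
(* [Z i] has mass [lev i / 2], and [hA] is at least [hA (z i).1] on it. *)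
have epsZ i : eps i `^ p' <= \int[m]_(t in Z i) (hA D t `^ p').
  rewrite /eps /Z; case: ifPn => Qi; last by rewrite integral_set0 poweR0r// gt_eqF.
  have [z0 z12 pz1 pz2 hlt] := hz i (hQ i Qi).
  have l2 : 0 <= (lev i / 2)%:E :> \bar R by rewrite lee_fin divr_ge0// lev_ge0.
  have a0 : 0 <= hA D (z i).1 by exact: (nnm_hA D).2.
  rewrite (poweRM _ (poweR_ge0 _ _) a0) (poweRVK l2 (lt0r_neq0 p'0)).
  have mE : (lev i / 2)%:E = m (`](z i).1, (z i).2]%classic).
    transitivity (dminus (hphi D p) `](z i).1, (z i).2]); last by [].
    rewrite (dminus_hphi p1 phoo z0 (ltW z12)).
    by rewrite pz1 pz2 -EFinB; congr EFin; move: (lev i) => l; field.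
  have mI : measurable (`](z i).1, (z i).2]%classic : set B) by exact: measurable_itv.
  rewrite muleC mE -(integral_cst m mI).
  apply: le_integral_nng => t; first by move=> _; exact: poweR_ge0.
  rewrite /= in_itv/= => /andP[zt _]; apply: (le_poweR (ltW p'0) a0).
  exact: le_primitive (nha D) (ltW zt).
have epsS i : eps i `^ p' <= S i.
  apply: le_trans (epsZ i) _; rewrite /S /Z; case: ifPn => Qi; last by rewrite integral_set0.
  have [z0 _ _ _ _] := hz i (hQ i Qi).
  apply: subset_integral_nng => [t _|]; first exact: poweR_ge0.
  by apply: subset_itvr; rewrite bnd_simp; exact: ltW.
have Se i : S i = 0 -> eps i = 0.
  move=> Si; have := epsS i; rewrite Si => h.
  by apply: (poweR_eq0_eq0 (eps0 i) (r := p')); apply/eqP; rewrite eq_le h poweR_ge0.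
(* Among finitely many indices, the intervals [Z i] with [S i <= l] are disjoint and lie in a single
   []0, d]] with [hE d <= l], unless all are empty. *)
have rk : rank counting setT (fun i => eps i `^ p') S.
  move=> l l0; rewrite setTI counting_integral; last by move=> i; exact: poweR_ge0.
  apply: nneseries_le_partial => [i|N]; first by rewrite patchE; case: ifP => // _; exact: poweR_ge0.
  pose Zl i : set B := if S i <= l%:E then Z i else set0.
  have mZl i : measurable (Zl i) by rewrite /Zl; case: ifP.
  have tZl : trivIset setT Zl.
    move=> i j _ _ [x [hi hj]]; apply: tZ => //; exists x; split.
      by move: hi; rewrite /Zl; case: ifP.
    by move: hj; rewrite /Zl; case: ifP.
  apply: (@le_trans _ _ (\sum_(i <- iota 0 N) \int[m]_(t in Zl i) (hA D t `^ p'))).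
    rewrite -(big_mkord xpredT (fun i => ((fun i => eps i `^ p') \_ [set x | S x <= l%:E]) i)) /index_iota subn0.
    apply: lee_sum => i _; rewrite patchE /Zl.
    have [Sl|Sl] := boolP (S i <= l%:E).
      by rewrite mem_set//; exact: epsZ.
    rewrite memNset; last by move/negP: Sl.
    by rewrite integral_set0.
  have tZl' : trivIset [set` iota 0 N] Zl by exact: sub_trivIset tZl.
  have := @ge0_integral_bigsetU _ B R m _ Zl (fun t => hA D t `^ p') (iota 0 N) mZl (iota_uniq 0 N) tZl'.
  rewrite /= => <-; [|exact: nnm_meas nAp|by move=> t _; exact: poweR_ge0].
  have : \big[setU/set0]_(i <- iota 0 N) Zl i = set0 \/
      exists2 d, \int[m]_(t in `]0%R, d]) (hA D t `^ p') <= l%:E &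
        \big[setU/set0]_(i <- iota 0 N) Zl i `<=` `]0%R, d]%classic.
    elim: (iota 0 N) => [|i s IH]; first by left; rewrite big_nil.
    rewrite big_cons; have [Zi|/set0P[x Zx]] := eqVneq (Zl i) set0.
      by rewrite Zi set0U.
    right; have : exists2 d, \int[m]_(t in `]0%R, d]) (hA D t `^ p') <= l%:E & Zl i `<=` `]0%R, d]%classic.
      have [Sl Zix] : S i <= l%:E /\ Z i x by move: Zx; rewrite /Zl; case: ifP.
      have [Qi _ _ _] := Zin i x Zix.
      exists (z i).2; first by move: Sl; rewrite /S Qi.
      move=> y; rewrite /Zl Sl => /Zin[_ y0 yz _].
      by rewrite /= in_itv/= y0.
    move=> [d hd Zd]; case: IH => [->|[e he se]]; first by exists d => //; rewrite setU0.
    have [de|ed] := leP d e.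
      exists e => //; rewrite subUset; split => //; apply: subset_trans Zd _.
      by apply: subset_itvl; rewrite bnd_simp.
    exists d => //; rewrite subUset; split => //; apply: subset_trans se _.
    by apply: subset_itvl; rewrite bnd_simp ltW.
  move=> [->|[d hd sd]]; first by rewrite integral_set0 lee_fin ltW.
  apply: le_trans hd; apply: subset_integral_nng => // t _; exact: poweR_ge0.
have [hdel sdel] := hC1 _ nat counting S kap eps nS nkap neps Se rk.
set cc := (p / (2 * p'))%R in hdel sdel.
pose Del n := \int[counting]_(i in [set i | S i <= (2 * lev n)%:E])
  ((lev n)%:E `^ (- cc) * (S i `^ cc * kap i `^ p)) : \bar R.
have Del0 n : 0 <= Del n.
  by apply: integral_nng => i _; apply: mule_ge0; [|apply: mule_ge0]; exact: poweR_ge0.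
have sDel : \sum_(n <oo) Del n <= (C1 * C2)%:E * hnorm D p k.
  apply: le_trans sdel _; rewrite EFinM -muleA; apply: (le_mull C1E).
  rewrite counting_integral; last by move=> i; exact: poweR_ge0.
  rewrite patch_setT; apply: le_trans (hC2 D k phoo nk).
  rewrite (@eq_eseriesr _ _ (fun i => hdelta p 2 D k i)) => [|i _]; first exact: lexx.
  by rewrite /kap poweRVK// gt_eqF.
(* the sum defining [hH1 x] only involves indices [i] with [S i <= hE x] *)
have H1le (l : \bar R) x : (0 < x)%R -> hE D p m x <= l ->
    hH1 p D k x <= (2 `^ p'^-1)%:E * \int[counting]_(i in [set i | S i <= l]) (kap i * eps i).
  move=> x0 xl; rewrite counting_integral; last by move=> i; exact: mule_ge0.
  have c0 : 0 <= (2 `^ p'^-1)%:E :> \bar R by rewrite lee_fin powR_ge0.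
  have f0 i : 0 <= ((fun i => kap i * eps i) \_ [set i | S i <= l]) i.
    by rewrite patchE; case: ifP => // _; exact: mule_ge0.
  rewrite -nneseriesZl; last by move=> i _; exact: f0.
  have A0 i : 0 <= hAi p D i by apply: integral_nng => t _; exact: (nha D).2.
  apply: lee_nneseries => [i _ _|i _].
    by case: (hpt D p x < _) => //; rewrite mule_ge0// mule_ge0 ?poweR_ge0.
  case: ifPn => pxi; last by apply: mule_ge0.
  have [Qi|nQi] := boolP (Q i); last first.
    rewrite (_ : hAi p D i = 0) ?mule0; first exact: mule_ge0.
    rewrite /hAi (_ : _ `&` _ = set0) ?integral_set0//; apply/seteqP; split => // t [].
    rewrite /= in_itv/= andbT => t0 ht; move/negP: nQi; apply; apply/asboolP; by exists t.
  have [z0 z12 pz1 pz2 hlt] := hz i (hQ i Qi).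
  have z2x : ((z i).2 <= x)%R.
    rewrite leNgt; apply/negP => /ltW /(hpt_anti D p); rewrite pz2 leNgt pxi//.
  have Sl : S i <= l by rewrite /S Qi; apply: le_trans xl; exact: le_hE.
  rewrite patchE mem_set// /eps Qi /kap.
  have hAle : hAi p D i <= hA D (z i).1.
    apply: subset_integral_nng => [t _|t [/=]]; first exact: (nha D).2.
    rewrite !in_itv/= andbT => -> ht; rewrite ltNge; apply/negP.
    rewrite le_eqVlt => /predU1P[E|/hlt]; first by move: ht; rewrite -E pz1 ltxx.
    by move=> /(lt_trans ht); rewrite ltxx.
  have lE : (lev i)%:E `^ p'^-1 = (2 `^ p'^-1)%:E * (lev i / 2)%:E `^ p'^-1.
    rewrite !poweR_EFin -EFinM -powRM//; last by rewrite divr_ge0// lev_ge0.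
    by rewrite mulrCA mulfV ?mulr1.
  rewrite lE -!muleA; apply: (le_mull c0).
  rewrite muleCA; apply: (le_mull (poweR_ge0 _ _)); exact: (le_mull (poweR_ge0 _ _)).
have rkW : rank mu (pos : set T) (hw D) (hW D) by exact: rank_tail (nhw D).
have ng : nnm (fun x : T => hH1 p D k x `^ q * hw D x) by exact: nnmM (nnm_poweR q n1) (nhw D).
have g0 : \int[mu]_(x in ((pos : set T) `&` [set x | hE D p m x = 0])) (hH1 p D k x `^ q * hw D x) = 0.
  apply: integral0_eq => x []; rewrite /pos/= in_itv/= andbT => x0 Ex.
  rewrite (_ : hH1 p D k x = 0) ?poweR0r ?mul0e ?gt_eqF//.
  apply/eqP; rewrite eq_le n1.2 andbT; apply: le_trans (H1le 0 x x0 _) _; first by rewrite Ex.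
  rewrite (_ : \int[counting]_(i in _) _ = 0) ?mule0//.
  by apply: integral0_eq => i /= Si; rewrite Se ?mule0//; apply/eqP; rewrite eq_le Si S0.
have goo : \int[mu]_(x in ((pos : set T) `&` [set x | hE D p m x = +oo])) (hH1 p D k x `^ q * hw D x) = 0.
  apply: integral_null_mul; [|exact: nnm_poweR|exact: nhw|].
    by apply: measurableI => //; exact: measurable_eqy.
  exact: (hardy_const_null p1 q1 mpos (nhw D) nE nW pos_nonempty rkW T4).
pose E n := (pos : set T) `&` [set x | (lev n)%:E < hE D p m x <= (2 * lev n)%:E].
have mE n : measurable (E n).
  apply: measurableI => //; rewrite (_ : [set x | _] =
    [set x | (lev n)%:E < hE D p m x] `&` [set x | hE D p m x <= (2 * lev n)%:E]); last first.
    by apply/seteqP; split => x /= => [/andP[]|[-> ->]].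
  by apply: measurableI; [exact: measurable_gt|exact: measurable_le].
have tE : trivIset setT E.
  move=> i j _ _ [x [[_ /= hi] [_ /= hj]]].
  move: hi hj; case: (hE D p m x) => [f| |]//=; rewrite ?lte_fin ?lee_fin; first exact: lev_disjoint.
  by move=> /andP[_]; rewrite leye_eq.
have ED n : E n `<=` pos by move=> x [].
have c0 n : 0 <= (lev n)%:E :> \bar R by exact: levE_ge0.
have EI n x : E n x -> (lev n)%:E <= hE D p m x by move=> [_ /andP[/ltW]].
pose Y n := (lev n)%:E `^ (q / p') * \int[mu]_(x in E n) hw D x.
have Y0 n : 0 <= Y n.
  by apply: mule_ge0; [exact: poweR_ge0|apply: integral_nng => x _; exact: (nhw D).2].
have gY : gauge p q Y <= C3%:E * hT4 D p q m `^ q.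
  exact: (hC3 _ T mu pos (hw D) _ _ E _ mpos (nhw D) nE nW pos_nonempty rkW mE ED tE c0 EI).
have KqE : 0 <= K%:E `^ q by exact: poweR_ge0.
have est n : \int[mu]_(x in E n) (hH1 p D k x `^ q * hw D x) <= K%:E `^ q * (Del n `^ (q / p) * Y n).
  pose b := (K%:E * ((lev n)%:E `^ p'^-1 * Del n `^ p^-1)) `^ q.
  have b0 : 0 <= b by exact: poweR_ge0.
  apply: (@le_trans _ _ (\int[mu]_(x in E n) (b * hw D x))).
    apply: le_integral_nng => x; first by move=> _; exact: ng.2.
    move=> [px /andP[_ xl]]; apply: (le_mulr ((nhw D).2 x)); apply: (le_poweR q00 (n1.2 x)).
    have x0 : (0 < x)%R by move: px; rewrite /pos/= in_itv/= andbT.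
    apply: le_trans (H1le _ x x0 xl) _.
    rewrite KEq -[leRHS]muleA; apply: le_mull; first by rewrite lee_fin powR_ge0.
    by rewrite muleA; exact: hdel.
  rewrite (integralMl mu (mE n) b0 (nhw D)) /b.
  have z0 : 0 <= (lev n)%:E `^ p'^-1 * Del n `^ p^-1 by apply: mule_ge0; exact: poweR_ge0.
  rewrite (poweRM _ KE z0) (poweRM _ (poweR_ge0 _ _) (poweR_ge0 _ _)) -!poweRrM.
  rewrite [(p^-1 * q)%R]mulrC [(p'^-1 * q)%R]mulrC -!muleA; apply: (le_mull KqE).
  by rewrite /Y muleCA.
apply: le_trans (level_decomp mu mpos nE ng) _; rewrite g0 goo !adde0.
apply: (@le_trans _ _ (\sum_(n <oo) (K%:E `^ q * (Del n `^ (q / p) * Y n)))).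
  by apply: lee_nneseries => [n _ _|n _]; [apply: integral_nng => x _; exact: ng.2|exact: est].
rewrite nneseriesZl; last by move=> n _; apply: mule_ge0; [exact: poweR_ge0|exact: Y0].
rewrite EFinM -[leRHS]muleA; apply: le_mull; first by rewrite lee_fin powR_ge0.
apply: le_trans (gauge_hoelder p1 q1 Del0 Y0) _.
have C12 : 0 <= (C1 * C2)%:E by rewrite lee_fin mulr_ge0 ?ltW.
apply: (@le_trans _ _ (((C1 * C2)%:E `^ (q / p) * hnorm D p k `^ (q / p)) * (C3%:E * hT4 D p q m `^ q))).
  apply: lee_pmul; [exact: poweR_ge0|exact: gauge_ge0| |exact: gY].
  by rewrite -(poweRM _ C12 L0); exact: (le_poweR qp0 (nneseries_ge0 (fun n _ _ => Del0 n)) sDel).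
rewrite (poweR_EFin (C1 * C2)) EFinM -!muleA; apply: le_mull; first by rewrite lee_fin powR_ge0.
rewrite muleCA; apply: le_mull; first by rewrite lee_fin ltW.
by rewrite muleC.
Qed.

End upper_final.

(** * Lower bounds from duality *)

Section nd_sup.
Context {R : realType}.
Implicit Types (x y : nat -> \bar R) (X Y : \bar R).

(** Monotone approximation from below, in a form stable under products, powers and integrals. Only
    [X <= sup] is recorded, since upper bounds for truncated data are to be transferred to [X]. *)
Definition nd_sup x X := [/\ forall n, 0 <= x n,
  {homo x : m n / (m <= n)%N >-> m <= n} & X <= ereal_sup (range x)].

Lemma nd_sup_cst X : 0 <= X -> nd_sup (fun=> X) X.
Proof. by move=> X0; split => //; apply: ereal_sup_ubound; exists 0%N. Qed.

Lemma nd_sup_mul x y X Y : nd_sup x X -> nd_sup y Y -> 0 <= X -> nd_sup (fun n => x n * y n) (X * Y).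
Proof.
move=> [x0 ndx hX] [y0 ndy hY] X0; split => [n|m n mn|]; first exact: mule_ge0.
  by apply: lee_pmul => //; [exact: ndx|exact: ndy].
set Z := ereal_sup _; have hZ n : x n * y n <= Z by apply: ereal_sup_ubound; exists n.
have Z0 : 0 <= Z by apply: le_trans (hZ 0%N); exact: mule_ge0.
apply: (mule_le_of_lt X0 Z0) => l l0 lY.
have l0' : 0 <= l%:E by rewrite lee_fin ltW.
rewrite muleC; apply: (mule_le_of_lt l0' Z0) => k k0 kX; rewrite muleC.
have [_ [i _ <-] li] := ereal_sup_gt (lt_le_trans lY hY).
have [_ [j _ <-] kj] := ereal_sup_gt (lt_le_trans kX hX).
apply: le_trans (hZ (maxn i j)); apply: lee_pmul; rewrite ?lee_fin ?(ltW k0)//.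
- by apply: le_trans (ltW kj) _; apply: ndx; exact: leq_maxr.
- by apply: le_trans (ltW li) _; apply: ndy; exact: leq_maxl.
Qed.

Lemma nd_sup_poweR x X (a : R) : (0 <= a)%R -> 0 <= X -> nd_sup x X ->
  nd_sup (fun n => x n `^ a) (X `^ a).
Proof.
move=> a0 X0 [x0 ndx hX]; split => [n|m n mn|]; first exact: poweR_ge0.
  by apply: le_poweR => //; exact: ndx.
move: a0; rewrite le_eqVlt => /predU1P[<-|a0].
  by rewrite poweRe0; apply: ereal_sup_ubound; exists 0%N => //; rewrite poweRe0.
set Z := ereal_sup _; have hZ n : x n `^ a <= Z by apply: ereal_sup_ubound; exists n.
have Z0 : 0 <= Z by apply: le_trans (hZ 0%N); exact: poweR_ge0.
rewrite -[leRHS](poweRVK Z0 (lt0r_neq0 a0)); apply: le_poweR => //; first exact: ltW.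
apply: le_trans hX _; apply: ge_ereal_sup => _ [n _ <-].
rewrite -[leLHS](poweRK (x0 n) (lt0r_neq0 a0)); apply: le_poweR => //; last exact: poweR_ge0.
by rewrite invr_ge0 ltW.
Qed.

Lemma nd_sup_min X : 0 <= X -> nd_sup (fun n => mine X n%:R%:E) X.
Proof.
move=> X0; split => [n|m n mn|].
- by rewrite le_min X0 lee_fin ler0n.
- by rewrite le_min ge_min lexx/= ge_min lee_fin ler_nat mn orbT.
set Z := ereal_sup _; have hZ n : mine X n%:R%:E <= Z by apply: ereal_sup_ubound; exists n.
case: X X0 @Z hZ => [r| |//] r0 Z hZ.
  apply: le_trans (hZ (Num.trunc r).+1); rewrite le_min lexx lee_fin ltW//; exact: truncnS_gt.
rewrite leye_eq; apply/eqP; apply/eqyP => z z0.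
apply: le_trans (hZ (Num.trunc z).+1); rewrite le_min leey lee_fin ltW//; exact: truncnS_gt.
Qed.

Lemma nd_sup_integral d (T : measurableType d) (m : {measure set T -> \bar R}) (D : set T)
    (f : nat -> T -> \bar R) (F : T -> \bar R) : measurable D -> (forall n, nnm (f n)) ->
  (forall z, D z -> 0 <= F z) -> (forall z, D z -> nd_sup (f ^~ z) (F z)) ->
  nd_sup (fun n => \int[m]_(z in D) f n z) (\int[m]_(z in D) F z).
Proof.
move=> mD nf F0 h; have nd : {homo (fun n => \int[m]_(z in D) f n z) : i j / (i <= j)%N >-> i <= j}.
  move=> i j ij; apply: le_integral_nng => z Dz; first exact: (nf i).2.
  by have [_ + _] := h z Dz; exact.
split => //; first by move=> n; apply: integral_nng => z _; exact: (nf n).2.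
apply: (@le_trans _ _ (\int[m]_(z in D) limn (f ^~ z))).
  apply: le_integral_nng => // z Dz; have [_ ndz hz] := h z Dz.
  by rewrite (cvg_lim _ (ereal_nondecreasing_cvgn ndz)).
rewrite monotone_convergence//.
- by rewrite (cvg_lim _ (ereal_nondecreasing_cvgn nd)).
- by move=> n; exact: nnm_meas.
- by move=> n z _; exact: (nf n).2.
- by move=> z Dz; have [_ + _] := h z Dz.
Qed.

Lemma nd_integral_le d (T : measurableType d) (m : {measure set T -> \bar R}) (D : set T)
    (f : nat -> T -> \bar R) (F : T -> \bar R) (l : \bar R) : measurable D -> (forall n, nnm (f n)) ->
  (forall z, D z -> 0 <= F z) -> (forall z, D z -> nd_sup (f ^~ z) (F z)) ->
  (forall n, \int[m]_(z in D) f n z <= l) -> \int[m]_(z in D) F z <= l.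
Proof.
move=> mD nf F0 h hl; have [_ _ H] := nd_sup_integral m mD nf F0 h.
by apply: le_trans H _; apply: ge_ereal_sup => _ [n _ <-].
Qed.

End nd_sup.

Lemma mule_rot {R : realType} (x y z t : \bar R) : x * (y * (z * t)) = z * (y * (t * x)).
Proof. by rewrite (muleCA y) (muleCA x) (muleC x) -!muleA. Qed.

Lemma mule_shuffle {R : realType} (f b l n1 n2 a : \bar R) :
  f * b * l * (n2 * n1 * a) = a * (n2 * l) * (n1 * (f * b)).
Proof.
by rewrite (AC (3*3) (6*(4*3)*(5*(1*2)))).
Qed.

Lemma mule_shuffle2 {R : realType} (C v1 v2 n1 n2 n b : \bar R) :
  C * (v1 * v2 * (n1 * n2 * n) * b) = v1 * n1 * b * (C * (n2 * v2)) * n.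
Proof.
by rewrite (AC (1*(2*3*1)) ((2*4*7)*(1*(5*3))*6)).
Qed.

(* If [N y z] grows as [y] moves into [b y], a bound for the operator with kernel
   [N] from L^Q(beta) to L^P(alpha) bounds the associated Hardy constants. *)
Section kernel_test.
Context {R : realType}.
Local Notation T := (lebesgueR R).
Local Notation mu := (@completed_lebesgue_measure R).
Context d2 {T2 : measurableType d2}.
Variables (m2 : {sigma_finite_measure set T2 -> \bar R}).
Variables (P Q M : R) (beta : T -> \bar R) (alpha : T2 -> \bar R) (N : T * T2 -> \bar R) (b : R -> set R).
Hypotheses (P1 : (1 < P)%R) (Q1 : (1 < Q)%R) (M0 : (0 <= M)%R).
Hypotheses (nb : nnm beta) (na : nnm alpha) (nN : nnm N).
Hypothesis mb : forall y, measurable (b y : set T).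
Hypothesis bN : forall y y' z, b y y' -> N (y, z) <= N (y', z).
Definition ktest_V (y : R) := \int[mu]_(y' in b y) beta y'.
Definition ktest_N (y : R) := \int[m2]_z (N (y, z) `^ P * alpha z).
Hypotheses (nV : nnm (ktest_V : T -> \bar R)) (rkV : rank mu setT beta ktest_V).
Hypothesis b_oo : \int[mu]_y beta y < +oo.
Hypothesis bound : forall f : T -> \bar R, nnm f -> (exists c : R, forall y, f y <= c%:E) ->
  \int[m2]_z ((\int[mu]_y (N (y, z) * (f y * beta y))) `^ P * alpha z) <=
  (M `^ P)%:E * (\int[mu]_y (f y `^ Q * beta y)) `^ (P / Q).
Let P0 : (0 < P)%R := lt_trans ltr01 P1.
Let Q0 : (0 < Q)%R := lt_trans ltr01 Q1.
Let Pm0 : (0 < P - 1)%R. Proof. by rewrite subr_gt0. Qed.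

Let N_snd y : nnm (fun z => N (y, z)).
Proof. by split => [|z]; [apply: (measurableT_comp nN.1); exact: measurable_fun_pair|exact: nN.2]. Qed.

Let N_fst z : nnm (fun y : T => N (y, z)).
Proof. by split => [|y]; [apply: (measurableT_comp nN.1); exact: measurable_fun_pair|exact: nN.2]. Qed.

Let nNa : nnm (fun v : T * T2 => N v `^ P * alpha v.2).
Proof.
apply: nnmM; first exact: nnm_poweR.
by split => [|v]; [exact: (measurableT_comp na.1)|exact: na.2].
Qed.

Lemma nnm_ktest_N : nnm (ktest_N : T -> \bar R).
Proof.
split; last by move=> y; apply: integral_nng => z _; exact: (nNa).2.
exact: (@measurable_fun_fubini_tonelli_F _ _ T T2 R m2 _ nNa.1 nNa.2).
Qed.

Let N_ge0 y : 0 <= ktest_N y. Proof. exact: nnm_ktest_N.2. Qed.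

Let V_oo y : ktest_V y < +oo.
Proof.
apply: le_lt_trans b_oo; apply: subset_integral_nng => [z _|//]; exact: nb.2.
Qed.

Let le_N y y' : b y y' -> ktest_N y <= ktest_N y'.
Proof.
move=> yy'; apply: le_integral_nng => z _; first exact: nNa.2 (y, z).
apply: (le_mulr (na.2 z)); apply: le_poweR; [exact: ltW|exact: nN.2|exact: bN].
Qed.

Let G (f : T -> \bar R) z := \int[mu]_y (N (y, z) * (f y * beta y)).

Let nfb f : nnm f -> nnm (fun y => f y * beta y).
Proof. by move=> nf; exact: nnmM nf nb. Qed.

Let nNfb f z : nnm f -> nnm (fun y => N (y, z) * (f y * beta y)).
Proof. by move=> nf; exact: nnmM (N_fst z) (nfb nf). Qed.

Let G_ge f y z : nnm f -> N (y, z) * (\int[mu]_(y' in b y) (f y' * beta y')) <= G f z.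
Proof.
move=> nf; rewrite -(integralMl mu (mb y) (nN.2 (y, z)) (nfb nf)).
apply: (@le_trans _ _ (\int[mu]_(y' in b y) (N (y', z) * (f y' * beta y')))).
  apply: le_integral_nng => y' by'; first by apply: mule_ge0; [exact: nN.2|exact: (nfb nf).2].
  by apply: (le_mulr ((nfb nf).2 y')); exact: bN.
by apply: subset_integral_nng => [y' _|//]; exact: (nNfb z nf).2.
Qed.

(** Test with the indicator of [b y], on which [N] is at least [N (y, z)]; the powers of [ktest_V y]
    are then cancelled, which is finite and, apart from a trivial case, positive. *)
Lemma ktest_le y : ktest_V y `^ (conjexp Q)^-1 * ktest_N y `^ P^-1 <= M%:E.
Proof.
have V0 := nV.2 y; have M0E : 0 <= M%:E by rewrite lee_fin.
have Q'0 := conjexp_gt0 Q1.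
have [->|Vp] := eqVneq (ktest_V y) 0.
  have i : ((conjexp Q)^-1 != 0)%R by rewrite gt_eqF// invr_gt0.
  by rewrite (poweR0r i) mul0e.
have {}Vp : 0 < ktest_V y by rewrite lt_def Vp.
pose f : T -> \bar R := (fun=> 1) \_ (b y).
have nf : nnm f by apply: nnm_patch => //; exact: nnm_cst.
have fc : exists c : R, forall y, f y <= c%:E.
  by exists 1%R => z; rewrite /f patchE; case: ifP => // _; rewrite lee01.
have Kf : \int[mu]_(y' in b y) (f y' * beta y') = ktest_V y.
  by apply: eq_integral => y' by'; rewrite /f patchE by' mul1e.
have fQ : \int[mu]_y' (f y' `^ Q * beta y') = ktest_V y.
  rewrite /ktest_V [RHS]integral_mkcond; apply: eq_integral => y' _.
  rewrite /f !patchE; case: ifP => _; first by rewrite poweR1r mul1e.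
  by rewrite poweR0r ?mul0e// gt_eqF.
have h := bound nf fc; rewrite fQ in h.
have h2 : ktest_V y `^ P * ktest_N y <= (M `^ P)%:E * ktest_V y `^ (P / Q).
  apply: le_trans h; rewrite -(integralMl m2 measurableT (poweR_ge0 _ _)); last first.
    by split => [|z]; [exact: (nnmM (nnm_poweR P (N_snd y)) na).1|exact: nNa.2 (y, z)].
  apply: le_integral_nng => z _.
    by apply: mule_ge0; [exact: poweR_ge0|exact: nNa.2 (y, z)].
  rewrite muleA; apply: (le_mulr (na.2 z)).
  rewrite -(poweRM _ V0 (nN.2 (y, z))) muleC -Kf.
  apply: le_poweR; [exact: ltW| |exact: G_ge].
  by apply: mule_ge0; [exact: nN.2|rewrite Kf].
apply: (poweR_le_inv P0 _ M0E); first by apply: mule_ge0; exact: poweR_ge0.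
rewrite (poweRM _ (poweR_ge0 _ _) (poweR_ge0 _ _)) (poweRVK (N_ge0 y) (lt0r_neq0 P0)) -poweRrM.
have -> : ktest_N y = ktest_V y `^ (- P) * (ktest_V y `^ P * ktest_N y).
  by rewrite muleA (poweR_inv_le1 P Vp (V_oo y)) mul1e.
have VP : 0 <= ktest_V y `^ (- P) by exact: poweR_ge0.
apply: le_trans (le_mull (poweR_ge0 _ _) (le_mull VP h2)) _.
rewrite poweR_EFin; set c := (M `^ P)%:E.
have -> : ktest_V y `^ ((conjexp Q)^-1 * P) * (ktest_V y `^ (- P) * (c * ktest_V y `^ (P / Q))) =
    c * (ktest_V y `^ (- P) * (ktest_V y `^ (P / Q) * ktest_V y `^ ((conjexp Q)^-1 * P))).
  exact: mule_rot.
have i1 : (0 < P / Q)%R by rewrite divr_gt0.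
have i2 : (0 < (conjexp Q)^-1 * P)%R by rewrite mulr_gt0// invr_gt0.
rewrite (poweR_addr V0 i1 i2).
rewrite [((conjexp Q)^-1 * P)%R]mulrC -mulrDr conjexp_add mulr1.
rewrite (poweR_inv_le1 P Vp (V_oo y)) mule1.
exact: lexx.
Qed.

(** The exponents of the test function are chosen so that its norm and the lower bound for the
    left-hand side both produce [Y], the truncated integral to be estimated; the cut at [n] makes
    [Y] finite, so that it can be cancelled. *)
Lemma ktest_lt_step (n : nat) : (P < Q)%R ->
  let r := rexp Q P in
  let g := (r / (Q * conjexp P))%R in
  let ga := (r / (Q * P))%R in
  let Y := \int[mu]_y ((ktest_V y `^ g * mine (ktest_N y) n%:R%:E `^ ga) `^ Q * beta y) in
  ((2^-1 `^ (g + 1)) `^ (P - 1))%:E * Y <= (M `^ P)%:E * Y `^ (P / Q) /\ Y < +oo.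
Proof.
move=> PQ r g ga Y.
have r0 : (0 < r)%R := rexp_gt0 P0 PQ.
have P'0 := conjexp_gt0 P1.
have g0 : (0 <= g)%R by rewrite divr_ge0 ?mulr_ge0 ?ltW.
have ga0 : (0 <= ga)%R by rewrite divr_ge0 ?mulr_ge0 ?ltW.
have nNn : nnm (fun y : T => mine (ktest_N y) n%:R%:E).
  split; last by move=> y; rewrite le_min N_ge0 lee_fin ler0n.
  by apply: measurable_mine; [exact: nnm_ktest_N.1|exact: measurable_cst].
pose Nn y := mine (ktest_N y) n%:R%:E.
pose f (y : T) := ktest_V y `^ g * Nn y `^ ga.
have nf : nnm f by exact: nnmM (nnm_poweR g nV) (nnm_poweR ga nNn).
pose I := \int[mu]_y beta y; have I0 : 0 <= I by apply: integral_nng => y _; exact: nb.2.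
have VI y : ktest_V y <= I by apply: subset_integral_nng => [z _|//]; exact: nb.2.
have IE : I = (fine I)%:E by rewrite fineK// ge0_fin_numE.
have fle y : f y <= (fine I `^ g * n%:R `^ ga)%:E.
  rewrite EFinM -!poweR_EFin -IE; apply: lee_pmul; rewrite ?poweR_ge0//.
    by apply: le_poweR => //; exact: nV.2.
  by apply: le_poweR => //; [exact: nNn.2|rewrite ge_min lexx orbT].
have fc : exists c : R, forall y, f y <= c%:E by exists (fine I `^ g * n%:R `^ ga)%R.
have nY : nnm (fun y : T => f y `^ Q * beta y) by exact: nnmM (nnm_poweR Q nf) nb.
have Yoo : Y < +oo.
  apply: (@le_lt_trans _ _ (\int[mu]_y ((fine I `^ g * n%:R `^ ga)%:E `^ Q * beta y))).
    apply: le_integral_nng => y _; first exact: nY.2.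
    by apply: (le_mulr (nb.2 y)); apply: le_poweR; [exact: ltW|exact: nf.2|exact: fle].
  rewrite (integralMl mu measurableT (poweR_ge0 _ _) nb) -/I IE poweR_EFin -EFinM.
  exact: ltry.
split => //; have h := bound nf fc.
have Pm1 : (0 <= P - 1)%R by exact: ltW.
have [c [c0 cE]] : exists c : R, (0 <= c)%R /\ (c = 2^-1 `^ (g + 1))%R.
  by exists (2^-1 `^ (g + 1))%R; rewrite powR_ge0.
have c0E : 0 <= c%:E by rewrite lee_fin.
(* A lower bound for the integral of [f * beta] over [b y]: there [Nn] is at least its value at [y],
   and [rank_poweR_int] integrates the power of [ktest_V]. *)
pose l (y : R) := c%:E * (Nn y `^ ga * ktest_V y `^ (g + 1)).
have nl : nnm (l : T -> \bar R).
  exact: nnmM (nnm_cst c0E) (nnmM (nnm_poweR ga nNn) (nnm_poweR _ nV)).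
have lK y : l y <= \int[mu]_(y' in b y) (f y' * beta y').
  have nVg : nnm (fun y' : T => ktest_V y' `^ g * beta y') by exact: nnmM (nnm_poweR g nV) nb.
  have rk : rank mu (b y : set T) beta ktest_V by exact: rank_sub rkV.
  have := rank_poweR_int (mb y) nb nV rk g0; rewrite -/(ktest_V y) -cE => hr.
  apply: (@le_trans _ _ (Nn y `^ ga * \int[mu]_(y' in b y) (ktest_V y' `^ g * beta y'))).
    by rewrite /l muleCA; apply: le_mull hr; exact: poweR_ge0.
  rewrite -(integralMl mu (mb y) (poweR_ge0 _ _) nVg).
  apply: le_integral_nng => y' by'; first by apply: mule_ge0; [exact: poweR_ge0|exact: nVg.2].
  rewrite /f muleA [X in X * _ <= _]muleC; apply: (le_mulr (nb.2 y')).
  apply: (le_mull (poweR_ge0 _ _)); apply: (le_poweR ga0 (nNn.2 y)).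
  by rewrite /Nn le_min ge_min (le_N by')/= ge_min lexx orbT.
pose W (y : R) := f y * beta y * l y `^ (P - 1).
have nW : nnm (W : T -> \bar R) by exact: nnmM (nfb nf) (nnm_poweR _ nl).
have nH : nnm (fun v : T * T2 => W v.1 * (N v `^ P * alpha v.2)).
  apply: nnmM nNa; split => [|v]; [exact: (measurableT_comp nW.1)|exact: nW.2].
(* Write [G^P = G^(P-1) G], open the last factor as an integral over [y], and use
   [G f z >= N (y, z) * l y] in the other one. *)
have stepB : \int[mu]_y (W y * ktest_N y) <= \int[m2]_z (G f z `^ P * alpha z).
  have -> : \int[mu]_y (W y * ktest_N y) = \int[mu]_y \int[m2]_z (W y * (N (y, z) `^ P * alpha z)).
    apply: eq_integral => y _; rewrite (integralMl m2 measurableT (nW.2 y))//.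
    by split => [|z]; [exact: (nnmM (nnm_poweR P (N_snd y)) na).1|exact: nNa.2 (y, z)].
  rewrite (@fubini_tonelli _ _ T T2 R mu m2 _ nH.1 nH.2).
  apply: le_integral_nng => z _.
    by apply: integral_nng => y _; exact: nH.2 (y, z).
  have G0 : 0 <= G f z by apply: integral_nng => y _; exact: (nNfb z nf).2.
  have cc : 0 <= alpha z * G f z `^ (P - 1) by apply: mule_ge0; [exact: na.2|exact: poweR_ge0].
  apply: (@le_trans _ _ (\int[mu]_y ((alpha z * G f z `^ (P - 1)) * (N (y, z) * (f y * beta y))))).
    apply: le_integral_nng => y _; first exact: nH.2 (y, z).
    have N0 := nN.2 (y, z).
    have -> : W y * (N (y, z) `^ P * alpha z) =
        alpha z * (N (y, z) * l y) `^ (P - 1) * (N (y, z) * (f y * beta y)).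
      rewrite (poweRM _ N0 (nl.2 y)) -[X in N (y, z) `^ X](subrK 1%R) -(poweR_addr N0 Pm0 ltr01) (poweRe1 N0) /W.
      exact: mule_shuffle.
    apply: le_mulr; first by apply: mule_ge0 => //; exact: (nfb nf).2.
    apply: le_mull; first exact: na.2.
    apply: le_poweR => //; first by apply: mule_ge0 => //; exact: nl.2.
    by apply: le_trans (le_mull N0 (lK y)) _; exact: G_ge.
  rewrite (integralMl mu measurableT cc (nNfb z nf)) -/(G f z) -muleA.
  have GE : G f z `^ (P - 1) * G f z = G f z `^ P.
    by rewrite -[X in _ * X](poweRe1 G0) (poweR_addr G0 Pm0 ltr01) subrK.
  rewrite GE muleC; exact: lexx.
apply: le_trans h; apply: le_trans stepB.
have cP : 0 <= ((2^-1 `^ (g + 1)) `^ (P - 1))%:E by rewrite lee_fin powR_ge0.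
rewrite -(integralMl mu measurableT cP nY).
apply: le_integral_nng => y _; first by apply: mule_ge0 => //; exact: nY.2.
apply: (@le_trans _ _ (W y * Nn y)); last first.
  by apply: (le_mull (nW.2 y)); rewrite /Nn ge_min lexx.
have V0 := nV.2 y; have Nn0 : 0 <= Nn y := nNn.2 y.
have rq := rexp_q P0 PQ; rewrite -/r in rq.
have PP' := conjexp_div P1.
(* This identity and the next come from [r/P = r/Q + 1]; they match the powers of [ktest_V] and [Nn]
   in [W y * Nn y] with those in [f ^ Q]. *)
have e1 : (g + (g + 1) * (P - 1) = g * Q)%R.
  have -> : (g = r / Q * (P - 1) / P)%R.
    by rewrite /g -PP' invfM; field; rewrite !gt_eqF.
  have -> : (r / Q * (P - 1) / P * Q = (r / P) * (P - 1))%R by field; rewrite !gt_eqF.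
  by rewrite rq; field; rewrite !gt_eqF.
have e2 : (ga + ga * (P - 1) + 1 = ga * Q)%R.
  have -> : (ga * Q = r / P)%R by rewrite /ga; field; rewrite !gt_eqF.
  by rewrite rq /ga; field; rewrite !gt_eqF.
have g1 : (0 < (g + 1) * (P - 1))%R by rewrite mulr_gt0// ltr_wpDl.
have ga1 : (0 <= ga * (P - 1))%R by rewrite mulr_ge0.
rewrite (poweRM _ (poweR_ge0 _ _) (poweR_ge0 _ _)) -!poweRrM -e1 -e2.
rewrite -(poweR_addr_unit V0 g0 g1).
rewrite -(poweR_addr_unit Nn0 (addr_ge0 ga0 ga1) ltr01) (poweRe1 Nn0).
rewrite /W /l (poweRM _ c0E (mule_ge0 (poweR_ge0 _ _) (poweR_ge0 _ _))).
rewrite (poweRM _ (poweR_ge0 _ _) (poweR_ge0 _ _)) -!poweRrM poweR_EFin cE /f.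
have -> : Nn y `^ (ga + ga * (P - 1)) = Nn y `^ ga * Nn y `^ (ga * (P - 1)).
  have gap : (0 < ga)%R by rewrite divr_gt0// mulr_gt0.
  by rewrite (poweR_addr Nn0 gap (mulr_gt0 gap Pm0)).
set C := ((2^-1 `^ _) `^ _)%:E.
rewrite le_eqVlt; apply/orP; left; apply/eqP.
exact: mule_shuffle2.
Qed.

(** Cancel [Y^(P/Q)] in [ktest_lt_step], where [1 - P/Q = P/r], and let [n] tend to infinity. *)
Lemma ktest_lt : (P < Q)%R ->
    \int[mu]_y (ktest_V y `^ (rexp Q P / conjexp P) * ktest_N y `^ (rexp Q P / P) * beta y) <=
  ((((2^-1 `^ (rexp Q P / (Q * conjexp P) + 1)) `^ (P - 1))^-1 `^ (rexp Q P / P))%R)%:E * (M `^ rexp Q P)%:E.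
Proof.
pose r := rexp Q P; rewrite -/r => PQ; have r0 : (0 < r)%R := rexp_gt0 P0 PQ.
have P'0 := conjexp_gt0 P1.
pose g := (r / (Q * conjexp P))%R; pose ga := (r / (Q * P))%R.
have gQ : (g * Q = r / conjexp P)%R by rewrite /g; field; rewrite !gt_eqF.
have gaQ : (ga * Q = r / P)%R by rewrite /ga; field; rewrite !gt_eqF.
have nNn n : nnm (fun y : T => mine (ktest_N y) n%:R%:E).
  split; last by move=> y; rewrite le_min N_ge0 lee_fin ler0n.
  by apply: measurable_mine; [exact: nnm_ktest_N.1|exact: measurable_cst].
have rP0 : (0 <= r / P)%R by rewrite divr_ge0 ?ltW.
have rP'0 : (0 <= r / conjexp P)%R by rewrite divr_ge0 ?ltW.
apply: (@nd_integral_le _ _ _ mu setT (fun n y => ktest_V y `^ (r / conjexp P) *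
   mine (ktest_N y) n%:R%:E `^ (r / P) * beta y)).
- exact: measurableT.
- move=> n; exact: nnmM (nnmM (nnm_poweR _ nV) (nnm_poweR _ (nNn n))) nb.
- move=> y _; apply: mule_ge0; [apply: mule_ge0; exact: poweR_ge0|exact: nb.2].
- move=> y _; apply: nd_sup_mul; last by apply: mule_ge0; exact: poweR_ge0.
    apply: nd_sup_mul; last exact: poweR_ge0.
      apply: nd_sup_cst; exact: poweR_ge0.
    exact: (nd_sup_poweR rP0 (N_ge0 y) (nd_sup_min (N_ge0 y))).
  apply: nd_sup_cst; exact: nb.2.
move=> n; have [] := ktest_lt_step n PQ; rewrite -/r -/g -/ga.
have -> : \int[mu]_y ((ktest_V y `^ g * mine (ktest_N y) n%:R%:E `^ ga) `^ Q * beta y) =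
   \int[mu]_y (ktest_V y `^ (r / conjexp P) * mine (ktest_N y) n%:R%:E `^ (r / P) * beta y).
  apply: eq_integral => y _.
  by rewrite (poweRM _ (poweR_ge0 _ _) (poweR_ge0 _ _)) -!poweRrM gQ gaQ.
set Y := \int[mu]_y _; set c := ((2^-1 `^ _) `^ _)%R.
have c0 : (0 < c)%R by rewrite !powR_gt0.
have Y0 : 0 <= Y.
  apply: integral_nng => y _; apply: mule_ge0; last exact: nb.2.
  by apply: mule_ge0; exact: poweR_ge0.
clearbody Y c; case: Y Y0 => [Y| |//] Y0; last by rewrite ltxx.
move=> + _; move: Y0; rewrite lee_fin le_eqVlt => /predU1P[<- _|Y0].
  by rewrite -EFinM lee_fin mulr_ge0 ?powR_ge0.
rewrite poweR_EFin -!EFinM !lee_fin => h.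
have e : (P / Q + P / r = 1)%R.
  rewrite -mulrDr (_ : r^-1 = P^-1 - Q^-1)%R; last by rewrite /r /rexp invrK.
  by rewrite addrC subrK mulfV// gt_eqF.
have Yr : (Y `^ (P / r) <= c^-1 * M `^ P)%R.
  have Yp : (0 < Y `^ (P / Q))%R by rewrite powR_gt0.
  rewrite -(ler_pM2r Yp) -powRD; last by apply/implyP => _; rewrite gt_eqF.
  rewrite addrC e (powRr1 (ltW Y0)) -mulrA ler_pdivlMl; last exact: c0.
  exact: h.
have -> : Y = ((Y `^ (P / r)) `^ (r / P))%R.
  rewrite -powRrM (_ : P / r * (r / P) = 1)%R ?(powRr1 (ltW Y0))//.
  by field; rewrite !gt_eqF.
have -> : (c^-1 `^ (r / P) * M `^ r = (c^-1 * M `^ P) `^ (r / P))%R.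
  rewrite powRM ?invr_ge0 ?powR_ge0 ?(ltW c0)// -powRrM.
  by congr (_ * M `^ _)%R; field; rewrite gt_eqF.
by apply: ge0_ler_powR; rewrite ?nnegrE ?powR_ge0// mulr_ge0 ?powR_ge0// invr_ge0 ltW.
Qed.

End kernel_test.

Section absorb.
Context {R : realType}.

(** Division by [J^(1/p)]. It rests on [J] being finite, and the dual estimates truncate in order to
    have this. *)
Lemma poweR_absorb (p : R) (J X : \bar R) : (1 < p)%R -> 0 <= J -> J < +oo -> 0 <= X ->
  J <= X * J `^ p^-1 -> J <= X `^ conjexp p.
Proof.
move=> p1 J0 Joo X0 h; have p0 := lt_trans ltr01 p1; have p'0 := conjexp_gt0 p1.
have [->|Jn] := eqVneq J 0; first exact: poweR_ge0.
have Jp : 0 < J by rewrite lt_def Jn.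
have i2 : (0 < (conjexp p)^-1)%R by rewrite invr_gt0.
apply: (poweR_le_inv i2 J0 (poweR_ge0 _ _)).
rewrite (poweRK X0 (lt0r_neq0 p'0)).
have JV : 0 <= J `^ (- p^-1) by exact: poweR_ge0.
have := le_mull JV h; rewrite muleCA (poweR_inv_le1 _ Jp Joo) mule1; apply: le_trans.
have i1 : (0 < p^-1)%R by rewrite invr_gt0.
rewrite -[X in _ <= _ * X](poweRe1 J0) -(conjexp_add p) -(poweR_addr J0 i1 i2) [leRHS]muleA.
by rewrite (poweR_inv_le1 _ Jp Joo) mul1e.
Qed.

Lemma weighted_hoelder d (T : measurableType d) (m : {measure set T -> \bar R}) (q : R)
    (f g w : T -> \bar R) (E : set T) : (1 < q)%R -> measurable E -> nnm f -> nnm g -> nnm w ->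
  \int[m]_(x in E) (f x * g x * w x) <=
  (\int[m]_(x in E) (f x `^ q * w x)) `^ q^-1 *
  (\int[m]_(x in E) (g x `^ conjexp q * w x)) `^ (conjexp q)^-1.
Proof.
move=> q1 mE nf ng nw; have q0 := lt_trans ltr01 q1; have q'0 := conjexp_gt0 q1.
have n1 : nnm (fun x => f x * w x `^ q^-1) by exact: nnmM nf (nnm_poweR _ nw).
have n2 : nnm (fun x => g x * w x `^ (conjexp q)^-1) by exact: nnmM ng (nnm_poweR _ nw).
have := integral_hoelder m mE q0 q'0 (conjexp_add q) n1 n2.
have -> : \int[m]_(x in E) (f x * w x `^ q^-1 * (g x * w x `^ (conjexp q)^-1)) =
    \int[m]_(x in E) (f x * g x * w x).
  apply: eq_integral => x _; rewrite muleACA.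
  have i1 : (0 < q^-1)%R by rewrite invr_gt0.
  have i2 : (0 < (conjexp q)^-1)%R by rewrite invr_gt0.
  by rewrite (poweR_addr (nw.2 x) i1 i2) conjexp_add (poweRe1 (nw.2 x)).
have E1 : \int[m]_(x in E) (f x * w x `^ q^-1) `^ q = \int[m]_(x in E) (f x `^ q * w x).
  apply: eq_integral => x _; rewrite (poweRM _ (nf.2 x) (poweR_ge0 _ _)).
  by rewrite (poweRVK (nw.2 x) (lt0r_neq0 q0)).
have E2 : \int[m]_(x in E) (g x * w x `^ (conjexp q)^-1) `^ conjexp q =
    \int[m]_(x in E) (g x `^ conjexp q * w x).
  apply: eq_integral => x _; rewrite (poweRM _ (ng.2 x) (poweR_ge0 _ _)).
  by rewrite (poweRVK (nw.2 x) (lt0r_neq0 q'0)).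
by rewrite E1 E2.
Qed.

Lemma conjexpK (p : R) : conjexp (conjexp p) = p.
Proof. by rewrite /conjexp invrK opprB addrCA subrr addr0 invrK. Qed.

Lemma rexp_conjexp (p q : R) : rexp (conjexp q) (conjexp p) = rexp p q.
Proof. by rewrite /rexp !conjexpV; congr (_^-1)%R; ring. Qed.

Lemma conjexp_lt (p q : R) : (1 < q)%R -> (q < p)%R -> (conjexp p < conjexp q)%R.
Proof.
move=> q1 qp; have p1 := lt_trans q1 qp.
rewrite -(ltf_pV2 (conjexp_gt0 q1) (conjexp_gt0 p1)) !conjexpV ltrD2l ltrN2.
by rewrite ltf_pV2// posrE (lt_trans ltr01).
Qed.

End absorb.

(** The [r]-th root of the constant in [ktest_lt], and 1 where [ktest_le] applies. *)
Definition lower_const {R : realType} (P Q : R) : R :=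
  let r := rexp Q P in
  if (Q <= P)%R then 1%R
  else ((((2^-1 `^ (r / (Q * conjexp P) + 1)) `^ (P - 1))^-1 `^ (r / P)) `^ r^-1)%R.

Lemma lower_const_gt0 {R : realType} (P Q : R) : (0 < lower_const P Q)%R.
Proof. by rewrite /lower_const; case: ifP => // _; rewrite !powR_gt0// invr_gt0 !powR_gt0. Qed.

(** * Lower bounds for the two kernel terms *)

Section lower.
Context {R : realType}.
Local Notation T := (lebesgueR R).
Local Notation mu := (@completed_lebesgue_measure R).
Variables (p q : R).
Hypotheses (p1 : (1 < p)%R) (q1 : (1 < q)%R).
Local Notation p' := (conjexp p).
Local Notation q' := (conjexp q).
Local Notation r := (rexp p q).
Let pos : set R := `]0%R, +oo[%classic.
Let p0 : (0 < p)%R := lt_trans ltr01 p1.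
Let q0 : (0 < q)%R := lt_trans ltr01 q1.
Let p'0 : (0 < p')%R := conjexp_gt0 p1.
Let q'0 : (0 < q')%R := conjexp_gt0 q1.
Let p'1 : (1 < p')%R := conjexp_gt1 p1.
Let q'1 : (1 < q')%R := conjexp_gt1 q1.
Let pm0 : (0 < p' - 1)%R. Proof. by rewrite subr_gt0. Qed.
Let mpos : measurable (pos : set T) := measurable_litv _.
Variables (D : hdata R) (M : R).
Hypothesis M0 : (0 <= M)%R.

Definition hbound := forall k, nnm (k : T -> \bar R) ->
  \int[mu]_(x in pos) (hT D k x `^ q * hw D x) <= (M `^ q)%:E * hnorm D p k `^ (q / p).
Hypothesis hyp : hbound.

(** [hK k] is non-decreasing, so its value at [t] is at most the one at each [tau >= t] in the
    supremum. *)
Lemma hUs_hK_le (k : R -> \bar R) t : nnm (k : T -> \bar R) -> hUs D t * hK D k t <= hR D k t.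
Proof.
move=> nk; have K0 : 0 <= hK D k t by exact: (nnm_hK D nk).2.
have R0 : 0 <= hR D k t.
  by apply: sup_from_ge0 => u; apply: mule_ge0; [rewrite lee_fin hU_ge0|exact: (nnm_hK D nk).2].
rewrite muleC; apply: (mule_le_of_lt K0 R0) => l l0 /ereal_sup_gt[_ [tau /= + <-] ltau].
rewrite in_itv/= andbT => ttau.
apply: (@le_trans _ _ ((hU D tau)%:E * hK D k tau)).
  rewrite muleC; apply: lee_pmul => //; [by rewrite lee_fin ltW|exact: ltW|].
  exact: le_primitive (nnm_ks D nk) ttau.
exact: (sup_from_ge (fun tau => (hU D tau)%:E * hK D k tau)).
Qed.

Lemma hUK_le_hT (k : R -> \bar R) x : nnm (k : T -> \bar R) -> primitive (hUK D k) x <= hT D k x.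
Proof.
move=> nk; apply: le_integral_nng => t _; first exact: (nnm_hUK D nk).2.
rewrite /hUK /hUa muleAC; apply: (le_mulr ((nha D).2 t)); exact: hUs_hK_le.
Qed.

Lemma primitive_le0 (e : R -> \bar R) z : (z <= 0)%R -> primitive e z = 0.
Proof.
by move=> z0; rewrite /primitive /lebesgue_integral set_itv_ge ?integral_set0// bnd_simp -leNgt.
Qed.

(** Presents the operator as an integral against [hB], the form that the kernel test expects. *)
Lemma hUK_kernel (k : R -> \bar R) z : nnm (k : T -> \bar R) ->
  \int[mu]_y (hB D y z * (k y * hs D y)) = primitive (hUK D k) z.
Proof.
move=> nk; have nks := nnm_ks D nk; have nUa := nnm_hUa D.
have n1 : nnm (fun y : T => hB D y z * (k y * hs D y)) by exact: nnmM (nnm_hB_fst D z) nks.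
rewrite -lint_pos; last by move=> y y0; rewrite hs_le0// !mule0.
rewrite setIT.
have B0 y : (z <= y)%R -> hB D y z = 0.
  by move=> zy; rewrite /hB /lkernel set_itv_ge ?integral_set0// bnd_simp -leNgt.
have [z0|z0] := ltP 0%R z; last first.
  rewrite (primitive_le0 _ z0); apply: integral0_eq => y; rewrite /pos/= in_itv/= andbT => y0.
  by rewrite B0 ?mul0e// (le_trans z0)// ltW.
have b1 : (BLeft z <= BInfty R false)%O by rewrite bnd_simp.
rewrite (lint_split n1 (ltW z0) b1) [X in _ + X = _]integral0_eq ?adde0; last first.
  by move=> y; rewrite /= in_itv/= andbT => /ltW zy; rewrite B0// mul0e.
have := tonelli_lkernel 0%R z nUa nks.
rewrite /primitive /lebesgue_integral /hUK /hK /primitive /lebesgue_integral /lkernel => ->.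
by apply: eq_integral => y _; rewrite muleC.
Qed.

Lemma kernel_bound (k : R -> \bar R) : nnm (k : T -> \bar R) ->
  \int[mu]_(x in pos) (primitive (hUK D k) x `^ q * hw D x) <=
  (M `^ q)%:E * hnorm D p k `^ (q / p).
Proof.
move=> nk; apply: le_trans (hyp nk).
apply: le_integral_nng => x _; first by apply: mule_ge0; [exact: poweR_ge0|exact: (nhw D).2].
apply: (le_mulr ((nhw D).2 x)); apply: le_poweR; [exact: ltW| |exact: hUK_le_hT].
exact: primitive_ge0 (nnm_hUK D nk).
Qed.

Let Ico (n : R) : set T := `]0%R, n[%classic.
Let mIco n : measurable (Ico n) := measurable_litv _.

Lemma Ico_le0 n (f : R -> \bar R) x : (x <= 0)%R -> ((f : T -> \bar R) \_ (Ico n)) x = 0.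
Proof.
by move=> x0; rewrite patchE memNset// /Ico/= in_itv/= => /andP[/(le_lt_trans x0)]; rewrite ltxx.
Qed.

Lemma primitive_Ico n (f : R -> \bar R) y : (y <= n)%R ->
  primitive ((f : T -> \bar R) \_ (Ico n)) y = primitive f y.
Proof.
move=> yn; apply: eq_integral => x /set_mem/=; rewrite in_itv/= => /andP[x0 xy].
by rewrite patchE mem_set// /Ico/= in_itv/= x0 (lt_le_trans xy).
Qed.

Lemma itv_NyoE (y : R) : [set y' : R | (y' < y)%R] = `]-oo, y[%classic.
Proof. by rewrite set_itvNyo. Qed.

Lemma ktest_V_lt (be : R -> \bar R) : (forall x, (x <= 0)%R -> be x = 0) ->
  @ktest_V R be (fun y => [set y' | (y' < y)%R]) = primitive be.
Proof.
move=> b0; apply/funext => y; rewrite /ktest_V -lint_pos//.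
by rewrite /primitive /lebesgue_integral set_itv0o.
Qed.

Lemma rank_primitive_all (be : R -> \bar R) : nnm (be : T -> \bar R) ->
  (forall x, (x <= 0)%R -> be x = 0) -> rank mu (setT : set T) be (primitive be).
Proof.
move=> nbe b0 l l0; apply: le_trans (rank_primitive nbe l0).
by rewrite setTI lint_pos//; exact: lexx.
Qed.

(** [hB y z] grows as [y] moves left, so the kernel test is run with [b y] the points left of [y],
    [P = q] and [Q = p]. The measure [s] is cut to []0, n[] to be finite, which leaves [hS]
    unchanged up to [n]. *)
Lemma hT2_lower : hT2 D p q <= (lower_const q p * M)%:E.
Proof.
have nw : nnm ((hw D : T -> \bar R) \_ (pos : set T)) by exact: (nnm_patch mpos (nhw D)).
pose be n := (hs D : T -> \bar R) \_ (Ico n).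
have nbe n : nnm (be n : T -> \bar R) by exact: (nnm_patch (mIco n) (nhs D)).
have be0 n x : (x <= 0)%R -> be n x = 0 by exact: Ico_le0.
have nN : nnm (fun v : T * T => hB D v.1 v.2) by exact: nnm_lkernel (nnm_hUa D).
have mb y : measurable ([set y' | (y' < y)%R] : set T) by rewrite itv_NyoE; exact: measurable_litv.
have bN y y' z : [set y' | (y' < y)%R] y' -> hB D y z <= hB D y' z.
  by move=> /= /ltW yy'; exact: le_hB.
have nV n : nnm (@ktest_V R (be n) (fun y => [set y' | (y' < y)%R]) : T -> \bar R).
  by rewrite ktest_V_lt; [exact: nnm_primitive|exact: be0].
have rkV n : rank mu (setT : set T) (be n) (@ktest_V R (be n) (fun y => [set y' | (y' < y)%R])).
  by rewrite ktest_V_lt; [apply: rank_primitive_all; [exact: nbe|exact: be0]|exact: be0].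
have boo n : \int[mu]_y be n y < +oo by rewrite -integral_mkcond; exact: hs_oo.
have bnd n (f : T -> \bar R) : nnm f -> (exists c : R, forall y, f y <= c%:E) ->
  \int[mu]_z ((\int[mu]_y (hB D y z * (f y * be n y))) `^ q * ((hw D : T -> \bar R) \_ (pos : set T)) z) <=
  (M `^ q)%:E * (\int[mu]_y (f y `^ p * be n y)) `^ (q / p).
  move=> nf _; have nk : nnm (f \_ (Ico n)) by exact: (nnm_patch (mIco n) nf).
  have := kernel_bound nk.
  have -> : hnorm D p (f \_ (Ico n)) = \int[mu]_y (f y `^ p * be n y).
    rewrite /hnorm -[RHS]lint_pos; last by move=> x x0; rewrite be0// mule0.
    rewrite setIT; apply: eq_integral => y _; rewrite /be !patchE; case: ifP => // _.
    by rewrite mule0 poweR0r ?mul0e// gt_eqF.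
  apply: le_trans; rewrite [leRHS]integral_mkcond; apply: le_integral_nng => z _.
    by apply: mule_ge0; [exact: poweR_ge0|exact: nw.2].
  rewrite !patchE; case: ifP => _; last by rewrite mule0.
  apply: (le_mulr ((nhw D).2 z)); rewrite -(hUK_kernel z nk).
  rewrite (_ : \int[mu]_y _ = \int[mu]_y (hB D y z * ((f \_ (Ico n)) y * hs D y))); first exact: lexx.
  by apply: eq_integral => y _; rewrite /be !patchE; case: ifP => // _; rewrite mul0e mule0.
have NE y : (0 <= y)%R -> ktest_N mu q ((hw D : T -> \bar R) \_ (pos : set T)) (fun v : T * T => hB D v.1 v.2) y = hOm D q y.
  move=> y0; rewrite -(hOm_pos q1 D y0) [RHS]integral_mkcond /ktest_N; apply: eq_integral => z _ /=.
  by rewrite !patchE; case: ifP => // _; rewrite mule0.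
have [pq|qp] := leP p q.
  rewrite /lower_const pq mul1r /hT2 pq.
  apply: ge_ereal_sup => _ [y + <-]; rewrite /= in_itv/= andbT => y0.
  have := @ktest_le R _ T mu q p M (be y) _ _ _ q1 p1 M0 (nbe y) nw nN mb bN (nV y) (boo y) (bnd y) y.
  rewrite (NE y (ltW y0)) ktest_V_lt; last exact: be0.
  by rewrite primitive_Ico.
have qp' : (p <= q)%R = false by rewrite leNgt qp.
have r0 : (0 < r)%R := rexp_gt0 q0 qp.
rewrite /lower_const qp'; set C := (_ `^ (r / q))%R.
have C0 : (0 < C)%R by rewrite powR_gt0// invr_gt0 !powR_gt0.
rewrite /hT2 qp'.
have I0 : 0 <= \int[mu]_(t in pos) (hS D t `^ (r / q') * hs D t * hOm D q t `^ (r / q)).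
  apply: integral_nng => t _; apply: mule_ge0; last exact: poweR_ge0.
  by apply: mule_ge0; [exact: poweR_ge0|exact: (nhs D).2].
have h : \int[mu]_(t in pos) (hS D t `^ (r / q') * hs D t * hOm D q t `^ (r / q)) <= C%:E * (M `^ r)%:E.
  have nF : nnm (fun t : T => hS D t `^ (r / q') * hs D t * hOm D q t `^ (r / q)).
    exact: nnmM (nnmM (nnm_poweR _ (nnm_hS D)) (nhs D)) (nnm_poweR _ (nnm_hOm D q1)).
  apply: (integral_unbounded_le nF mpos) => n; rewrite -set_itv0o.
  have := @ktest_lt R _ T mu q p M (be n) _ _ _ q1 p1 (nbe n) nw nN mb bN (nV n) (rkV n) (boo n) (bnd n) qp.
  apply: le_trans; rewrite [leLHS]integral_mkcond; apply: le_integral_nng => y _.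
    rewrite patchE; case: ifP => // _; apply: mule_ge0; last exact: poweR_ge0.
    by apply: mule_ge0; [exact: poweR_ge0|exact: (nhs D).2].
  rewrite patchE; case: ifPn => [/set_mem/=|_]; last first.
    apply: mule_ge0; last exact: (nbe n).2.
    by apply: mule_ge0; exact: poweR_ge0.
  move=> yn; have [y0' yn'] := in_oo yn.
  rewrite (NE y (ltW y0')) ktest_V_lt; last exact: be0.
  rewrite (primitive_Ico _ (ltW yn')) /be patchE (mem_set (yn : Ico n y)) muleAC; exact: lexx.
apply: (@le_trans _ _ ((C%:E * (M `^ r)%:E) `^ r^-1)).
  by apply: le_poweR => //; rewrite invr_ge0 ltW.
rewrite -EFinM poweR_EFin powRM ?powR_ge0 ?(ltW C0)// -powRrM mulfV ?gt_eqF// powRr1//.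
Qed.

Lemma nd_sup_Ico (f : R -> \bar R) z : 0 <= f z -> ((z <= 0)%R -> f z = 0) ->
  nd_sup (fun m : nat => ((f : T -> \bar R) \_ (Ico m%:R)) z) (f z).
Proof.
move=> f0 fz; have [z0|z0] := leP z 0%R.
  rewrite fz//; under [X in nd_sup X]eq_fun do rewrite Ico_le0//.
  exact: nd_sup_cst.
have h m : (z < m%:R)%R -> ((f : T -> \bar R) \_ (Ico m%:R)) z = f z.
  by move=> zm; rewrite patchE mem_set// /Ico/= in_itv/= z0.
split => [m|m n mn|].
- by rewrite patchE; case: ifP.
- rewrite patchE; case: ifPn => [/set_mem|_]; last by rewrite patchE; case: ifP.
  by rewrite /Ico/= in_itv/= => /andP[_ zm]; rewrite h// (lt_le_trans zm)// ler_nat.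
- apply: ereal_sup_ubound; exists (Num.trunc z).+1 => //; apply: h; exact: truncnS_gt.
Qed.

(** Boundedness of the adjoint, by testing with [k = Ts^(p'-1)], for which [int k^p s] and
    [int k Ts s] agree. Cutting [Ts] at height [m] and to []0, m[] makes this quantity finite, so
    that [poweR_absorb] applies. *)
Lemma dual_kernel n (f : T -> \bar R) : nnm f ->
  \int[mu]_z ((\int[mu]_y (hB D z y * (f y * ((hw D : T -> \bar R) \_ (Ico n)) y))) `^ p' * hs D z) <=
  (M `^ p')%:E * (\int[mu]_y (f y `^ q' * ((hw D : T -> \bar R) \_ (Ico n)) y)) `^ (p' / q').
Proof.
move=> nf; have [be beE] : exists be : T -> \bar R, be = (hw D : T -> \bar R) \_ (Ico n) by eexists.
rewrite -beE; have nbe : nnm be by rewrite beE; exact: (nnm_patch (mIco n) (nhw D)).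
have nfb : nnm (fun y => f y * be y) by exact: nnmM nf nbe.
have nv : nnm (fun v : T * T => hB D v.1 v.2 * (f v.2 * be v.2)).
  exact: nnmM (nnm_lkernel (nnm_hUa D)) (nnm_snd nfb).
pose Ts z := \int[mu]_y (hB D z y * (f y * be y)).
have nTs : nnm (Ts : T -> \bar R).
  split; last by move=> z; apply: integral_nng => y _; exact: nv.2 (z, y).
  exact: (@measurable_fun_fubini_tonelli_F _ _ T T R mu _ nv.1 nv.2).
set I := \int[mu]_y (f y `^ q' * be y).
have I0 : 0 <= I by apply: integral_nng => y _; apply: mule_ge0; [exact: poweR_ge0|exact: nbe.2].
have ME : 0 <= M%:E by rewrite lee_fin.
have H0 : 0 <= I `^ q'^-1 by exact: poweR_ge0.
have X0 : 0 <= M%:E * I `^ q'^-1 by exact: mule_ge0.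
have -> : (M `^ p')%:E * I `^ (p' / q') = (M%:E * I `^ q'^-1) `^ p'.
  by rewrite (poweRM _ ME H0) -poweRrM poweR_EFin [(q'^-1 * p')%R]mulrC.
have nmin m : nnm (fun z : T => mine (Ts z) m%:R%:E).
  split; last by move=> z; rewrite le_min nTs.2 lee_fin ler0n.
  by apply: measurable_mine; [exact: nTs.1|exact: measurable_cst].
have p'00 : (0 <= p')%R := ltW p'0.
apply: (@nd_integral_le _ _ _ mu setT (fun (m : nat) z => mine (Ts z) m%:R%:E `^ p' *
  ((hs D : T -> \bar R) \_ (Ico m%:R)) z)).
- exact: measurableT.
- move=> m; exact: nnmM (nnm_poweR _ (nmin m)) (nnm_patch (mIco m%:R) (nhs D)).
- move=> z _; apply: mule_ge0; [exact: poweR_ge0|exact: (nhs D).2].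
- move=> z _; apply: nd_sup_mul; last exact: poweR_ge0.
    exact: (nd_sup_poweR p'00 (nTs.2 z) (nd_sup_min (nTs.2 z))).
  by apply: nd_sup_Ico; [exact: (nhs D).2|exact: hs_le0].
move=> m; set J := \int[mu]_z _.
pose k : T -> \bar R := (fun z => mine (Ts z) m%:R%:E `^ (p' - 1)) \_ (Ico m%:R).
have nk : nnm k by exact: (nnm_patch (mIco m%:R) (nnm_poweR _ (nmin m))).
have J0 : 0 <= J.
  apply: integral_nng => z _; apply: mule_ge0; first exact: poweR_ge0.
  exact: (nnm_patch (mIco m%:R) (nhs D)).2.
have Joo : J < +oo.
  apply: (@le_lt_trans _ _ (\int[mu]_z (m%:R%:E `^ p' * ((hs D : T -> \bar R) \_ (Ico m%:R)) z))).
    apply: le_integral_nng => z _.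
      by apply: mule_ge0; [exact: poweR_ge0|exact: (nnm_patch (mIco m%:R) (nhs D)).2].
    apply: le_mulr; first exact: (nnm_patch (mIco m%:R) (nhs D)).2.
    by apply: le_poweR; [exact: p'00|exact: (nmin m).2|rewrite ge_min lexx orbT].
  rewrite (integralMl mu measurableT (poweR_ge0 _ _) (nnm_patch (mIco m%:R) (nhs D))) -integral_mkcond.
  by rewrite poweR_EFin; apply: lte_mul_pinfty; [rewrite lee_fin powR_ge0|by []|exact: hs_oo].
apply: (poweR_absorb p1 J0 Joo X0).
have LJ : hnorm D p k = J.
  rewrite /hnorm -[RHS]lint_pos; last by move=> z z0; rewrite Ico_le0// mule0.
  rewrite setIT; apply: eq_integral => z _; rewrite /k !patchE; case: ifP => _.
    by rewrite -poweRrM conjexpB1.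
  by rewrite mule0 poweR0r ?mul0e// gt_eqF.
have nks : nnm (fun z : T => k z * hs D z) by exact: nnm_ks.
apply: (@le_trans _ _ (\int[mu]_z (k z * hs D z * Ts z))).
  apply: le_integral_nng => z _.
    by apply: mule_ge0; [exact: poweR_ge0|exact: (nnm_patch (mIco m%:R) (nhs D)).2].
  rewrite /k !patchE; case: ifP => _; last by rewrite mule0 !mul0e.
  have m0 := (nmin m).2 z; rewrite muleAC; apply: (le_mulr ((nhs D).2 z)).
  rewrite -[X in _ `^ X](subrK 1%R) -(poweR_addr m0 pm0 ltr01) (poweRe1 m0).
  by apply: (le_mull (poweR_ge0 _ _)); rewrite ge_min lexx.
have -> : \int[mu]_z (k z * hs D z * Ts z) = \int[mu]_y (f y * be y * primitive (hUK D k) y).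
  have nB2 z : nnm (fun y : T => hB D z y * (f y * be y)) by exact: nnmM (nnm_hB_snd D z) nfb.
  have nB1 y : nnm (fun z : T => hB D z y * (k z * hs D z)) by exact: nnmM (nnm_hB_fst D y) nks.
  have nvv : nnm (fun v : T * T => k v.1 * hs D v.1 * (hB D v.1 v.2 * (f v.2 * be v.2))).
    exact: nnmM (nnm_fst nks) nv.
  transitivity (\int[mu]_z \int[mu]_y (k z * hs D z * (hB D z y * (f y * be y)))).
    by apply: eq_integral => z _; rewrite (integralMl mu measurableT (nks.2 z) (nB2 z)).
  apply: (etrans (@fubini_tonelli _ _ T T R mu mu _ nvv.1 nvv.2)).
  apply: eq_integral => y _; rewrite -(hUK_kernel y nk) -(integralMl mu measurableT (nfb.2 y) (nB1 y)).
  by apply: eq_integral => z _ /=; rewrite muleCA [RHS]muleCA; congr (_ * _); exact: muleC.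
pose f1 : T -> \bar R := f \_ (Ico n).
have nf1 : nnm f1 by exact: (nnm_patch (mIco n) nf).
have nF : nnm (primitive (hUK D k) : T -> \bar R) by exact: nnm_primitive (nnm_hUK D nk).
have -> : \int[mu]_y (f y * be y * primitive (hUK D k) y) =
    \int[mu]_(y in pos) (primitive (hUK D k) y * f1 y * hw D y).
  rewrite -lint_pos; last by move=> y y0; rewrite beE Ico_le0// mule0 mul0e.
  rewrite setIT; apply: eq_integral => y _; rewrite beE /f1 !patchE; case: ifP => _.
    by rewrite muleC muleA.
  by rewrite !mule0 !mul0e.
apply: le_trans (weighted_hoelder mu q1 mpos nF nf1 (nhw D)) _.
have -> : \int[mu]_(y in pos) (f1 y `^ q' * hw D y) = I.
  rewrite /I -[RHS]lint_pos; last by move=> y y0; rewrite beE Ico_le0// mule0.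
  rewrite setIT; apply: eq_integral => y _; rewrite beE /f1 !patchE; case: ifP => _ //.
  by rewrite mule0 poweR0r ?mul0e// gt_eqF.
rewrite [leRHS]muleAC; apply: (le_mulr H0).
have := kernel_bound nk; rewrite LJ => h.
have i0 : 0 <= \int[mu]_(x in pos) (primitive (hUK D k) x `^ q * hw D x).
  by apply: integral_nng => y _; apply: mule_ge0; [exact: poweR_ge0|exact: (nhw D).2].
have qV0 : (0 <= q^-1)%R by rewrite invr_ge0 ltW.
apply: le_trans (le_poweR qV0 i0 h) _.
have MqE : 0 <= (M `^ q)%:E by rewrite lee_fin powR_ge0.
rewrite (poweRM _ MqE (poweR_ge0 _ _)) poweR_EFin -powRrM mulfV ?gt_eqF// powRr1// -poweRrM.
by rewrite (_ : q / p * q^-1 = p^-1)%R//; field; rewrite !gt_eqF.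
Qed.

Lemma ktest_V_gt (be : R -> \bar R) : @ktest_V R be (fun y => [set y' | (y < y')%R]) = tail be.
Proof.
by apply/funext => y; rewrite /ktest_V /tail -set_itvoy.
Qed.

Lemma rank_tail_all (be : R -> \bar R) : nnm (be : T -> \bar R) ->
  (forall x, (x <= 0)%R -> be x = 0) -> rank mu (setT : set T) be (tail be).
Proof.
move=> nbe b0 l l0; apply: le_trans (rank_tail nbe l0).
by rewrite setTI lint_pos//; exact: lexx.
Qed.

(** The kernel test in dual form, with exponents [p'] and [q'] and tails of [w], for any [I]
    dominated by a kernel that grows with [y]; it serves both [hT1] and [hT4]. Passing to the
    conjugates exchanges the order of the exponents and preserves [r]. *)
Lemma hardy_tail_lower d2 (T2 : measurableType d2) (m2 : {sigma_finite_measure set T2 -> \bar R})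
    (alpha : T2 -> \bar R) (N : T * T2 -> \bar R) (I : R -> \bar R) (L : R) :
  (0 <= L)%R -> nnm alpha -> nnm N -> nnm (I : T -> \bar R) ->
  (forall (y y' : R) z, (y < y')%R -> N (y, z) <= N (y', z)) ->
  (forall y : R, (0 < y)%R -> I y <= ktest_N m2 p' alpha N y) ->
  (forall (n : R) (f : T -> \bar R), nnm f -> (exists c : R, forall y, f y <= c%:E) ->
    \int[m2]_z ((\int[mu]_y (N (y, z) * (f y * ((hw D : T -> \bar R) \_ (Ico n)) y))) `^ p' * alpha z) <=
    (L `^ p')%:E * (\int[mu]_y (f y `^ q' * ((hw D : T -> \bar R) \_ (Ico n)) y)) `^ (p' / q')) ->
  hardy_const p q mu pos (hw D) I (hW D) <= (lower_const p' q' * L)%:E.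
Proof.
move=> L0 na nN nI bN NE bnd.
pose be n := (hw D : T -> \bar R) \_ (Ico n).
have nbe n : nnm (be n : T -> \bar R) by exact: (nnm_patch (mIco n) (nhw D)).
have be0 n x : (x <= 0)%R -> be n x = 0 by exact: Ico_le0.
have mb y : measurable ([set y' | (y < y')%R] : set T) by rewrite -set_itvoy; exact: measurable_litv.
have nV n : nnm (@ktest_V R (be n) (fun y => [set y' | (y < y')%R]) : T -> \bar R).
  by rewrite ktest_V_gt; exact: nnm_tail.
have rkV n : rank mu (setT : set T) (be n) (@ktest_V R (be n) (fun y => [set y' | (y < y')%R])).
  by rewrite ktest_V_gt; apply: rank_tail_all; [exact: nbe|exact: be0].
have boo n : \int[mu]_y be n y < +oo by rewrite -integral_mkcond; exact: hw_oo.
have ndV (y : R) : (0 < y)%R -> nd_sup (fun n : nat => tail (be n%:R) y) (hW D y).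
  move=> y0; apply: nd_sup_integral; [exact: measurable_litv|by move=> m; exact: nbe|by move=> z _; exact: (nhw D).2|].
  move=> z; rewrite /= in_itv/= andbT => yz; apply: nd_sup_Ico; first exact: (nhw D).2.
  by rewrite leNgt (lt_trans y0).
have [pq|qp] := leP p q.
  have q'p' : (q' <= p')%R.
    move: pq; rewrite le_eqVlt => /predU1P[->|pq]; first exact: lexx.
    exact: ltW (conjexp_lt p1 pq).
  rewrite /lower_const q'p' mul1r /hardy_const pq.
  apply: ge_ereal_sup => _ [y + <-]; rewrite /pos/= in_itv/= andbT => y0.
  have W0 : 0 <= hW D y by exact: (nnm_hW D).2.
  have qV0 : (0 <= q^-1)%R by rewrite invr_ge0 ltW.
  have [_ _ h] := nd_sup_mul (nd_sup_cst (poweR_ge0 (I y) p'^-1))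
     (nd_sup_poweR qV0 W0 (ndV y y0)) (poweR_ge0 _ _).
  apply: le_trans h _; apply: ge_ereal_sup => _ [n _ <-].
  have := @ktest_le R _ T2 m2 p' q' L (be n%:R) _ _ _ p'1 q'1 L0 (nbe n%:R) na nN mb bN (nV n%:R) (boo n%:R) (bnd n%:R) y.
  rewrite ktest_V_gt conjexpK muleC; apply: le_trans; apply: (le_mulr (poweR_ge0 _ _)).
  by apply: le_poweR (NE y y0); [rewrite invr_ge0 ltW|exact: nI.2].
have qp' : (p <= q)%R = false by rewrite leNgt qp.
have p'q' : (p' < q')%R by exact: conjexp_lt.
have p'q'' : (q' <= p')%R = false by rewrite leNgt p'q'.
have r0 : (0 < r)%R := rexp_gt0 q0 qp.
rewrite /lower_const p'q'' (rexp_conjexp p q) (conjexpK p); set C := (_ `^ (r / p'))%R.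
have C0 : (0 < C)%R by rewrite powR_gt0// invr_gt0 !powR_gt0.
rewrite /hardy_const qp'.
have rp0 : (0 <= r / p)%R by rewrite divr_ge0 ?ltW.
have I0 : 0 <= \int[mu]_(t in pos) (I t `^ (r / p') * hW D t `^ (r / p) * hw D t).
  apply: integral_nng => t _; apply: mule_ge0; last exact: (nhw D).2.
  by apply: mule_ge0; exact: poweR_ge0.
have h : \int[mu]_(t in pos) (I t `^ (r / p') * hW D t `^ (r / p) * hw D t) <= C%:E * (L `^ r)%:E.
  apply: (@nd_integral_le _ _ _ mu pos (fun (m : nat) z => I z `^ (r / p') *
    tail (be m%:R) z `^ (r / p) * be m%:R z) _ _ mpos).
  - move=> m; exact: nnmM (nnmM (nnm_poweR _ nI) (nnm_poweR _ (nnm_tail (nbe m%:R)))) (nbe m%:R).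
  - by move=> t _; apply: mule_ge0; [apply: mule_ge0; exact: poweR_ge0|exact: (nhw D).2].
  - move=> t; rewrite /pos/= in_itv/= andbT => t0.
    apply: nd_sup_mul; last by apply: mule_ge0; exact: poweR_ge0.
      apply: nd_sup_mul; last exact: poweR_ge0.
        exact: (nd_sup_cst (poweR_ge0 _ _)).
      exact: (nd_sup_poweR rp0 ((nnm_hW D).2 t) (ndV t t0)).
    by apply: nd_sup_Ico; [exact: (nhw D).2|rewrite leNgt t0].
  move=> n; have := @ktest_lt R _ T2 m2 p' q' L (be n%:R) _ _ _ p'1 q'1 (nbe n%:R) na nN mb bN (nV n%:R) (rkV n%:R) (boo n%:R) (bnd n%:R) p'q'.
  rewrite (rexp_conjexp p q) (conjexpK p) -/C => hn.
  apply: le_trans hn; rewrite [leLHS]integral_mkcond.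
  apply: le_integral_nng => y _.
    rewrite patchE; case: ifP => // _; apply: mule_ge0; last exact: (nbe n%:R).2.
    by apply: mule_ge0; exact: poweR_ge0.
  rewrite patchE; case: ifPn => [/set_mem|_]; last first.
    apply: mule_ge0; last exact: (nbe n%:R).2.
    by apply: mule_ge0; exact: poweR_ge0.
  rewrite /pos/= in_itv/= andbT => y0.
  rewrite ktest_V_gt [X in _ <= X * _]muleC; apply: (le_mulr ((nbe n%:R).2 y)).
  apply: (le_mulr (poweR_ge0 _ _)); apply: le_poweR (NE y y0); last exact: nI.2.
  by rewrite divr_ge0 ?ltW.
apply: (@le_trans _ _ ((C%:E * (L `^ r)%:E) `^ r^-1)).
  by apply: le_poweR => //; rewrite invr_ge0 ltW.
rewrite -EFinM poweR_EFin powRM ?powR_ge0 ?(ltW C0)// -powRrM mulfV ?gt_eqF// powRr1//.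
Qed.

Lemma hT1_lower : hT1 D p q <= (lower_const p' q' * M)%:E.
Proof.
have nB := nnm_lkernel (nnm_hUa D).
have nN : nnm (fun v : T * T => hB D v.2 v.1).
  split => [|v]; last exact: nB.2 (v.2, v.1).
  have ms : measurable_fun setT (fun v : T * T => (v.2, v.1)).
    exact: (measurable_fun_pair measurable_snd measurable_fst).
  exact (measurableT_comp nB.1 ms).
apply: (hardy_tail_lower (m2 := mu) M0 (nhs D) nN (nnm_hI D p1)).
- by move=> y y' z /ltW yy'; exact: le_hB.
- move=> y y0; have n1 : nnm (fun z : T => hB D z y `^ p' * hs D z).
    exact: nnmM (nnm_poweR _ (nnm_hB_fst D y)) (nhs D).
  apply: (@le_trans _ _ (\int[mu]_(z in `]0%R, y[) (hB D z y `^ p' * hs D z))).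
    by apply: le_integral_nng => z _; [exact: (nnm_hI_integrand D p y).2|rewrite muleC].
  by apply: subset_integral_nng => [z _|//]; exact: n1.2.
- by move=> n f nf _; exact: dual_kernel.
Qed.

End lower.

(** * Crossing points of dyadic levels *)

Section crossing_points.
Context {R : realType}.
Variables (D : hdata R) (p : R).
Hypotheses (p1 : (1 < p)%R) (phoo : hphi_inf D p < +oo).

Lemma hpt_tau_ex m : exists t : R, (exists2 t0, (0 < t0)%R & (lev m)%:E < hpt D p t0) ->
  [/\ (0 < t)%R, hpt D p t = (lev m)%:E, (lev m)%:E <= hg D p t &
    forall z, (t < z)%R -> hpt D p z < (lev m)%:E].
Proof.
have [[t0 t00 ht]|h] := pselect (exists2 t, (0 < t)%R & (lev m)%:E < hpt D p t); last by exists 0%R.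
have [c [c0 cE gE hc]] := hpt_cross p1 phoo (lev_gt0 m) t00 ht.
by exists c => _; split => //; rewrite gE leeDl// hphi_inf_ge0.
Qed.

(** The levels that [hpt] exceeds strictly, and hence crosses. *)
Definition hpt_occ m : bool := `[< exists2 t0, (0 < t0)%R & (lev m)%:E < hpt D p t0 >].
(* The last point at which [hpt] is at least [lev m]; there [hphi] is attained by [hg]. *)
Definition hpt_tau m : R := sval (cid (hpt_tau_ex m)).

Lemma hpt_tauP m : hpt_occ m ->
  [/\ (0 < hpt_tau m)%R, hpt D p (hpt_tau m) = (lev m)%:E, (lev m)%:E <= hg D p (hpt_tau m) &
    forall z, (hpt_tau m < z)%R -> hpt D p z < (lev m)%:E].
Proof. by move=> /asboolP h; exact: (svalP (cid (hpt_tau_ex m))). Qed.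

Lemma lt_hpt_tau m (t : R) : (0 < t)%R -> (lev m)%:E < hpt D p t -> hpt_occ m /\ (t < hpt_tau m)%R.
Proof.
move=> t0 h; have o : hpt_occ m by apply/asboolP; exists t.
split => //; have [_ tE _ hz] := hpt_tauP o.
rewrite ltNge; apply/negP; rewrite le_eqVlt => /predU1P[E|/hz].
  by move: h; rewrite -E tE ltxx.
by move=> /(lt_trans h); rewrite ltxx.
Qed.

Lemma le_hpt_tau m (t : R) : hpt_occ m -> (t <= hpt_tau m)%R -> (lev m)%:E <= hpt D p t.
Proof. by move=> /hpt_tauP[_ <- _ _]; exact: hpt_anti. Qed.

End crossing_points.

Lemma mule_cancel {R : realType} (x y z t : \bar R) : x * (y * z * t) = (x * z) * (y * t).
Proof. by rewrite (AC (1*(3)) ((1*3)*(2*4))). Qed.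

(** * Lower bounds from indicators of initial intervals *)

Section lower_phi.
Context {R : realType}.
Local Notation T := (lebesgueR R).
Local Notation mu := (@completed_lebesgue_measure R).
Variables (p q : R).
Hypotheses (p1 : (1 < p)%R) (q1 : (1 < q)%R).
Local Notation p' := (conjexp p).
Let pos : set R := `]0%R, +oo[%classic.
Let p0 : (0 < p)%R := lt_trans ltr01 p1.
Let q0 : (0 < q)%R := lt_trans ltr01 q1.
Let p'0 : (0 < p')%R := conjexp_gt0 p1.
Let p'1 : (1 < p')%R := conjexp_gt1 p1.
Let q00 : (0 <= q)%R := ltW q0.
Let p'V0 : (0 <= p'^-1)%R. Proof. by rewrite invr_ge0 ltW. Qed.
Let pVp : (0 < p^-1)%R. Proof. by rewrite invr_gt0. Qed.
Let p'Vp : (0 < p'^-1)%R. Proof. by rewrite invr_gt0. Qed.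
Let qV0 : (0 <= q^-1)%R. Proof. by rewrite invr_ge0 ltW. Qed.
Let mpos : measurable (pos : set T) := measurable_litv _.
Variables (D : hdata R) (M : R).
Hypothesis M0 : (0 <= M)%R.
Hypothesis hyp : hbound p q D M.
Let ME : 0 <= M%:E. Proof. by rewrite lee_fin. Qed.

Lemma nnm_hR (k : R -> \bar R) : nnm (k : T -> \bar R) -> nnm (hR D k : T -> \bar R).
Proof.
move=> nk; apply: nnm_sup_from => u; apply: mule_ge0; first by rewrite lee_fin hU_ge0.
exact: (nnm_hK D nk).2.
Qed.

(* The indicator of [(0, tau)] is a test function. *)
Lemma hg_lower (x tau : R) : (0 < x)%R -> (x <= tau)%R ->
  hg D p tau `^ p'^-1 * hAt D q x `^ q^-1 <= M%:E.
Proof.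
move=> x0 xtau; have tau0 := lt_le_trans x0 xtau.
have nAq := nnm_hAq D q; have At0 : 0 <= hAt D q x by exact: (nnm_hAt D q).2.
pose k : T -> \bar R := (fun=> 1) \_ (`]0%R, tau[%classic : set T).
have nk : nnm k.
  by apply: nnm_patch; [exact: measurable_litv|exact: (nnm_cst lee01)].
have KS : hK D k tau = hS D tau.
  apply: eq_integral => y /set_mem yt; rewrite /k patchE (mem_set (yt : (`]0%R, tau[%classic : set T) y)).
  exact: mul1e.
have LS : hnorm D p k = hS D tau.
  rewrite /hnorm /hS /primitive /lebesgue_integral.
  rewrite -[RHS](lint_pos (`]0%R, tau[%classic) (hs_le0 D)).
  rewrite [RHS]integral_mkcondr; apply: eq_integral => y _; rewrite /k !patchE; case: ifP => _.
    by rewrite poweR1r mul1e.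
  by rewrite poweR0r ?mul0e// gt_eqF.
have U0 : 0 <= (hU D tau)%:E by rewrite lee_fin hU_ge0.
have S0 : 0 <= hS D tau by exact: (nnm_hS D).2.
have Sp : 0 < hS D tau by exact: hs_gt0.
have Soo : hS D tau < +oo by exact: hs_oo.
pose c := (hU D tau)%:E * hS D tau; have c0 : 0 <= c by exact: mule_ge0.
have Rk t : (t <= tau)%R -> c <= hR D k t.
  by move=> tt; rewrite /c -KS; exact: (sup_from_ge (fun tau => (hU D tau)%:E * hK D k tau)).
have Tk y : (y <= tau)%R -> c * hA D y <= hT D k y.
  move=> yt; rewrite /hA /primitive /lebesgue_integral -(integralMl mu (measurable_litv _) c0 (nha D)).
  apply: le_integral_nng => t; first by move=> _; apply: mule_ge0 => //; exact: (nha D).2.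
  by move=> /in_oo[_ ty]; apply: (le_mulr ((nha D).2 t)); apply: Rk; exact: le_trans (ltW ty) yt.
have h : c `^ q * hAt D q x <= (M `^ q)%:E * hS D tau `^ (q / p).
  rewrite -LS; apply: le_trans (hyp nk).
  rewrite /hAt /primitive /lebesgue_integral -(integralMl mu (measurable_litv _) (poweR_ge0 _ _) nAq).
  apply: (@le_trans _ _ (\int[mu]_(y in `]0%R, x[) (hT D k y `^ q * hw D y))); last first.
    apply: subset_integral_nng => [y _|y /=]; first by apply: mule_ge0; [exact: poweR_ge0|exact: (nhw D).2].
    by rewrite /pos/= !in_itv/= andbT => /andP[].
  apply: le_integral_nng => y; first by move=> _; apply: mule_ge0; [exact: poweR_ge0|exact: nAq.2].
  move=> /in_oo[_ yx]; rewrite /hAq muleA; apply: (le_mulr ((nhw D).2 y)).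
  rewrite -(poweRM _ c0 ((nnm_hA D).2 y)); apply: le_poweR q00 _ _.
    by apply: mule_ge0 => //; exact: (nnm_hA D).2.
  by apply: Tk; exact: le_trans (ltW yx) xtau.
apply: (poweR_le_inv q0 _ ME); first by apply: mule_ge0; exact: poweR_ge0.
rewrite (poweRM _ (poweR_ge0 _ _) (poweR_ge0 _ _)) (poweRVK At0 (lt0r_neq0 q0)) poweR_EFin.
(* [hU * hS] is [hg^(1/p')] times [hS^(1/p)], the norm of the indicator. *)
have cE : hg D p tau `^ p'^-1 * hS D tau `^ p^-1 = c.
  rewrite /hg (poweRM _ (poweR_ge0 _ _) S0) (poweRK U0 (lt0r_neq0 p'0)) -muleA.
  by rewrite (poweR_addr S0 p'Vp pVp) addrC conjexp_add (poweRe1 S0).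
have qp : (0 < q / p)%R by rewrite divr_gt0.
move: h; rewrite -cE (poweRM _ (poweR_ge0 _ _) (poweR_ge0 _ _)) -[(hS D tau `^ _) `^ q]poweRrM.
rewrite [(p^-1 * q)%R]mulrC => h.
have SV : 0 <= hS D tau `^ (- (q / p)) by exact: poweR_ge0.
have := le_mull SV h; rewrite [X in X <= _]mule_cancel [X in _ <= X]muleCA.
by rewrite (poweR_inv_le1 _ Sp Soo) mule1 mul1e.
Qed.

Lemma hphi_lower (x : R) : (0 < x)%R -> hphi D p x `^ p'^-1 * hAt D q x `^ q^-1 <= M%:E.
Proof.
move=> x0; have c0 : 0 <= hAt D q x `^ q^-1 by exact: poweR_ge0.
rewrite muleC; apply: (mule_le_of_lt c0 ME) => l l0 lphi.
have l0E : 0 <= l%:E by rewrite lee_fin ltW.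
have : l%:E `^ p' < hphi D p x.
  rewrite ltNge; apply/negP => h; move: lphi; rewrite ltNge => /negP; apply.
  have := le_poweR p'V0 (hphi_ge0 D p x) h; by rewrite (poweRK l0E (lt0r_neq0 p'0)).
move=> /ereal_sup_gt[_ [tau + <-] ltau]; rewrite /= in_itv/= andbT => xtau.
apply: le_trans (hg_lower x0 xtau); rewrite muleC; apply: (le_mulr c0).
have := le_poweR p'V0 (poweR_ge0 _ _) (ltW ltau); by rewrite (poweRK l0E (lt0r_neq0 p'0)).
Qed.

(** Half of the mass of [w] on []0, x[] lies to the right of some [c > 0], where
    [hA >= hA c > 0]. *)
Lemma hAt_gt0 (x : R) : (0 < x)%R -> 0 < hAt D q x.
Proof.
move=> x0; have w0 := hw_gt0 D x0; have woo := hw_oo D x.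
have wE : primitive (hw D) x = (fine (primitive (hw D) x))%:E.
  by rewrite fineK// ge0_fin_numE// ltW.
move: w0; rewrite wE lte_fin => w0.
have l0 : (0 < fine (primitive (hw D) x) / 2)%R by rewrite divr_gt0.
have l1 : (fine (primitive (hw D) x) / 2)%:E < primitive (hw D) x by rewrite wE lte_fin half_lt.
have [c /andP[c0 cx] cE] := primitive_level (nhw D) l0 l1 woo.
have Ac : 0 < hA D c by exact: ha_gt0.
have Aq0 : 0 < hA D c `^ q by exact: poweR_gt0.
have kw : lkernel (hw D) c x = (fine (primitive (hw D) x) / 2)%:E.
  have := primitive_split (nhw D) (ltW c0) (ltW cx); rewrite wE cE.
  have := lkernel_ge0 c x (nhw D); case: (lkernel (hw D) c x) => [k| |]//= _ [E].
  by congr EFin; lra.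
apply: (@lt_le_trans _ _ (hA D c `^ q * lkernel (hw D) c x)).
  by apply: mule_gt0 => //; rewrite kw lte_fin.
rewrite /lkernel -(integralMl mu (measurable_litv _) (ltW Aq0) (nhw D)).
apply: (@le_trans _ _ (\int[mu]_(y in `]c, x[) hAq D q y)).
  apply: le_integral_nng => y; first by move=> _; apply: mule_ge0; [exact: ltW|exact: (nhw D).2].
  move=> /in_oo[cy _]; apply: (le_mulr ((nhw D).2 y)); apply: (le_poweR q00 (ltW Ac)).
  exact: le_primitive (nha D) (ltW cy).
apply: subset_integral_nng => [y _|]; first exact: (nnm_hAq D q).2.
by apply: subset_itvr; rewrite bnd_simp; exact: ltW.
Qed.

(** [hphi 1 = +oo] would contradict [hphi_lower], as [hAt 1 > 0]. *)
Lemma hphi_inf_lower : hphi_inf D p < +oo.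
Proof.
apply: (@le_lt_trans _ _ (hphi D p 1%R)); first exact: hphi_inf_le.
rewrite ltey; apply/eqP => h; have := hphi_lower ltr01; rewrite h.
have Ap : 0 < hAt D q 1%R `^ q^-1 by apply: poweR_gt0; exact: hAt_gt0.
by rewrite poweRyr ?gt_eqF// gt0_mulye// leye_eq.
Qed.

(** This is [hphi_lower] as [x] tends to infinity, with [hphi x] bounded below by its limit. *)
Lemma hT5_lower : hT5 D p q <= M%:E.
Proof.
rewrite /hT5; set c := hphi_inf D p `^ p'^-1; have c0 : 0 <= c by exact: poweR_ge0.
rewrite muleC; apply: (mule_le_of_lt c0 ME) => l l0 lA.
have l0E : 0 <= l%:E by rewrite lee_fin ltW.
have [x x0 lx] : exists2 x, (0 < x)%R & l%:E `^ q < hAt D q x.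
  apply: contrapT => h; move: lA; rewrite ltNge => /negP; apply.
  have : \int[mu]_(y in pos) hAq D q y <= l%:E `^ q.
    apply: (integral_unbounded_le (nnm_hAq D q) mpos) => x; rewrite -set_itv0o.
    rewrite leNgt; apply/negP => lx; apply: h; exists x => //.
    rewrite ltNge; apply/negP => x0; move: lx; rewrite set_itv_ge; last by rewrite bnd_simp -leNgt.
    by rewrite integral_set0 ltNge poweR_ge0.
  move=> /(le_poweR qV0 (integral_nng _ _)); rewrite (poweRK l0E (lt0r_neq0 q0)); apply.
  by move=> y _; exact: (nnm_hAq D q).2.
apply: le_trans (hphi_lower x0); apply: lee_pmul => //.
  by apply: (le_poweR p'V0 (hphi_inf_ge0 D p)); exact: hphi_inf_le.
by have := le_poweR qV0 (poweR_ge0 _ _) (ltW lx); rewrite (poweRK l0E (lt0r_neq0 q0)).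
Qed.

Let phoo := hphi_inf_lower.

Lemma hT3_le_lower : (p <= q)%R -> hT3 D p q <= M%:E.
Proof.
move=> pq; rewrite /hT3 /hardy_const pq; apply: ge_ereal_sup => _ [x + <-].
rewrite /= in_itv/= andbT => x0; apply: le_trans (hphi_lower x0).
apply: (le_mulr (poweR_ge0 _ _)); apply: (le_poweR p'V0 (hpt_ge0 phoo x)).
by rewrite (hphi_hpt phoo) leeDl// hphi_inf_ge0.
Qed.

End lower_phi.

(** * The discrete dual inequality *)

Section dual_sum.
Context {R : realType}.
Local Notation T := (lebesgueR R).
Local Notation mu := (@completed_lebesgue_measure R).
Variables (p q : R).
Hypotheses (p1 : (1 < p)%R) (q1 : (1 < q)%R).
Local Notation p' := (conjexp p).
Local Notation q' := (conjexp q).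
Let pos : set R := `]0%R, +oo[%classic.
Let p0 : (0 < p)%R := lt_trans ltr01 p1.
Let q0 : (0 < q)%R := lt_trans ltr01 q1.
Let p'0 : (0 < p')%R := conjexp_gt0 p1.
Let p'1 : (1 < p')%R := conjexp_gt1 p1.
Let pV0 : (0 <= p^-1)%R. Proof. by rewrite invr_ge0 ltW. Qed.
Let p'V0 : (0 <= p'^-1)%R. Proof. by rewrite invr_ge0 ltW. Qed.
Let pVp : (0 < p^-1)%R. Proof. by rewrite invr_gt0. Qed.
Let p'Vp : (0 < p'^-1)%R. Proof. by rewrite invr_gt0. Qed.
Let qV0 : (0 <= q^-1)%R. Proof. by rewrite invr_ge0 ltW. Qed.
Let pm0 : (0 < p' - 1)%R. Proof. by rewrite subr_gt0. Qed.
Let pm00 : (0 <= p' - 1)%R := ltW pm0.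
Let mpos : measurable (pos : set T) := measurable_litv _.
Let p'p : (p' * p^-1 = p' - 1)%R.
Proof. by rewrite -{1}(conjexpB1 p1) mulfK// gt_eqF. Qed.

Section fixed.
Variables (D : hdata R) (M : R).
Hypothesis M0 : (0 <= M)%R.
Hypothesis hyp : hbound p q D M.
Hypothesis phoo : hphi_inf D p < +oo.
Variables (h : T -> \bar R) (c n : R).
Hypotheses (nh : nnm h) (hc : forall y, h y <= c%:E) (hn : forall y, (n <= y)%R -> h y = 0).

Lemma lint_pos_patch (f : T -> \bar R) (z : R) :
  \int[mu]_(t in pos) (f \_ (`]0%R, z[%classic : set T)) t = \int[mu]_(t in `]0%R, z[) f t.
Proof.
rewrite -integral_mkcondr; congr (integral _ _ _); apply/seteqP; split => t /= => [[]//|ht].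
by split => //; move: ht; rewrite /pos/= !in_itv/= andbT => /andP[].
Qed.

Definition dH : R -> \bar R := tail (fun y => h y * hw D y).
Definition db (t : R) := ha D t * dH t.
Definition dB := primitive db.
Local Notation tau := (hpt_tau p1 phoo).
(** The mass of [d(-phi)] beyond [tau m] is [lev m], so the sum over [m] discretizes the integral of
    [dB^p'] against [d(-phi)]. *)
Definition dx m := if hpt_occ D p m then (lev m)%:E * dB (tau m) `^ p' else 0.

Lemma nnm_dhw : nnm (fun y : T => h y * hw D y). Proof. exact: nnmM nh (nhw D). Qed.
Lemma nnm_dH : nnm (dH : T -> \bar R). Proof. exact: nnm_tail nnm_dhw. Qed.
Lemma nnm_db : nnm (db : T -> \bar R). Proof. exact: nnmM (nha D) nnm_dH. Qed.
Lemma nnm_dB : nnm (dB : T -> \bar R). Proof. exact: nnm_primitive nnm_db. Qed.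

Let c0 : (0 <= c)%R. Proof. by rewrite -lee_fin; exact: le_trans (nh.2 0%R) (hc 0%R). Qed.

Lemma dH_le t : (0 < t)%R -> dH t <= c%:E * primitive (hw D) n.
Proof.
move=> t0; have cE : 0 <= c%:E by rewrite lee_fin.
rewrite /primitive /lebesgue_integral -(integralMl mu (measurable_litv _) cE (nhw D)).
have ncw : nnm (fun y : T => c%:E * hw D y) by exact: nnmM (nnm_cst cE) (nhw D).
apply: (@le_trans _ _ (\int[mu]_(y in pos) ((fun y : T => c%:E * hw D y) \_ (`]0%R, n[%classic : set T)) y)); last first.
  rewrite -integral_mkcondr; apply: subset_integral_nng => [y _|y []//]; exact: ncw.2.
apply: (@le_trans _ _ (\int[mu]_(y in pos) (h y * hw D y))).
  apply: subset_integral_nng => [y _|y]; first exact: nnm_dhw.2.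
  by rewrite /pos/= !in_itv/= !andbT; exact: lt_trans.
apply: le_integral_nng => y; first by move=> _; exact: nnm_dhw.2.
rewrite /pos/= in_itv/= andbT => y0; have w0 := (nhw D).2 y.
rewrite patchE; have [ny|yn] := leP n y.
  by rewrite hn// mul0e; case: (y \in _) => //; exact: ncw.2.
by rewrite mem_set; [exact: (le_mulr w0)|rewrite /= in_itv/= yn y0].
Qed.

(** Here [h] has to be bounded and to vanish beyond [n]; finiteness allows the final absorption. *)
Lemma dB_oo z : dB z < +oo.
Proof.
set K := c%:E * primitive (hw D) n.
have K0 : 0 <= K by apply: mule_ge0; [rewrite lee_fin|exact: primitive_ge0 (nhw D)].
have Koo : K < +oo.
  by apply: lte_mul_pinfty; [rewrite lee_fin|by []|exact: hw_oo].
apply: (@le_lt_trans _ _ (K * primitive (ha D) z)).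
  rewrite [in leRHS]/primitive /lebesgue_integral -(integralMl mu (measurable_litv _) K0 (nha D)).
  apply: le_integral_nng => t; first by move=> _; exact: nnm_db.2.
  move=> /in_oo[t0 _]; rewrite /db muleC; apply: (le_mulr ((nha D).2 t)); exact: dH_le.
by apply: lte_mul_pinfty => //; [rewrite ge0_fin_numE|exact: ha_oo].
Qed.

Lemma dx_ge0 m : 0 <= dx m.
Proof. by rewrite /dx; case: ifP => // _; apply: mule_ge0; [exact: levE_ge0|exact: poweR_ge0]. Qed.

Lemma dx_oo m : dx m < +oo.
Proof.
rewrite /dx; case: ifP => // _; apply: lte_mul_pinfty; [exact: levE_ge0|by []|].
by apply: poweR_lty; exact: dB_oo.
Qed.

Variable N : nat.

Let F m (t : R) : \bar R := (dx m * hS D (tau m) `^ (-1)) * ((fun=> 1) \_ (`]0%R, tau m[%classic : set T)) t.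
(* The test function: by the choice of the points [tau m], [hR dk] is at least
   [lev m `^ p'^-1 * dx m `^ p^-1] on [(0, tau m)]. *)
Definition dk (t : R) := (\sum_(m < N) F m t) `^ p^-1.

Let xS0 m : 0 <= dx m * hS D (tau m) `^ (-1).
Proof. by apply: mule_ge0; [exact: dx_ge0|exact: poweR_ge0]. Qed.

Let n1 m : nnm ((fun=> 1 : \bar R) \_ (`]0%R, tau m[%classic : set T)).
Proof. exact: (nnm_patch (measurable_litv _) (nnm_cst lee01)). Qed.

Let nF m : nnm (F m : T -> \bar R).
Proof. exact: nnmM (nnm_cst (xS0 m)) (n1 m). Qed.

Lemma nnm_dk : nnm (dk : T -> \bar R).
Proof. exact: (nnm_poweR _ (nnm_sum N nF)). Qed.

Let J := \sum_(m < N) dx m.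

Let J0 : 0 <= J. Proof. by apply: sume_ge0 => i _; exact: dx_ge0. Qed.

Let Joo : J < +oo. Proof. by apply/lte_sum_pinfty => i _; exact: dx_oo. Qed.

(** The factor [hS^-1] in [F] normalises each indicator to unit mass against [s]. *)
Lemma hnorm_dk : hnorm D p dk = J.
Proof.
have nFs m : nnm (fun t : T => F m t * hs D t) by exact: nnmM (nF m) (nhs D).
transitivity (\int[mu]_(t in pos) (\sum_(m < N) (F m t * hs D t))).
  apply: eq_integral => t _; rewrite /dk poweRVK ?gt_eqF//; last first.
    by apply: sume_ge0 => i _; exact: (nF i).2.
  by rewrite ge0_sume_distrl// => i _; exact: (nF i).2.
rewrite (integral_sumn mu N mpos nFs); apply: eq_bigr => m _.
have -> : \int[mu]_(t in pos) (F m t * hs D t) = (dx m * hS D (tau m) `^ (-1)) * hS D (tau m).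
  have nsp : nnm ((hs D : T -> \bar R) \_ (`]0%R, tau m[%classic : set T)).
    exact: (nnm_patch (measurable_litv _) (nhs D)).
  have hSE : hS D (tau m) = \int[mu]_(t in pos) (((hs D : T -> \bar R) \_ (`]0%R, tau m[%classic : set T)) t).
    by rewrite lint_pos_patch.
  rewrite [X in _ = _ * X]hSE -(integralMl mu mpos (xS0 m) nsp); apply: eq_integral => t _; rewrite /F !patchE.
  by case: (t \in (`]0%R, tau m[%classic : set T)); rewrite ?mule1// !mule0 mul0e.
have [ho|nho] := boolP (hpt_occ D p m); last by rewrite /dx (negbTE nho) !mul0e.
have [t0 _ _ _] := hpt_tauP p1 phoo ho.
have S0 : 0 <= hS D (tau m) by exact: (nnm_hS D).2.
have e : hS D (tau m) `^ (-1) * hS D (tau m) = 1.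
  by rewrite -[X in _ * X](poweRe1 S0); apply: poweR_inv_le1; [exact: hs_gt0|exact: hs_oo].
by rewrite -muleA e mule1.
Qed.

(** Keep only the [m]-th indicator in [dk] and only [tau m] in the supremum: there [hg >= lev m],
    and [1/p + 1/p' = 1] and [p'/p = p' - 1] combine the powers. *)
Lemma dk_hR m t : (m < N)%N -> hpt_occ D p m -> (t <= tau m)%R ->
  (lev m)%:E * dB (tau m) `^ (p' - 1) <= hR D dk t.
Proof.
move=> mN o tt; have [t0 ptE gl _] := hpt_tauP p1 phoo o.
set z := tau m in t0 ptE gl tt *.
have S0 : 0 <= hS D z by exact: (nnm_hS D).2.
have Sp : 0 < hS D z by exact: hs_gt0.
have Soo : hS D z < +oo by exact: hs_oo.
have U0 : 0 <= (hU D z)%:E by rewrite lee_fin hU_ge0.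
have x0 := dx_ge0 m; have B0 : 0 <= dB z by exact: nnm_dB.2.
have Kge : (dx m * hS D z `^ (-1)) `^ p^-1 * hS D z <= hK D dk z.
  rewrite /hS /primitive /lebesgue_integral -(integralMl mu (measurable_litv _) (poweR_ge0 _ _) (nhs D)).
  apply: le_integral_nng => y; first by move=> _; apply: mule_ge0; [exact: poweR_ge0|exact: (nhs D).2].
  move=> yz; apply: (le_mulr ((nhs D).2 y)); apply: (le_poweR pV0 (xS0 m)).
  apply: (@le_trans _ _ (F m y)).
    by rewrite /F patchE (mem_set (yz : (`]0%R, tau m[%classic : set T) y)) mule1; exact: lexx.
  rewrite (bigD1 (Ordinal mN))//= leeDl// sume_ge0// => i _; exact: (nF i).2.
apply: le_trans (sup_from_ge (fun tau => (hU D tau)%:E * hK D dk tau) tt).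
apply: le_trans (le_mull U0 Kge).
have e1 : (dx m * hS D z `^ (-1)) `^ p^-1 * hS D z = dx m `^ p^-1 * hS D z `^ p'^-1.
  rewrite (poweRM _ x0 (poweR_ge0 _ _)) -poweRrM mulN1r.
  rewrite -[X in _ * _ * X](poweRe1 S0) -(conjexp_add p) -(poweR_addr S0 pVp p'Vp).
  by rewrite -muleA [X in _ * X]muleA (poweR_inv_le1 _ Sp Soo) mul1e.
rewrite e1; have e2 : (hU D z)%:E * (dx m `^ p^-1 * hS D z `^ p'^-1) = dx m `^ p^-1 * hg D p z `^ p'^-1.
  by rewrite /hg (poweRM _ (poweR_ge0 _ _) S0) (poweRK U0 (lt0r_neq0 p'0)) muleCA.
rewrite e2 /dx o -/z (poweRM _ (levE_ge0 m) (poweR_ge0 _ _)) -poweRrM p'p.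
rewrite [X in _ <= X * _]muleC -muleA [X in X <= _]muleC; apply: (le_mull (poweR_ge0 _ _)).
apply: (@le_trans _ _ ((lev m)%:E `^ p^-1 * (lev m)%:E `^ p'^-1)).
  by rewrite (poweR_addr (levE_ge0 m) pVp p'Vp) conjexp_add poweRe1// levE_ge0.
by apply: (le_mull (poweR_ge0 _ _)); exact: (le_poweR p'V0 (levE_ge0 m)).
Qed.

Variable C0 : R.
Hypotheses (C00 : (0 < C0)%R) (hC0 : forall (P : pred nat) (b rho : \bar R), 0 <= b -> 0 <= rho ->
  (forall n, P n -> (lev n)%:E `^ 1 * b <= rho) ->
  \sum_(n <oo | P n) ((lev n)%:E `^ 1 * b) <= C0%:E * rho).

Let K1 := ((2^-1 `^ p')^-1)%R.

(** [rank_poweR_int] turns [dB(tau m)^p'] into an integral over []0, tau m[]. At a fixed [t] the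
    levels with [t < tau m] then form a geometric sum, all of whose terms are at most [hR dk t] by
    [dk_hR], so [level_sum] applies. *)
Lemma dx_le_integral : J <= (K1 * C0)%:E * \int[mu]_(t in pos) (hR D dk t * db t).
Proof.
have K10 : (0 < 2^-1 `^ p' :> R)%R by rewrite powR_gt0.
have K1E : 0 <= K1%:E by rewrite lee_fin invr_ge0 ltW.
have nb := nnm_db; have nBb : nnm (fun t : T => dB t `^ (p' - 1) * db t).
  exact: nnmM (nnm_poweR _ nnm_dB) nb.
pose G m (t : R) := if hpt_occ D p m then
  (lev m)%:E * ((fun t : T => dB t `^ (p' - 1) * db t) \_ (`]0%R, tau m[%classic : set T)) t else 0.
have nG m : nnm (G m : T -> \bar R).
  rewrite /G; case: (hpt_occ D p m); last exact: nnm_cst.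
  exact: nnmM (nnm_cst (levE_ge0 m)) (nnm_patch (measurable_litv _) nBb).
have xG m : dx m <= K1%:E * \int[mu]_(t in pos) G m t.
  rewrite /dx /G; case: (hpt_occ D p m); last first.
    by apply: mule_ge0 K1E _; apply: integral_nng => t _.
  rewrite (integralMl mu mpos (levE_ge0 m) (nnm_patch (measurable_litv _) nBb)) muleCA.
  apply: (le_mull (levE_ge0 m)).
  rewrite lint_pos_patch.
  have rk : rank mu (`]0%R, tau m[%classic : set T) db dB.
    by apply: rank_sub (rank_primitive nb) => //; apply: subset_itvl; rewrite bnd_simp.
  have := rank_poweR_int (measurable_litv _) nb nnm_dB rk pm00.
  rewrite subrK -/(dB (tau m)) => h1.
  apply: le_trans (le_mull K1E h1); rewrite muleA -EFinM mulVf ?gt_eqF// mul1e.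
  exact: lexx.
apply: (@le_trans _ _ (\sum_(m < N) (K1%:E * \int[mu]_(t in pos) G m t))).
  by apply: lee_sum => m _.
rewrite -ge0_sume_distrr; last by move=> m _; apply: integral_nng => t _; exact: (nG m).2.
rewrite EFinM -muleA; apply: (le_mull K1E).
have C0E : 0 <= C0%:E by rewrite lee_fin ltW.
have nRb : nnm (fun t : T => hR D dk t * db t) by exact: nnmM (nnm_hR D nnm_dk) nb.
rewrite -(integral_sumn mu N mpos nG) -(integralMl mu mpos C0E nRb).
apply: le_integral_nng => t; first by move=> _; apply: sume_ge0 => m _; exact: (nG m).2.
rewrite /pos/= in_itv/= andbT => t0; rewrite muleA.
pose P m := [&& (m < N)%N, hpt_occ D p m & (t < tau m)%R].
have B0 : 0 <= dB t `^ (p' - 1) by exact: poweR_ge0.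
have Rk0 : 0 <= hR D dk t by exact: (nnm_hR D nnm_dk).2.
have hP m : P m -> (lev m)%:E `^ 1 * dB t `^ (p' - 1) <= hR D dk t.
  move=> /and3P[mN o tt]; rewrite (poweRe1 (levE_ge0 m)).
  apply: le_trans (dk_hR mN o (ltW tt)); apply: (le_mull (levE_ge0 m)).
  by apply: (le_poweR pm00 (nnm_dB.2 t)); exact: le_primitive nb (ltW tt).
apply: le_trans (le_mulr (nb.2 t) (hC0 B0 Rk0 hP)).
pose e m := if P m then (lev m)%:E `^ 1 * dB t `^ (p' - 1) else 0.
have -> : \sum_(m <oo | P m) ((lev m)%:E `^ 1 * dB t `^ (p' - 1)) = \sum_(m <oo) e m.
  by rewrite eseries_mkcond.
have e0 m : 0 <= e m by rewrite /e; case: ifP => // _; apply: mule_ge0; exact: poweR_ge0.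
apply: (@le_trans _ _ ((\sum_(m < N) e m) * db t)).
  rewrite ge0_sume_distrl; last by move=> m _; exact: e0.
  apply: lee_sum => m _.
  have PE : P m = hpt_occ D p m && (t < tau m)%R by rewrite /P ltn_ord.
  rewrite /G /e PE; case: (hpt_occ D p m); last by rewrite mul0e; exact: lexx.
  rewrite patchE andTb; case: ifPn => [/set_mem/in_oo[_ tt]|_]; last first.
    rewrite mule0; apply: mule_ge0 (nb.2 t); case: ((t < tau m)%R) => //.
    by apply: mule_ge0; exact: poweR_ge0.
  by rewrite tt (poweRe1 (levE_ge0 m)) muleA; exact: lexx.
apply: (le_mulr (nb.2 t)).
rewrite -(big_mkord xpredT e); apply: nneseries_lim_ge => m _ _; exact: e0.
Qed.

(** An exchange of integrals turns [hR dk * db] into [hT dk * h * w]; Hoelder's inequality for the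
    measure [w] and the assumed bound then control [J] by a multiple of its own [p]-th root, which
    is absorbed. *)
Lemma dual_sum_partial : J <=
  ((K1 * C0 * M)%:E * (\int[mu]_(y in pos) (h y `^ q' * hw D y)) `^ q'^-1) `^ p'.
Proof.
have K10 : (0 < 2^-1 `^ p' :> R)%R by rewrite powR_gt0.
have KE : 0 <= (K1 * C0)%:E by rewrite lee_fin mulr_ge0 ?invr_ge0 ?ltW.
have KME : 0 <= (K1 * C0 * M)%:E by rewrite lee_fin mulr_ge0// -lee_fin.
set H := _ `^ q'^-1; have H0 : 0 <= H by exact: poweR_ge0.
apply: (poweR_absorb p1 J0 Joo (mule_ge0 KME H0)).
apply: le_trans dx_le_integral _; rewrite (EFinM (K1 * C0) M) -!muleA; apply: (le_mull KE).
have nk := nnm_dk; have nRk := nnm_hR D nk.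
have nRa : nnm (fun t : T => hR D dk t * ha D t) by exact: nnmM nRk (nha D).
have nT : nnm (hT D dk : T -> \bar R) by exact: nnm_primitive.
have -> : \int[mu]_(t in pos) (hR D dk t * db t) = \int[mu]_(t in pos) (hT D dk t * h t * hw D t).
  have := tonelli_tail 0%R nnm_dhw nRa => /esym e.
  transitivity (\int[mu]_(x in pos) ((hR D dk x * ha D x) * tail (fun y => h y * hw D y) x)).
    by apply: eq_integral => t _; rewrite /db /dH muleA.
  rewrite e; apply: eq_integral => t _.
  by rewrite muleC -muleA.
apply: le_trans (weighted_hoelder mu q1 mpos nT nh (nhw D)) _.
rewrite -/H [leRHS]muleCA [leRHS]muleC; apply: (le_mulr H0).
have := hyp nk; rewrite hnorm_dk => hk.
have i0 : 0 <= \int[mu]_(x in pos) (hT D dk x `^ q * hw D x).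
  by apply: integral_nng => y _; apply: mule_ge0; [exact: poweR_ge0|exact: (nhw D).2].
apply: le_trans (le_poweR qV0 i0 hk) _.
have MqE : 0 <= (M `^ q)%:E by rewrite lee_fin powR_ge0.
rewrite (poweRM _ MqE (poweR_ge0 _ _)) poweR_EFin -powRrM mulfV ?gt_eqF// powRr1// -poweRrM.
rewrite (_ : q / p * q^-1 = p^-1)%R; last by field; rewrite !gt_eqF.
exact: lexx.
Qed.

End fixed.

Lemma dual_sum : exists2 C : R, (0 < C)%R & forall (D : hdata R) (M : R) (M0 : (0 <= M)%R)
  (hyp : hbound p q D M) (phoo : hphi_inf D p < +oo) (h : T -> \bar R) (c n : R),
  nnm h -> (forall y, h y <= c%:E) -> (forall y, (n <= y)%R -> h y = 0) ->
  \sum_(m <oo) dx phoo h m <=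
  ((C * M)%:E * (\int[mu]_(y in pos) (h y `^ q' * hw D y)) `^ q'^-1) `^ p'.
Proof.
have [C0 C00 hC0] := @level_sum R 1 (oner_neq0 _).
exists ((2^-1 `^ p')^-1 * C0)%R; first by rewrite mulr_gt0// invr_gt0 powR_gt0.
move=> D M M0 hyp phoo h c n nh hc hn.
apply: nneseries_le_partial => [m|N]; first exact: dx_ge0.
exact: (dual_sum_partial M0 hyp phoo nh hc hn N C00 hC0).
Qed.

End dual_sum.

(** Makes the counting measure admissible as [m2] in the kernel test, for [hT3_lt_lower]. *)
HB.instance Definition _ (R : realType) :=
  Measure_isSigmaFinite.Build _ _ _ (@counting nat R) (sigma_finite_counting R).

(** * Mass estimates and integration for [d(-phi)] *)

Section mass.
Context {R : realType}.
Local Notation B := (measurableTypeR R).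
Variables (D : hdata R) (p : R).
Hypotheses (p1 : (1 < p)%R) (phoo : hphi_inf D p < +oo).
Local Notation m := (dminus (hphi D p) : {measure set B -> \bar R}).
Let pos : set B := `]0%R, +oo[%classic.

Let nptB : nnm (hpt D p : B -> \bar R).
Proof.
split; last by move=> x; exact: hpt_ge0.
by apply: nonincreasing_measurableE => x y; exact: hpt_anti.
Qed.

Let hpt_level (l : \bar R) : measurable (pos `&` [set x | hpt D p x <= l]).
Proof. by apply: measurableI; [exact: measurable_itv|exact: (measurable_le l nptB)]. Qed.

(** The level is doubled so that the points with [hpt <= l] lie strictly to the right of the
    crossing point of [2 l], beyond which the mass is exactly [2 l]. If [2 l] is never exceeded, the
    whole half-line has mass at most [2 l]. *)
Lemma dminus_level (l : R) : (0 < l)%R -> m (pos `&` [set x | hpt D p x <= l%:E]) <= (2 * l)%:E.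
Proof.
move=> l0; have l20 : (0 < 2 * l)%R by rewrite mulr_gt0.
have [[t t0 ht]|h] := pselect (exists2 t, (0 < t)%R & (2 * l)%:E < hpt D p t).
  have [c [c0 cE _ _]] := hpt_cross p1 phoo l20 t0 ht.
  rewrite -cE -(dminus_hphi_oy p1 phoo c0); apply: le_measure; rewrite ?inE//.
  move=> x [_ /= hx]; rewrite in_itv/= andbT ltNge; apply/negP => xc.
    have := le_trans (hpt_anti D p xc) hx; rewrite cE lee_fin; lra.
have b (t : R) : (0 < t)%R -> hpt D p t <= (2 * l)%:E.
  by move=> t0; rewrite leNgt; apply/negP => ht; apply: h; exists t.
pose F (n : nat) : set B := `]n.+1%:R^-1%R, +oo[%classic.
have mF n : measurable (F n) by exact: measurable_itv.
have mUF : measurable (\bigcup_n F n) by exact: bigcup_measurable.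
have nd : nondecreasing_seq F.
  move=> i j ij; rewrite subsetEset; apply: subset_itvr; rewrite bnd_simp.
  by rewrite lef_pV2 ?posrE// ler_nat.
have cv : (m \o F) @ \oo --> m (\bigcup_n F n) := nondecreasing_cvg_mu mF mUF nd.
apply: (@le_trans _ _ (m (\bigcup_n F n))).
  apply: le_measure; rewrite ?inE// => x [/=]; rewrite /pos/= in_itv/= andbT => x0 _.
  exists (Num.trunc x^-1) => //; rewrite /F/= in_itv/= andbT.
  rewrite -[ltRHS]invrK ltf_pV2 ?posrE ?invr_gt0//; exact: truncnS_gt.
rewrite -(cvg_lim _ cv)//; apply: lime_le; first by apply/cvg_ex; exists (m (\bigcup_n F n)).
by apply: nearW => n /=; rewrite [leLHS](dminus_hphi_oy p1 phoo) ?b// invr_gt0.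
Qed.

Lemma dminus_null : m (pos `&` [set x | hpt D p x = 0]) = 0.
Proof.
have mN : measurable (pos `&` [set x | hpt D p x = 0]).
  rewrite (_ : [set x | hpt D p x = 0] = [set x | hpt D p x <= 0]); first exact: hpt_level.
  apply/seteqP; split => x /= h; first by rewrite h.
  by apply/eqP; rewrite eq_le h hpt_ge0.
apply/eqP; rewrite eq_le measure_ge0 andbT; apply/lee_addgt0Pr => e e0; rewrite add0e.
have e2 : (0 < e / 2)%R by rewrite divr_gt0.
apply: le_trans (_ : m (pos `&` [set x | hpt D p x <= (e / 2)%:E]) <= _).
  apply: le_measure; rewrite ?inE// => x [px /= hx]; split => //=.
  by rewrite hx lee_fin ltW.
by apply: le_trans (dminus_level e2) _; rewrite lee_fin; lra.
Qed.

End mass.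

Section stieltjes_integral.
Context {R : realType}.
Local Notation T := (lebesgueR R).
Local Notation B := (measurableTypeR R).
Local Notation mu := (@completed_lebesgue_measure R).
Variable p : R.
Hypotheses (p1 : (1 < p)%R).
Local Notation p' := (conjexp p).
Let p'0 : (0 < p')%R := conjexp_gt0 p1.
Let pm0 : (0 < p' - 1)%R. Proof. by rewrite subr_gt0; exact: conjexp_gt1 p1. Qed.

Definition hpA (D : hdata R) (t : R) := hA D t `^ (p' - 1) * ha D t.

Lemma nnm_hpA D : nnm (hpA D : T -> \bar R).
Proof. exact: nnmM (nnm_poweR _ (nnm_hA D)) (nha D). Qed.

Lemma hA_le_primitive D z : (2^-1 `^ p')%:E * hA D z `^ p' <= primitive (hpA D) z.
Proof.
have rk : rank mu (`]0%R, z[%classic : set T) (ha D) (hA D).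
  by apply: rank_sub (nha D) _ (rank_primitive (nha D)); apply: subset_itvl; rewrite bnd_simp.
have := rank_poweR_int (measurable_litv _) (nha D) (nnm_hA D) rk (ltW pm0).
by rewrite subrK.
Qed.

(** One half of an integration by parts: [d(-phi)] is replaced by a density against Lebesgue
    measure, to which the kernel test applies. On each layer of [hpt] use the mass from
    [dminus_level] and an upper bound of [A], then rewrite [A^p'] as an integral by
    [hA_le_primitive]. *)
Lemma hE_le : exists2 C : R, (0 < C)%R & forall (D : hdata R), hphi_inf D p < +oo ->
  forall x, (0 < x)%R -> hE D p (dminus (hphi D p)) x <=
    C%:E * \int[mu]_(t in (`]0%R, x[%classic : set T)) (hpt D p t * hpA D t).
Proof.
have [C0 C00 hC0] := @level_sum R 1 (oner_neq0 _).
have [K [K0 KE]] : exists K : R, (0 < K)%R /\ K = ((2^-1 `^ p')^-1)%R.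
  by exists ((2^-1 `^ p')^-1)%R; rewrite invr_gt0 powR_gt0.
exists (2 * (2 * K) * C0)%R; first by rewrite !mulr_gt0.
move=> D phoo x x0; pose m := dminus (hphi D p) : {measure set B -> \bar R}.
have nptB : nnm (hpt D p : B -> \bar R).
  split; last by move=> t; exact: hpt_ge0.
  by apply: nonincreasing_measurableE => t y; exact: hpt_anti.
have nAp := nnm_hAp p D; have npA := nnm_hpA D; have npt := nnm_hpt (p := p) phoo.
pose I := `]0%R, x]%classic : set B.
have mI : measurable I by exact: measurable_itv.
have Ip t : I t -> (0 < t)%R /\ (t <= x)%R by rewrite /I/= in_itv/= => /andP.
have bnd (E : set B) (z : R) : measurable E -> (forall t, E t -> (t <= z)%R) ->
    \int[m]_(t in E) (hA D t `^ p') <= hA D z `^ p' * m E.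
  move=> mE hE'; rewrite -(integral_cst m mE); apply: le_integral_nng => t; first by move=> _; exact: poweR_ge0.
  move=> /hE' tz; apply: (le_poweR (ltW p'0)); first exact: (nnm_hA D).2.
  exact: le_primitive (nha D) tz.
apply: le_trans (level_decomp m mI nptB nAp) _.
have -> : I `&` [set t | hpt D p t = +oo] = set0.
  apply/seteqP; split => t //= [/Ip[t0 _] h]; have := hpt_oo p1 phoo t0; by rewrite h ltxx.
rewrite integral_set0 adde0.
have mle (l : \bar R) : measurable [set t : B | hpt D p t <= l] by exact: (measurable_le l nptB).
have -> : \int[m]_(t in I `&` [set t | hpt D p t = 0]) (hA D t `^ p') = 0.
  have E0 : [set t : B | hpt D p t = 0] = [set t | hpt D p t <= 0].
    apply/seteqP; split => t /= h; first by rewrite h.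
    by apply/eqP; rewrite eq_le h hpt_ge0.
  have mN : measurable (I `&` [set t : B | hpt D p t = 0]).
    by apply: measurableI; [exact: mI|rewrite E0; exact: mle].
  have mN' : measurable ((`]0%R, +oo[%classic : set B) `&` [set t : B | hpt D p t = 0]).
    by apply: measurableI; [exact: measurable_itv|rewrite E0; exact: mle].
  have N0 : m (I `&` [set t | hpt D p t = 0]) = 0.
    apply/eqP; rewrite eq_le measure_ge0 andbT -[leRHS](dminus_null p1 phoo).
    apply: le_measure; rewrite ?inE//; apply: setSI => t /Ip[t0 _].
    by rewrite /= in_itv/= t0.
  apply/eqP; rewrite eq_le; apply/andP; split; last by apply: integral_nng => t _; exact: poweR_ge0.
  have := bnd _ x mN; rewrite N0 mule0; apply => t [/Ip[]] //.
rewrite adde0.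
pose tau := hpt_tau p1 phoo.
pose G n (t : R) := if hpt_occ D p n && (t < tau n)%R then (lev n)%:E `^ 1 * hpA D t else 0.
have nG n : nnm (G n : T -> \bar R).
  rewrite /G; case: (hpt_occ D p n); last exact: nnm_cst.
  have -> : (fun t : T => if true && (t < tau n)%R then (lev n)%:E `^ 1 * hpA D t else 0) =
     (fun t => (lev n)%:E `^ 1 * hpA D t) \_ (`]-oo, tau n[%classic : set T).
    by apply/funext => t; rewrite patchE mem_setE in_itv.
  apply: nnm_patch; first exact: measurable_litv.
  exact: nnmM (nnm_cst (poweR_ge0 _ _)) npA.
have KE0 : 0 <= (2 * (2 * K))%:E by rewrite lee_fin !mulr_ge0// ltW.
have C0E : 0 <= C0%:E by rewrite lee_fin ltW.
apply: (@le_trans _ _ (\sum_(n <oo) ((2 * (2 * K))%:E * \int[mu]_(t in (`]0%R, x[%classic : set T)) G n t))).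
  apply: lee_nneseries => [n _ _|n _]; first by apply: integral_nng => t _; exact: poweR_ge0.
  set L := I `&` _.
  have [[t [It /= /andP[h _]]]|h0] := pselect (L !=set0); last first.
    have -> : L = set0 by apply/eqP/negPn/negP => /set0P.
    rewrite integral_set0; apply: mule_ge0 KE0 _; apply: integral_nng => t _; exact: (nG n).2.
  have [t0 _] := Ip t It.
  have [ho _] := lt_hpt_tau p1 phoo t0 h; have [tau0 _ _ _] := hpt_tauP p1 phoo ho.
  have mL : measurable L.
    apply: measurableI; first exact: mI.
    rewrite (_ : [set _ | _] = [set x | (lev n)%:E < hpt D p x] `&` [set x | hpt D p x <= (2 * lev n)%:E]).
      apply: measurableI; last exact: mle.
      exact: (measurable_gt _ nptB).
    by apply/seteqP; split => y /=; [move=> /andP|move=> [-> ->]].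
  (* The layer lies in []0, x]] and to the left of the crossing point [tau n], so [A] is at most
     [A z] on it. *)
  pose z := Num.min (tau n) x.
  have zx : (z <= x)%R by rewrite /z ge_min lexx orbT.
  have ztau : (z <= tau n)%R by rewrite /z ge_min lexx.
  apply: le_trans (bnd _ z mL _) _.
    move=> y [/Ip[y0 yx] /= /andP[hy _]]; rewrite /z le_min yx andbT.
    by have [_] := lt_hpt_tau p1 phoo y0 hy => /ltW.
  have l2 : (0 < 2 * lev n :> R)%R by rewrite mulr_gt0// lev_gt0.
  have mLle : m L <= (2 * (2 * lev n))%:E.
    apply: le_trans (dminus_level p1 phoo l2); apply: le_measure; rewrite ?inE//.
      by apply: measurableI; [exact: measurable_itv|exact: mle].
    by move=> y [/Ip[y0 yx] /= /andP[_ hy]]; split => //=; rewrite in_itv/= y0.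
  apply: le_trans (le_mull (poweR_ge0 _ _) mLle) _.
  have GE : (lev n)%:E * primitive (hpA D) z <= \int[mu]_(t in (`]0%R, x[%classic : set T)) G n t.
    rewrite /primitive /lebesgue_integral -(integralMl mu (measurable_litv _) (levE_ge0 n) npA).
    apply: (@le_trans _ _ (\int[mu]_(t in (`]0%R, z[%classic : set T)) G n t)).
      apply: le_integral_nng => y; first by move=> _; apply: mule_ge0; [exact: levE_ge0|exact: npA.2].
      move=> /in_oo[_ yz]; rewrite /G ho andTb (lt_le_trans yz ztau) (poweRe1 (levE_ge0 n)); exact: lexx.
    apply: subset_integral_nng => [y _|]; first exact: (nG n).2.
    by apply: subset_itvl; rewrite bnd_simp.
  apply: le_trans (le_mull KE0 GE).
  have := hA_le_primitive D z; set P := primitive _ _; set Az := _ `^ p' => hP.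
  have KK : 0 <= K%:E by rewrite lee_fin ltW.
  have := le_mull KK hP; rewrite muleA -EFinM KE mulVf ?gt_eqF ?powR_gt0// mul1e -KE => hP'.
  have l4 : 0 <= (2 * (2 * lev n))%:E :> \bar R by rewrite lee_fin mulr_ge0// ltW.
  rewrite muleC; apply: le_trans (le_mull l4 hP') _.
  rewrite !muleA -!EFinM (_ : 2 * (2 * lev n) * K = 2 * (2 * K) * lev n)%R; first exact: lexx.
  by ring.
rewrite nneseriesZl; last by move=> n _; apply: integral_nng => t _; exact: (nG n).2.
rewrite [(_ * C0)%:E]EFinM -muleA; apply: (le_mull KE0).
rewrite -(integral_seriesn mu (measurable_litv _) nG).
have nHA : nnm (fun t : T => hpt D p t * hpA D t) by exact: nnmM npt npA.
rewrite -(integralMl mu (measurable_litv _) C0E nHA).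
apply: le_integral_nng => t; first by move=> _; apply: nneseries_ge0 => n _ _; exact: (nG n).2.
move=> /in_oo[t0 tx]; rewrite /G -eseries_mkcond.
(* For fixed [t] the levels with [t < tau n] are at most [hpt t], so their sum is of that order. *)
apply: (hC0 (fun n => hpt_occ D p n && (t < tau n)%R)); [exact: npA.2|exact: nHA.2|].
move=> n /andP[ho tt]; rewrite (poweRe1 (levE_ge0 n)); apply: (le_mulr (npA.2 t)).
exact: (le_hpt_tau ho (ltW tt)).
Qed.

End stieltjes_integral.

(** * Lower bounds for the third and fourth terms *)

Section lower34.
Context {R : realType}.
Local Notation T := (lebesgueR R).
Local Notation B := (measurableTypeR R).
Local Notation mu := (@completed_lebesgue_measure R).
Variables (p q : R).
Hypotheses (p1 : (1 < p)%R) (q1 : (1 < q)%R).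
Local Notation p' := (conjexp p).
Local Notation q' := (conjexp q).
Local Notation r := (rexp p q).
Let pos : set R := `]0%R, +oo[%classic.
Let p0 : (0 < p)%R := lt_trans ltr01 p1.
Let q0 : (0 < q)%R := lt_trans ltr01 q1.
Let p'0 : (0 < p')%R := conjexp_gt0 p1.
Let q'0 : (0 < q')%R := conjexp_gt0 q1.
Let p'1 : (1 < p')%R := conjexp_gt1 p1.
Let q'1 : (1 < q')%R := conjexp_gt1 q1.
Let pm0 : (0 < p' - 1)%R. Proof. by rewrite subr_gt0. Qed.
Let qm0 : (0 < q - 1)%R. Proof. by rewrite subr_gt0. Qed.
Let mpos : measurable (pos : set T) := measurable_litv _.
Let Ico (n : R) : set T := `]0%R, n[%classic.
Let mIco n : measurable (Ico n) := measurable_litv _.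
Local Notation cnt := (@counting nat R : {sigma_finite_measure set nat -> \bar R}).

Section dual.
Variables (D : hdata R) (phoo : hphi_inf D p < +oo) (h : T -> \bar R).
Hypothesis nh : nnm h.

(** [dH] is non-increasing, so its value at [z] may be moved under the integral of [a]. *)
Lemma hA_dH_le z : hA D z * dH D h z <= dB D h z.
Proof.
rewrite muleC -(integralMl mu (measurable_litv _) ((nnm_dH D nh).2 z) (nha D)).
apply: le_integral_nng => t.
  by move=> _; apply: mule_ge0; [exact: (nnm_dH D nh).2|exact: (nha D).2].
move=> /in_oo[_ tz]; rewrite /db muleC; apply: (le_mull ((nha D).2 t)).
exact: le_tail (nnm_dhw D nh) (ltW tz).
Qed.

Lemma dH_power_le z : dH D h z `^ p' * hpA p D z <= dB D h z `^ (p' - 1) * db D h z.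
Proof.
have H0 := (nnm_dH D nh).2 z; have A0 := (nnm_hA D).2 z; have a0 := (nha D).2 z.
rewrite -[X in _ `^ X * _](subrK 1%R) -(poweR_addr H0 pm0 ltr01) (poweRe1 H0) /hpA /db.
rewrite (_ : dH D h z `^ (p' - 1) * dH D h z * (hA D z `^ (p' - 1) * ha D z) =
  (hA D z * dH D h z) `^ (p' - 1) * (ha D z * dH D h z)).
  apply: (le_mulr (mule_ge0 a0 H0)); apply: (le_poweR (ltW pm0) (mule_ge0 A0 H0)).
  exact: hA_dH_le.
by rewrite (poweRM _ A0 H0) (AC (2*2) ((3*1)*(4*2))).
Qed.

Lemma integral_dB_power tau :
  \int[mu]_(t in (`]0%R, tau[%classic : set T)) (dB D h t `^ (p' - 1) * db D h t) <= dB D h tau `^ p'.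
Proof.
have nb := nnm_db D nh; have B0 := (nnm_dB D nh).2 tau.
rewrite -[X in _ <= _ `^ X](subrK 1%R) -(poweR_addr B0 pm0 ltr01) (poweRe1 B0).
rewrite [X in _ <= _ * X]/dB /primitive /lebesgue_integral -(integralMl mu (mIco tau) (poweR_ge0 _ _) nb).
apply: le_integral_nng => t; first by move=> _; apply: mule_ge0; [exact: poweR_ge0|exact: nb.2].
move=> /in_oo[_ tt]; apply: (le_mulr (nb.2 t)); apply: (le_poweR (ltW pm0)).
  exact: (nnm_dB D nh).2.
exact: le_primitive nb (ltW tt).
Qed.

(** A layer of [hpt] lies to the left of its crossing point, up to which the integral of
    [dB^(p'-1) db] is at most [dB^p']; the factor 2 is the ratio of the ends of a layer. *)
Lemma integral_hpt_dB : \int[mu]_(t in pos) (hpt D p t * (dB D h t `^ (p' - 1) * db D h t)) <=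
  2%:E * \sum_(m <oo) dx p1 phoo h m.
Proof.
have npt := nnm_hpt (p := p) phoo.
have npsi : nnm (fun t : T => dB D h t `^ (p' - 1) * db D h t).
  exact: nnmM (nnm_poweR _ (nnm_dB D nh)) (nnm_db D nh).
have ng : nnm (fun t : T => hpt D p t * (dB D h t `^ (p' - 1) * db D h t)) by exact: nnmM npt npsi.
apply: le_trans (level_decomp mu mpos npt ng) _.
have -> : pos `&` [set t | hpt D p t = +oo] = set0.
  apply/seteqP; split => t //= [+ ht]; rewrite /pos/= in_itv/= andbT => t0.
  by have := hpt_oo p1 phoo t0; rewrite ht ltxx.
rewrite integral_set0 adde0 [X in _ + X <= _]integral0_eq ?adde0; last first.
  by move=> t [_ /= ->]; rewrite mul0e.
have E2 : 0 <= 2%:E :> \bar R by rewrite lee_fin.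
rewrite -nneseriesZl; last by move=> m _; exact: dx_ge0.
apply: lee_nneseries => [m _ _|m _]; first by apply: integral_nng => t _; exact: ng.2.
set L := pos `&` _.
have [[t [+ /= /andP[ht _]]]|h0] := pselect (L !=set0); last first.
  have -> : L = set0 by apply/eqP/negPn/negP => /set0P.
  by rewrite integral_set0; apply: mule_ge0 E2 _; exact: dx_ge0.
rewrite /pos/= in_itv/= andbT => t0.
have [ho _] := lt_hpt_tau p1 phoo t0 ht; rewrite /dx ho muleA -EFinM.
set tau := hpt_tau _ _ _.
have l2 : 0 <= (2 * lev m)%:E :> \bar R by rewrite lee_fin mulr_ge0// ltW// lev_gt0.
apply: le_trans (le_mull l2 (integral_dB_power tau)).
rewrite -(integralMl mu (mIco tau) l2 npsi).
have mlt : measurable (L : set T).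
  apply: measurableI; first exact: mpos.
  rewrite (_ : [set _ | _] = [set x | (lev m)%:E < hpt D p x] `&` [set x | hpt D p x <= (2 * lev m)%:E]).
    by apply: measurableI; [exact: (measurable_gt _ npt)|exact: (measurable_le _ npt)].
  by apply/seteqP; split => y /=; [move=> /andP|move=> [-> ->]].
apply: (@le_trans _ _ (\int[mu]_(t in L) ((2 * lev m)%:E * (dB D h t `^ (p' - 1) * db D h t)))).
  apply: le_integral_nng => y; first by move=> _; exact: ng.2.
  by move=> [_ /= /andP[_ hy]]; apply: (le_mulr (npsi.2 y)).
apply: subset_integral_nng => [y _|y [yp /= /andP[hy _]]].
  by apply: mule_ge0 l2 _; exact: npsi.2.
have y0 : (0 < y)%R by move: yp; rewrite /pos/= in_itv/= andbT.
have [_ yt] := lt_hpt_tau p1 phoo y0 hy.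
have : y \in `]0%R, tau[ by rewrite in_itv/= y0 yt.
exact: id.
Qed.

End dual.

(** By [hE_le], [hE] is dominated by an integral with density [hpt * hpA], so the test uses the
    kernel that is 1 for [z < y]. The dual bound it asks for is [dual_sum], reached through
    [dH_power_le] and [integral_hpt_dB]. *)
Lemma hT4_lower : exists2 C : R, (0 < C)%R & forall (D : hdata R) (M : R), (0 <= M)%R ->
  hbound p q D M -> hphi_inf D p < +oo -> hT4 D p q (dminus (hphi D p)) <= (C * M)%:E.
Proof.
have [C1 C10 hC1] := dual_sum p1 q1.
have [C2 C20 hC2] := hE_le p1.
(* The chain of constants: [C2] from [hE_le], 2 from the layers, [C1^p'] from [dual_sum]. *)
have [L0 [L00 L0E]] : exists L : R, (0 < L)%R /\ (L `^ p' = C2 * 2 * C1 `^ p')%R.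
  exists ((C2 * 2 * C1 `^ p') `^ p'^-1)%R; split; first by rewrite powR_gt0// !mulr_gt0// powR_gt0.
  by rewrite -powRrM mulVf ?gt_eqF// powRr1// !mulr_ge0 ?powR_ge0// ltW.
exists (lower_const p' q' * L0)%R; first by rewrite mulr_gt0// lower_const_gt0.
move=> D M M0 hyp phoo; rewrite -mulrA.
have LM0 : (0 <= L0 * M)%R by rewrite mulr_ge0// ltW.
set m : {measure set B -> \bar R} := dminus (hphi D p).
have npt := nnm_hpt (p := p) phoo; have npA := nnm_hpA p D.
have C2E : 0 <= C2%:E by rewrite lee_fin ltW.
have nHA : nnm (fun t : T => hpt D p t * hpA p D t) by exact: nnmM npt npA.
have nal : nnm ((fun t : T => C2%:E * (hpt D p t * hpA p D t)) \_ (pos : set T)).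
  by apply: (nnm_patch mpos); exact: nnmM (nnm_cst C2E) nHA.
pose N (v : T * T) : \bar R := if (v.2 < v.1)%R then 1 else 0.
have nN : nnm N.
  split => [|v]; last by rewrite /N; case: ifP.
  pose A : set (T * T) := [set v | (v.2 < v.1)%R].
  have mA : measurable A.
    have := measurable_fun_pair (@measurable_snd _ _ T T) (@measurable_fst _ _ T T).
    by move=> /(_ measurableT _ measurable_fun_lt_prod); rewrite setTI.
  rewrite (_ : N = (fun=> 1) \_ A); first exact: (nnm_patch mA (nnm_cst lee01)).1.
  by apply/funext => v; rewrite patchE /N mem_setE.
apply: (hardy_tail_lower p1 q1 (m2 := mu) LM0 nal nN (nnm_hE p D m)).
- move=> y y' z yy'; rewrite /N/=; case: ifP => [zy|_]; last by case: ifP.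
  by rewrite (lt_trans zy yy').
- move=> y y0; apply: le_trans (hC2 D phoo y y0) _.
  rewrite -(integralMl mu (mIco y) C2E nHA) /ktest_N [leLHS]integral_mkcond.
  apply: le_integral_nng => t _.
    by rewrite patchE; case: ifP => // _; apply: mule_ge0 C2E _; exact: nHA.2.
  rewrite patchE; case: ifPn => [/set_mem/in_oo[t0 ty]|_]; last first.
    by apply: mule_ge0; [exact: poweR_ge0|exact: nal.2].
  rewrite /N ty poweR1r mul1e patchE mem_set; first exact: lexx.
  by rewrite /pos/= in_itv/= t0.
move=> n f nf [c hc].
have c0 : (0 <= c)%R by rewrite -lee_fin; exact: le_trans (nf.2 0%R) (hc 0%R).
pose h : T -> \bar R := f \_ (Ico n).
have nh : nnm h by exact: (nnm_patch (mIco n) nf).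
have hh y : h y <= c%:E.
  by rewrite /h patchE; case: ifP => _; [exact: hc|rewrite lee_fin].
have hn y : (n <= y)%R -> h y = 0.
  move=> ny; rewrite /h patchE memNset// => /in_oo[_ yn].
  by move: (le_lt_trans ny yn); rewrite ltxx.
have h2 := hC1 D M M0 hyp phoo h c n nh hh hn.
have hwE y : f y * ((hw D : T -> \bar R) \_ (Ico n)) y = h y * hw D y.
  by rewrite /h !patchE; case: ifP => _; rewrite ?mule0 ?mul0e.
have IE : \int[mu]_y (f y `^ q' * ((hw D : T -> \bar R) \_ (Ico n)) y) =
    \int[mu]_(y in pos) (h y `^ q' * hw D y).
  rewrite -lint_pos; last by move=> y y0; rewrite Ico_le0// mule0.
  rewrite setIT; apply: eq_integral => y _; rewrite /h !patchE; case: ifP => _ //.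
  by rewrite mule0 poweR0r ?mul0e// gt_eqF.
rewrite IE; set I := integral _ _ _ in h2 *.
have I0 : 0 <= I by apply: integral_nng => y _; apply: mule_ge0; [exact: poweR_ge0|exact: (nhw D).2].
have nps : nnm (fun t : T => hpt D p t * (dB D h t `^ (p' - 1) * db D h t)).
  exact: nnmM npt (nnmM (nnm_poweR _ (nnm_dB D nh)) (nnm_db D nh)).
apply: (@le_trans _ _ (C2%:E * \int[mu]_(t in pos) (hpt D p t * (dB D h t `^ (p' - 1) * db D h t)))).
  rewrite -(integralMl mu mpos C2E nps) [leRHS]integral_mkcond; apply: le_integral_nng => z _.
    by apply: mule_ge0; [exact: poweR_ge0|exact: nal.2].
  rewrite !patchE; case: ifP => zp; last by rewrite mule0.
  have -> : \int[mu]_y (N (y, z) * (f y * ((hw D : T -> \bar R) \_ (Ico n)) y)) = dH D h z.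
    rewrite /dH /tail /lebesgue_integral [RHS]integral_mkcond; apply: eq_integral => y _.
    rewrite hwE /N patchE mem_setE in_itv/= andbT; case: ifP => _; first by rewrite mul1e.
    by rewrite mul0e.
  rewrite muleCA; apply: (le_mull C2E); rewrite muleCA; apply: (le_mull (npt.2 z)).
  exact: dH_power_le.
apply: le_trans (le_mull C2E (integral_hpt_dB phoo nh)) _.
have E2 : 0 <= 2%:E :> \bar R by rewrite lee_fin.
apply: le_trans (le_mull C2E (le_mull E2 h2)) _.
have CM0 : 0 <= (C1 * M)%:E by rewrite lee_fin mulr_ge0// ltW.
rewrite (poweRM _ CM0 (poweR_ge0 _ _)) poweR_EFin -poweRrM [(q'^-1 * p')%R]mulrC.
rewrite !muleA -!EFinM (powRM _ (ltW L00) M0) L0E (powRM _ (ltW C10) M0) mulrA; exact: lexx.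
Qed.

(** The kernel test runs on [R] times [nat], with masses [2 lev n] at the crossing points: those
    beyond [y] add up to at least [hpt y], so the test controls [hT3]. The bound it asks for follows
    from [dual_sum] with [h = f A^(q-1)]. *)
Lemma hT3_lt_lower : (q < p)%R -> exists2 C : R, (0 < C)%R & forall (D : hdata R) (M : R), (0 <= M)%R ->
  hbound p q D M -> hphi_inf D p < +oo -> hT3 D p q <= (C * M)%:E.
Proof.
move=> qp; have [C1 C10 hC1] := dual_sum p1 q1.
have [L0 [L00 L0E]] : exists L : R, (0 < L)%R /\ (L `^ p' = 2 * C1 `^ p')%R.
  exists ((2 * C1 `^ p') `^ p'^-1)%R; split; first by rewrite powR_gt0// mulr_gt0// powR_gt0.
  by rewrite -powRrM mulVf ?gt_eqF// powRr1// mulr_ge0 ?powR_ge0.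
have p'q' : (p' < q')%R by exact: conjexp_lt.
have r0 : (0 < r)%R := rexp_gt0 q0 qp.
have qp' : (p <= q)%R = false by rewrite leNgt qp.
have p'q'' : (q' <= p')%R = false by rewrite leNgt p'q'.
exists (lower_const p' q' * L0)%R; first by rewrite mulr_gt0// lower_const_gt0.
move=> D M M0 hyp phoo; rewrite -mulrA.
set L := (L0 * M)%R; have LM0 : (0 <= L)%R by rewrite mulr_ge0// ltW.
have npt := nnm_hpt (p := p) phoo; have nAq := nnm_hAq D q.
have rp0 : (0 <= r / p)%R by rewrite divr_ge0 ?ltW.
have rp'0 : (0 <= r / p')%R by rewrite divr_ge0 ?ltW.
have E2 : 0 <= 2%:E :> \bar R by rewrite lee_fin.
pose tau := hpt_tau p1 phoo.
pose alpha (n : nat) : \bar R := if hpt_occ D p n then 2%:E * (lev n)%:E else 0.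
have nal : nnm alpha.
  split => // n; rewrite /alpha; case: (hpt_occ D p n) => //; exact: mule_ge0 E2 (levE_ge0 n).
pose N (v : T * nat) : \bar R := if (v.1 < tau v.2)%R then 1 else 0.
have nN : nnm N.
  split => [|v]; last by rewrite /N; case: ifP.
  pose A : set (T * nat) := \bigcup_n (`]-oo, tau n[%classic `*` [set n]).
  have mA : measurable A.
    by apply: bigcup_measurable => n _; apply: measurableX => //; exact: measurable_litv.
  rewrite (_ : N = (fun=> 1) \_ A); first exact: (nnm_patch mA (nnm_cst lee01)).1.
  apply/funext => -[y n]; rewrite patchE /N/=; case: ifPn => h.
    by rewrite mem_set//; exists n => //; split => //=; rewrite in_itv.
  rewrite memNset// => -[k _ [/= + nk]]; rewrite -nk in_itv/= => h'.
  by move: h; rewrite h'.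
pose be n := (hAq D q : T -> \bar R) \_ (Ico n).
have nbe n : nnm (be n : T -> \bar R) by exact: (nnm_patch (mIco n) nAq).
have be0 n x : (x <= 0)%R -> be n x = 0 by exact: Ico_le0.
have mb y : measurable ([set y' | (y' < y)%R] : set T) by rewrite itv_NyoE; exact: measurable_litv.
have bN y y' z : [set y' | (y' < y)%R] y' -> N (y, z) <= N (y', z).
  move=> /= yy'; rewrite /N/=; case: ifPn => [yt|_]; last by case: ifP.
  by rewrite (lt_trans yy' yt).
have nV n : nnm (@ktest_V R (be n) (fun y => [set y' | (y' < y)%R]) : T -> \bar R).
  by rewrite ktest_V_lt; [exact: nnm_primitive|exact: be0].
have rkV n : rank mu (setT : set T) (be n) (@ktest_V R (be n) (fun y => [set y' | (y' < y)%R])).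
  by rewrite ktest_V_lt; [apply: rank_primitive_all; [exact: nbe|exact: be0]|exact: be0].
have Aoo n : hA D n < +oo by exact: ha_oo.
have A0 n : 0 <= hA D n by exact: (nnm_hA D).2.
have boo n : \int[mu]_y be n y < +oo.
  rewrite -integral_mkcond.
  apply: (@le_lt_trans _ _ (hA D n `^ q * primitive (hw D) n)).
    rewrite /primitive /lebesgue_integral -(integralMl mu (mIco n) (poweR_ge0 _ _) (nhw D)).
    apply: le_integral_nng => y; first by move=> _; exact: nAq.2.
    move=> /in_oo[_ yn]; apply: (le_mulr ((nhw D).2 y)); apply: (le_poweR (ltW q0) (A0 y)).
    exact: le_primitive (nha D) (ltW yn).
  apply: lte_mul_pinfty; [exact: poweR_ge0| |exact: hw_oo].
  by rewrite ge0_fin_numE ?poweR_ge0//; apply: poweR_lty; exact: Aoo.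
have bnd n (f : T -> \bar R) : nnm f -> (exists c : R, forall y, f y <= c%:E) ->
  \int[counting]_z ((\int[mu]_y (N (y, z) * (f y * be n y))) `^ p' * alpha z) <=
  (L `^ p')%:E * (\int[mu]_y (f y `^ q' * be n y)) `^ (p' / q').
  move=> nf [c hc].
  have c0 : (0 <= c)%R by rewrite -lee_fin; exact: le_trans (nf.2 0%R) (hc 0%R).
  (* With this [h] the density [f A^q w] is [h w A], and since [(q-1) q' = q] the [q']-norm of [f]
     for [A^q w] is that of [h] for [w]. *)
  pose h : T -> \bar R := (fun y => f y * hA D y `^ (q - 1)) \_ (Ico n).
  have nfA : nnm (fun y => f y * hA D y `^ (q - 1)) by exact: nnmM nf (nnm_poweR _ (nnm_hA D)).
  have nh : nnm h by exact: (nnm_patch (mIco n) nfA).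
  have hh y : h y <= (c * fine (hA D n) `^ (q - 1))%:E.
    rewrite /h patchE; case: ifPn => [/set_mem/in_oo[_ yn]|_]; last by rewrite lee_fin mulr_ge0// powR_ge0.
    rewrite EFinM -poweR_EFin fineK ?ge0_fin_numE//.
    apply: lee_pmul; [exact: nf.2|exact: poweR_ge0|exact: hc|].
    by apply: (le_poweR (ltW qm0) (A0 y)); exact: le_primitive (nha D) (ltW yn).
  have hn y : (n <= y)%R -> h y = 0.
    move=> ny; rewrite /h patchE memNset// => /in_oo[_ yn].
    by move: (le_lt_trans ny yn); rewrite ltxx.
  have h2 := hC1 D M M0 hyp phoo h _ n nh hh hn.
  have fbE y : f y * be n y = h y * hw D y * hA D y.
    rewrite /h /be !patchE; case: ifP => _; last by rewrite mule0 !mul0e.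
    rewrite /hAq -[X in hA D y `^ X](subrK 1%R) -(poweR_addr (A0 y) qm0 ltr01) (poweRe1 (A0 y)).
    by rewrite (AC (1*(2*1)) (((1*2)*4)*3)).
  have IE : \int[mu]_y (f y `^ q' * be n y) = \int[mu]_(y in pos) (h y `^ q' * hw D y).
    rewrite -lint_pos; last by move=> y y0; rewrite be0// mule0.
    rewrite setIT; apply: eq_integral => y _; rewrite /h /be !patchE; case: ifP => _; last first.
      by rewrite mule0 poweR0r ?mul0e// gt_eqF.
    rewrite (poweRM _ (nf.2 y) (poweR_ge0 _ _)) -poweRrM /hAq -muleA.
    by rewrite (_ : (q - 1) * q' = q)%R// -(conjexp_div q1); field; rewrite !gt_eqF.
  rewrite IE; set I := integral _ _ _ in h2 *.
  have I0 : 0 <= I by apply: integral_nng => y _; apply: mule_ge0; [exact: poweR_ge0|exact: (nhw D).2].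
  have nhw' := nnm_dhw D nh.
  (* Writing [A] as an integral and exchanging, [int_0^tau h w A] equals
     [int_0^tau a(t) int_t^tau h w], whose inner integral is at most the tail [dH t]. *)
  have NdB z : hpt_occ D p z -> \int[mu]_y (N (y, z) * (f y * be n y)) <= dB D h (tau z).
    move=> ho; have nhA : nnm (fun y : T => h y * hw D y * hA D y) by exact: nnmM nhw' (nnm_hA D).
    have -> : \int[mu]_y (N (y, z) * (f y * be n y)) = \int[mu]_(y in Ico (tau z)) (h y * hw D y * hA D y).
      rewrite -lint_pos; last by move=> y y0; rewrite be0// !mule0.
      rewrite setIT [RHS]integral_mkcond [LHS]integral_mkcond; apply: eq_integral => y _.
      rewrite !patchE !mem_setE !in_itv/= andbT fbE /N/=.
      by case: ((0 < y)%R) => //=; case: ifP => _; rewrite ?mul1e ?mul0e.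
    have := tonelli_lkernel 0%R (tau z) nhw' (nha D) => eq1.
    apply: (@le_trans _ _ (\int[mu]_(t in `]0%R, (tau z)[) (ha D t * lkernel (fun y => h y * hw D y) t (tau z)))).
      rewrite -eq1; exact: lexx.
    apply: le_integral_nng => y; first by move=> _; apply: mule_ge0; [exact: (nha D).2|exact: lkernel_ge0].
    move=> _; rewrite /db; apply: (le_mull ((nha D).2 y)).
    apply: subset_integral_nng => [t _|]; first exact: nhw'.2.
    by apply: subset_itvl; rewrite bnd_simp.
  have term z : (\int[mu]_y (N (y, z) * (f y * be n y))) `^ p' * alpha z <= 2%:E * dx p1 phoo h z.
    rewrite /alpha /dx; have [ho|_] := boolP (hpt_occ D p z); last by rewrite !mule0.
    rewrite muleC -muleA; apply: (le_mull E2); apply: (le_mull (levE_ge0 z)).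
    apply: (le_poweR (ltW p'0)); last exact: NdB.
    apply: integral_nng => y _; apply: mule_ge0; first exact: nN.2.
    by apply: mule_ge0; [exact: nf.2|exact: (nbe n).2].
  have t0 z : 0 <= (\int[mu]_y (N (y, z) * (f y * be n y))) `^ p' * alpha z.
    by apply: mule_ge0; [exact: poweR_ge0|exact: nal.2].
  rewrite (counting_integral setT t0) patch_setT.
  apply: (@le_trans _ _ (\sum_(z <oo) (2%:E * dx p1 phoo h z))).
    by apply: lee_nneseries => [z _ _|z _]; [exact: t0|exact: term].
  rewrite nneseriesZl; last by move=> z _; exact: dx_ge0.
  apply: le_trans (le_mull E2 h2) _.
  have CM0 : 0 <= (C1 * M)%:E by rewrite lee_fin mulr_ge0// ltW.
  rewrite (poweRM _ CM0 (poweR_ge0 _ _)) poweR_EFin -poweRrM [(q'^-1 * p')%R]mulrC.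
  rewrite !muleA -!EFinM (powRM _ (ltW L00) M0) L0E (powRM _ (ltW C10) M0) mulrA; exact: lexx.
(* The single level with [lev n < hpt y <= 2 lev n] already contributes enough, which explains the 2
   in [alpha]. *)
have NE y : (0 < y)%R -> hpt D p y <= ktest_N cnt p' alpha N y.
  move=> y0; have f0 z : 0 <= N (y, z) `^ p' * alpha z.
    by apply: mule_ge0; [exact: poweR_ge0|exact: nal.2].
  rewrite /ktest_N (counting_integral setT f0) patch_setT.
  have pE : hpt D p y = (fine (hpt D p y))%:E.
    by rewrite fineK// ge0_fin_numE ?(hpt_ge0 phoo)// (hpt_oo p1 phoo).
  have [p00|pn0] := leP (hpt D p y) 0.
    by apply: le_trans p00 _; apply: nneseries_ge0 => z _ _; exact: f0.
  have fp : (0 < fine (hpt D p y))%R by rewrite -lte_fin -pE.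
  have [n /andP[ln nl]] := lev_exists fp.
  have hl : (lev n)%:E < hpt D p y by rewrite pE lte_fin.
  have [ho yt] := lt_hpt_tau p1 phoo y0 hl.
  apply: le_trans (nneseries_term n f0).
  rewrite /alpha /N ho/= yt poweR1r mul1e pE -EFinM lee_fin; exact: nl.
rewrite /lower_const p'q'' (rexp_conjexp p q) (conjexpK p); set C := (_ `^ (r / p'))%R.
have C0 : (0 < C)%R by rewrite powR_gt0// invr_gt0 !powR_gt0.
rewrite /hT3 /hardy_const qp'.
have nF : nnm (fun t : T => hpt D p t `^ (r / p') * hAt D q t `^ (r / p) * hAq D q t).
  exact: nnmM (nnmM (nnm_poweR _ npt) (nnm_poweR _ (nnm_hAt D q))) nAq.
have I0 : 0 <= \int[mu]_(t in pos) (hpt D p t `^ (r / p') * hAt D q t `^ (r / p) * hAq D q t).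
  by apply: integral_nng => t _; exact: nF.2.
have hI : \int[mu]_(t in pos) (hpt D p t `^ (r / p') * hAt D q t `^ (r / p) * hAq D q t) <= C%:E * (L `^ r)%:E.
  apply: (integral_unbounded_le nF mpos) => n; rewrite -set_itv0o.
  have := @ktest_lt R _ _ cnt p' q' L (be n) alpha N _ p'1 q'1 (nbe n) nal nN mb bN (nV n) (rkV n) (boo n) (bnd n) p'q'.
  rewrite (rexp_conjexp p q) (conjexpK p) -/C => hn.
  apply: le_trans hn; rewrite [leLHS]integral_mkcond; apply: le_integral_nng => y _.
    by rewrite patchE; case: ifP => // _; exact: nF.2.
  rewrite patchE; case: ifPn => [/set_mem/=|_]; last first.
    apply: mule_ge0; last exact: (nbe n).2.
    by apply: mule_ge0; exact: poweR_ge0.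
  move=> yn; have [y0' yn'] := in_oo yn.
  rewrite ktest_V_lt; last exact: be0.
  rewrite (primitive_Ico _ (ltW yn')) /be patchE (mem_set (yn : Ico n y)).
  rewrite [X in X * _ <= _]muleC; apply: (le_mulr (nAq.2 y)); apply: (le_mull (poweR_ge0 _ _)).
  exact: (le_poweR rp'0 (npt.2 y) (NE y y0')).
apply: (@le_trans _ _ ((C%:E * (L `^ r)%:E) `^ r^-1)).
  by apply: le_poweR => //; rewrite invr_ge0 ltW.
rewrite -EFinM poweR_EFin powRM ?powR_ge0 ?(ltW C0)// -powRrM mulfV ?gt_eqF// powRr1//.
Qed.

End lower34.

Lemma le_sum5 {R : realType} (a b c d e : \bar R) : 0 <= a -> 0 <= b -> 0 <= c -> 0 <= d -> 0 <= e ->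
  let s := a + b + c + d + e in [/\ a <= s, b <= s, c <= s, d <= s & e <= s].
Proof.
move=> a0 b0 c0 d0 e0; split.
- by rewrite -!addeA leeDl// !adde_ge0.
- by rewrite [X in X + c]addeC -!addeA leeDl// !adde_ge0.
- by rewrite [X in X + d]addeC -!addeA leeDl// !adde_ge0.
- by rewrite [X in X + e]addeC -!addeA leeDl// !adde_ge0.
- by rewrite leeDr// !adde_ge0.
Qed.

Lemma mule2_ge0 {R : realType} (x : \bar R) : 0 <= x -> 2%:E * x = x + x.
Proof. by move=> x0; rewrite -[2%R]/(1 + 1)%R EFinD ge0_muleDl// mul1e. Qed.

(** * Assembly of the upper and lower bounds *)

Section combine.
Context {R : realType}.
Local Notation T := (lebesgueR R).
Local Notation mu := (@completed_lebesgue_measure R).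
Variables (p q : R).
Hypotheses (p1 : (1 < p)%R) (q1 : (1 < q)%R).
Local Notation p' := (conjexp p).
Let pos : set R := `]0%R, +oo[%classic.
Let p0 : (0 < p)%R := lt_trans ltr01 p1.
Let q0 : (0 < q)%R := lt_trans ltr01 q1.
Let q00 : (0 <= q)%R := ltW q0.
Let p'0 : (0 < p')%R := conjexp_gt0 p1.
Let mpos : measurable (pos : set T) := measurable_litv _.

Definition hsum (D : hdata R) :=
  hT1 D p q + hT2 D p q + hT3 D p q + hT4 D p q (dminus (hphi D p)) + hT5 D p q.

Lemma hT_ge0 (D : hdata R) m : [/\ 0 <= hT1 D p q, 0 <= hT2 D p q, 0 <= hT3 D p q, 0 <= hT4 D p q m & 0 <= hT5 D p q].
Proof.
have n0 : pos !=set0 by exact: pos_nonempty.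
split.
- exact: hardy_const_ge0.
- rewrite /hT2; case: ifP => _; last exact: poweR_ge0.
  apply: (@le_trans _ _ (hS D 1%R `^ p'^-1 * hOm D q 1%R `^ q^-1)).
    by apply: mule_ge0; exact: poweR_ge0.
  by apply: ereal_sup_ubound; exists 1%R => //; rewrite /= in_itv/= ltr01.
- exact: hardy_const_ge0.
- exact: hardy_const_ge0.
- by apply: mule_ge0; exact: poweR_ge0.
Qed.

Lemma hT_split (D : hdata R) k x : hphi_inf D p < +oo -> nnm (k : T -> \bar R) -> (0 < x)%R ->
  hT D k x <= primitive (hUK D k) x + 2%:E * ((hA D x * hH2 p D k x `^ p^-1 + hH1 p D k x) +
    hphi_inf D p `^ p'^-1 * hnorm D p k `^ p^-1 * hA D x).
Proof.
move=> phoo nk x0; set c := hphi_inf D p `^ p'^-1 * hnorm D p k `^ p^-1.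
have c0 : 0 <= c by apply: mule_ge0; exact: poweR_ge0.
have E2 : 0 <= 2%:E :> \bar R by rewrite lee_fin.
have nlp := nnm_hlamp (p := p) phoo nk.
have nh : nnm (htail p D k : T -> \bar R) by exact: nnm_tail.
have nha' : nnm (fun t : T => htail p D k t `^ p^-1 * ha D t) by exact: nnmM (nnm_poweR _ nh) (nha D).
have nca : nnm (fun t : T => c * ha D t) by exact: nnmM (nnm_cst c0) (nha D).
have nsum : nnm (fun t : T => htail p D k t `^ p^-1 * ha D t + c * ha D t) by exact: nnmD nha' nca.
have n2 : nnm (fun t : T => 2%:E * (htail p D k t `^ p^-1 * ha D t + c * ha D t)).
  exact: nnmM (nnm_cst E2) nsum.
have mx := measurable_litv `]0%R, x[ : measurable (`]0%R, x[%classic : set T).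
apply: (@le_trans _ _ (primitive (hUK D k) x + 2%:E * (hH p D k x + c * hA D x))); last first.
  apply: leeD; first exact: lexx.
  apply: (le_mull E2); apply: leeD; [exact: hH_split|exact: lexx].
rewrite /hH /hA /primitive /lebesgue_integral.
rewrite -(integralMl mu mx c0 (nha D)) -(integralDn mu mx nha' nca) -(integralMl mu mx E2 nsum).
rewrite -(integralDn mu mx (nnm_hUK D nk) n2).
apply: le_integral_nng => t.
  by move=> _; apply: mule_ge0; [exact: (nnm_hR D nk).2|exact: (nha D).2].
move=> /in_oo[t0 _]; have a0 := (nha D).2 t.
apply: le_trans (le_mulr a0 (hR_le p1 phoo nk t0)) _.
have h0 : 0 <= htail p D k t `^ p^-1 by exact: poweR_ge0.
have K0 : 0 <= hUs D t * hK D k t.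
  by apply: mule_ge0; [exact: (nnm_hUs D).2|exact: (nnm_hK D nk).2].
rewrite ge0_muleDl//; last by apply: mule_ge0 E2 _; exact: adde_ge0.
rewrite -[X in _ + X <= _]muleA ge0_muleDl// /hUK /hUa.
rewrite [X in X + _ <= _]muleAC; exact: lexx.
Qed.

Lemma hsum_upper : exists2 C : R, (0 < C)%R & forall D k, hphi_inf D p < +oo -> nnm (k : T -> \bar R) ->
  hT1 D p q < +oo -> hT4 D p q (dminus (hphi D p)) < +oo -> hnorm D p k < +oo ->
  \int[mu]_(x in pos) (hT D k x `^ q * hw D x) <= C%:E * (hsum D `^ q * hnorm D p k `^ (q / p)).
Proof.
have [C1 C10 hC1] := upper_hUK p1 q1.
have [C2 C20 hC2] := upper_hH2 p1 q1.
have [C3 C30 hC3] := upper_hH1 p1 q1.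
have [K [K0 KE]] : exists K : R, (0 < K)%R /\ (K = 2 `^ q)%R by exists (2 `^ q)%R; rewrite powR_gt0.
pose c' := (2 * C1 + C2 + C3 + 1)%R.
have c'0 : (0 < c')%R by rewrite /c'; lra.
have [[b1 b2] [b3 b4]] : ((C1 * 2 <= c') /\ (C2 <= c'))%R /\ ((C3 <= c') /\ (1 <= c'))%R.
  by rewrite /c'; lra.
have [C1p [C2p C3p]] : ((0 <= C1 * 2) /\ (0 <= C2) /\ (0 <= C3))%R by lra.
(* The four contributions are at most [Y] each; a factor [K = 2^q] enters at every splitting of a
   [q]-th power and for the factor 2 in [hT_split]. *)
exists (K * (1 + K * (K * (K * 2 + 1))) * c')%R.
  by rewrite mulr_gt0// mulr_gt0// addr_gt0// !mulr_gt0// addr_gt0// mulr_gt0.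
move=> D k phoo nk T1oo T4oo Loo.
pose m := dminus (hphi D p).
have [T10 T20 T30 T40 T50] := hT_ge0 D m.
have L0 : 0 <= hnorm D p k by exact: hnorm_ge0.
have KE0 : 0 <= K%:E by rewrite lee_fin ltW.
have E2 : 0 <= 2%:E :> \bar R by rewrite lee_fin.
set S := hsum D `^ q; set L := hnorm D p k `^ (q / p).
have SL0 : 0 <= S * L by apply: mule_ge0; exact: poweR_ge0.
have leS t : 0 <= t -> t <= hsum D -> t `^ q <= S by exact: le_poweR.
have [l1 l2 l3 l4 l5] := le_sum5 T10 T20 T30 T40 T50; rewrite -/(hsum D) in l1 l2 l3 l4 l5.
have s1 := leS _ T10 l1; have s2 := leS _ T20 l2; have s3 := leS _ T30 l3.
have s4 := leS _ T40 l4; have s5 := leS _ T50 l5.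
set X1 := primitive (hUK D k); pose X2 x := hA D x * hH2 p D k x `^ p^-1; pose X3 := hH1 p D k.
set c := hphi_inf D p `^ p'^-1 * hnorm D p k `^ p^-1; pose X4 x := c * hA D x.
have c0 : 0 <= c by apply: mule_ge0; exact: poweR_ge0.
have n1 : nnm (X1 : T -> \bar R) by exact: nnm_primitive (nnm_hUK D nk).
have n2 : nnm (X2 : T -> \bar R) by exact: nnmM (nnm_hA D) (nnm_poweR _ (nnm_hH2 phoo nk)).
have n3 : nnm (X3 : T -> \bar R) by exact: nnm_hH1.
have n4 : nnm (X4 : T -> \bar R) by exact: nnmM (nnm_cst c0) (nnm_hA D).
have L00 : 0 <= L by exact: poweR_ge0.
have w (X : R -> \bar R) : nnm (X : T -> \bar R) -> nnm (fun x : T => X x `^ q * hw D x).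
  by move=> nX; exact: nnmM (nnm_poweR _ nX) (nhw D).
have cmp (a b : R) (Z : \bar R) : (0 <= a)%R -> (a <= b)%R -> 0 <= Z -> a%:E * Z <= b%:E * Z.
  by move=> a0 ab Z0; apply: le_mulr; rewrite ?lee_fin.
pose Y := c'%:E * (S * L); have Y0 : 0 <= Y by apply: mule_ge0 SL0; rewrite lee_fin ltW.
pose J X := \int[mu]_(x in pos) (X x `^ q * hw D x).
have J1 : J X1 <= Y.
  apply: le_trans (hC1 D k nk T1oo Loo) _.
  have C1E : 0 <= C1%:E by rewrite lee_fin ltW.
  apply: (@le_trans _ _ (C1%:E * ((2%:E * S) * L))).
    apply: (le_mull C1E); apply: (le_mulr L00).
    rewrite (mule2_ge0 (poweR_ge0 _ _)); exact: (leeD s1 s2).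
  have -> : C1%:E * (2%:E * S * L) = (C1 * 2)%:E * (S * L) by rewrite EFinM !muleA.
  exact: (cmp _ _ _ C1p b1 SL0).
have J2 : J X2 <= Y.
  apply: le_trans (hC2 D k phoo nk) _.
  have C2E : 0 <= C2%:E by rewrite lee_fin ltW.
  apply: le_trans (le_mull C2E (le_mulr L00 s3)) _.
  exact: (cmp _ _ _ C2p b2 SL0).
have J3 : J X3 <= Y.
  apply: le_trans (hC3 D k phoo nk T4oo) _.
  have C3E : 0 <= C3%:E by rewrite lee_fin ltW.
  apply: le_trans (le_mull C3E (le_mulr L00 s4)) _.
  exact: (cmp _ _ _ C3p b3 SL0).
have J4 : J X4 <= Y.
  have -> : J X4 = hT5 D p q `^ q * L.
    have nAq := nnm_hAq D q; set I := \int[mu]_(y in pos) hAq D q y.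
    have I0 : 0 <= I by apply: integral_nng => y _; exact: nAq.2.
    transitivity (\int[mu]_(x in pos) (c `^ q * hAq D q x)).
      apply: eq_integral => x _; rewrite /X4 /hAq (poweRM _ c0 ((nnm_hA D).2 x)); by rewrite -muleA.
    rewrite (integralMl mu mpos (poweR_ge0 _ _) nAq) -/I /c /hT5 -/I.
    rewrite (poweRM _ (poweR_ge0 _ _) (poweR_ge0 _ _)) (poweRM _ (poweR_ge0 _ _) (poweR_ge0 _ _)).
    rewrite (poweRVK I0 (lt0r_neq0 q0)) -!poweRrM /L [(p^-1 * q)%R]mulrC.
    by rewrite (AC (2*1) ((3*1)*2)).
  apply: le_trans (le_mulr L00 s5) _; rewrite -[leLHS]mul1e.
  exact: (cmp _ _ _ ler01 b4 SL0).
pose Z12 x := X2 x + X3 x; pose Z x := Z12 x + X4 x.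
have n12 : nnm (Z12 : T -> \bar R) by exact: nnmD.
have nZ : nnm (Z : T -> \bar R) by exact: nnmD.
have nTZ : nnm (fun x : T => 2%:E * Z x) by exact: nnmM (nnm_cst E2) nZ.
have Jsum (F G : R -> \bar R) : nnm (F : T -> \bar R) -> nnm (G : T -> \bar R) ->
    J (fun x => F x + G x) <= K%:E * (J F + J G).
  move=> nF nG; rewrite /J -(integralDn mu mpos (w _ nF) (w _ nG)).
  have nFG : nnm (fun x : T => F x `^ q * hw D x + G x `^ q * hw D x) by exact: nnmD (w _ nF) (w _ nG).
  rewrite -(integralMl mu mpos KE0 nFG); apply: le_integral_nng => x.
    by move=> _; apply: mule_ge0; [exact: poweR_ge0|exact: (nhw D).2].
  move=> _; rewrite -ge0_muleDl ?poweR_ge0// muleA; apply: (le_mulr ((nhw D).2 x)).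
  rewrite KE; exact: (poweR_max_le q00 (nF.2 x) (nG.2 x)).
have JZ : J (fun x => 2%:E * Z x) = K%:E * J Z.
  rewrite /J -(integralMl mu mpos KE0 (w _ nZ)); apply: eq_integral => x _.
  by rewrite (poweRM _ E2 (nZ.2 x)) poweR_EFin KE muleA.
have step : J (hT D k) <= K%:E * (Y + K%:E * (K%:E * (K%:E * (Y + Y) + Y))).
  apply: (@le_trans _ _ (J (fun x => X1 x + 2%:E * Z x))).
    apply: le_integral_nng => x.
      by move=> _; apply: mule_ge0; [exact: poweR_ge0|exact: (nhw D).2].
    rewrite /pos/= in_itv/= andbT => x0; apply: (le_mulr ((nhw D).2 x)); apply: (le_poweR q00).
      exact: primitive_ge0 (nnmM (nnm_hR D nk) (nha D)).
    exact: hT_split.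
  apply: le_trans (Jsum _ _ n1 nTZ) _; apply: (le_mull KE0); apply: leeD J1 _.
  rewrite JZ; apply: (le_mull KE0); apply: le_trans (Jsum _ _ n12 n4) _.
  apply: (le_mull KE0); apply: leeD J4; apply: le_trans (Jsum _ _ n2 n3) _.
  apply: (le_mull KE0); exact: leeD J2 J3.
apply: le_trans step _; rewrite [(_ * c')%:E]EFinM -muleA -/Y.
have cK : (0 < K * (1 + K * (K * (K * 2 + 1))))%R.
  by rewrite mulr_gt0// addr_gt0// !mulr_gt0// addr_gt0// mulr_gt0.
case: Y Y0 {J1 J2 J3 J4} => [y| |//] Y0; last by rewrite [leRHS]gt0_muley ?lte_fin// leey.
rewrite -!(EFinD, EFinM) lee_fin.
by rewrite le_eqVlt; apply/orP; left; apply/eqP; ring.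
Qed.
(** As [int A^q w > 0], an infinite limit of [hphi] would make the last term infinite. *)
Lemma hT5_fin (D : hdata R) : hT5 D p q < +oo -> hphi_inf D p < +oo.
Proof.
move=> h5; rewrite ltey; apply/eqP => h; move: h5; rewrite /hT5 h poweRyr; last by rewrite gt_eqF// invr_gt0.
have A0 : 0 < hAt D q 1%R by exact: hAt_gt0.
have : 0 < \int[mu]_(y in pos) hAq D q y.
  apply: lt_le_trans A0 _; apply: subset_integral_nng => [x _|x]; first exact: (nnm_hAq D q).2.
  by rewrite /pos/= !in_itv/= andbT => /andP[].
by move=> /(poweR_gt0 q^-1) I0; rewrite gt0_muley.
Qed.

Lemma hsum_upper_root : exists2 C : R, (0 < C)%R & forall D k, hsum D < +oo -> nnm (k : T -> \bar R) ->
  hnorm D p k < +oo ->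
  (\int[mu]_(x in pos) (hT D k x `^ q * hw D x)) `^ q^-1 <= C%:E * hsum D * hnorm D p k `^ p^-1.
Proof.
have [C C0 hC] := hsum_upper; exists (C `^ q^-1)%R; first by rewrite powR_gt0.
move=> D k Soo nk Loo; set m := dminus (hphi D p).
have [T10 T20 T30 T40 T50] := hT_ge0 D m.
have [l1 l2 l3 l4 l5] := le_sum5 T10 T20 T30 T40 T50.
have phoo : hphi_inf D p < +oo by apply: hT5_fin; exact: le_lt_trans l5 Soo.
have h := hC D k phoo nk (le_lt_trans l1 Soo) (le_lt_trans l4 Soo) Loo.
have S0 : 0 <= hsum D by exact: le_trans T10 l1.
have L0 := hnorm_ge0 p D nk.
have CE : 0 <= C%:E by rewrite lee_fin ltW.
have i0 : 0 <= \int[mu]_(x in pos) (hT D k x `^ q * hw D x).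
  by apply: integral_nng => x _; apply: mule_ge0; [exact: poweR_ge0|exact: (nhw D).2].
have qV : (0 <= q^-1)%R by rewrite invr_ge0 ltW.
apply: le_trans (le_poweR qV i0 h) _.
rewrite (poweRM _ CE (mule_ge0 (poweR_ge0 _ _) (poweR_ge0 _ _))) (poweRM _ (poweR_ge0 _ _) (poweR_ge0 _ _)).
rewrite poweR_EFin (poweRK S0 (lt0r_neq0 q0)) -poweRrM muleA.
rewrite (_ : q / p * q^-1 = p^-1)%R; first exact: lexx.
by field; rewrite !gt_eqF.
Qed.

Lemma hsum_lower : exists2 C : R, (0 < C)%R & forall (D : hdata R) (M : R), (0 <= M)%R ->
  hbound p q D M -> hsum D <= (C * M)%:E.
Proof.
have [C4 C40 hC4] := hT4_lower p1 q1.
have [C3 C30 hC3] : exists2 C : R, (0 < C)%R & forall (D : hdata R) (M : R), (0 <= M)%R ->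
    hbound p q D M -> hphi_inf D p < +oo -> hT3 D p q <= (C * M)%:E.
  have [pq|qp] := leP p q; last exact: hT3_lt_lower.
  by exists 1%R => // D M M0 hyp phoo; rewrite mul1r; exact: hT3_le_lower.
exists (lower_const p' (conjexp q) + lower_const q p + C3 + C4 + 1)%R.
  by rewrite !addr_gt0// lower_const_gt0.
move=> D M M0 hyp; have phoo := hphi_inf_lower p1 q1 M0 hyp.
rewrite !mulrDl mul1r !EFinD; apply: leeD; last exact: (hT5_lower p1 q1 M0 hyp).
apply: leeD; last exact: hC4.
apply: leeD; last exact: hC3.
apply: leeD; first exact: (hT1_lower p1 q1 M0 hyp).
exact: (hT2_lower p1 q1 M0 hyp).
Qed.

End combine.

(** * Removal of the monotonicity *)

Section ratio.
Context {R : realType}.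
Implicit Types n d G : \bar R.

(** The conventions agree at both ends: [d = +oo] gives the quotient 0, and for [d = 0] the
    hypothesis forces [n = 0]. *)
Lemma le_ratio n d G : 0 <= n -> 0 <= d -> 0 <= G -> (d < +oo -> n <= G * d) -> n / d <= G.
Proof.
move=> n0; case: d => [d| |//] d0 G0 h; last by rewrite invey mule0.
have {}h := h (ltry d); have [d00|dn] := eqVneq d 0%R.
  move: h; rewrite d00 mule0 => h; have -> : n = 0 by apply/eqP; rewrite eq_le h.
  by rewrite mul0e.
have dp : (0 < d)%R by rewrite lt_neqAle eq_sym dn -lee_fin.
rewrite inver (negbTE dn); apply: le_trans (le_mulr _ h) _; first by rewrite lee_fin invr_ge0 ltW.
by rewrite -muleA -EFinM mulfV// mule1 lexx.
Qed.

(** [G < +oo] excludes [n > 0 = d], where the quotient is infinite while [G * d = 0]. *)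
Lemma ratio_le n d G : 0 <= n -> 0 <= d -> d < +oo -> G < +oo -> n / d <= G -> n <= G * d.
Proof.
move=> n0; case: d => [d| |//] d0 doo Goo; last by rewrite ltxx in doo.
have [->|dn] := eqVneq d 0%R.
  rewrite inve0 mule0; have [->//|nn] := eqVneq n 0.
  have np : 0 < n by rewrite lt_def nn.
  by rewrite gt0_muley// leye_eq => /eqP GE; move: Goo; rewrite GE ltxx.
have dp : (0 < d)%R by rewrite lt_neqAle eq_sym dn -lee_fin.
move=> h; apply: le_trans (le_mulr d0 h).
by rewrite inver (negbTE dn) -muleA -EFinM mulVf// mule1 lexx.
Qed.

End ratio.

Section positive_part.
Context {R : realType}.
Local Notation T := (lebesgueR R).
Let pos : set R := `]0%R, +oo[%classic.
Let mpos : measurable (pos : set T) := measurable_litv _.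
Implicit Types f : R -> \bar R.

Definition posp f : R -> \bar R := (f : T -> \bar R) \_ (pos : set T).

Lemma posp_gt f x : (0 < x)%R -> posp f x = f x.
Proof. by move=> x0; rewrite /posp patchE mem_set// /pos/= in_itv/= x0. Qed.

Lemma posp_le f x : (x <= 0)%R -> posp f x = 0.
Proof.
by move=> x0; rewrite /posp patchE memNset// /pos/= in_itv/= andbT => /(le_lt_trans x0); rewrite ltxx.
Qed.

Lemma nnm_posp f : Mplus f -> nnm (posp f : T -> \bar R).
Proof.
move=> [mf f0]; split; first by apply/(measurable_restrictT (f : T -> \bar R) mpos).
move=> x; have [x0|x0] := ltP 0%R x; first by rewrite posp_gt// f0.
by rewrite posp_le.
Qed.

Lemma primitive_posp f x : primitive (posp f) x = primitive f x.
Proof. by apply: eq_integral => t /set_mem/in_oo[t0 _]; rewrite posp_gt. Qed.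

Lemma weight_primitive f x : weight f -> (0 < x)%R -> 0 < primitive f x /\ primitive f x < +oo.
Proof. by move=> [_ h] x0; exact: h. Qed.

Lemma weight_primitive_oo f x : weight f -> primitive f x < +oo.
Proof.
move=> wf; have [x0|x0] := ltP 0%R x; first by have [] := weight_primitive wf x0.
by rewrite primitive_le0.
Qed.

End positive_part.

Section reduction_data.
Context {R : realType}.
Local Notation T := (lebesgueR R).
Local Notation mu := (@completed_lebesgue_measure R).
Variables (p : R) (u : R -> R) (a v w : R -> \bar R).
Hypothesis p1 : (1 < p)%R.
Hypotheses (wu : weight (fun x => (u x)%:E)) (cu : continuous_on_pos u).
Hypotheses (wa : weight a) (wv : weight v) (ww : weight w).
Local Notation p' := (conjexp p).
Let p'0 : (0 < p')%R := conjexp_gt0 p1.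
Local Notation V := (primitive v).

Definition rs (x : R) : \bar R := V x `^ p' * posp v x.
(** Real-valued because continuity is asked of [hU]; [fine] loses nothing for [x > 0], where [V] is
    positive and finite. *)
Definition rU (x : R) : R := if (0 < x)%R then fine (uVm2 u v x) else 0%R.

Let nv : nnm (posp v : T -> \bar R). Proof. by apply: nnm_posp; case: wv. Qed.

Lemma nnm_V : nnm (V : T -> \bar R).
Proof.
have <- : primitive (posp v) = V by apply/funext => x; exact: primitive_posp.
exact: (nnm_primitive nv).
Qed.

Lemma le_V x y : (x <= y)%R -> V x <= V y.
Proof. by move=> xy; rewrite -(primitive_posp v x) -(primitive_posp v y); exact: le_primitive nv xy. Qed.

Let V0 x : 0 <= V x := nnm_V.2 x.
Let Vgt0 x : (0 < x)%R -> 0 < V x. Proof. by move=> x0; have [] := weight_primitive wv x0. Qed.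
Let Voo x : V x < +oo. Proof. exact: weight_primitive_oo. Qed.
Let VE x : V x = (fine (V x))%:E. Proof. by rewrite fineK// ge0_fin_numE. Qed.
Let fVgt0 x : (0 < x)%R -> (0 < fine (V x))%R. Proof. by move=> x0; rewrite -lte_fin -VE Vgt0. Qed.

Lemma rank_V x : rank mu (`]0%R, x[%classic : set T) (posp v) V.
Proof.
have <- : primitive (posp v) = V by apply/funext => y; exact: primitive_posp.
by apply: rank_sub nv _ (rank_primitive nv); apply: subset_itvl; rewrite bnd_simp.
Qed.

Lemma nnm_rs : nnm (rs : T -> \bar R).
Proof. exact: nnmM (nnm_poweR _ nnm_V) nv. Qed.

Lemma rs_gt x : (0 < x)%R -> rs x = Vpv p v x.
Proof. by move=> x0; rewrite /rs posp_gt. Qed.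

Lemma primitive_rs x : primitive rs x = primitive (Vpv p v) x.
Proof. by apply: eq_integral => t /set_mem/in_oo[t0 _]; rewrite rs_gt. Qed.

Lemma rs_oo x : primitive rs x < +oo.
Proof.
apply: (@le_lt_trans _ _ (V x `^ p' * V x)).
  rewrite -[X in _ <= _ * X]primitive_posp /primitive /lebesgue_integral.
  rewrite -(integralMl mu (measurable_litv _) (poweR_ge0 _ _) nv).
  apply: le_integral_nng => t; first by move=> _; exact: nnm_rs.2.
  move=> /in_oo[_ tx]; apply: (le_mulr (nv.2 t)); apply: (le_poweR (ltW p'0)) (le_V (ltW tx)).
  exact: V0.
apply: lte_mul_pinfty; [exact: poweR_ge0| |exact: Voo].
by rewrite ge0_fin_numE ?poweR_ge0//; apply: poweR_lty; exact: Voo.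
Qed.

(** [rank_poweR_int] bounds it below by a multiple of [V^(p'+1)]. *)
Lemma rs_gt0 x : (0 < x)%R -> 0 < primitive rs x.
Proof.
move=> x0; have := rank_poweR_int (measurable_litv _) nv nnm_V (@rank_V x) (ltW p'0).
have -> : \int[mu]_(t in `]0%R, x[) posp v t = V x by rewrite -[RHS]primitive_posp.
apply: lt_le_trans; apply: mule_gt0; first by rewrite lte_fin powR_gt0.
by apply: poweR_gt0; exact: Vgt0.
Qed.

Lemma u_ge0 x : (0 < x)%R -> (0 <= u x)%R.
Proof. by have [[_ h] _] := wu => /h; rewrite lee_fin. Qed.

Lemma VpowE x (c : R) : (0 < x)%R -> V x `^ c = (fine (V x) `^ c)%:E.
Proof. by move=> x0; rewrite [in LHS]VE poweR_EFin. Qed.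

Lemma rU_gt x : (0 < x)%R -> (rU x)%:E = uVm2 u v x.
Proof. by move=> x0; rewrite /rU x0 fineK// /uVm2 VpowE. Qed.

Lemma rU_ge0 x : (0 <= rU x)%R.
Proof.
rewrite /rU; case: ifP => // x0; rewrite fine_ge0// /uVm2; apply: mule_ge0; last exact: poweR_ge0.
by rewrite lee_fin u_ge0.
Qed.

Lemma rU_cont x : (0 < x)%R -> {for x, continuous rU}.
Proof.
move=> x0.
have cV : {for x, continuous (fun y => fine (V y))}.
  have oo y : primitive (posp v) y < +oo by rewrite primitive_posp.
  have := continuous_primitive (b := x) nv oo.
  by under eq_fun do rewrite primitive_posp; rewrite primitive_posp.
have cu' : {for x, continuous u}.
  have : {in (`]0%R, +oo[%classic : set R), continuous u}.
    by rewrite -continuous_open_subspace; [exact: cu|exact: interval_open].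
  by apply; rewrite inE/= in_itv/= x0.
have V2 y : (0 < y)%R -> (fine (V y) `^ (- 2%:R) = (fine (V y) ^+ 2)^-1)%R.
  by move=> y0; rewrite powRN powR_mulrn// ltW// fVgt0.
have cc : {for x, continuous (fun y => u y * (fine (V y) ^+ 2)^-1)%R}.
  apply: cvgM; first exact: cu'.
  apply: cvgV; first by rewrite expf_neq0// gt_eqF// fVgt0.
  by rewrite expr2; under eq_fun do rewrite expr2; apply: cvgM; exact: cV.
have E y : (0 < y)%R -> rU y = (u y * (fine (V y) ^+ 2)^-1)%R.
  by move=> y0; rewrite /rU y0 /uVm2 VpowE// V2.
suff : rU y @[y --> x] --> rU x by [].
rewrite (E x x0); apply: cvg_trans cc; apply: near_eq_cvg.
near=> y; rewrite E//; near: y; exact: lt_nbhsr.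
Unshelve. all: by end_near. Qed.

(** Closed with [Defined]: its projections are later replaced by [posp a], [posp w], [rs] and [rU]
    through conversion. *)
Definition rdata : hdata R.
Proof.
apply: (@HData R (posp a) (posp w) rs rU).
- by apply: nnm_posp; case: wa.
- by apply: nnm_posp; case: ww.
- exact: nnm_rs.
- by move=> x; rewrite primitive_posp; exact: weight_primitive_oo wa.
- by move=> x; rewrite primitive_posp; exact: weight_primitive_oo ww.
- exact: rs_oo.
- by move=> x x0; rewrite primitive_posp; have [] := weight_primitive wa x0.
- by move=> x x0; rewrite primitive_posp; have [] := weight_primitive ww x0.
- exact: rs_gt0.
- by move=> x x0; rewrite /rs posp_le// mule0.
- exact: rU_ge0.
- exact: rU_cont.
Defined.

End reduction_data.

Lemma nneseriesMl {R : realType} (c : \bar R) (f : nat -> \bar R) : 0 <= c -> (forall n, 0 <= f n) ->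
  \sum_(n <oo) (c * f n) = c * \sum_(n <oo) f n.
Proof.
move=> c0 f0; have nf : nnm f by split.
have cf0 n : 0 <= c * f n by exact: mule_ge0.
have := integralMl (@counting nat R) measurableT c0 nf.
by rewrite (counting_integral setT f0) (counting_integral setT cf0) !patch_setT.
Qed.

Section reduction.
Context {R : realType}.
Local Notation T := (lebesgueR R).
Local Notation mu := (@completed_lebesgue_measure R).
Variables (p q : R) (u : R -> R) (a v w : R -> \bar R).
Hypotheses (p1 : (1 < p)%R) (q1 : (1 < q)%R).
Hypotheses (wu : weight (fun x => (u x)%:E)) (cu : continuous_on_pos u).
Hypotheses (wa : weight a) (wv : weight v) (ww : weight w).
Local Notation p' := (conjexp p).
Let pos : set R := `]0%R, +oo[%classic.
Let p0 : (0 < p)%R := lt_trans ltr01 p1.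
Let q0 : (0 < q)%R := lt_trans ltr01 q1.
Let p'0 : (0 < p')%R := conjexp_gt0 p1.
Let p'1 : (1 < p')%R := conjexp_gt1 p1.
Let pm0 : (0 < p' - 1)%R. Proof. by rewrite subr_gt0. Qed.
Let pVp : (0 < p^-1)%R. Proof. by rewrite invr_gt0. Qed.
Let mpos : measurable (pos : set T) := measurable_litv _.
Local Notation V := (primitive v).
Local Notation D := (rdata p1 wu cu wa wv ww).
Let nv : nnm (posp v : T -> \bar R). Proof. by apply: nnm_posp; case: wv. Qed.
Let nV : nnm (V : T -> \bar R) := nnm_V wv.
Let V0 x : 0 <= V x := nV.2 x.
Let Vgt0 x : (0 < x)%R -> 0 < V x. Proof. by move=> x0; have [] := weight_primitive wv x0. Qed.
Let Voo x : V x < +oo. Proof. exact: weight_primitive_oo wv. Qed.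
Let VE x : V x = (fine (V x))%:E. Proof. by rewrite fineK// ge0_fin_numE. Qed.
Let fVgt0 x : (0 < x)%R -> (0 < fine (V x))%R. Proof. by move=> x0; rewrite -lte_fin -VE Vgt0. Qed.

(** This is 4, the loss of [rank_poweR_int] for [g = 1]. *)
Definition rconst : R := ((2^-1 `^ (1 + 1))^-1)%R.
Lemma rconst_gt0 : (0 < rconst)%R. Proof. by rewrite invr_gt0. Qed.

Lemma V_square_le x : V x `^ (1 + 1) <= rconst%:E * \int[mu]_(y in (`]0%R, x[%classic : set T)) (V y * posp v y).
Proof.
have := rank_poweR_int (measurable_litv _) nv nV (@rank_V _ _ wv x) (ler01 : (0 <= 1 :> R)%R).
have -> : \int[mu]_(t in `]0%R, x[) posp v t = V x by rewrite -[RHS]primitive_posp.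
have -> : \int[mu]_(t in `]0%R, x[) (V t `^ 1 * posp v t) = \int[mu]_(t in `]0%R, x[) (V t * posp v t).
  by apply: eq_integral => t _; rewrite (poweRe1 (V0 t)).
move=> h; have c0 : 0 <= rconst%:E by rewrite lee_fin ltW// rconst_gt0.
by have := le_mull c0 h; rewrite muleA -EFinM /rconst mulVf ?gt_eqF// mul1e.
Qed.

Let in_oy x : pos x -> (0 < x)%R. Proof. by rewrite /pos/= in_itv/= andbT. Qed.

Section le_direction.
Variable f : R -> \bar R.
Hypothesis nif : Mplus_nonincreasing f.
Let f0 x : (0 < x)%R -> 0 <= f x. Proof. by case: nif => -[_ +] _; exact. Qed.
Let fanti x y : (0 < x)%R -> (x <= y)%R -> f y <= f x. Proof. by case: nif => _; exact. Qed.
Let nf : nnm (posp f : T -> \bar R). Proof. by apply: nnm_posp; case: nif. Qed.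

(* [test_of * V^p' v = f V v], and [V^-2] times its primitive dominates [f] up to a constant. *)
Definition test_of (x : R) : \bar R := posp f x * V x `^ (- (p' - 1)).

Lemma nnm_test_of : nnm (test_of : T -> \bar R).
Proof. exact: nnmM nf (nnm_poweR _ nV). Qed.

Lemma test_of_rs x : (0 < x)%R -> test_of x * rs p v x = f x * (V x * posp v x).
Proof.
move=> x0; rewrite /test_of /rs posp_gt// -muleA [X in _ * X]muleA; congr (_ * (_ * _)).
have fx := fVgt0 x0; rewrite VE !poweR_EFin -EFinM -powRD; last by apply/implyP => _; rewrite gt_eqF.
by rewrite (_ : - (p' - 1) + p' = 1)%R ?powRr1 ?(ltW fx)//; ring.
Qed.

Lemma test_of_pow x : (0 < x)%R -> test_of x `^ p * rs p v x = f x `^ p * v x.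
Proof.
move=> x0; rewrite /test_of /rs !posp_gt//.
rewrite (poweRM _ (f0 x0) (poweR_ge0 _ _)) -muleA; congr (_ * _).
rewrite -poweRrM muleA mulNr (conjexpB1 p1) (poweR_inv_le1 _ (Vgt0 x0) (Voo x)) mul1e//.
Qed.

Lemma hnorm_test_of : hnorm D p test_of = \lint_(s in `]0%R, +oo[) (f s `^ p * v s).
Proof.
apply: eq_integral => x /set_mem; rewrite /= in_itv/= andbT => x0.
exact: test_of_pow.
Qed.

(** As [f] does not increase, [f(tau) int_0^tau V v] is at most [int_0^tau f V v], which is [hK] of
    the test function; [V_square_le] compares the integral with [V^2], which cancels [V^-2]. *)
Lemma sup_operator_le t : (0 < t)%R -> sup_operator u f t <= rconst%:E * hR D test_of t.
Proof.
move=> t0; apply: sup_from_le => tau ttau; have tau0 := lt_le_trans t0 ttau.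
have c0 : 0 <= rconst%:E by rewrite lee_fin ltW// rconst_gt0.
apply: (@le_trans _ _ (rconst%:E * ((hU D tau)%:E * hK D test_of tau))); last first.
  apply: (le_mull c0); exact: (sup_from_ge (fun tau => (hU D tau)%:E * hK D test_of tau)).
rewrite -[hU D tau]/(rU u v tau) (rU_gt u wv tau0).
have nVv : nnm (fun y : T => V y * posp v y) by exact: nnmM nV nv.
have hKge : f tau * \int[mu]_(y in (`]0%R, tau[%classic : set T)) (V y * posp v y) <= hK D test_of tau.
  rewrite -(integralMl mu (measurable_litv _) (f0 tau0) nVv); apply: le_integral_nng => y.
    by move=> _; apply: mule_ge0; [exact: f0|exact: nVv.2].
  move=> /in_oo[y0 yt]; rewrite -[hs D y]/(rs p v y) test_of_rs//; apply: (le_mulr (nVv.2 y)).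
  exact: fanti (ltW yt).
have U0 : 0 <= uVm2 u v tau.
  by apply: mule_ge0; [rewrite lee_fin; exact: (u_ge0 wu)|exact: poweR_ge0].
apply: le_trans (le_mull c0 (le_mull U0 hKge)).
rewrite muleCA [X in _ <= _ * X]muleCA.
apply: (@le_trans _ _ (uVm2 u v tau * (f tau * V tau `^ (1 + 1)))); last first.
  apply: (le_mull U0); apply: (le_mull (f0 tau0)); exact: V_square_le.
have -> : uVm2 u v tau * (f tau * V tau `^ (1 + 1)) = (u tau)%:E * f tau * (V tau `^ (- 2%:R) * V tau `^ 2%:R).
  by rewrite /uVm2 (AC (2*2) ((1*3)*(2*4))).
by rewrite (poweR_inv_le1 _ (Vgt0 tau0) (Voo tau)) mule1 lexx.
Qed.

Lemma numerator_le :
  (\lint_(x in `]0%R, +oo[)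
     ((\lint_(t in `]0%R, x[) (sup_operator u f t * a t)) `^ q * w x)) `^ q^-1 <=
  rconst%:E * (\int[mu]_(x in pos) (hT D test_of x `^ q * hw D x)) `^ q^-1.
Proof.
have nk := nnm_test_of; have c0 : 0 <= rconst%:E by rewrite lee_fin ltW// rconst_gt0.
have wa0 x : (0 < x)%R -> 0 <= a x by case: wa => -[_ +] _; exact.
have ww0 x : (0 < x)%R -> 0 <= w x by case: ww => -[_ +] _; exact.
have sup0 t : (0 < t)%R -> 0 <= sup_operator u f t.
  move=> t0; apply: le_trans (sup_from_ge (fun tau => (u tau)%:E * f tau) (lexx t)).
  by apply: mule_ge0; [rewrite lee_fin; exact: (u_ge0 wu)|exact: f0].
have nT : nnm (hT D test_of : T -> \bar R) by exact: nnm_primitive (nnmM (nnm_hR D nk) (nha D)).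
have nTw : nnm (fun x : T => hT D test_of x `^ q * hw D x) by exact: nnmM (nnm_poweR _ nT) (nhw D).
have i0 : 0 <= \int[mu]_(x in pos) (hT D test_of x `^ q * hw D x).
  by apply: integral_nng => x _; exact: nTw.2.
have qV : (0 <= q^-1)%R by rewrite invr_ge0 ltW.
have E : rconst%:E = (rconst%:E `^ q) `^ q^-1 by rewrite (poweRK c0 (lt0r_neq0 q0)).
rewrite [X in _ <= X * _]E -(poweRM _ (poweR_ge0 _ _) i0); apply: le_poweR => //.
  apply: integral_nng => x; rewrite /= in_itv/= andbT => x0.
  by apply: mule_ge0; [exact: poweR_ge0|exact: ww0].
rewrite -(integralMl mu mpos (poweR_ge0 _ _) nTw); apply: le_integral_nng => x.
  by move=> /in_oy x0; apply: mule_ge0; [exact: poweR_ge0|exact: ww0].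
move=> /in_oy x0; rewrite muleA -(poweRM _ c0 (nT.2 x)).
rewrite -[hw D x]/(posp w x) posp_gt//; apply: (le_mulr (ww0 x x0)); apply: (le_poweR (ltW q0)).
  by apply: integral_nng => t /in_oo[t0 _]; apply: mule_ge0; [exact: sup0|exact: wa0].
rewrite /hT /primitive /lebesgue_integral.
rewrite -(integralMl mu (measurable_litv _) c0 (nnmM (nnm_hR D nk) (nha D))).
apply: le_integral_nng => t /in_oo[t0 _]; first by apply: mule_ge0; [exact: sup0|exact: wa0].
rewrite -[ha D t]/(posp a t) posp_gt// muleA; apply: (le_mulr (wa0 t t0)); exact: sup_operator_le.
Qed.

End le_direction.

Lemma best_constant_le (G : \bar R) : 0 <= G ->
  (forall k, nnm (k : T -> \bar R) -> hnorm D p k < +oo ->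
    (\int[mu]_(x in pos) (hT D k x `^ q * hw D x)) `^ q^-1 <= G * hnorm D p k `^ p^-1) ->
  best_constant p q u a v w <= rconst%:E * G.
Proof.
move=> G0 h; have c0 : 0 <= rconst%:E by rewrite lee_fin ltW// rconst_gt0.
apply: ge_ereal_sup => _ [f nif <-].
apply: le_ratio; [exact: poweR_ge0|exact: poweR_ge0|exact: mule_ge0|].
rewrite -(hnorm_test_of nif) => doo; have nk := nnm_test_of nif.
have Loo : hnorm D p (test_of f) < +oo.
  rewrite ltey; apply/eqP => E; move: doo; rewrite E poweRyr ?ltxx//.
  by rewrite gt_eqF// invr_gt0.
apply: le_trans (numerator_le nif) _; rewrite -muleA; apply: (le_mull c0); exact: h.
Qed.

Section ge_direction.
Variables (k : R -> \bar R) (C : R) (del : nat -> \bar R).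
Hypothesis nk : nnm (k : T -> \bar R).
Hypothesis C0 : (0 < C)%R.
Hypothesis del0 : forall n, 0 <= del n.
(** One factor [V] less than in [k V^p' v]: it is pulled out of the integral as [V x], and what
    remains is estimated by [rank_hoelder] with [V] ranking [v]. *)
Let kv (x : R) : \bar R := k x * V x `^ (p' - 1) * posp v x.
Hypothesis hdel : forall n, \int[mu]_(x in [set x : T | V x <= (2 * lev n)%:E]) kv x <=
  C%:E * (lev n)%:E `^ p'^-1 * del n `^ p^-1.
Hypothesis sdel : \sum_(n <oo) del n <= C%:E * hnorm D p k.
Let CE : 0 <= C%:E. Proof. by rewrite lee_fin ltW. Qed.

(* A non-increasing majorant, up to a constant, of [V^-2] times the primitive of [k V^p' v]. *)
Definition envelope (x : R) : \bar R :=
  (\sum_(n <oo) if V x <= (2 * lev n)%:E then (lev n)%:E `^ (- 1) * del n else 0) `^ p^-1.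

Let term_ge0 x n : 0 <= (if V x <= (2 * lev n)%:E then (lev n)%:E `^ (- 1) * del n else 0).
Proof. by case: ifP => // _; apply: mule_ge0; [exact: poweR_ge0|exact: del0]. Qed.

Lemma envelope_anti x y : (x <= y)%R -> envelope y <= envelope x.
Proof.
move=> xy; apply: (le_poweR (ltW pVp)); first by apply: nneseries_ge0 => n _ _; exact: term_ge0.
apply: lee_nneseries => [n _ _|n _]; first exact: term_ge0.
case: ifPn => [h|_]; last exact: term_ge0.
by rewrite (le_trans (le_V wv xy) h).
Qed.

Lemma nnm_envelope : nnm (envelope : T -> \bar R).
Proof. by apply: nnm_nonincreasing => [x|]; [exact: poweR_ge0|exact: envelope_anti]. Qed.

Lemma envelope_mono : Mplus_nonincreasing envelope.
Proof.
split; last by move=> x y _; exact: envelope_anti.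
by split; [exact: nnm_meas nnm_envelope|move=> x _; exact: nnm_envelope.2].
Qed.

(** By [rank] the set [V <= 2 lev n] has [v]-mass at most [2 lev n], which the factor [lev n ^ -1]
    cancels, leaving [2 sum_n del n]. *)
Lemma integral_envelope : \lint_(s in `]0%R, +oo[) (envelope s `^ p * v s) <= (2 * C)%:E * hnorm D p k.
Proof.
have E2 : 0 <= 2%:E :> \bar R by rewrite lee_fin.
pose F n (x : R) : \bar R := if V x <= (2 * lev n)%:E then (lev n)%:E `^ (- 1) * del n * posp v x else 0.
have c0 n : 0 <= (lev n)%:E `^ (- 1) * del n by apply: mule_ge0; [exact: poweR_ge0|exact: del0].
have nc n : nnm (fun x : T => (lev n)%:E `^ (- 1) * del n * posp v x) by exact: nnmM (nnm_cst (c0 n)) nv.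
have mV n : measurable ([set x | V x <= (2 * lev n)%:E] : set T) by exact: measurable_le.
have FE n : F n = (fun x : T => (lev n)%:E `^ (- 1) * del n * posp v x) \_ [set x | V x <= (2 * lev n)%:E].
  by apply/funext => x; rewrite patchE mem_setE.
have nF n : nnm (F n : T -> \bar R) by rewrite FE; exact: nnm_patch.
have -> : \lint_(s in `]0%R, +oo[) (envelope s `^ p * v s) = \int[mu]_(x in pos) (\sum_(n <oo) F n x).
  apply: eq_integral => x /set_mem/in_oy x0; rewrite /envelope poweRVK; last by rewrite gt_eqF.
    rewrite muleC -(nneseriesMl _ (term_ge0 x)); last by case: wv => -[_ +] _; exact.
    apply: eq_eseriesr => n _; rewrite /F posp_gt//; case: ifP => _; last by rewrite mule0.
    exact: muleC.
  by apply: nneseries_ge0 => n _ _; exact: term_ge0.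
rewrite (integral_seriesn mu mpos nF) EFinM -muleA; apply: le_trans (le_mull E2 sdel).
rewrite -nneseriesZl; last by move=> n _; exact: del0.
apply: lee_nneseries => [n _ _|n _]; first by apply: integral_nng => x _; exact: (nF n).2.
rewrite FE -integral_mkcondr (integralMl mu (measurableI _ _ mpos (mV n)) (c0 n) nv).
have l2 : (0 < 2 * lev n :> R)%R by rewrite mulr_gt0// lev_gt0.
have rk : rank mu (pos : set T) (posp v) V.
  have <- : primitive (posp v) = V by apply/funext => y; exact: primitive_posp.
  exact: rank_primitive nv.
apply: le_trans (le_mull (c0 n) (rk _ l2)) _.
rewrite EFinM muleCA; apply: (le_mull E2); rewrite muleAC -[X in X * _ <= _](muleC).
have lE : (lev n)%:E * (lev n)%:E `^ (- 1) = 1 :> \bar R.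
  by rewrite poweR_EFin -EFinM powR_inv1 ?lev_ge0// mulfV// gt_eqF// lev_gt0.
by rewrite lE mul1e lexx.
Qed.

(** For [V x] in layer [n], [V^-2 V <= lev n ^ -1], and [-1 + 1/p' = -1/p]; so [hdel] yields the
    [p]-th root of the [n]-th term of the envelope. *)
Lemma hU_hK_le x : (0 < x)%R -> (hU D x)%:E * hK D k x <= C%:E * ((u x)%:E * envelope x).
Proof.
move=> x0; have fV := fVgt0 x0; have [n /andP[ln nl]] := lev_exists fV.
have hl : V x <= (2 * lev n)%:E by rewrite VE lee_fin.
have u0 : 0 <= (u x)%:E by rewrite lee_fin; exact: (u_ge0 wu).
have nkv : nnm (kv : T -> \bar R) by exact: nnmM (nnmM nk (nnm_poweR _ nV)) nv.
have hKle : hK D k x <= V x * (C%:E * (lev n)%:E `^ p'^-1 * del n `^ p^-1).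
  apply: le_trans (le_mull (V0 x) (hdel n)).
  apply: (@le_trans _ _ (V x * \int[mu]_(y in (`]0%R, x[%classic : set T)) kv y)); last first.
    apply: (le_mull (V0 x)); apply: subset_integral_nng => [y _|y]; first exact: nkv.2.
    by move=> /in_oo[_ yx]; exact: (le_trans (le_V wv (ltW yx)) hl).
  rewrite -(integralMl mu (measurable_litv _) (V0 x) nkv); apply: le_integral_nng => y.
    by move=> _; apply: mule_ge0; [exact: nk.2|exact: (nnm_rs p wv).2].
  move=> /in_oo[y0 yx]; rewrite -[hs D y]/(rs p v y) /rs /kv muleA.
  have Vp : V y `^ p' = V y `^ (p' - 1) * V y.
    by rewrite -[X in _ * X](poweRe1 (V0 y)) (poweR_addr (V0 y) pm0 ltr01) subrK.
  rewrite Vp [leRHS]muleA; apply: (le_mulr (nv.2 y)); rewrite [leLHS]muleA [leLHS]muleC.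
  apply: le_mulr; first by apply: mule_ge0; [exact: nk.2|exact: poweR_ge0].
  exact: (le_V wv (ltW yx)).
have U0 : 0 <= uVm2 u v x by apply: mule_ge0 u0 (poweR_ge0 _ _).
rewrite -[hU D x]/(rU u v x) (rU_gt u wv x0); apply: le_trans (le_mull U0 hKle) _.
have l0 : (0 < lev n :> R)%R by exact: lev_gt0.
have VV : V x `^ (- 2%:R) * V x <= (lev n)%:E `^ (- 1).
  rewrite VE !poweR_EFin -EFinM lee_fin powRN powR_mulrn ?(ltW fV)// powR_inv1 ?(ltW l0)//.
  rewrite expr2 invfM -mulrA mulVf ?gt_eqF// mulr1 lef_pV2 ?posrE//; exact: ltW.
have -> : uVm2 u v x * (V x * (C%:E * (lev n)%:E `^ p'^-1 * del n `^ p^-1)) =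
   C%:E * ((u x)%:E * ((V x `^ (- 2%:R) * V x) * ((lev n)%:E `^ p'^-1 * del n `^ p^-1))).
  by rewrite /uVm2 (AC (2*(1*3)) (4*(1*((2*3)*(5*6))))).
apply: (le_mull CE); apply: (le_mull u0).
have t0 : 0 <= (lev n)%:E `^ p'^-1 * del n `^ p^-1 by apply: mule_ge0; exact: poweR_ge0.
apply: le_trans (le_mulr t0 VV) _; rewrite muleA.
have lE : (lev n)%:E `^ (- 1) * (lev n)%:E `^ p'^-1 = ((lev n)%:E `^ (- 1)) `^ p^-1 :> \bar R.
  rewrite !poweR_EFin -EFinM -powRD; last by apply/implyP => _; rewrite gt_eqF.
  by rewrite -powRrM conjexpV; congr (_ `^ _)%:E; ring.
rewrite lE -(poweRM _ (poweR_ge0 _ _) (del0 n)); apply: (le_poweR (ltW pVp)).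
  by apply: mule_ge0; [exact: poweR_ge0|exact: del0].
apply: le_trans (nneseries_term n (term_ge0 x)); by rewrite hl lexx.
Qed.

End ge_direction.

End reduction.

Lemma nnm_sup_operator {R : realType} (u : R -> R) (f : R -> \bar R) :
  weight (fun x => (u x)%:E) -> Mplus_nonincreasing f ->
  nnm (posp (sup_operator u f) : lebesgueR R -> \bar R).
Proof.
move=> wu [[_ f0] _]; apply: nnm_posp; split.
  have mS : measurable_fun setT (sup_operator u f : lebesgueR R -> \bar R).
    by apply: measurable_fun_lebesgue; apply: nonincreasing_measurableE => x y; exact: sup_from_anti.
  exact: (measurable_funS measurableT (@subsetT _ _) mS).
move=> x x0; apply: le_trans (sup_from_ge (fun tau => (u tau)%:E * f tau) (lexx x)).
by apply: mule_ge0; [rewrite lee_fin; exact: (u_ge0 wu)|exact: f0].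
Qed.

Section lower_reduction.
Context {R : realType}.
Local Notation T := (lebesgueR R).
Local Notation mu := (@completed_lebesgue_measure R).
Variables (p q : R).
Hypotheses (p1 : (1 < p)%R) (q1 : (1 < q)%R).
Local Notation p' := (conjexp p).
Let pos : set R := `]0%R, +oo[%classic.
Let p0 : (0 < p)%R := lt_trans ltr01 p1.
Let q0 : (0 < q)%R := lt_trans ltr01 q1.
Let p'0 : (0 < p')%R := conjexp_gt0 p1.
Let pVp : (0 < p^-1)%R. Proof. by rewrite invr_gt0. Qed.
Let p'Vp : (0 < p'^-1)%R. Proof. by rewrite invr_gt0. Qed.
Let mpos : measurable (pos : set T) := measurable_litv _.

(** [rank_hoelder] for [V] and [v] provides the sequence [del] of the envelope [f]. The inequality
    for [f] gives the one for [k], as [hT k <= C Tf] and the norm of [f] is at most a multiple of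
    that of [k]; [N > 0] settles the case of infinite norm. *)
Lemma best_constant_ge : exists2 C : R, (0 < C)%R &
  forall (u : R -> R) (a v w : R -> \bar R) (wu : weight (fun x => (u x)%:E))
    (cu : continuous_on_pos u) (wa : weight a) (wv : weight v) (ww : weight w) (N : R), (0 < N)%R ->
  best_constant p q u a v w <= N%:E -> hbound p q (rdata p1 wu cu wa wv ww) (C * N).
Proof.
have [C C0 hC] := @rank_hoelder R p p' p1 (conjexp_gt1 p1) (conjexp_add p).
exists (C * (2 * C) `^ p^-1)%R; first by rewrite mulr_gt0// powR_gt0// mulr_gt0.
move=> u a v w wu cu wa wv ww N N0 bN k nk; set D := rdata p1 wu cu wa wv ww.
have CE : 0 <= C%:E by rewrite lee_fin ltW.
have L0 : 0 <= hnorm D p k by exact: hnorm_ge0.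
have qp0 : (0 < q / p)%R by rewrite divr_gt0.
have M0 : (0 < C * (2 * C) `^ p^-1 * N)%R by rewrite !mulr_gt0// powR_gt0// mulr_gt0.
have [Loo|Loo] := eqVneq (hnorm D p k) +oo.
  by rewrite Loo poweRyr ?gt_eqF// gt0_muley ?lte_fin ?powR_gt0// leey.
have {}Loo : hnorm D p k < +oo by rewrite ltey.
have nv : nnm (posp v : T -> \bar R) by exact: (nnm_posp wv.1).
have nV := nnm_V wv.
pose kap (x : T) := k x * primitive v x `^ (p' - 1) * posp v x `^ p^-1.
pose eps (x : T) := posp v x `^ p'^-1.
have nkap : nnm kap by exact: nnmM (nnmM nk (nnm_poweR _ nV)) (nnm_poweR _ nv).
have neps : nnm eps by exact: nnm_poweR.
have e0 x : primitive v x = 0 -> eps x = 0.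
  move=> Vx; rewrite /eps posp_le; first by rewrite poweR0r// gt_eqF.
  by rewrite leNgt; apply/negP => x0; have [] := weight_primitive wv x0; rewrite Vx ltxx.
have epsE : (fun x => eps x `^ p') = posp v.
  by apply/funext => x; rewrite /eps (poweRVK (nv.2 x) (lt0r_neq0 p'0)).
have rk : rank mu (setT : set T) (fun x => eps x `^ p') (primitive v).
  rewrite epsE; have <- : primitive (posp v) = primitive v by apply/funext => y; exact: primitive_posp.
  by apply: rank_primitive_all nv _ => x; exact: posp_le.
have [hd sd] := hC _ T mu (primitive v) kap eps nV nkap neps e0 rk.
pose del n := \int[mu]_(x in [set x : T | primitive v x <= (2 * lev n)%:E])
  ((lev n)%:E `^ (- (p / (2 * p'))) * (primitive v x `^ (p / (2 * p')) * kap x `^ p)).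
have del0 n : 0 <= del n.
  rewrite /del; apply: integral_nng => x _; apply: mule_ge0; first exact: poweR_ge0.
  by apply: mule_ge0; exact: poweR_ge0.
have kE : \int[mu]_x kap x `^ p = hnorm D p k.
  rewrite /hnorm -(lint_pos _ (f := fun x => kap x `^ p)); last first.
    by move=> x x0; rewrite /kap posp_le// poweR0r ?mule0 ?poweR0r// gt_eqF// invr_gt0.
  rewrite setIT; apply: eq_integral => x _.
  rewrite /kap (poweRM _ (mule_ge0 (nk.2 x) (poweR_ge0 _ _)) (poweR_ge0 _ _)).
  rewrite (poweRM _ (nk.2 x) (poweR_ge0 _ _)) (poweRVK (nv.2 x) (lt0r_neq0 p0)).
  by rewrite -poweRrM (conjexpB1 p1) -[hs D x]/(rs p v x) /rs muleA.
have {}sd : \sum_(n <oo) del n <= C%:E * hnorm D p k by rewrite -kE; exact: sd.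
have hdel n : \int[mu]_(x in [set x : T | primitive v x <= (2 * lev n)%:E])
    (k x * primitive v x `^ (p' - 1) * posp v x) <= C%:E * (lev n)%:E `^ p'^-1 * del n `^ p^-1.
  apply: le_trans (hd n); rewrite le_eqVlt; apply/orP; left; apply/eqP.
  apply: eq_integral => x _; rewrite /kap /eps -[RHS]muleA (poweR_addr (nv.2 x) pVp p'Vp).
  by rewrite conjexp_add (poweRe1 (nv.2 x)).
pose f := envelope p v del.
have nif : Mplus_nonincreasing f by exact: envelope_mono.
have Fle : \lint_(s in `]0%R, +oo[) (f s `^ p * v s) <= (2 * C)%:E * hnorm D p k.
  exact: (integral_envelope del0 sd).
have UKle x : (0 < x)%R -> (hU D x)%:E * hK D k x <= C%:E * ((u x)%:E * f x).
  exact: (hU_hK_le p1 wu cu wa wv ww nk C0 del0 hdel).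
have nsup := nnm_sup_operator wu nif.
have nsa : nnm (fun t : T => posp (sup_operator u f) t * posp a t) by exact: nnmM nsup (nha D).
pose Tf := primitive (fun t => posp (sup_operator u f) t * posp a t).
have nTf : nnm (Tf : T -> \bar R) by exact: nnm_primitive nsa.
have nTw : nnm (fun x : T => Tf x `^ q * posp w x) by exact: nnmM (nnm_poweR _ nTf) (nhw D).
have hTle x : hT D k x <= C%:E * Tf x.
  rewrite /hT /Tf /primitive /lebesgue_integral -(integralMl mu (measurable_litv _) CE nsa).
  apply: le_integral_nng => t.
    by move=> _; apply: mule_ge0; [exact: (nnm_hR D nk).2|exact: (nha D).2].
  move=> /in_oo[t0 _]; rewrite muleA; apply: (le_mulr ((nha D).2 t)); rewrite posp_gt//.
  apply: sup_from_le => tau ttau; apply: le_trans (UKle tau (lt_le_trans t0 ttau)) _.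
  apply: (le_mull CE); exact: (sup_from_ge (fun tau => (u tau)%:E * f tau)).
pose num := (\lint_(x in `]0%R, +oo[)
     ((\lint_(t in `]0%R, x[) (sup_operator u f t * a t)) `^ q * w x)) `^ q^-1.
have I0 : 0 <= \int[mu]_(x in pos) (Tf x `^ q * posp w x).
  by apply: integral_nng => x _; exact: nTw.2.
have numE : num = (\int[mu]_(x in pos) (Tf x `^ q * posp w x)) `^ q^-1.
  congr (_ `^ _); apply: eq_integral => x /set_mem; rewrite /pos/= in_itv/= andbT => x0.
  rewrite (posp_gt w x0); congr (_ `^ _ * _); apply: eq_integral => t /set_mem/in_oo[t0 _].
  by rewrite !posp_gt.
have num0 : 0 <= num by exact: poweR_ge0.
set den := (\lint_(s in `]0%R, +oo[) (f s `^ p * v s)) `^ p^-1.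
have fv0 : 0 <= \lint_(s in `]0%R, +oo[) (f s `^ p * v s).
  apply: integral_nng => x; rewrite /= in_itv/= andbT => x0.
  by apply: mule_ge0; [exact: poweR_ge0|exact: wv.1.2].
have C2E : 0 <= (2 * C)%:E by rewrite lee_fin mulr_ge0// ltW.
have denle : den <= ((2 * C) `^ p^-1)%:E * hnorm D p k `^ p^-1.
  by apply: le_trans (le_poweR (ltW pVp) fv0 Fle) _; rewrite (poweRM _ C2E L0) poweR_EFin.
have denoo : den < +oo.
  apply: le_lt_trans denle _; apply: lte_mul_pinfty; [by rewrite lee_fin powR_ge0|by []|].
  exact: poweR_lty.
have ratio : num / den <= N%:E.
  by apply: le_trans bN; apply: ereal_sup_ubound; exists f.
have := ratio_le num0 (poweR_ge0 _ _) denoo (ltry N) ratio => numle.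
apply: (@le_trans _ _ (C%:E `^ q * \int[mu]_(x in pos) (Tf x `^ q * posp w x))).
  rewrite -(integralMl mu mpos (poweR_ge0 _ _) nTw); apply: le_integral_nng => x.
    by move=> _; apply: mule_ge0; [exact: poweR_ge0|exact: (nhw D).2].
  move=> _; rewrite muleA; apply: (le_mulr ((nhw D).2 x)); rewrite -(poweRM _ CE (nTf.2 x)).
  apply: (le_poweR (ltW q0)); last exact: hTle.
  exact: primitive_ge0 (nnmM (nnm_hR D nk) (nha D)).
have NE : 0 <= N%:E by rewrite lee_fin ltW.
have numle' := le_trans numle (le_mull NE denle).
have nq : \int[mu]_(x in pos) (Tf x `^ q * posp w x) = num `^ q by rewrite numE (poweRVK I0 (lt0r_neq0 q0)).
rewrite nq; apply: le_trans (le_mull (poweR_ge0 _ _) (le_poweR (ltW q0) num0 numle')) _.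
rewrite [X in _ * X `^ q](muleA) -EFinM (poweRM _ _ (poweR_ge0 _ _)); last by rewrite lee_fin mulr_ge0 ?powR_ge0// ltW.
rewrite muleA -poweRrM !poweR_EFin -EFinM -powRM ?mulr_ge0 ?powR_ge0 ?(ltW C0) ?(ltW N0)//.
rewrite (_ : C * (N * (2 * C) `^ p^-1) = C * (2 * C) `^ p^-1 * N)%R; last by ring.
rewrite (_ : p^-1 * q = q / p)%R ?lexx//; exact: mulrC.
Qed.

End lower_reduction.

(** * Equivalence with the sum of the five terms *)

Section equivalence.
Context {R : realType}.
Variables (p q : R).
Hypotheses (p1 : (1 < p)%R) (q1 : (1 < q)%R).

Lemma best_constant_ge0 (u : R -> R) (a v w : R -> \bar R) : 0 <= best_constant p q u a v w.
Proof.
apply: (@le_trans _ _ ((\lint_(x in `]0%R, +oo[)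
     ((\lint_(t in `]0%R, x[) (sup_operator u (fun=> 0) t * a t)) `^ q * w x)) `^ q^-1
  / (\lint_(s in `]0%R, +oo[) (0 `^ p * v s)) `^ p^-1)).
  by apply: mule_ge0; [exact: poweR_ge0|rewrite inve_ge0; exact: poweR_ge0].
have n0 : @Mplus_nonincreasing R (fun=> 0).
  by split=> [|x y _ _]; [split; [exact: measurable_cst|]|].
by apply: ereal_sup_ubound; exists (fun=> 0).
Qed.

Lemma best_constant_hsum : exists2 c : R, (0 < c)%R & forall (u : R -> R) (a v w : R -> \bar R)
    (wu : weight (fun x => (u x)%:E)) (cu : continuous_on_pos u) (wa : weight a) (wv : weight v)
    (ww : weight w), equivalent_upto c (best_constant p q u a v w) (hsum p q (rdata p1 wu cu wa wv ww)).
Proof.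
have [C1 C10 hC1] := hsum_upper_root p1 q1.
have [C2 C20 hC2] := hsum_lower p1 q1.
have [C3 C30 hC3] := best_constant_ge p1 q1.
have r0 := @rconst_gt0 R.
pose c := (@rconst R * C1 + C2 * C3)%R.
have c0 : (0 < c)%R by rewrite addr_gt0// mulr_gt0.
exists c => // u a v w wu cu wa wv ww; set D := rdata p1 wu cu wa wv ww.
have N0 := best_constant_ge0 u a v w; set N := best_constant p q u a v w in N0 *.
have S0 : 0 <= hsum p q D.
  have [T10 T20 T30 T40 T50] := hT_ge0 p q D (dminus (hphi D p)).
  have [l1 _ _ _ _] := le_sum5 T10 T20 T30 T40 T50; exact: le_trans T10 l1.
have cE : 0 <= c%:E by rewrite lee_fin ltW.
have C1E : 0 <= C1%:E by rewrite lee_fin ltW.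
split.
  have cVE : 0 <= (c^-1)%:E by rewrite lee_fin invr_ge0 ltW.
  have [Noo|Noo] := eqVneq N +oo; first by rewrite Noo leey.
  have NE : N = (fine N)%:E by rewrite fineK// ge0_fin_numE// ltey.
  have n0 : (0 <= fine N)%R by rewrite fine_ge0.
  have hle : hsum p q D <= (C2 * C3 * fine N)%:E.
    apply/lee_addgt0Pr => e e0.
    (* [best_constant_ge] asks for a positive bound, which the best constant itself is not known to
       be; it is enlarged by an amount that costs [e] in the end. *)
    have e'0 : (0 < e / (C2 * C3))%R by rewrite divr_gt0// mulr_gt0.
    have N'0 : (0 < fine N + e / (C2 * C3))%R by rewrite ltr_wpDl.
    have bN : best_constant p q u a v w <= (fine N + e / (C2 * C3))%:E.
      by rewrite -/N {1}NE lee_fin lerDl ltW.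
    have M0 : (0 <= C3 * (fine N + e / (C2 * C3)))%R by rewrite mulr_ge0// ltW.
    apply: le_trans (hC2 D _ M0 (hC3 u a v w wu cu wa wv ww _ N'0 bN)) _.
    rewrite -EFinD lee_fin le_eqVlt; apply/orP; left; apply/eqP.
    by field; rewrite !gt_eqF.
  apply: le_trans (le_mull cVE hle) _; rewrite NE -EFinM lee_fin mulrA ler_piMl//.
  by rewrite mulrC ler_pdivrMr// mul1r lerDr ltW// mulr_gt0.
have [Soo|Soo] := eqVneq (hsum p q D) +oo; first by rewrite Soo gt0_muley ?lte_fin// leey.
have {}Soo : hsum p q D < +oo by rewrite ltey.
apply: (@le_trans _ _ ((@rconst R)%:E * (C1%:E * hsum p q D))).
  apply: (best_constant_le q1 (wu := wu) (cu := cu) (wa := wa) (wv := wv) (ww := ww) (mule_ge0 C1E S0)).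
  move=> k nk Loo; exact: hC1 D k Soo nk Loo.
rewrite muleA -EFinM; apply: (le_mulr S0); rewrite lee_fin lerDl ltW// mulr_gt0//.
Qed.

End equivalence.

(** * Identification of the terms with those of the theorem *)

Section terms.
Context {R : realType}.
Local Notation B := (measurableTypeR R).
Local Notation mu := (@completed_lebesgue_measure R).
Variables (p q : R) (u : R -> R) (a v w : R -> \bar R).
Hypotheses (p1 : (1 < p)%R) (q1 : (1 < q)%R).
Hypotheses (wu : weight (fun x => (u x)%:E)) (cu : continuous_on_pos u).
Hypotheses (wa : weight a) (wv : weight v) (ww : weight w).
Local Notation p' := (conjexp p).
Let pos : set R := `]0%R, +oo[%classic.
Let p'0 : (0 < p')%R := conjexp_gt0 p1.
Let p'Vp : (0 < p'^-1)%R. Proof. by rewrite invr_gt0. Qed.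
Local Notation D := (rdata p1 wu cu wa wv ww).
Local Notation U := (sup_from (uVm2 u v)).
Local Notation A := (primitive a).

Let in_oy (x y : R) : (0 <= x)%R -> `]x, +oo[%classic y -> (0 < y)%R.
Proof. by rewrite /= in_itv/= andbT; exact: le_lt_trans. Qed.

Lemma hUsE t : (0 < t)%R -> hUs D t = U t.
Proof. by move=> t0; apply: (eq_sup_from t0) => tau tau0; rewrite -[hU D tau]/(rU u v tau) (rU_gt u wv tau0). Qed.

Lemma hBE x y : (0 <= x)%R -> hB D x y = \lint_(s in `]x, y[) (U s * a s).
Proof.
move=> x0; apply: eq_integral => t /set_mem/in_oo[xt _]; have t0 := le_lt_trans x0 xt.
by rewrite /hUa hUsE// -[ha D t]/(posp a t) posp_gt.
Qed.

Lemma hSE t : hS D t = \lint_(x in `]0%R, t[) Vpv p v x. Proof. exact: primitive_rs. Qed.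

Lemma hAE t : hA D t = A t. Proof. exact: primitive_posp. Qed.

Lemma hWE t : (0 <= t)%R -> hW D t = \lint_(y in `]t, +oo[) w y.
Proof.
move=> t0; apply: eq_integral => y /set_mem/(in_oy t0) y0; exact: posp_gt.
Qed.

Lemma hIE t : hI D p t =
  \lint_(x in `]0%R, t[) (Vpv p v x * (\lint_(s in `]x, t[) (U s * a s)) `^ p').
Proof.
apply: eq_integral => x /set_mem/in_oo[x0 _]; rewrite hBE ?ltW//; congr (_ * _).
exact: rs_gt.
Qed.

Lemma hOmE t : (0 <= t)%R -> hOm D q t =
  \lint_(y in `]t, +oo[) ((\lint_(s in `]t, y[) (U s * a s)) `^ q * w y).
Proof.
move=> t0; apply: eq_integral => y /set_mem/(in_oy t0) y0; rewrite hBE//; congr (_ * _).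
exact: posp_gt.
Qed.

Lemma hAqE x : (0 < x)%R -> hAq D q x = A x `^ q * w x.
Proof. by move=> x0; rewrite /hAq hAE; congr (_ * _); exact: posp_gt. Qed.

Lemma hAtE x : hAt D q x = \lint_(y in `]0%R, x[) (A y `^ q * w y).
Proof. by apply: eq_integral => y /set_mem/in_oo[y0 _]; exact: hAqE. Qed.

Lemma hAt_ooE : \int[mu]_(y in pos) hAq D q y = \lint_(y in `]0%R, +oo[) (A y `^ q * w y).
Proof. by apply: eq_integral => y /set_mem/(in_oy (lexx _)) y0; exact: hAqE. Qed.

Let uVm2_ge0 x : (0 < x)%R -> 0 <= uVm2 u v x.
Proof. by move=> x0; apply: mule_ge0; [rewrite lee_fin (u_ge0 wu)|exact: poweR_ge0]. Qed.

Lemma hgE x : (0 < x)%R -> hg D p x = uVm2 u v x `^ p' * \lint_(s in `]0%R, x[) Vpv p v s.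
Proof. by move=> x0; rewrite /hg hSE -[hU D x]/(rU u v x) (rU_gt u wv x0). Qed.

Lemma hphiE t : (0 < t)%R -> hphi D p t = varphi p u v t.
Proof.
move=> t0; apply: (eq_sup_from t0) => tau tau0.
have ut : 0 <= (u tau)%:E by rewrite lee_fin (u_ge0 wu).
by rewrite hgE// /uVm2 (poweRM _ ut (poweR_ge0 _ _)) -poweRrM mulNr.
Qed.

Lemma dminus_hphiE : dminus (hphi D p) = dminus (varphi p u v) :> (set B -> \bar R).
Proof.
have E : (fun s => - fine (hphi D p (expR s)))%R = (fun s => - fine (varphi p u v (expR s)))%R.
  by apply/funext => s; rewrite (hphiE (expR_gt0 s)).
by rewrite /dminus E.
Qed.

Lemma hEE x : hE D p (dminus (hphi D p)) x = \int[dminus (varphi p u v)]_(t in `]0%R, x]) (A t `^ p').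
Proof.
rewrite /hE; transitivity (\int[dminus (varphi p u v)]_(t in `]0%R, x]) (hA D t `^ p')).
  by apply: eq_measure_integral => E _ _; exact: (congr1 (fun m => m E) dminus_hphiE).
by apply: eq_integral => t _; rewrite hAE.
Qed.

Lemma hptE x : hphi_inf D p < +oo -> (0 < x)%R ->
  \int[dminus (varphi p u v)]_(t in `[x, +oo[) 1 = hpt D p x.
Proof.
move=> phoo x0; rewrite integral_cst; last exact: measurable_itv.
by rewrite mul1e -(dminus_hphi_cy p1 phoo x0); exact: (congr1 (fun m => m _) (esym dminus_hphiE)).
Qed.

Lemma sup_from_poweR (g : R -> \bar R) (r t : R) : (0 < r)%R -> (forall x, (t <= x)%R -> 0 <= g x) ->
  sup_from (fun x => g x `^ r) t = sup_from g t `^ r.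
Proof.
move=> r0 g0; have s0 : 0 <= sup_from g t by apply: le_trans (sup_from_ge g (lexx t)); exact: g0.
have s0' : 0 <= sup_from (fun x => g x `^ r) t.
  by apply: le_trans (sup_from_ge _ (lexx t)); exact: poweR_ge0.
apply/eqP; rewrite eq_le; apply/andP; split.
  by apply: sup_from_le => x tx; apply: (le_poweR (ltW r0) (g0 x tx)); exact: sup_from_ge.
rewrite -[leRHS](poweRVK s0' (lt0r_neq0 r0)); apply: (le_poweR (ltW r0) s0).
apply: sup_from_le => x tx; rewrite -[leLHS](poweRK (g0 x tx) (lt0r_neq0 r0)).
apply: le_poweR; [by rewrite invr_ge0 ltW|exact: poweR_ge0|].
exact: (sup_from_ge (fun x => g x `^ r) tx).
Qed.

(** The limit of a non-increasing function is its infimum, and positive powers commute with suprema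
    and infima of non-negative values; the arguments [t <= 0] do not lower the infimum, by
    monotonicity. *)
Lemma limit_termE : limit_term p q u a v w = hT5 D p q.
Proof.
rewrite /limit_term /hT5 hAt_ooE; congr (_ * _).
set F := sup_from _.
have FE t : (0 < t)%R -> F t = hphi D p t `^ p'^-1.
  move=> t0; rewrite /hphi -sup_from_poweR//; last first.
    by move=> x tx; apply: mule_ge0; [exact: poweR_ge0|exact: (nnm_hS D).2].
  apply: (eq_sup_from t0) => tau tau0.
  rewrite hgE// -hSE (poweRM _ (poweR_ge0 _ _) ((nnm_hS D).2 tau)).
  by rewrite (poweRK (uVm2_ge0 tau0) (lt0r_neq0 p'0)).
have Fa : nonincreasing_fun F by move=> x y; exact: sup_from_anti.
rewrite (cvg_lim _ (nonincreasing_cvge Fa))//.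
have Pi0 := hphi_inf_ge0 D p.
have F0 t : 0 <= F t.
  have [t0|t0] := ltP 0%R t; first by rewrite FE// poweR_ge0.
  apply: le_trans (Fa _ _ (le_trans t0 ler01)); rewrite FE ?ltr01//; exact: poweR_ge0.
have I0 : 0 <= ereal_inf (range F) by apply: le_ereal_inf_tmp => _ [t _ <-]; exact: F0.
apply/eqP; rewrite eq_le; apply/andP; split; last first.
  apply: le_ereal_inf_tmp => _ [t _ <-].
  have [t0|t0] := ltP 0%R t.
    by rewrite FE//; apply: (le_poweR (ltW p'Vp) Pi0); exact: hphi_inf_le.
  apply: le_trans (Fa _ _ (le_trans t0 ler01)); rewrite FE ?ltr01//.
  by apply: (le_poweR (ltW p'Vp) Pi0); exact: hphi_inf_le.
rewrite -[leLHS](poweRK I0 (lt0r_neq0 p'0)); apply: (le_poweR (ltW p'Vp) (poweR_ge0 _ _)).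
apply: le_ereal_inf_tmp => _ [t + <-]; rewrite /= in_itv/= andbT => t0.
rewrite -[leRHS](poweRVK (hphi_ge0 D p t) (lt0r_neq0 p'0)); apply: (le_poweR (ltW p'0) I0).
by rewrite -FE//; apply: ereal_inf_lbound; exists t.
Qed.

(** If [phi] is infinite, [dminus] is 0 and the third term need not be [hT3], but then the last term
    is infinite and both sums are [+oo]; hence [X3] is identified for finite [phi] only. *)
Lemma hsumE (X1 X2 X3 X4 : \bar R) : X1 = hT1 D p q -> X2 = hT2 D p q -> 0 <= X3 ->
  (hphi_inf D p < +oo -> X3 = hT3 D p q) -> X4 = hT4 D p q (dminus (hphi D p)) ->
  X1 + X2 + X3 + X4 + limit_term p q u a v w = hsum p q D.
Proof.
move=> -> -> X30 X3E ->; rewrite limit_termE /hsum.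
have [T10 T20 T30 T40 T50] := hT_ge0 p q D (dminus (hphi D p)).
have [phoo|/negP] := boolP (hphi_inf D p < +oo); first by rewrite X3E.
move=> h; have -> : hT5 D p q = +oo.
  apply/eqP; apply: contrapT => /negP h5; apply: h; apply: (hT5_fin p1 q1).
  by rewrite ltey.
have ay (x : \bar R) : 0 <= x -> x + +oo = +oo by case: x.
rewrite (ay _ (adde_ge0 (adde_ge0 (adde_ge0 T10 T20) X30) T40)).
by rewrite (ay _ (adde_ge0 (adde_ge0 (adde_ge0 T10 T20) T30) T40)).
Qed.

End terms.

Theorem theorem4p1 (R : realType) (p q : R) (p1 : (1 < p)%R) (q1 : (1 < q)%R) :
  let p' := conjexp p in
  let q' := conjexp q in
  let r := rexp p q in
  ((p <= q)%R ->
   exists2 c : R, (0 < c)%R &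
   forall (u : R -> R) (a v w : R -> \bar R),
     weight (fun x => (u x)%:E) -> continuous_on_pos u ->
     weight a -> weight v -> weight w ->
     let A := primitive a in
     let phi := varphi p u v in
     let U := sup_from (uVm2 u v) in
     equivalent_upto c (best_constant p q u a v w)
       (ereal_sup [set
          (\lint_(x in `]0%R, t[)
             (Vpv p v x * (\lint_(s in `]x, t[) (U s * a s)) `^ p')) `^ p'^-1 *
          (\lint_(y in `]t, +oo[) w y) `^ q^-1
          | t in `]0%R, +oo[]
        + ereal_sup [set
          (\lint_(x in `]0%R, t[) Vpv p v x) `^ p'^-1 *
          (\lint_(y in `]t, +oo[)
             ((\lint_(s in `]t, y[) (U s * a s)) `^ q * w y)) `^ q^-1
          | t in `]0%R, +oo[]
        + ereal_sup [set
          (\int[dminus phi]_(t in `[x, +oo[) 1) `^ p'^-1 *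
          (\lint_(y in `]0%R, x[) (A y `^ q * w y)) `^ q^-1
          | x in `]0%R, +oo[]
        + ereal_sup [set
          (\int[dminus phi]_(t in `]0%R, x]) (A t `^ p')) `^ p'^-1 *
          (\lint_(y in `]x, +oo[) w y) `^ q^-1
          | x in `]0%R, +oo[]
        + limit_term p q u a v w)) /\
  ((q < p)%R ->
   exists2 c : R, (0 < c)%R &
   forall (u : R -> R) (a v w : R -> \bar R),
     weight (fun x => (u x)%:E) -> continuous_on_pos u ->
     weight a -> weight v -> weight w ->
     let A := primitive a in
     let phi := varphi p u v in
     let U := sup_from (uVm2 u v) in
     equivalent_upto c (best_constant p q u a v w)
       ((\lint_(t in `]0%R, +oo[)
           ((\lint_(x in `]0%R, t[) Vpv p v x) `^ (r / q')%R * Vpv p v t *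
            (\lint_(z in `]t, +oo[)
               ((\lint_(s in `]t, z[) (U s * a s)) `^ q * w z)) `^ (r / q)%R))
          `^ r^-1
        + (\lint_(t in `]0%R, +oo[)
           ((\lint_(x in `]0%R, t[)
               (Vpv p v x * (\lint_(s in `]x, t[) (U s * a s)) `^ p'))
              `^ (r / p')%R *
            (\lint_(s in `]t, +oo[) w s) `^ (r / p)%R * w t)) `^ r^-1
        + (\lint_(x in `]0%R, +oo[)
           ((\int[dminus phi]_(t in `[x, +oo[) 1) `^ (r / p')%R *
            (\lint_(y in `]0%R, x[) (A y `^ q * w y)) `^ (r / p)%R *
            (A x `^ q * w x))) `^ r^-1
        + (\lint_(x in `]0%R, +oo[)
           ((\int[dminus phi]_(t in `]0%R, x]) (A t `^ p')) `^ (r / p')%R *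
            (\lint_(y in `]x, +oo[) w y) `^ (r / p)%R * w x)) `^ r^-1
        + limit_term p q u a v w)).
Proof.
move=> p' q' r; have p0 := lt_trans ltr01 p1; have q0 := lt_trans ltr01 q1.
have [c c0 hc] := best_constant_hsum p1 q1.
have in_oy (x : R) : `]0%R, +oo[%classic x -> (0 < x)%R by rewrite /= in_itv/= andbT.
split => pq; exists c => // u a v w wu cu wa wv ww A phi U.
  set S := (X in equivalent_upto _ _ X); suff -> : S = hsum p q (rdata p1 wu cu wa wv ww) by exact: hc.
  apply: (hsumE q1).
  - rewrite /hT1 /hardy_const pq; congr ereal_sup; apply: eq_imagel => t /in_oy t0.
    by rewrite hIE hWE ?ltW.
  - rewrite /hT2 pq; congr ereal_sup; apply: eq_imagel => t /in_oy t0.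
    by rewrite hSE hOmE ?ltW.
  - apply: le_trans (ereal_sup_ubound _); last by exists 1%R => //; rewrite /= in_itv/= ltr01.
    by apply: mule_ge0; exact: poweR_ge0.
  - move=> phoo; rewrite /hT3 /hardy_const pq; congr ereal_sup; apply: eq_imagel => t /in_oy t0.
    by rewrite (hptE phoo t0) hAtE.
  - rewrite /hT4 /hardy_const pq; congr ereal_sup; apply: eq_imagel => t /in_oy t0.
    by rewrite hEE hWE ?ltW.
have qp : (p <= q)%R = false by rewrite leNgt pq.
set S := (X in equivalent_upto _ _ X); suff -> : S = hsum p q (rdata p1 wu cu wa wv ww) by exact: hc.
(* Part (ii) lists the first two terms in the opposite order. *)
rewrite /S [X in X + _ + _ + _ = _]addeC.
apply: (hsumE q1).
- rewrite /hT1 /hardy_const qp; congr (_ `^ _); apply: eq_integral => t /set_mem/in_oy t0.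
  by rewrite hIE hWE ?ltW// -[hw _ t]/(posp w t) posp_gt.
- rewrite /hT2 qp; apply: (congr1 (fun z => z `^ r^-1)); apply: eq_integral => t /set_mem/in_oy t0.
  have sE : hs (rdata p1 wu cu wa wv ww) t = Vpv p v t := rs_gt p v t0.
  by rewrite hSE sE (hOmE q _ _ _ _ _ _ (ltW t0)).
- exact: poweR_ge0.
- move=> phoo; rewrite /hT3 /hardy_const qp; congr (_ `^ _); apply: eq_integral => t /set_mem/in_oy t0.
  by rewrite (hptE phoo t0) hAtE hAqE.
- rewrite /hT4 /hardy_const qp; congr (_ `^ _); apply: eq_integral => t /set_mem/in_oy t0.
  by rewrite hEE hWE ?ltW// -[hw _ t]/(posp w t) posp_gt.
Qed.
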